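(* Assume the Generalized Riemann Hypothesis. Let $b\ge2$, $\ell\ge1$ be integers, let $\langle \mathrm{Trun}^L_b\rangle_{b^\ell}:=\frac{1}{b^\ell}\sum_{1\le n<b^\ell}\mathrm{Trun}^L_b(n)$ and \[\mathrm{Var}_{b^\ell}(\mathrm{Trun}^L_b):=\frac{1}{b^\ell} \sum_{1\le n< b^\ell} \left(\mathrm{Trun}^L_b(n)-\langle \mathrm{Trun}^L_b\rangle_{b^\ell}\right)^2.\] Then as $b\to\infty$, \begin{align*} \mathrm{Var}_{b^\ell}(\mathrm{Trun}^L_b)=& \frac{1}{\log b}\sum_{h=1}^\ell \frac{1}{h}+\frac{1}{\log^2 b}\left(\frac{b}{\phi(b)} -1\right)\left[\left(\sum_{h=1}^\ell \frac{1}{h}\right)^2-\sum_{h=1}^\ell \frac{1}{h^2}\right]\\ &+O\Bigg(\frac{\log \ell \log \log b}{\log^3 b} + \frac{\ell^5 \log^3 b}{\sqrt b}\Bigg), \end{align*} where $\phi$ is Euler's totient function and the implied constant is independent of $\ell$ and $b$.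
   Context: For $b\ge 2$ and a positive integer $n$ with base-$b$ expansion $n=\sum_{j=0}^{\ell'} a_j b^j$ ($0\le a_j\le b-1$, $a_{\ell'}\neq 0$), a truncation of $n$ is any integer $\sum_{j=0}^k a_j b^j$ with $0\le k\le \ell'$ and $a_k\ne 0$. $\mathrm{Trun}^L_b(n)$ denotes the number of truncations of $n$ that are prime.
   Formalization: The factor log ℓ in the error term is read as log max(ℓ,2), i.e. log 2 when ℓ = 1; with log 1 = 0 the formula fails at ℓ = 1, where Var − 1/log b ~ 1/log⁴ b exceeds O(log³ b/√b). For ℓ ≥ 2 the statement is unchanged. *)

(* Defs.v *)
From HB Require Import structures.
From mathcomp Require Import all_boot all_order all_algebra.
From mathcomp Require Import complex.
From mathcomp Require Import all_classical all_reals all_analysis.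
Set Implicit Arguments.
Unset Strict Implicit.
Unset Printing Implicit Defensive.
Import Order.TTheory GRing.Theory Num.Theory.
Import numFieldNormedType.Exports.
Local Open Scope classical_set_scope.
Local Open Scope ring_scope.

Section LFunctions.
Variable R : realType.
Local Notation C := (R[i]^o).

Definition dirichlet_character (q : nat) (chi : nat -> C) : Prop :=
  [/\ forall n, chi (n + q)%N = chi n,
      forall m n, chi (m * n)%N = chi m * chi n &
      forall n, (chi n != 0) = coprime n q].

(* n^(-s) = exp (- s log n), split into real and imaginary parts (n >= 1). *)
Definition npowN (n : nat) (s : C) : C :=
  let r := expR (- (complex.Re s * ln n%:R)) in
  let theta := - (complex.Im s * ln n%:R) in
  Complex (r * cos theta) (r * sin theta).

(* F is the analytic continuation of the Dirichlet series of chi to the half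
   plane Re s > 0 punctured at s = 1 (the possible pole). This domain is
   connected and contains the critical strip, so F is determined by chi there;
   the values of F elsewhere are irrelevant. Since the scalars are complex,
   [derivable F s 1] is complex differentiability at s. *)
Definition is_Lfunction (chi : nat -> C) (F : C -> C) : Prop :=
  (forall s : C, 1 < complex.Re s ->
     series (fun k : nat => chi k.+1 * npowN k.+1 s : C) @ \oo --> F s) /\
  (forall s : C, 0 < complex.Re s -> s != 1 -> derivable F s (1 : C)).

(* q = 1 is the Riemann zeta function. Imprimitive characters are included:
   the extra Euler factors have no zeros with Re s > 0. *)
Definition generalized_riemann_hypothesis : Prop :=
  forall (q : nat) (chi : nat -> C) (F : C -> C),
    (0 < q)%N -> dirichlet_character q chi -> is_Lfunction chi F ->
    forall s : C, 0 < complex.Re s < 1 -> F s = 0 -> complex.Re s = 2^-1.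

End LFunctions.

Definition digit (b n j : nat) : nat := (n %/ b ^ j) %% b.

(* For b >= 2 and n >= 1, [trunc_log b n] is the index of the leading
   base-b digit of n. *)
Definition truncations (b n : nat) : seq nat :=
  undup [seq (\sum_(0 <= j < k.+1) digit b n j * b ^ j)%N
        | k <- iota 0 (trunc_log b n).+1 & digit b n k != 0%N].

Definition TrunL (b n : nat) : nat := count prime (truncations b n).

Section Moments.
Variable R : realType.

(* The factor log l of the error term, read as log 2 when l = 1. With the value
   log 1 = 0 the asymptotic formula fails at l = 1: there the variance is
   m - m^2 - m^2/b with m = pi(b-1)/b, which by the prime number theorem is
   1/log b + (1 + o(1))/log^4 b, while the remaining error term is only
   O(log^3 b / sqrt b). *)
Definition ln_max2 (l : nat) : R := ln (maxn l 2)%:R.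

Definition mean_TrunL (b l : nat) : R :=
  (b ^ l)%:R^-1 * \sum_(1 <= n < b ^ l) (TrunL b n)%:R.

Definition var_TrunL (b l : nat) : R :=
  (b ^ l)%:R^-1 *
  \sum_(1 <= n < b ^ l) ((TrunL b n)%:R - mean_TrunL b l) ^+ 2.

End Moments.

(* Main.v *)
Require Import Defs.
From HB Require Import structures.
From mathcomp Require Import all_boot all_order all_algebra.
From mathcomp Require Import complex.
From mathcomp Require Import cyclic.
From mathcomp Require fingroup algC cyclotomic classfun character.
From mathcomp Require Import all_classical all_reals all_analysis.
From mathcomp Require Import ring lra zify.

(** For n < b^l the truncations of n are the residues n mod b^h that are at least
    b^(h-1), so Trun(n) counts the h <= l for which this residue is prime. Up to
    O(l^2/b) the variance is therefore the sum over h, k <= l of the covariances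
    of the events [n mod b^h is prime] under the uniform measure on n < b^l. The
    diagonal is the sum of m_h - m_h^2, where m_h = pi(b^h)/b^h. For h < k the
    correlation counts primes p < b^k in prime residue classes modulo b^h; under
    GRH the primes are equidistributed among the classes coprime to b, so it is
    b/phi(b) m_h m_k with a power saving. The prime number theorem
    pi(x) = x/log x + x/log^2 x + O(x/log^3 x) gives
    m_h - m_h^2 = 1/(h log b) + O(1/(h log b)^3), and b/phi(b) << log log b
    accounts for the factor log log b in the error.

    GRH enters through log L(s, chi), which is holomorphic on Re s > 1/2 (once the
    pole of zeta is removed) and O(log(q|s|) log X) on Re s = 1/2 + 1/log X by
    Borel-Caratheodory. A Perron formula with the absolutely convergent kernel
    X^s/s^2 bounds sums of Lambda(n) chi(n) log(X/n)/log n, and differencing in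
    log X removes the weight. *)

Set Implicit Arguments.
Unset Strict Implicit.
Unset Printing Implicit Defensive.
Import Order.TTheory GRing.Theory Num.Theory.
Import numFieldNormedType.Exports.
Local Open Scope classical_set_scope.
Local Open Scope complex_scope.
Local Open Scope ring_scope.
Local Notation Re := complex.Re.
Local Notation Im := complex.Im.

(** * Complex differentiation *)

Section ComplexModulus.
Variable R : realType.
Local Notation C := R[i].
Implicit Types (z w u v : C) (x y : R).

(** Complex analysis rests here on two tools: the mean value inequality, which bounds increments of
    primitives, and a maximum principle, which yields the Schwarz lemma, the Cauchy estimates and
    Borel-Caratheodory. The hypothesis speaks of zeros in the open strip 0 < Re s < 1, whereas log L
    is needed on all of Re s > 1/2. The line Re s = 1 is therefore treated separately: by the 3-4-1
    inequality for zeta and for L(s, chi), and at s = 1 for quadratic chi by an elementary argument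
    of Monsky. Perron's kernel dictates the growth allowed to log L: sqrt|s| against 1/s^2 leaves
    the integrable |s|^(-3/2), so logarithms of |s| are weakened to sqrt|s|. The smoothing has width
    about b^(-1/8). It costs b^(-1/8) times the density of the primes below b^h, while the character
    sums, divided by the width, cost b^(-1/2 + 1/8) = b^(-3/8); both are negligible as long as l
    stays below a small power of b. Since m - m^2 loses its term of order 1/log^2, the main term of
    the variance is exact up to order 1/log^3. *)

Definition cn z : R := Num.sqrt (Re z ^+ 2 + Im z ^+ 2).

Lemma cnE z : `|z| = (cn z)%:C.
Proof. by rewrite normc_def. Qed.

Lemma cn_ge0 z : 0 <= cn z.
Proof. exact: sqrtr_ge0. Qed.

Lemma cn0 : cn 0 = 0.
Proof. by apply: complexI; rewrite -cnE normr0. Qed.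

Lemma cn1 : cn 1 = 1.
Proof. by apply: complexI; rewrite -cnE normr1. Qed.

Lemma cn_eq0 z : (cn z == 0) = (z == 0).
Proof. by rewrite -[RHS]normr_eq0 cnE; apply/eqP/eqP => [->|[]]. Qed.

Lemma cn_gt0 z : (0 < cn z) = (z != 0).
Proof. by rewrite lt_neqAle cn_ge0 andbT eq_sym cn_eq0. Qed.

Lemma realcD x y : (x + y)%:C = x%:C + y%:C :> C. Proof. exact: rmorphD. Qed.
Lemma realcN x : (- x)%:C = - x%:C :> C. Proof. exact: rmorphN. Qed.
Lemma realcM x y : (x * y)%:C = x%:C * y%:C :> C. Proof. exact: rmorphM. Qed.
Lemma realcV x : (x^-1)%:C = (x%:C)^-1 :> C. Proof. exact: fmorphV. Qed.
Lemma realcX x n : (x ^+ n)%:C = x%:C ^+ n :> C. Proof. exact: rmorphXn. Qed.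
Lemma realc_nat n : (n%:R)%:C = n%:R :> C. Proof. exact: rmorph_nat. Qed.

Lemma cnM z w : cn (z * w) = cn z * cn w.
Proof. by apply: complexI; rewrite realcM -!cnE normrM. Qed.

Lemma cnN z : cn (- z) = cn z.
Proof. by apply: complexI; rewrite -!cnE normrN. Qed.

Lemma cnB z w : cn (z - w) = cn (w - z).
Proof. by rewrite -cnN opprB. Qed.

Lemma cnV z : cn z^-1 = (cn z)^-1.
Proof. by apply: complexI; rewrite realcV -!cnE normfV. Qed.

Lemma cnX z n : cn (z ^+ n) = cn z ^+ n.
Proof. by apply: complexI; rewrite realcX -!cnE normrX. Qed.

Lemma cnD z w : cn (z + w) <= cn z + cn w.
Proof. by rewrite -lecR realcD -!cnE ler_normD. Qed.

Lemma cn_subD z w : cn (z - w) <= cn z + cn w.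
Proof. by rewrite (le_trans (cnD _ _))// cnN. Qed.

Lemma cn_distD z w u : cn (z - w) <= cn (z - u) + cn (u - w).
Proof. by rewrite (le_trans _ (cnD _ _))// addrA subrK. Qed.

Lemma cn_lerB z w : cn z - cn w <= cn (z - w).
Proof. by rewrite lerBlDr (le_trans _ (cnD _ _))// subrK. Qed.

Lemma cn_real x : cn x%:C = `|x|.
Proof. by rewrite /cn /= expr0n addr0 sqrtr_sqr. Qed.

Lemma cn_real_ge0 x : 0 <= x -> cn x%:C = x.
Proof. by move=> x0; rewrite cn_real ger0_norm. Qed.

Lemma cn_nat n : cn n%:R = n%:R.
Proof. by rewrite -realc_nat cn_real ger0_norm. Qed.

Lemma Re_le_cn z : `|Re z| <= cn z.
Proof. by rewrite -sqrtr_sqr ler_sqrt ?lerDl ?sqr_ge0// addr_ge0 ?sqr_ge0. Qed.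

Lemma Im_le_cn z : `|Im z| <= cn z.
Proof. by rewrite -sqrtr_sqr ler_sqrt ?lerDr ?sqr_ge0// addr_ge0 ?sqr_ge0. Qed.

Lemma sqr_cn z : cn z ^+ 2 = Re z ^+ 2 + Im z ^+ 2.
Proof. by rewrite sqr_sqrtr// addr_ge0 ?sqr_ge0. Qed.

Lemma cn_le_ReIm z : cn z <= `|Re z| + `|Im z|.
Proof.
rewrite -(@ler_pXn2r _ 2)// ?nnegrE ?cn_ge0 ?addr_ge0// sqr_cn sqrrD.
by rewrite !real_normK ?num_real// lerD2r lerDl mulrn_wge0 ?mulr_ge0.
Qed.

Lemma cn_sum (I : Type) (r : seq I) (P : pred I) (F : I -> C) :
  cn (\sum_(i <- r | P i) F i) <= \sum_(i <- r | P i) cn (F i).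
Proof.
elim/big_ind2: _ => [|x1 x2 y1 y2 h1 h2|//]; first by rewrite cn0.
by rewrite (le_trans (cnD _ _))// lerD.
Qed.

Lemma ReD z w : Re (z + w) = Re z + Re w. Proof. by case: z; case: w. Qed.
Lemma ImD z w : Im (z + w) = Im z + Im w. Proof. by case: z; case: w. Qed.
Lemma ReN z : Re (- z) = - Re z. Proof. by case: z. Qed.
Lemma ImN z : Im (- z) = - Im z. Proof. by case: z. Qed.
Lemma ReM z w : Re (z * w) = Re z * Re w - Im z * Im w.
Proof. by case: z; case: w. Qed.
Lemma ImM z w : Im (z * w) = Re z * Im w + Im z * Re w.
Proof. by case: z; case: w. Qed.
Lemma Re0 : Re (0 : C) = 0. Proof. by []. Qed.
Lemma Im0 : Im (0 : C) = 0. Proof. by []. Qed.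
Lemma Re1 : Re (1 : C) = 1. Proof. by []. Qed.
Lemma Im1 : Im (1 : C) = 0. Proof. by []. Qed.
Lemma ReR x : Re (x%:C : C) = x. Proof. by []. Qed.
Lemma ImR x : Im (x%:C : C) = 0. Proof. by []. Qed.
Lemma Renat n : Re (n%:R : C) = n%:R.
Proof. by rewrite -realc_nat. Qed.
Lemma Imnat n : Im (n%:R : C) = 0.
Proof. by rewrite -realc_nat. Qed.
Definition cpE := (ReD, ImD, ReN, ImN, ReM, ImM, Re0, Im0, Re1, Im1, ReR, ImR,
  Renat, Imnat).

Lemma Re_sum (I : Type) (r : seq I) (P : pred I) (F : I -> C) :
  Re (\sum_(i <- r | P i) F i) = \sum_(i <- r | P i) Re (F i).
Proof. by apply: (big_morph _ ReD Re0). Qed.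

Lemma Im_sum (I : Type) (r : seq I) (P : pred I) (F : I -> C) :
  Im (\sum_(i <- r | P i) F i) = \sum_(i <- r | P i) Im (F i).
Proof. by apply: (big_morph _ ImD Im0). Qed.

Lemma complexP z w : Re z = Re w -> Im z = Im w -> z = w.
Proof. by case: z => a b; case: w => c d /= -> ->. Qed.

Lemma Re_unit_mul_le z w : cn z <= 1 -> Re (z * w) <= cn w.
Proof.
move=> z1; rewrite (le_trans (ler_norm _))// (le_trans (Re_le_cn _))// cnM.
by rewrite ler_piMl ?cn_ge0.
Qed.

(** Rotation by the conjugate of w makes its modulus a real part. Inequalities for complex-valued
    functions thereby reduce to the monotonicity of one real function. *)
Lemma unit_dual w : exists2 u, cn u <= 1 & Re (u * w) = cn w.
Proof.
have [->|w0] := eqVneq w 0; first by exists 0; rewrite ?mul0r cn0 ?ler01.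
have cw : 0 < cn w by rewrite cn_gt0.
exists (w^* * (cn w)^-1%:C).
  by rewrite cnM cn_real normfV (ger0_norm (cn_ge0 _)) -ler_pdivlMr ?invr_gt0//
    invrK mul1r /cn; case: (w) => a b /=; rewrite sqrrN.
rewrite mulrAC ReM ImR mulr0 subr0 ReR.
apply: (mulIf (lt0r_neq0 cw)); rewrite mulfVK ?gt_eqF// -expr2 sqr_cn.
by case: (w) => a b /=; ring.
Qed.

End ComplexModulus.

Section Exponential.
Variable R : realType.
Local Notation C := R[i].
Implicit Types (z w : C) (x y : R).

Definition cexp z : C := Complex (expR (Re z) * cos (Im z)) (expR (Re z) * sin (Im z)).

Lemma cexpD z w : cexp (z + w) = cexp z * cexp w.
Proof.
by apply: complexP; rewrite ?ReM ?ImM /= !(ReD, ImD) expRD ?cosD ?sinD; ring.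
Qed.

Lemma cexp0 : cexp 0 = 1.
Proof. by apply: complexP; rewrite /= expR0 ?cos0 ?sin0 ?mulr1 ?mulr0. Qed.

Lemma cn_cexp z : cn (cexp z) = expR (Re z).
Proof.
rewrite /cn /= !exprMn -mulrDr cos2Dsin2 mulr1 sqrtr_sqr ger0_norm//.
Qed.

Lemma cexp_neq0 z : cexp z != 0.
Proof. by rewrite -cn_gt0 cn_cexp expR_gt0. Qed.

Lemma cexp_real x : cexp x%:C = (expR x)%:C.
Proof. by apply: complexP; rewrite /= cos0 || rewrite /= sin0; rewrite ?mulr1 ?mulr0. Qed.

Lemma cexpMn z n : cexp (n%:R * z) = cexp z ^+ n.
Proof.
elim: n => [|n IH]; first by rewrite mul0r cexp0.
by rewrite -natr1 mulrDl mul1r cexpD IH exprSr.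
Qed.

End Exponential.

(** * Real, path and complex derivatives, and the mean value inequality *)

Section Derivatives.
Variable R : realType.
Local Notation C := R[i].
Implicit Types (F G : C -> C) (s d z w : C) (p : R -> C) (f g H : R -> R) (x y : R).

(** Derivatives of real functions, of paths ([pder]) and of complex functions ([cder]) share this
    form with an explicit radius, so that error terms combine by plain arithmetic. *)
Definition rder f x (d : R) := forall e : R, 0 < e -> exists2 r : R, 0 < r &
  forall h : R, `|h| < r -> `|f (x + h) - f x - d * h| <= e * `|h|.

Lemma rderP f x (d : R) : rder f x d <-> is_derive x 1 f d.
Proof.
split=> [H|[H1 H2] e e0].
  have cv : (h^-1 *: (f (h *: 1 + x) - f x) @[h --> 0^'] --> d)%classic.
    apply/cvgrPdist_le => e e0; have [r r0 Hr] := H e e0.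
    near=> h.
    have h0 : h != 0 by near: h; exact: nbhs_dnbhs_neq.
    have hr : `|h| < r.
      by near: h; apply: dnbhs0_lt.
    have := Hr _ hr.
    rewrite /GRing.scale /= mulr1 (addrC h).
    have -> : d - h^-1 * (f (x + h) - f x) = - (h^-1 * (f (x + h) - f x - d * h)).
      by field.
    rewrite normrN normrM normfV => Hh.
    by rewrite mulrC ler_pdivrMr ?normr_gt0.
  split; first by apply/cvg_ex; exists d.
  exact/cvg_lim.
move: H1 => /cvg_ex [l Hl].
have ld : l = d by rewrite -H2; apply/esym/cvg_lim.
rewrite ld in Hl.
move/cvgrPdist_le : Hl => /(_ e e0) /= [r /= r0 Hr].
exists r => // h hr.
have [->|h0] := eqVneq h 0; first by rewrite addr0 subrr mulr0 subr0 normr0 mulr0.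
have := Hr h; rewrite /ball_ /= sub0r normrN => /(_ hr h0).
rewrite /GRing.scale /= mulr1 (addrC h).
have -> : d - h^-1 * (f (x + h) - f x) = - (h^-1 * (f (x + h) - f x - d * h)).
  by field.
by rewrite normrN normrM normfV mulrC ler_pdivrMr ?normr_gt0.
Unshelve. all: by end_near. Qed.

Lemma rderB f g x (d1 d2 : R) : rder f x d1 -> rder g x d2 ->
  rder (fun t => f t - g t) x (d1 - d2).
Proof.
move=> Hf Hg e e0; have e2 : 0 < e / 2 by rewrite divr_gt0.
have [r1 r10 H1] := Hf _ e2; have [r2 r20 H2] := Hg _ e2.
exists (Num.min r1 r2); first by rewrite lt_min r10.
move=> h; rewrite lt_min => /andP[h1 h2].
have -> : f (x + h) - g (x + h) - (f x - g x) - (d1 - d2) * h =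
  (f (x + h) - f x - d1 * h) - (g (x + h) - g x - d2 * h) by ring.
rewrite (le_trans (ler_normB _ _))// (le_trans (lerD (H1 _ h1) (H2 _ h2)))//.
by rewrite -mulrDl -splitr.
Qed.

Lemma rder_nondecreasing f f' x y : x <= y ->
  (forall t, x <= t <= y -> rder f t (f' t)) ->
  (forall t, x <= t <= y -> 0 <= f' t) -> f x <= f y.
Proof.
move=> xy Hd Hp.
have [||c cxy E] := @MVT_segment R f f' x y xy.
- move=> t; rewrite in_itv /= => /andP[h1 h2]; apply/rderP/Hd.
  by rewrite !ltW.
- apply: derivable_within_continuous => t; rewrite in_itv /= => H.
  by have /rderP[] := Hd _ H.
rewrite -subr_ge0 E mulr_ge0 ?subr_ge0// Hp//.
Qed.

Definition pder (p : R -> C) x (d : C) := forall e : R, 0 < e -> exists2 r : R, 0 < r &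
  forall h : R, `|h| < r -> cn (p (x + h) - p x - d * h%:C) <= e * `|h|.

Definition cder F s d := forall e : R, 0 < e -> exists2 r : R, 0 < r &
  forall h : C, cn h < r -> cn (F (s + h) - F s - d * h) <= e * cn h.

Lemma rder_Re_pder p x d u : cn u <= 1 -> pder p x d ->
  rder (fun t => Re (u * p t)) x (Re (u * d)).
Proof.
move=> u1 H e e0; have [r r0 Hr] := H e e0; exists r => // h hr.
have -> : Re (u * p (x + h)) - Re (u * p x) - Re (u * d) * h =
  Re (u * (p (x + h) - p x - d * h%:C)) by rewrite !cpE; ring.
rewrite (le_trans (Re_le_cn _))// cnM (le_trans _ (Hr _ hr))//.
by rewrite ler_piMl ?cn_ge0.
Qed.

(* This mean value inequality stands in for estimates of line integrals: a
   contour integral is a difference of values of a primitive. *)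
Lemma pder_le p p' H H' x y : x <= y ->
  (forall t, x <= t <= y -> pder p t (p' t)) ->
  (forall t, x <= t <= y -> rder H t (H' t)) ->
  (forall t, x <= t <= y -> cn (p' t) <= H' t) ->
  cn (p y - p x) <= H y - H x.
Proof.
move=> xy Hp HH Hle; have [u u1 Eu] := unit_dual (p y - p x).
suff : H x - Re (u * p x) <= H y - Re (u * p y).
  by rewrite -Eu mulrBr !cpE; lra.
apply: (@rder_nondecreasing (fun t => H t - Re (u * p t))
  (fun t => H' t - Re (u * p' t))) => // t txy.
  by apply: rderB; [exact: HH|apply: rder_Re_pder => //; exact: Hp].
by rewrite subr_ge0 (le_trans (Re_unit_mul_le _ u1))// Hle.
Qed.

Lemma pder_cder F s w x d : cder F (s + x%:C * w) d ->
  pder (fun t => F (s + t%:C * w)) x (d * w).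
Proof.
move=> H e e0.
have ew : 0 < e / (cn w + 1) by rewrite divr_gt0// ltr_wpDl ?cn_ge0.
have [r r0 Hr] := H _ ew.
have w1 : 0 < cn w + 1 by rewrite ltr_wpDl ?cn_ge0.
exists (r / (cn w + 1)); first by rewrite divr_gt0.
move=> h; rewrite ltr_pdivlMr// => hr.
have hw : cn (h%:C * w) < r.
  rewrite cnM cn_real (le_lt_trans _ hr)// ler_wpM2l// lerDl//.
have := Hr _ hw.
have -> : s + x%:C * w + h%:C * w = s + (x + h)%:C * w by rewrite realcD; ring.
have -> : d * (h%:C * w) = d * w * h%:C by ring.
move=> /le_trans; apply; rewrite cnM cn_real mulrA mulrAC ler_wpM2r//.
by rewrite mulrAC ler_pdivrMr// ler_pM2l// lerDl ler01.
Qed.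

Lemma rder_lin x c k : rder (fun t => k * t + c) x k.
Proof.
move=> e e0; exists 1 => // h _.
have -> : k * (x + h) + c - (k * x + c) - k * h = 0 by ring.
by rewrite normr0 mulr_ge0// ltW.
Qed.

Lemma cder_segment_le F F' s w K :
  (forall t : R, 0 <= t <= 1 -> cder F (s + t%:C * w) (F' (s + t%:C * w))) ->
  (forall t : R, 0 <= t <= 1 -> cn (F' (s + t%:C * w)) <= K) ->
  cn (F (s + w) - F s) <= K * cn w.
Proof.
move=> HF HK.
have := @pder_le (fun t => F (s + t%:C * w)) (fun t => F' (s + t%:C * w) * w)
  (fun t => (K * cn w) * t + 0) (fun=> K * cn w) 0 1 ler01.
rewrite !mulr1 !mulr0 !addr0 !subr0 mul1r mul0r addr0; apply.
- by move=> t t01; apply: pder_cder; exact: HF.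
- by move=> t _; exact: rder_lin.
- by move=> t t01; rewrite cnM ler_wpM2r ?cn_ge0// HK.
Qed.

Lemma cder_cst c s : cder (fun=> c) s 0.
Proof.
move=> e e0; exists 1 => // h _.
by rewrite subrr mul0r subr0 cn0 mulr_ge0 ?cn_ge0 ?ltW.
Qed.

Lemma cder_id s : cder id s 1.
Proof.
move=> e e0; exists 1 => // h _.
by rewrite mul1r [s + h]addrC addrK subrr cn0 mulr_ge0 ?cn_ge0 ?ltW.
Qed.

Lemma cderD F G s d1 d2 : cder F s d1 -> cder G s d2 ->
  cder (fun z => F z + G z) s (d1 + d2).
Proof.
move=> Hf Hg e e0; have e2 : 0 < e / 2 by rewrite divr_gt0.
have [r1 r10 H1] := Hf _ e2; have [r2 r20 H2] := Hg _ e2.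
exists (Num.min r1 r2); first by rewrite lt_min r10.
move=> h; rewrite lt_min => /andP[h1 h2].
have -> : F (s + h) + G (s + h) - (F s + G s) - (d1 + d2) * h =
  (F (s + h) - F s - d1 * h) + (G (s + h) - G s - d2 * h) by ring.
rewrite (le_trans (cnD _ _))// (le_trans (lerD (H1 _ h1) (H2 _ h2)))//.
by rewrite -mulrDl -splitr.
Qed.

Lemma cder_lip F s d : cder F s d -> exists2 r : R, 0 < r &
  forall h : C, cn h < r -> cn (F (s + h) - F s) <= (cn d + 1) * cn h.
Proof.
move=> /(_ 1 ltr01)[r r0 H]; exists r => // h /H Hh.
have -> : F (s + h) - F s = (F (s + h) - F s - d * h) + d * h by ring.
by rewrite (le_trans (cnD _ _))// cnM addrC mulrDl lerD2l.
Qed.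

Lemma cder_cont F s d : cder F s d -> forall e : R, 0 < e -> exists2 r : R, 0 < r &
  forall h : C, cn h < r -> cn (F (s + h) - F s) <= e.
Proof.
move=> /cder_lip[r r0 H] e e0.
have d1 : 0 < cn d + 1 by rewrite ltr_wpDl ?cn_ge0.
exists (Num.min r (e / (cn d + 1))); first by rewrite lt_min r0 divr_gt0.
move=> h; rewrite lt_min ltr_pdivlMr// => /andP[/H h1 h2].
by rewrite (le_trans h1)// mulrC ltW.
Qed.

Lemma cderM F G s d1 d2 : cder F s d1 -> cder G s d2 ->
  cder (fun z => F z * G z) s (d1 * G s + F s * d2).
Proof.
move=> Hf Hg e e0.
set A := cn (F s) + cn (G s) + cn d2 + 1.
have A0 : 0 < A by rewrite ltr_wpDl// !addr_ge0 ?cn_ge0.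
pose k := Num.min 1 (e / (3 * A)).
have k0 : 0 < k by rewrite lt_min ltr01 divr_gt0// mulr_gt0.
have k1 : k <= 1 by rewrite ge_min lexx.
have kA : k * (3 * A) <= e.
  by rewrite -ler_pdivlMr ?mulr_gt0// ge_min lexx orbT.
have [r1 r10 H1] := Hf _ k0; have [r2 r20 H2] := Hg _ k0.
have [r3 r30 H3] := cder_cont Hf k0.
exists (Num.min (Num.min r1 r2) r3); first by rewrite !lt_min r10 r20 r30.
move=> h; rewrite !lt_min => /andP[/andP[h1 h2] h3].
have -> : F (s + h) * G (s + h) - F s * G s - (d1 * G s + F s * d2) * h =
  (F (s + h) - F s - d1 * h) * G s + F (s + h) * (G (s + h) - G s - d2 * h)
  + (F (s + h) - F s) * (d2 * h) by ring.
have {}H1 := H1 _ h1; have {}H2 := H2 _ h2; have {}H3 := H3 _ h3.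
have F1 : cn (F (s + h)) <= cn (F s) + k.
  by have := cn_lerB (F (s + h)) (F s); lra.
rewrite (le_trans (cnD _ _))// (le_trans (lerD (cnD _ _) (lexx _)))// !cnM.
have := cn_ge0 h; have := cn_ge0 (F s); have := cn_ge0 (G s); have := cn_ge0 d2.
move=> p1 p2 p3 p4.
have := ler_wpM2r p2 H1.
have := ler_pM (cn_ge0 _) (cn_ge0 _) F1 H2.
have := ler_wpM2r (mulr_ge0 p1 p4) H3.
have hk : 0 <= k * cn h by rewrite mulr_ge0// ltW.
move=> q1 q2 q3.
have q4 : (cn (F s) + k) * (k * cn h) <= A * (k * cn h).
  by rewrite ler_wpM2r// /A; lra.
have q5 : k * cn h * cn (G s) <= A * (k * cn h).
  by rewrite mulrC ler_wpM2r// /A; lra.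
have q6 : k * (cn d2 * cn h) <= A * (k * cn h).
  by rewrite mulrCA ler_wpM2r// /A; lra.
have q7 : k * (3 * A) * cn h <= e * cn h by rewrite ler_wpM2r.
lra.
Qed.

Lemma cder_inv s : s != 0 -> cder (fun z => z^-1) s (- s ^- 2).
Proof.
move=> s0 e e0; have cs : 0 < cn s by rewrite cn_gt0.
exists (Num.min (cn s / 2) (e * cn s ^+ 3 / 2)).
  by rewrite lt_min !divr_gt0// mulr_gt0// exprn_gt0.
move=> h; rewrite lt_min => /andP[h1 h2].
have sh : cn s / 2 <= cn (s + h).
  by have := cn_lerB s (- h); rewrite opprK cnN; lra.
have sh0 : s + h != 0 by rewrite -cn_gt0 (lt_le_trans _ sh)// divr_gt0.
have -> : (s + h)^-1 - s^-1 - - s ^- 2 * h = h ^+ 2 / (s ^+ 2 * (s + h)).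
  by field; rewrite s0 sh0.
rewrite cnM cnV cnM !cnX ler_pdivrMr ?mulr_gt0 ?exprn_gt0 ?cn_gt0//.
have -> : e * cn h * (cn s ^+ 2 * cn (s + h)) = cn h * (e * cn s ^+ 2 * cn (s + h)) by ring.
rewrite expr2 ler_wpM2l ?cn_ge0// (le_trans (ltW h2))//.
have -> : e * cn s ^+ 3 / 2 = e * cn s ^+ 2 * (cn s / 2) by field.
by rewrite ler_wpM2l// mulr_ge0 ?exprn_ge0 ?cn_ge0 ?ltW.
Qed.

Lemma cder_comp F G s d1 d2 : cder G s d1 -> cder F (G s) d2 ->
  cder (fun z => F (G z)) s (d2 * d1).
Proof.
move=> Hg Hf e e0; have e2 : 0 < e / 2 by rewrite divr_gt0.
have D1 : 0 < cn d1 + 1 by rewrite ltr_wpDl ?cn_ge0.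
have D2 : 0 < cn d2 + 1 by rewrite ltr_wpDl ?cn_ge0.
have [r1 r10 H1] := Hf _ (divr_gt0 e2 D1).
have [r2 r20 H2] := Hg _ (divr_gt0 e2 D2).
have [r3 r30 H3] := cder_lip Hg.
exists (Num.min (Num.min r3 r2) (r1 / (cn d1 + 1))).
  by rewrite !lt_min r30 r20 divr_gt0.
move=> h; rewrite !lt_min ltr_pdivlMr// => /andP[/andP[h3 h2] h1].
have {}H3 := H3 _ h3; have {}H2 := H2 _ h2.
set k := G (s + h) - G s in H3 H2.
have kr : cn k < r1 by rewrite (le_lt_trans H3)// mulrC.
have := H1 _ kr; rewrite (_ : G s + k = G (s + h)); last by rewrite /k; ring.
move=> {}H1.
have -> : F (G (s + h)) - F (G s) - d2 * d1 * h =
  (F (G (s + h)) - F (G s) - d2 * k) + d2 * (k - d1 * h) by rewrite /k; ring.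
rewrite (le_trans (cnD _ _))// cnM.
have a1 : cn (F (G (s + h)) - F (G s) - d2 * k) <= e / 2 * cn h.
  rewrite (le_trans H1)// (le_trans (ler_wpM2l (ltW (divr_gt0 e2 D1)) H3))//.
  by rewrite mulrA divfK ?lexx// gt_eqF.
have a2 : cn d2 * cn (k - d1 * h) <= e / 2 * cn h.
  rewrite (le_trans (ler_wpM2l (cn_ge0 _) H2))// mulrA ler_wpM2r ?cn_ge0//.
  by rewrite mulrCA ler_piMr ?(ltW e2)// ler_pdivrMr// mul1r lerDl.
by rewrite (le_trans (lerD a1 a2))// -mulrDl -splitr.
Qed.

Lemma cder_eq F G s d r : 0 < r -> (forall z, cn (z - s) < r -> F z = G z) ->
  cder G s d -> cder F s d.
Proof.
move=> r0 E H e e0; have [r1 r10 H1] := H _ e0.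
exists (Num.min r1 r); first by rewrite lt_min r10.
move=> h; rewrite lt_min => /andP[h1 h2].
rewrite !E ?subrr ?cn0//; last by rewrite addrC addKr.
exact: H1.
Qed.

Lemma cder_ext F G s d : F =1 G -> cder G s d -> cder F s d.
Proof. by move=> E; apply: (cder_eq ltr01) => z _. Qed.

Lemma cder_eqd F s d d' : d = d' -> cder F s d -> cder F s d'.
Proof. by move=> ->. Qed.

Lemma cderV F s d : F s != 0 -> cder F s d -> cder (fun z => (F z)^-1) s (- d / F s ^+ 2).
Proof.
move=> F0 H; apply: (cder_eqd _ (cder_comp H (cder_inv F0))).
by rewrite mulrC mulrN mulNr.
Qed.

Lemma cderZ F s d c : cder F s d -> cder (fun z => c * F z) s (c * d).
Proof.
move=> H; apply: (cder_eqd _ (cderM (cder_cst c s) H)).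
by rewrite mul0r add0r.
Qed.

Lemma cderN F s d : cder F s d -> cder (fun z => - F z) s (- d).
Proof.
move=> H; apply: (cder_ext (G := fun z => -1 * F z)) => [z|]; first by rewrite mulN1r.
by apply: (cder_eqd _ (cderZ (-1) H)); rewrite mulN1r.
Qed.

Lemma cderB F G s d1 d2 : cder F s d1 -> cder G s d2 ->
  cder (fun z => F z - G z) s (d1 - d2).
Proof. by move=> H1 H2; apply: cderD => //; exact: cderN. Qed.

Lemma cder_sum (I : Type) (r : seq I) (F F' : I -> C -> C) s :
  (forall i, cder (F i) s (F' i s)) ->
  cder (fun z => \sum_(i <- r) F i z) s (\sum_(i <- r) F' i s).
Proof.
move=> H; elim: r => [|i r IH].
  by rewrite big_nil; apply: (cder_ext (G := fun=> 0)) (cder_cst 0 s) => z; rewrite big_nil.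
rewrite big_cons; apply: (cder_ext (G := fun z => F i z + \sum_(j <- r) F j z)).
  by move=> z; rewrite big_cons.
exact: cderD.
Qed.

Lemma cder_uniq F s d1 d2 : cder F s d1 -> cder F s d2 -> d1 = d2.
Proof.
move=> H1 H2; apply/eqP; rewrite -subr_eq0 -cn_eq0; apply/negPn/negP => n0.
have p : 0 < cn (d1 - d2) by rewrite lt_neqAle eq_sym n0 cn_ge0.
have e0 : 0 < cn (d1 - d2) / 4 by rewrite divr_gt0.
have [r1 r10 {}H1] := H1 _ e0; have [r2 r20 {}H2] := H2 _ e0.
pose h : C := (Num.min r1 r2 / 2)%:C.
have m0 : 0 < Num.min r1 r2 by rewrite lt_min r10.
have ch : cn h = Num.min r1 r2 / 2 by rewrite cn_real_ge0// divr_ge0// ltW.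
have hlt : cn h < Num.min r1 r2 by rewrite ch; lra.
move: (hlt); rewrite lt_min => /andP[/H1 {}H1 /H2 {}H2].
have : cn ((d1 - d2) * h) <= cn (d1 - d2) / 4 * cn h + cn (d1 - d2) / 4 * cn h.
  have -> : (d1 - d2) * h = (F (s + h) - F s - d2 * h) - (F (s + h) - F s - d1 * h) by ring.
  by rewrite (le_trans (cn_subD _ _))// lerD.
rewrite cnM -mulrDl ler_pM2r; last by rewrite ch divr_gt0.
lra.
Qed.

(** Real analysis enters at 0 only, through the derivatives of exp, cos and sin; the addition
    formula carries the result to every other point. *)
Lemma cexp_der0 : cder (@cexp R) 0 1.
Proof.
have Dr (f : R -> R) (d : R) : is_derive (0 : R) 1 f d -> rder f 0 d by move=> /rderP.
have He := Dr _ _ (is_derive_expR 0); rewrite expR0 in He.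
have Hc := Dr _ _ (is_derive_cos 0); rewrite sin0 oppr0 in Hc.
have Hs := Dr _ _ (is_derive_sin 0); rewrite cos0 in Hs.
move=> e e0.
(* The two coordinates contribute errors of at most 3k|h| and 5k|h|, hence e/8. *)
have [k [k0 k1 ke]] : exists k : R, [/\ 0 < k, k <= 1 & k <= e / 8].
  exists (Num.min 1 (e / 8)); split; rewrite ?ge_min ?lexx ?orbT//.
  by rewrite lt_min ltr01 divr_gt0.
have [r1 r10 H1] := He _ k0; have [r2 r20 H2] := Hc _ k0; have [r3 r30 H3] := Hs _ k0.
exists (Num.min (Num.min r1 k) (Num.min r2 r3)); first by rewrite !lt_min r10 r20 r30 k0.
case=> a b; rewrite !lt_min => /andP[/andP[h1 h4] /andP[h2 h3]].
set h := Complex a b in h1 h2 h3 h4 *.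
have ha : `|a| <= cn h by exact: (Re_le_cn h).
have hb : `|b| <= cn h by exact: (Im_le_cn h).
have := H1 _ (le_lt_trans ha h1); have := H2 _ (le_lt_trans hb h2).
have := H3 _ (le_lt_trans hb h3).
rewrite !add0r expR0 cos0 sin0 !subr0 !mul1r mul0r subr0 => E3 E2 E1.
rewrite cexp0 (le_trans (cn_le_ReIm _))// !cpE /=.
have kb : k * `|b| <= k * cn h by rewrite ler_wpM2l// ltW.
have ka : k * `|a| <= k * cn h by rewrite ler_wpM2l// ltW.
have c1 : `|cos b| <= 1 by rewrite ler_norml cos_geN1 cos_le1.
have ea : `|expR a - 1| <= 2 * cn h.
  have -> : expR a - 1 = (expR a - 1 - a) + a by ring.
  rewrite (le_trans (ler_normD _ _))//.
  have : k * cn h <= 1 * cn h by rewrite ler_wpM2r ?cn_ge0.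
  lra.
have T1 : `|expR a * cos b - 1 - a| <= 3 * (k * cn h).
  have -> : expR a * cos b - 1 - a =
    (expR a - 1 - a) * cos b + (1 + a) * (cos b - 1).
    by ring.
  have a1 : `|1 + a| <= 2.
    by rewrite (le_trans (ler_normD _ _))// normr1; lra.
  rewrite (le_trans (ler_normD _ _))// !normrM.
  have := ler_pM (normr_ge0 _) (normr_ge0 _) E1 c1.
  have := ler_pM (normr_ge0 _) (normr_ge0 _) a1 E2.
  by rewrite mulr1; lra.
have sb : `|sin b| <= 2 * cn h.
  have -> : sin b = (sin b - b) + b by ring.
  rewrite (le_trans (ler_normD _ _))//.
  have : k * cn h <= 1 * cn h by rewrite ler_wpM2r ?cn_ge0.
  lra.
have T2 : `|expR a * sin b - b| <= 5 * (k * cn h).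
  have -> : expR a * sin b - b =
    (expR a - 1) * sin b + (sin b - b) by ring.
  rewrite (le_trans (ler_normD _ _))// normrM.
  have := ler_pM (normr_ge0 _) (normr_ge0 _) ea sb.
  have : cn h * cn h <= k * cn h by rewrite ler_wpM2r ?cn_ge0// ltW.
  lra.
have : k * cn h <= e / 8 * cn h by rewrite ler_wpM2r ?cn_ge0.
move: T1 T2; rewrite !subr0; lra.
Qed.

Lemma cder_cexp s : cder (@cexp R) s (cexp s).
Proof.
move=> e e0; have es : 0 < e / expR (Re s) by rewrite divr_gt0// expR_gt0.
have [r r0 H] := cexp_der0 es; exists r => // h /H.
rewrite add0r cexp0 mul1r => Hh.
have -> : cexp (s + h) - cexp s - cexp s * h = cexp s * (cexp h - 1 - h).
  by rewrite cexpD; ring.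
rewrite cnM cn_cexp (le_trans (ler_wpM2l (expR_ge0 _) Hh))//.
by rewrite mulrA mulrCA divff ?mulr1// gt_eqF// expR_gt0.
Qed.

Lemma cder_cexp_lin s k : cder (fun z => cexp (k * z)) s (k * cexp (k * s)).
Proof.
apply: (cder_eqd _ (cder_comp (cderZ k (cder_id s)) (cder_cexp _))).
by rewrite mulr1 mulrC.
Qed.

Lemma cexp_sub1_le z B : 0 <= B -> Re z <= B -> cn (cexp z - 1) <= cn z * expR B.
Proof.
move=> B0 zB; have := @cder_segment_le (@cexp R) (@cexp R) 0 z (expR B).
rewrite add0r cexp0 mulrC; apply=> [t _|t /andP[t0 t1]]; first exact: cder_cexp.
rewrite add0r cn_cexp ler_expR !cpE mul0r subr0.
have [z0|z0] := leP 0 (Re z); first by rewrite (le_trans _ zB)// ler_piMl.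
by rewrite (le_trans _ B0)// mulr_ge0_le0// ltW.
Qed.

Lemma cexp_sub1D_le z B : 0 <= B -> Re z <= B ->
  cn (cexp z - 1 - z) <= cn z ^+ 2 * expR B.
Proof.
move=> B0 zB.
have := @cder_segment_le (fun w => cexp w - w) (fun w => cexp w - 1) 0 z (cn z * expR B).
rewrite add0r cexp0 subr0.
have -> : cexp z - z - 1 = cexp z - 1 - z by ring.
have -> : cn z * expR B * cn z = cn z ^+ 2 * expR B by ring.
apply=> [t _|t /andP[t0 t1]].
  by rewrite add0r; apply: cderB; [exact: cder_cexp|exact: cder_id].
rewrite add0r (le_trans (cexp_sub1_le B0 _))//.
  rewrite !cpE mul0r subr0.
  have [z0|z0] := leP 0 (Re z); first by rewrite (le_trans _ zB)// ler_piMl.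
  by rewrite (le_trans _ B0)// mulr_ge0_le0// ltW.
by rewrite cnM cn_real_ge0// ler_wpM2r ?expR_ge0// ler_piMl ?cn_ge0.
Qed.

End Derivatives.

(** * Functions with finitely many complex derivatives *)

Section Holomorphic.
Variable R : realType.
Local Notation C := R[i].
Implicit Types (D : C -> Prop) (F G : C -> C).

(** The order n is a budget: every derivative that an argument takes draws one unit from it, and
    taking a primitive adds one. The L-functions below are shown to have every order. *)
Fixpoint hol D n F : Prop := if n is m.+1 then
  exists F', (forall s, D s -> cder F s (F' s)) /\ hol D m F' else True.

Lemma holW D n F : hol D n.+1 F -> hol D n F.
Proof.
elim: n F => [//|n IH] F [F' [H1 H2]]; exists F'; split => //; exact: IH.
Qed.

Lemma hol_leq D m n F : (m <= n)%N -> hol D n F -> hol D m F.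
Proof. by move/subnK <-; elim: (n - m)%N => // k IH /holW. Qed.

Lemma hol_sub D D' n F : (forall s, D' s -> D s) -> hol D n F -> hol D' n F.
Proof.
move=> DD; elim: n F => [//|n IH] F [F' [H1 H2]]; exists F'.
by split=> [s /DD/H1//|]; exact: IH.
Qed.

Lemma hol_cst D n c : hol D n (fun=> c).
Proof.
elim: n c => [//|n IH] c; exists (fun=> 0); split => // s _; exact: cder_cst.
Qed.

Lemma hol_id D n : hol D n id.
Proof.
case: n => [//|n]; exists (fun=> 1); split; last exact: hol_cst.
by move=> s _; exact: cder_id.
Qed.

Lemma holD D n F G : hol D n F -> hol D n G -> hol D n (fun z => F z + G z).
Proof.
elim: n F G => [//|n IH] F G [F' [H1 H2]] [G' [H3 H4]].
exists (fun z => F' z + G' z); split; last exact: IH.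
by move=> s Ds; apply: cderD; [exact: H1|exact: H3].
Qed.

Lemma holM D n F G : hol D n F -> hol D n G -> hol D n (fun z => F z * G z).
Proof.
elim: n F G => [//|n IH] F G HF HG.
have {}IHF := IH _ _ _ (holW HG); have {}IHG := IH _ _ (holW HF).
case: HF => F' [H1 H2]; case: HG => G' [H3 H4].
exists (fun z => F' z * G z + F z * G' z); split.
  by move=> s Ds; apply: cderM; [exact: H1|exact: H3].
by apply: holD; [exact: IHF|exact: IHG].
Qed.

Lemma holZ D n c F : hol D n F -> hol D n (fun z => c * F z).
Proof. by apply: holM; exact: hol_cst. Qed.

Lemma holB D n F G : hol D n F -> hol D n G -> hol D n (fun z => F z - G z).
Proof.
move=> HF HG; rewrite (_ : (fun z => _) = (fun z => F z + (-1) * G z)).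
  by apply: holD => //; exact: holZ.
by apply/funext => z; rewrite mulN1r.
Qed.

Lemma holV D n F : (forall s, D s -> F s != 0) -> hol D n F ->
  hol D n (fun z => (F z)^-1).
Proof.
move=> F0; elim: n => [//|n IH] HF; have {}IH := IH (holW HF).
case: HF => F' [H1 H2]; exists (fun z => (-1) * (F' z * ((F z)^-1 * (F z)^-1))); split.
  move=> s Ds; apply: (cder_eqd _ (cderV (F0 _ Ds) (H1 _ Ds))).
  by rewrite mulN1r mulNr expr2 invfM.
by apply: holZ; apply: holM => //; apply: holM.
Qed.

Lemma hol_cexp D n F : hol D n F -> hol D n (fun z => cexp (F z)).
Proof.
elim: n => [//|n IH] HF; have {}IH := IH (holW HF).
case: HF => F' [H1 H2]; exists (fun z => cexp (F z) * F' z); split.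
  by move=> s Ds; apply: cder_comp; [exact: H1|exact: cder_cexp].
exact: holM.
Qed.

Lemma hol_ext D n F G : F =1 G -> hol D n G -> hol D n F.
Proof. by move=> /funext ->. Qed.

Lemma hol_primitive D n F F' : (forall s, D s -> cder F s (F' s)) ->
  hol D n F' -> hol D n.+1 F.
Proof. by exists F'. Qed.

Definition copen D := forall s, D s -> exists2 r : R, 0 < r &
  forall z, cn (z - s) < r -> D z.

Lemma hol_eq D n F G : copen D -> (forall s, D s -> F s = G s) ->
  hol D n G -> hol D n F.
Proof.
move=> oD E; case: n => [//|n] [G' [H1 H2]]; exists G'; split => // s Ds.
have [r r0 Hr] := oD _ Ds.
by apply: (cder_eq r0) (H1 _ Ds) => z /Hr/E.
Qed.

End Holomorphic.

(** * Series and the maximum principle *)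

Section Series.
Variable R : realType.
Local Notation C := R[i].
Implicit Types (u v : nat -> C) (M : nat -> R).

Definition cvs u (l : C) := forall e : R, 0 < e -> exists N, forall n, (N <= n)%N ->
  cn (\sum_(0 <= k < n) u k - l) <= e.

Definition bsum M (B : R) := forall n, \sum_(0 <= k < n) M k <= B.

Lemma cvs_uniq u l l' : cvs u l -> cvs u l' -> l = l'.
Proof.
move=> H H'; apply/eqP; rewrite -subr_eq0 -cn_eq0; apply/negPn/negP => n0.
have p : 0 < cn (l - l') by rewrite lt_neqAle eq_sym n0 cn_ge0.
have p3 : 0 < cn (l - l') / 3 by rewrite divr_gt0.
have [N HN] := H _ p3; have [N' HN'] := H' _ p3.
have := HN _ (leq_maxl N N'); have := HN' _ (leq_maxr N N').
set S := \sum_(0 <= k < _) _ => h1 h2.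
have := cn_distD l l' S; rewrite (cnB l S); lra.
Qed.

Lemma cvsD u v l l' : cvs u l -> cvs v l' -> cvs (fun n => u n + v n) (l + l').
Proof.
move=> H H' e e0; have e2 : 0 < e / 2 by rewrite divr_gt0.
have [N HN] := H _ e2; have [N' HN'] := H' _ e2.
exists (maxn N N') => n; rewrite geq_max => /andP[/HN h1 /HN' h2].
rewrite big_split /= opprD addrACA (le_trans (cnD _ _))//; lra.
Qed.

Lemma cvsZ c u l : cvs u l -> cvs (fun n => c * u n) (c * l).
Proof.
move=> H e e0; have c1 : 0 < cn c + 1 by rewrite ltr_wpDl ?cn_ge0.
have [N HN] := H _ (divr_gt0 e0 c1); exists N => n /HN h.
rewrite -mulr_sumr -mulrBr cnM (le_trans (ler_wpM2l (cn_ge0 _) h))//.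
by rewrite mulrCA ler_piMr ?ltW// ltr_pdivrMr// mul1r ltrDl.
Qed.

Lemma cvsB u v l l' : cvs u l -> cvs v l' -> cvs (fun n => u n - v n) (l - l').
Proof.
move=> H /(cvsZ (-1)) H'.
have := cvsD H H'; rewrite mulN1r; congr cvs.
by apply/funext => n; rewrite mulN1r.
Qed.

Lemma eq_cvs u v l : u =1 v -> cvs u l -> cvs v l.
Proof. by move=> /funext ->. Qed.

Lemma cvs_le u l M B : (forall n, cn (u n) <= M n) -> bsum M B -> cvs u l -> cn l <= B.
Proof.
move=> uM MB H; apply/ler_addgt0Pr => e e0; have [N /(_ _ (leqnn N)) HN] := H _ e0.
have := cn_lerB l (\sum_(0 <= k < N) u k); rewrite cnB => h.
have : cn (\sum_(0 <= k < N) u k) <= B.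
  by rewrite (le_trans (cn_sum _ _ _))// (le_trans _ (MB N))// ler_sum.
lra.
Qed.

Lemma bsum_tail M B : (forall n, 0 <= M n) -> bsum M B -> forall e : R, 0 < e ->
  exists N, forall n m, (N <= n)%N -> \sum_(n <= k < m) M k <= e.
Proof.
move=> M0 MB e e0.
pose s := fun n => \sum_(0 <= k < n) M k.
have nd : {homo s : n m / (n <= m)%N >-> n <= m}.
  by move=> n m nm; rewrite /s (big_cat_nat _ nm)//= lerDl sumr_ge0.
have cv : cvgn s.
  by apply: nondecreasing_is_cvgn => //; exists B => _ [n _ <-]; exact: MB.
have /cvgrPdist_le/(_ _ e0) [N _ HN] := cv.
exists N => n m Nn.
have [mn|nm] := leqP m n; first by rewrite big_geq// ltW.
have := HN n Nn; have Hm : s m <= limn s by exact: nondecreasing_cvgn_le.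
have En : s m = s n + \sum_(n <= k < m) M k by rewrite /s (big_cat_nat _ (ltnW nm)).
by rewrite /= => /(le_trans (ler_norm _)); move: Hm; rewrite En; lra.
Qed.

Lemma nonneg_series_cvg (M : nat -> R) B : (forall n, 0 <= M n) -> bsum M B ->
  exists l : R, forall e : R, 0 < e -> exists N, forall n, (N <= n)%N ->
  `|\sum_(0 <= k < n) M k - l| <= e.
Proof.
move=> M0 MB; pose s := fun n => \sum_(0 <= k < n) M k.
have nd : {homo s : n m / (n <= m)%N >-> n <= m}.
  by move=> n m nm; rewrite /s (big_cat_nat _ nm)//= lerDl sumr_ge0.
have cv : cvgn s.
  by apply: nondecreasing_is_cvgn => //; exists B => _ [n _ <-]; exact: MB.
exists (limn s) => e e0.
have /cvgrPdist_le/(_ _ e0) [N _ HN] := cv.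
by exists N => n /HN; rewrite distrC.
Qed.

(** The series is the difference of those of f + M and of M, whose terms are nonnegative and whose
    partial sums are bounded. *)
Lemma real_series_cvg (f M : nat -> R) B : (forall n, `|f n| <= M n) -> bsum M B ->
  exists l : R, forall e : R, 0 < e -> exists N, forall n, (N <= n)%N ->
  `|\sum_(0 <= k < n) f k - l| <= e.
Proof.
move=> fM MB.
have M0 n : 0 <= M n by rewrite (le_trans _ (fM n)).
have [l Hl] := nonneg_series_cvg M0 MB.
have [||l' Hl'] := @nonneg_series_cvg (fun n => f n + M n) (2 * B).
- by move=> n; have := fM n; rewrite ler_norml; lra.
- move=> n; rewrite mulrDl mul1r (le_trans _ (lerD (MB n) (MB n)))// -big_split.
  by apply: ler_sum => k _; have := fM k; rewrite ler_norml /=; lra.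
exists (l' - l) => e e0; have e2 : 0 < e / 2 by rewrite divr_gt0.
have [N HN] := Hl _ e2; have [N' HN'] := Hl' _ e2.
exists (maxn N N') => n; rewrite geq_max => /andP[/HN h1 /HN' h2].
have E : \sum_(0 <= k < n) f k = \sum_(0 <= k < n) (f k + M k) - \sum_(0 <= k < n) M k.
  by rewrite big_split /= addrK.
move: h1 h2; rewrite E !ler_norml; lra.
Qed.

Lemma cvs_exists u M B : (forall n, cn (u n) <= M n) -> bsum M B -> exists l, cvs u l.
Proof.
move=> uM MB.
have [a Ha] := real_series_cvg (fun n => le_trans (Re_le_cn _) (uM n)) MB.
have [b Hb] := real_series_cvg (fun n => le_trans (Im_le_cn _) (uM n)) MB.
exists (Complex a b) => e e0; have e2 : 0 < e / 2 by rewrite divr_gt0.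
have [N HN] := Ha _ e2; have [N' HN'] := Hb _ e2.
exists (maxn N N') => n; rewrite geq_max => /andP[/HN h1 /HN' h2].
rewrite (le_trans (cn_le_ReIm _))// !cpE Re_sum Im_sum /=; lra.
Qed.

(** The limit is picked by choice, with value 0 for a divergent series, so that sums of functions
    are total functions of s. *)
Definition CS u : C := xget 0 [set l | cvs u l].

Lemma CSP u M B : (forall n, cn (u n) <= M n) -> bsum M B -> cvs u (CS u).
Proof. by move=> uM MB; have := cvs_exists uM MB => -[l Hl]; exact: xgetI Hl. Qed.

Lemma CS_eq u l : cvs u l -> CS u = l.
Proof. by move=> H; apply: (@cvs_uniq u) => //; exact: xgetI H. Qed.

Lemma bsumZ M B (c : R) : 0 <= c -> bsum M B -> bsum (fun n => c * M n) (c * B).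
Proof. by move=> c0 H n; rewrite -mulr_sumr ler_wpM2l. Qed.

End Series.

(** * The maximum modulus principle *)

Section MaximumPrinciple.
Variable R : realType.
Local Notation C := R[i].
Implicit Types (q g f : C -> C) (c z : C).

(** This is the regularity that the maximum principle consumes. Being local and of second order, it
    can also be verified by hand for g(z)/z at the origin. *)
Definition tay2 q c := exists a b : C, forall e : R, 0 < e -> exists2 r : R, 0 < r &
  forall h, cn h < r -> cn (q (c + h) - q c - a * h - b * h ^+ 2) <= e * cn h ^+ 2.

Definition disc c (r : R) := fun z : C => cn (z - c) < r.

Lemma disc_open c r : copen (disc c r).
Proof.
move=> s sc; exists (r - cn (s - c)); first by rewrite subr_gt0.
by move=> z zs; rewrite /disc (le_lt_trans (cn_distD _ _ s))//; lra.
Qed.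

Lemma disc_center c r : 0 < r -> disc c r c.
Proof. by rewrite /disc subrr cn0. Qed.

(** Minus its quadratic polynomial, q has derivative at most e|h| on the segment, because q1 is
    differentiable at c; the mean value inequality supplies the second factor |h|. *)
Lemma tay2_coef (D : C -> Prop) q q1 c (q2 : C) : copen D -> D c ->
  (forall s, D s -> cder q s (q1 s)) -> cder q1 c q2 ->
  forall e : R, 0 < e -> exists2 r : R, 0 < r & forall h, cn h < r ->
    cn (q (c + h) - q c - q1 c * h - q2 / 2 * h ^+ 2) <= e * cn h ^+ 2.
Proof.
move=> oD Dc H1 H2 e e0; have [r0 r00 Hr0] := oD _ Dc.
have [r1 r10 Hr1] := H2 _ e0.
exists (Num.min r0 r1); first by rewrite lt_min r00.
move=> h; rewrite lt_min => /andP[h0 h1].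
have := @cder_segment_le R (fun w => q w - q1 c * w - q2 / 2 * (w - c) ^+ 2)
  (fun w => q1 w - q1 c - q2 * (w - c)) c h (e * cn h).
have -> : q (c + h) - q1 c * (c + h) - q2 / 2 * (c + h - c) ^+ 2 -
    (q c - q1 c * c - q2 / 2 * (c - c) ^+ 2) =
  q (c + h) - q c - q1 c * h - q2 / 2 * h ^+ 2 by ring.
have -> : e * cn h * cn h = e * cn h ^+ 2 by ring.
apply=> t /andP[t0 t1].
  have Dt : D (c + t%:C * h).
    apply: Hr0; rewrite addrC addKr cnM cn_real_ge0// (le_lt_trans _ h0)//.
    by rewrite ler_piMl ?cn_ge0.
  set w := c + _.
  have E1 : cder (fun w => q2 / 2 * (w - c) ^+ 2) w (q2 * (w - c)).
    have Ew : cder (fun w => w - c) w 1.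
      by apply: (cder_eqd _ (cderB (cder_id w) (cder_cst c w))); rewrite subr0.
    apply: (cder_ext (G := fun w => q2 / 2 * ((w - c) * (w - c)))) => //.
    apply: (cder_eqd _ (cderZ (q2 / 2) (cderM Ew Ew))).
    by field.
  apply: cderB => //; apply: cderB; first exact: H1.
  by apply: (cder_eqd _ (cderZ (q1 c) (cder_id w))); rewrite mulr1.
have th : cn (t%:C * h) <= cn h by rewrite cnM cn_real_ge0// ler_piMl ?cn_ge0.
have -> : c + t%:C * h - c = t%:C * h by ring.
rewrite (le_trans (Hr1 _ (le_lt_trans th h1)))//.
by rewrite ler_wpM2l// ltW.
Qed.

Lemma tay2_hol D q c : copen D -> D c -> hol D 2 q -> tay2 q c.
Proof.
move=> oD Dc [q1 [H1 [q2 [H2 _]]]]; exists (q1 c), (q2 c / 2) => e.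
by apply: (tay2_coef oD) => //; exact: H2.
Qed.

Lemma tay2_cont q c : tay2 q c -> forall e : R, 0 < e -> exists2 r : R, 0 < r &
  forall h, cn h < r -> cn (q (c + h) - q c) <= e.
Proof.
move=> [a [b H]] e e0; have [r r0 Hr] := H 1 ltr01.
have A0 : 0 < cn a + cn b + 1 by rewrite ltr_wpDl// addr_ge0 ?cn_ge0.
exists (Num.min r (Num.min 1 (e / (cn a + cn b + 1)))).
  by rewrite !lt_min r0 ltr01 divr_gt0.
move=> h; rewrite !lt_min ltr_pdivlMr// => /and3P[/Hr h1 h2 h3].
have -> : q (c + h) - q c = (q (c + h) - q c - a * h - b * h ^+ 2) + a * h + b * h ^+ 2 by ring.
rewrite (le_trans (cnD _ _))// (le_trans (lerD (cnD _ _) (lexx _)))//.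
rewrite [cn (a * h)]cnM [cn (b * _)]cnM cnX.
have hh : cn h ^+ 2 <= cn h by rewrite expr2 ler_piMl ?cn_ge0// ltW.
have : cn b * cn h ^+ 2 <= cn b * cn h by rewrite ler_wpM2l ?cn_ge0.
lra.
Qed.

(** Compactness comes from a product of two real segments, in which the disc is a closed subset. *)
Lemma closed_disc_EVT (f : C -> R) (r : R) : 0 < r ->
  (forall c, cn c <= r -> forall e : R, 0 < e -> exists2 d : R, 0 < d &
    forall h, cn h < d -> `|f (c + h) - f c| <= e) ->
  exists2 c, cn c <= r & forall z, cn z <= r -> f z <= f c.
Proof.
move=> r0 cf.
pose A : set (R * R) := [set p | cn (Complex p.1 p.2) <= r].
pose F (p : R * R) := f (Complex p.1 p.2).
have close (p q : R * R) : cn (Complex q.1 q.2 - Complex p.1 p.2) <=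
    `|q.1 - p.1| + `|q.2 - p.2| by exact: cn_le_ReIm.
have cA : compact A.
  apply: (@subclosed_compact _ _ (`[- r, r] `*` `[- r, r])).
  - move=> p clp; rewrite /A /=; rewrite leNgt; apply/negP => pr.
    pose d := (cn (Complex p.1 p.2) - r) / 2.
    have d0 : 0 < d by rewrite divr_gt0// subr_gt0.
    have : nbhs p (ball p (d / 2)) by apply: nbhsx_ballx; rewrite divr_gt0.
    move=> /clp [q [Aq [/= b1 b2]]].
    have := close p q; rewrite -[`|q.1 - _|]distrC -[`|q.2 - _|]distrC.
    have := cn_lerB (Complex p.1 p.2) (Complex q.1 q.2); rewrite cnB.
    move: Aq b1 b2; rewrite /A /ball /= /ball_ /=.
    have : d + d = cn (Complex p.1 p.2) - r by rewrite /d -splitr.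
    lra.
  - by apply: compact_setX; exact: segment_compact.
  - move=> p Ap; split; rewrite /= in_itv /= -ler_norml (le_trans _ Ap)//.
      exact: (Re_le_cn (Complex _ _)).
    exact: (Im_le_cn (Complex _ _)).
have cF : {within A, continuous F}.
  apply/subspace_continuousP => p Ap; apply: cvg_within_filter.
  apply/cvgrPdist_le => e e0; have [d d0 Hd] := cf _ Ap _ e0.
  have d2 : 0 < d / 2 by rewrite divr_gt0.
  have nb : nbhs p (ball p (d / 2)) by apply: nbhsx_ballx.
  apply: filterS nb => q [/= b1 b2]; rewrite distrC /F.
  have := Hd (Complex q.1 q.2 - Complex p.1 p.2).
  have -> : Complex p.1 p.2 + (Complex q.1 q.2 - Complex p.1 p.2) = Complex q.1 q.2 by ring.
  apply; rewrite (le_lt_trans (close p q))//.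
  move: b1 b2; rewrite /ball /= /ball_ /= [`|p.1 - _|]distrC [`|p.2 - _|]distrC; lra.
have [|p Ap Hp] := compact_EVT_max _ cA cF.
  by exists (0, 0); rewrite /A /= (_ : Complex _ _ = 0)// cn0 ltW.
exists (Complex p.1 p.2); first by move: Ap; rewrite inE.
by case=> x y zr; apply: (Hp (x, y)); rewrite inE.
Qed.

(* Averaging over c + h, c + ih, c - h, c - ih kills the first and second order
   terms of q, so |q|^2 + k |z|^2 has no interior maximum. *)
Lemma maximum_modulus q (r K : R) : 0 < r -> 0 <= K ->
  (forall z, cn z <= r -> tay2 q z) ->
  (forall z, cn z = r -> cn (q z) <= K) ->
  forall z, cn z <= r -> cn (q z) <= K.
Proof.
move=> r0 K0 tq bq z0 z0r; rewrite leNgt; apply/negP => Kq.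
(* With this A the perturbation A |z|^2 is at most half the excess |q(z0)|^2 - K^2 on the disc, so
   the maximum of the perturbed function cannot lie on the circle. *)
pose A := (cn (q z0) ^+ 2 - K ^+ 2) / (2 * r ^+ 2).
have A0 : 0 < A.
  rewrite divr_gt0 ?mulr_gt0 ?exprn_gt0// subr_gt0 ltr_pXn2r// nnegrE ?cn_ge0//.
pose u z := cn (q z) ^+ 2 + A * cn z ^+ 2.
have [c cr cmax] : exists2 c, cn c <= r & forall z, cn z <= r -> u z <= u c.
  apply: closed_disc_EVT => // c cr e e0.
  pose B := 2 * cn (q c) + 1; pose B' := A * (2 * cn c + 1).
  have B0 : 0 < B by rewrite /B ltr_wpDl// mulr_ge0 ?cn_ge0.
  have B'0 : 0 < B' by rewrite /B' mulr_gt0// ltr_wpDl// mulr_ge0 ?cn_ge0.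
  have [k [k0 k1 kB kB']] : exists k : R, [/\ 0 < k, k <= 1, k * B <= e / 2 & k * B' <= e / 2].
    exists (Num.min 1 (Num.min (e / 2 / B) (e / 2 / B'))); split.
    - by rewrite !lt_min ltr01 !divr_gt0.
    - by rewrite ge_min lexx.
    - by rewrite -ler_pdivlMr// !ge_min lexx !orbT.
    - by rewrite -ler_pdivlMr// !ge_min lexx !orbT.
  have [d d0 Hd] := tay2_cont (tq _ cr) k0.
  exists (Num.min d k); first by rewrite lt_min d0.
  move=> h; rewrite lt_min => /andP[/Hd h1 h2].
  have sq (x y t : R) : 0 <= x -> 0 <= y -> `|x - y| <= t -> t <= 1 ->
      `|x ^+ 2 - y ^+ 2| <= t * (2 * y + 1).
    move=> x0 y0 xy t1; have -> : x ^+ 2 - y ^+ 2 = (x - y) * (x + y) by ring.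
    rewrite normrM ler_pM// ger0_norm ?addr_ge0//.
    by move: xy; rewrite ler_norml => /andP[]; lra.
  have dist (x y : C) : `|cn x - cn y| <= cn (x - y).
    rewrite ler_norml; have := cn_lerB x y; have := cn_lerB y x; rewrite (cnB y); lra.
  have -> : u (c + h) - u c = (cn (q (c + h)) ^+ 2 - cn (q c) ^+ 2)
     + A * (cn (c + h) ^+ 2 - cn c ^+ 2) by rewrite /u; ring.
  rewrite (le_trans (ler_normD _ _))// normrM (gtr0_norm A0).
  have s1 := sq _ _ _ (cn_ge0 _) (cn_ge0 _) (le_trans (dist _ _) h1) k1.
  have h3 : cn (c + h - c) <= k by rewrite addrC addKr ltW.
  have s2 := sq _ _ _ (cn_ge0 _) (cn_ge0 _) (le_trans (dist _ _) h3) k1.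
  have := ler_wpM2l (ltW A0) s2; move: s1 kB kB'; rewrite /B /B'.
  have -> : A * (k * (2 * cn c + 1)) = k * (A * (2 * cn c + 1)) by ring.
  lra.
have clt : cn c < r.
  rewrite lt_neqAle cr andbT; apply/negP => /eqP cE.
  have := cmax _ z0r; rewrite /u cE.
  have : cn (q c) ^+ 2 <= K ^+ 2 by rewrite ler_pXn2r ?nnegrE ?cn_ge0// bq.
  have : A * r ^+ 2 = (cn (q z0) ^+ 2 - K ^+ 2) / 2.
    by rewrite /A; field; rewrite gt_eqF.
  have : K ^+ 2 < cn (q z0) ^+ 2 by rewrite ltr_pXn2r ?nnegrE ?cn_ge0.
  have : 0 <= A * cn z0 ^+ 2 by apply: mulr_ge0; [exact: ltW|exact: sqr_ge0].
  lra.
have [a [b H]] := tq _ cr.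
pose S := cn (q c) + cn a + cn b + 1.
have S0 : 0 < S by rewrite ltr_wpDl// !addr_ge0 ?cn_ge0.
(* Since |P| + |q(c + w)| is at most 2S in the relevant case, a Taylor error of A/(4S) h^2 costs A/2
   h^2 in the squared moduli: half of what A |z|^2 gains on average. *)
have eS : 0 < A / (4 * S) by rewrite divr_gt0// mulr_gt0.
have [d d0 Hd] := H _ eS.
have [h [h0 h1 hd hr]] : exists h : R, [/\ 0 < h, h <= 1, h < d & h < r - cn c].
  exists (Num.min 1 (Num.min d (r - cn c)) / 2).
  have m0 : 0 < Num.min 1 (Num.min d (r - cn c)) by rewrite !lt_min ltr01 d0 subr_gt0.
  have m1 : Num.min 1 (Num.min d (r - cn c)) <= 1 by rewrite ge_min lexx.
  have m2 : Num.min 1 (Num.min d (r - cn c)) <= d by rewrite !ge_min lexx !orbT.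
  have m3 : Num.min 1 (Num.min d (r - cn c)) <= r - cn c by rewrite !ge_min lexx !orbT.
  by split; lra.
have step (w : C) : cn w = h ->
    cn (q c + a * w + b * w ^+ 2) ^+ 2 + A * cn (c + w) ^+ 2 - A / 2 * h ^+ 2 <= u c.
  move=> wh; have cw : cn (c + w) <= r by rewrite (le_trans (cnD _ _))// wh; lra.
  rewrite (le_trans _ (cmax _ cw))// /u.
  have := Hd w; rewrite wh => /(_ hd).
  set P := q c + a * w + b * w ^+ 2.
  have -> : q (c + w) - q c - a * w - b * w ^+ 2 = q (c + w) - P by rewrite /P; ring.
  rewrite cnB => E.
  have PS : cn P <= S.
    rewrite (le_trans (cnD _ _))// (le_trans (lerD (cnD _ _) (lexx _)))//.
    rewrite [cn (a * w)]cnM [cn (b * _)]cnM cnX wh /S.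
    have : cn a * h <= cn a by rewrite ler_piMr ?cn_ge0.
    have : cn b * h ^+ 2 <= cn b by rewrite ler_piMr ?cn_ge0 ?expr_le1// ltW.
    lra.
  have := cn_lerB P (q (c + w)) => PQ.
  suff : cn P ^+ 2 - A / 2 * h ^+ 2 <= cn (q (c + w)) ^+ 2 by lra.
  have [le|/ltW le] := leP (cn P) (cn (q (c + w))).
    have p2 : cn P ^+ 2 <= cn (q (c + w)) ^+ 2 by rewrite ler_pXn2r ?nnegrE ?cn_ge0.
    have : 0 <= A / 2 * h ^+ 2.
      by apply: mulr_ge0; [exact: (ltW (divr_gt0 A0 (ltr0Sn _ _)))|exact: sqr_ge0].
    lra.
  have fac : cn P ^+ 2 - cn (q (c + w)) ^+ 2 = (cn P - cn (q (c + w))) * (cn P + cn (q (c + w))).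
    by ring.
  have : (cn P - cn (q (c + w))) * (cn P + cn (q (c + w))) <= A / (4 * S) * h ^+ 2 * (2 * S).
    rewrite ler_pM ?subr_ge0 ?addr_ge0 ?cn_ge0//; first exact: le_trans PQ E.
    by lra.
  have -> : A / (4 * S) * h ^+ 2 * (2 * S) = A / 2 * h ^+ 2 by field; rewrite gt_eqF.
  lra.
pose j : C := Complex 0 1.
have cj : cn j = 1 by rewrite /cn /= expr0n add0r expr1n sqrtr1.
have ch : cn h%:C = h by rewrite cn_real_ge0// ltW.
have s1 := step h%:C ch.
have s2 := step (- h%:C); rewrite cnN in s2; have {}s2 := s2 ch.
have s3 := step (j * h%:C); rewrite cnM cj mul1r in s3; have {}s3 := s3 ch.
have s4 := step (- (j * h%:C)); rewrite cnN cnM cj mul1r in s4; have {}s4 := s4 ch.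
have Ah : 0 < A * h ^+ 2 by rewrite mulr_gt0// exprn_gt0.
have par (x y : C) : cn (x + y) ^+ 2 + cn (x - y) ^+ 2 = 2 * cn x ^+ 2 + 2 * cn y ^+ 2.
  by rewrite !sqr_cn !(ReD, ImD, ReN, ImN); ring.
have jj : j ^+ 2 = -1 by rewrite /j expr2; apply: complexP; rewrite /=; ring.
pose W := h%:C : C.
have e1 : cn (q c + a * W + b * W ^+ 2) ^+ 2 + cn (q c + a * (- W) + b * (- W) ^+ 2) ^+ 2
  + cn (q c + a * (j * W) + b * (j * W) ^+ 2) ^+ 2
  + cn (q c + a * (- (j * W)) + b * (- (j * W)) ^+ 2) ^+ 2
  = 4 * cn (q c) ^+ 2 + 4 * cn a ^+ 2 * h ^+ 2 + 4 * cn b ^+ 2 * h ^+ 4.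
  have := par (q c + b * W ^+ 2) (a * W); have := par (q c - b * W ^+ 2) (a * (j * W)).
  have := par (q c) (b * W ^+ 2); rewrite !sqrrN exprMn jj ![cn (a * _)]cnM [cn (b * _)]cnM (cnX W 2) [cn (j * W)]cnM cj ch.
  have -> : q c + a * (j * W) + b * (-1 * W ^+ 2) = q c - b * W ^+ 2 + a * (j * W) by ring.
  have -> : q c + a * - (j * W) + b * (-1 * W ^+ 2) = q c - b * W ^+ 2 - a * (j * W) by ring.
  have -> : q c + a * W + b * W ^+ 2 = q c + b * W ^+ 2 + a * W by ring.
  have -> : q c + a * - W + b * W ^+ 2 = q c + b * W ^+ 2 - a * W by ring.
  move: (cn (_ + a * W)) (cn (_ - a * W)) (cn (_ + a * (j * W))) (cn (_ - a * (j * W))).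
  move: (cn (q c + _)) (cn (q c - _)) => x1 x2 x3 x4 x5 x6.
  have -> : (cn b * h ^+ 2) ^+ 2 = cn b ^+ 2 * h ^+ 4 by ring.
  have -> : (cn a * h) ^+ 2 = cn a ^+ 2 * h ^+ 2 by ring.
  have -> : (cn a * (1 * h)) ^+ 2 = cn a ^+ 2 * h ^+ 2 by ring.
  lra.
have e2 : cn (c + W) ^+ 2 + cn (c - W) ^+ 2 + cn (c + j * W) ^+ 2
  + cn (c - j * W) ^+ 2 = 4 * cn c ^+ 2 + 4 * h ^+ 2.
  by have := par c W; have := par c (j * W); rewrite cnM cj ch mul1r; lra.
have p1 : 0 <= cn a ^+ 2 * h ^+ 2 by apply: mulr_ge0; exact: sqr_ge0.
have p2 : 0 <= cn b ^+ 2 * h ^+ 4 by rewrite mulr_ge0 ?sqr_ge0// exprn_ge0// ltW.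
have e3 := congr1 (fun x => A * x) e2.
move: s1 s2 s3 s4 e1 e3; rewrite /u !mulrDr; lra.
Qed.

End MaximumPrinciple.

Lemma itv01_0 (R : realType) : (0 : R) <= (0 : R) <= (1 : R).
Proof. by rewrite lexx ler01. Qed.

(** * Cauchy estimates, Borel-Caratheodory, primitives *)

Section CauchyEstimates.
Variable R : realType.
Local Notation C := R[i].
Implicit Types (q g f F G : C -> C) (c z s : C) (D : C -> Prop).

Lemma hol_der D n F F' : copen D -> (forall s, D s -> cder F s (F' s)) ->
  hol D n.+1 F -> hol D n F'.
Proof.
move=> oD HF [F1 [H1 H2]]; apply: (hol_eq oD _ H2) => s Ds.
exact: (cder_uniq (HF _ Ds) (H1 _ Ds)).
Qed.

Lemma cder_shift F c z d : cder F (c + z) d -> cder (fun w => F (c + w)) z d.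
Proof.
move=> H.
have Hc : cder (fun w => c + w) z 1.
  by apply: (cder_eqd _ (cderD (cder_cst c z) (cder_id z))); rewrite add0r.
by apply: (cder_eqd _ (cder_comp Hc H)); rewrite mulr1.
Qed.

Lemma hol_shift D n F c : hol D n F -> hol (fun z => D (c + z)) n (fun z => F (c + z)).
Proof.
elim: n F => [//|n IH] F [F' [H1 H2]]; exists (fun z => F' (c + z)).
by split; [move=> s Ds; apply: cder_shift; exact: H1|exact: IH].
Qed.

(** Away from 0 the quotient has as many derivatives as g. At 0 its expansion is that of g divided
    by z, with coefficients g''(0)/2 and g'''(0)/6, which is why g must have order 3. *)
Lemma tay2_quotient g (g1 : C) (r : R) : 0 < r -> hol (disc 0 r) 3 g -> g 0 = 0 ->
  cder g 0 g1 -> forall c, cn c < r ->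
  tay2 (fun z => if z == 0 then g1 else g z / z) c.
Proof.
move=> r0 hg g0 dg c cr; set q := fun z => _.
have [c0|c0] := eqVneq c 0; last first.
  have oD : copen (fun z => disc 0 r z /\ z != 0).
    move=> s [Ds s0]; have [d d0 Hd] := disc_open Ds.
    have cs : 0 < cn s by rewrite cn_gt0.
    exists (Num.min d (cn s)); first by rewrite lt_min d0.
    move=> z; rewrite lt_min => /andP[/Hd h1 h2]; split=> //.
    by apply/eqP => z0; move: h2; rewrite z0 sub0r cnN ltxx.
  apply: (tay2_hol oD) => //; first by split => //; rewrite /disc subr0.
  apply: (hol_eq oD (G := fun z => g z * z^-1)).
    by move=> s [_ /negbTE s0]; rewrite /q s0.
  apply: holM.
    by apply: (hol_sub _ (hol_leq (isT : 2 <= 3)%N hg)) => s [].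
  by apply: holV; [move=> s []|exact: hol_id].
have oD := @disc_open R 0 r.
have D0 : disc 0 r (0 : C) by exact: disc_center.
case: hg => G1 [H1 [G2 [H2 [G3 [H3 _]]]]].
have g1E : g1 = G1 0 by exact: (cder_uniq dg (H1 _ D0)).
rewrite c0; exists (G2 0 / 2), (G3 0 / 6) => e e0.
have [d d0 Hd] := tay2_coef oD D0 H2 (H3 _ D0) e0.
exists (Num.min d r); first by rewrite lt_min d0.
move=> h; rewrite lt_min => /andP[hd hr].
rewrite add0r; have [->|h0] := eqVneq h 0.
  by rewrite subrr !mulr0 expr0n /= mulr0 !subr0 cn0 expr0n mulr0.
rewrite /q (negbTE h0) eqxx.
have ch : 0 < cn h by rewrite cn_gt0.
have := @cder_segment_le R
  (fun w => g w - G1 0 * w - G2 0 / 2 * w ^+ 2 - G3 0 / 6 * w ^+ 3)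
  (fun w => G1 w - G1 0 - G2 0 * w - G3 0 / 2 * w ^+ 2) 0 h (e * cn h ^+ 2).
rewrite add0r g0.
have -> : g h - G1 0 * h - G2 0 / 2 * h ^+ 2 - G3 0 / 6 * h ^+ 3 -
    (0 - G1 0 * 0 - G2 0 / 2 * 0 ^+ 2 - G3 0 / 6 * 0 ^+ 3) =
  h * (g h / h - g1 - G2 0 / 2 * h - G3 0 / 6 * h ^+ 2).
  by rewrite g1E; field.
move=> Hs; rewrite -(ler_pM2l ch) -cnM [leRHS]mulrC; apply: Hs => t /andP[t0 t1].
  rewrite add0r; set w := _ * h.
  have Dw : disc 0 r w.
    by rewrite /disc subr0 cnM cn_real_ge0// (le_lt_trans _ hr)// ler_piMl ?cn_ge0.
  have W2 : cder (fun w => w ^+ 2) w (2 * w).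
    apply: (cder_ext (G := fun w => w * w)) => //.
    by apply: (cder_eqd _ (cderM (cder_id w) (cder_id w))); ring.
  have W3 : cder (fun w => w ^+ 3) w (3 * w ^+ 2).
    apply: (cder_ext (G := fun w => w * w ^+ 2)) => [x|]; first by rewrite exprS.
    by apply: (cder_eqd _ (cderM (cder_id w) W2)); ring.
  apply: cderB; last by apply: (cder_eqd _ (cderZ (G3 0 / 6) W3)); field.
  apply: cderB; last by apply: (cder_eqd _ (cderZ (G2 0 / 2) W2)); field.
  apply: cderB; first exact: H1.
  by apply: (cder_eqd _ (cderZ (G1 0) (cder_id w))); rewrite mulr1.
have th : cn (t%:C * h) <= cn h by rewrite cnM cn_real_ge0// ler_piMl ?cn_ge0.
have := Hd _ (le_lt_trans th hd); rewrite !add0r => /le_trans; apply.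
by rewrite ler_wpM2l ?(ltW e0)// ler_pXn2r ?nnegrE ?cn_ge0.
Qed.

(** The maximum principle on circles of radius r' < r gives the bound M/r', and r' may approach
    r. *)
Lemma schwarz_quotient g (g1 : C) (r M : R) : 0 < r -> 0 <= M -> hol (disc 0 r) 3 g ->
  g 0 = 0 -> cder g 0 g1 -> (forall z, cn z < r -> cn (g z) <= M) ->
  forall z, cn z < r -> cn (if z == 0 then g1 else g z / z) <= M / r.
Proof.
move=> r0 M0 hg g0 dg bg z zr; pose q z := if z == 0 then g1 else g z / z.
rewrite -/(q z).
have main r' : cn z < r' -> r' < r -> cn (q z) <= M / r'.
  move=> zr' rr'; have r'0 : 0 < r' by rewrite (le_lt_trans (cn_ge0 z)).
  apply: (maximum_modulus (r := r')) => //; [|move=> w wr|move=> w wr|exact: ltW].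
  - by rewrite divr_ge0// ltW.
  - exact: tay2_quotient (le_lt_trans wr rr').
  - have w0 : w != 0 by rewrite -cn_gt0 wr.
    rewrite /q (negbTE w0) cnM cnV wr ler_pM2r ?invr_gt0// bg//.
    by rewrite wr.
rewrite leNgt; apply/negP => Mq.
have q0 : 0 < cn (q z) by rewrite (le_lt_trans _ Mq)// divr_ge0// ltW.
have Mr : M / cn (q z) < r.
  by move: Mq; rewrite ltr_pdivrMr// ltr_pdivrMr// mulrC.
(* This radius exceeds both |z| and M/|q(z)| but stays below r, which contradicts the bound on its
   circle. *)
pose r' := Num.max ((r + cn z) / 2) ((r + M / cn (q z)) / 2).
have r1 : (r + cn z) / 2 <= r' by rewrite le_max lexx.
have r2 : (r + M / cn (q z)) / 2 <= r' by rewrite le_max lexx orbT.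
have r3 : r' < r by rewrite gt_max; apply/andP; split; lra.
have r4 : cn z < r' by lra.
have := main _ r4 r3; have r'0 : 0 < r' by rewrite (le_lt_trans (cn_ge0 z)).
rewrite ler_pdivlMr// mulrC -ler_pdivlMr//; lra.
Qed.

Lemma schwarz g (r M : R) : 0 < r -> 0 <= M -> hol (disc 0 r) 3 g -> g 0 = 0 ->
  (forall z, cn z < r -> cn (g z) <= M) ->
  forall z, cn z < r -> cn (g z) <= M / r * cn z.
Proof.
move=> r0 M0 hg g0 bg z zr.
have [g1 H1] : exists g1 : C, cder g 0 g1.
  by case: hg => G1 [H1 _]; exists (G1 0); apply: H1; exact: disc_center.
have := schwarz_quotient r0 M0 hg g0 H1 bg zr.
have [->|z0] := eqVneq z 0; first by rewrite g0 cn0 mulr0.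
by rewrite cnM cnV ler_pdivrMr// cn_gt0.
Qed.

Lemma disc0E c (r : R) z : disc c r (c + z) <-> disc 0 r z.
Proof. by rewrite /disc addrC addKr subr0. Qed.

Lemma hol_disc_shift c (r : R) n f : hol (disc c r) n f ->
  hol (disc 0 r) n (fun z => f (c + z)).
Proof. by move=> /(@hol_shift _ _ _ c); apply: hol_sub => z /disc0E. Qed.

(** The derivative is the value at 0 of the Schwarz quotient of f(c + z) - f(c), a function bounded
    by 2M. *)
Lemma cauchy_estimate f c d (r M : R) : 0 < r -> hol (disc c r) 3 f ->
  (forall z, disc c r z -> cn (f z) <= M) -> cder f c d -> cn d <= 2 * M / r.
Proof.
move=> r0 hf bf df.
have M0 : 0 <= M by rewrite (le_trans (cn_ge0 _) (bf c _))//; exact: disc_center.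
have := @schwarz_quotient (fun z => f (c + z) - f c) d r (2 * M) r0.
rewrite mulr_ge0// => /(_ isT) H; have := H _ _ _ _ 0.
rewrite eqxx cn0; apply => //.
- by apply: holB; [exact: hol_disc_shift|exact: hol_cst].
- by rewrite addr0 subrr.
- rewrite -[d]subr0; apply: cderB; last exact: cder_cst.
  by apply: cder_shift; rewrite addr0.
- move=> z zr; rewrite (le_trans (cn_subD _ _))// mulrDl mul1r lerD//.
    by apply: bf; apply/disc0E; rewrite /disc subr0.
  by apply: bf; exact: disc_center.
Qed.

Lemma disc_sub c s (r r' : R) : cn (s - c) + r' <= r ->
  forall z, disc s r' z -> disc c r z.
Proof. by move=> H z zs; rewrite /disc (le_lt_trans (cn_distD z c s))// (lt_le_trans _ H)// addrC ltrD2l. Qed.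

(** Two Cauchy estimates, on the half disc for f' and on the quarter disc for f'', bound f'' by
    32M/r^2; two applications of the mean value inequality then give the remainder. *)
Lemma cauchy_remainder f c d (r M : R) : 0 < r -> hol (disc c r) 4 f ->
  (forall z, disc c r z -> cn (f z) <= M) -> cder f c d ->
  forall h, cn h < r / 4 -> cn (f (c + h) - f c - d * h) <= 32 * M / r ^+ 2 * cn h ^+ 2.
Proof.
move=> r0 hf bf df h hr.
have M0 : 0 <= M by rewrite (le_trans (cn_ge0 _) (bf c _))//; exact: disc_center.
have [f1 [H1 hf1]] := hf; have hf1' : hol (disc c r) 3 f1 by [].
have [f2 [H2 _]] := hf1.
have r2 : 0 < r / 2 by rewrite divr_gt0.
have r4 : 0 < r / 4 by rewrite divr_gt0.
have B1 z : cn (z - c) < r / 2 -> cn (f1 z) <= 4 * M / r.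
  move=> zr; have sub : forall w, disc z (r / 2) w -> disc c r w by apply: disc_sub; lra.
  have -> : 4 * M / r = 2 * M / (r / 2) by field; rewrite gt_eqF.
  apply: (cauchy_estimate r2 (f := f)); last 1 first.
  - by apply: H1; apply: sub; exact: disc_center.
  - by apply: (hol_sub sub); exact: holW.
  - by move=> w /sub/bf.
have B2 z : cn (z - c) < r / 4 -> cn (f2 z) <= 32 * M / r ^+ 2.
  move=> zr; have sub : forall w, disc z (r / 4) w -> disc c (r / 2) w by apply: disc_sub; lra.
  have sub' : forall w, disc c (r / 2) w -> disc c r w by apply: disc_sub; rewrite subrr cn0; lra.
  have -> : 32 * M / r ^+ 2 = 2 * (4 * M / r) / (r / 4) by field; rewrite gt_eqF.
  apply: (cauchy_estimate r4 (f := f1)); last 1 first.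
  - by apply: H2; apply/sub'/sub; exact: disc_center.
  - by apply: (hol_sub _ hf1') => w /sub/sub'.
  - by move=> w /sub/B1.
have f1c : f1 c = d by apply: (cder_uniq (H1 _ _) df); exact: disc_center.
have inn t : 0 <= t <= 1 -> cn (c + t%:C * h - c) <= cn h.
  by move=> /andP[t0 t1]; rewrite addrC addKr cnM cn_real_ge0// ler_piMl ?cn_ge0.
have K0 : 0 <= 32 * M / r ^+ 2 by rewrite divr_ge0 ?mulr_ge0 ?exprn_ge0 ?(ltW r0).
have := @cder_segment_le R (fun w => f w - d * w) (fun w => f1 w - d) c h
  (32 * M / r ^+ 2 * cn h).
have -> : f (c + h) - d * (c + h) - (f c - d * c) = f (c + h) - f c - d * h by ring.
rewrite expr2 mulrA; apply=> t t01.
  apply: cderB; first by apply: H1; rewrite /disc (le_lt_trans (inn _ t01))//; lra.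
  by apply: (cder_eqd _ (cderZ d (cder_id _))); rewrite mulr1.
rewrite -f1c.
have := @cder_segment_le R f1 f2 c (t%:C * h) (32 * M / r ^+ 2) => Hs.
have th : cn (t%:C * h) <= cn h by have := inn _ t01; rewrite addrC addKr.
apply: (le_trans (Hs _ _)) => [x x01|x x01|]; last by rewrite ler_wpM2l.
  apply: H2; rewrite /disc addrC addKr; case/andP: x01 => x0 x1.
  rewrite cnM cn_real_ge0// (@le_lt_trans _ _ (cn h))//; last by lra.
  by rewrite (le_trans _ th)// ler_piMl ?cn_ge0.
apply: B2; rewrite addrC addKr; case/andP: x01 => x0 x1.
rewrite cnM cn_real_ge0// (@le_lt_trans _ _ (cn h))//.
by rewrite (le_trans _ th)// ler_piMl ?cn_ge0.
Qed.

(** The map w -> w/(2M - w) sends the half plane Re w <= M into the unit disc and fixes 0; the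
    Schwarz lemma applies to the composite and is then solved for f. *)
Lemma borel_caratheodory f c (r M : R) : 0 < r -> 0 < M -> hol (disc c r) 3 f ->
  (forall z, disc c r z -> Re (f z - f c) <= M) ->
  forall z, cn (z - c) < r -> cn (f z - f c) <= 2 * M * cn (z - c) / (r - cn (z - c)).
Proof.
move=> r0 M0 hf bf z zr.
pose f0 w := f (c + w) - f c.
have hf0 : hol (disc 0 r) 3 f0 by apply: holB; [exact: hol_disc_shift|exact: hol_cst].
have bf0 w : disc 0 r w -> Re (f0 w) <= M by move=> /(disc0E c)/bf.
have den w : disc 0 r w -> (2 * M)%:C - f0 w != 0.
  move=> /bf0 wM; apply/eqP => E; have := congr1 (@complex.Re R) E.
  by rewrite ReD ReN ReR /=; lra.
pose g w := f0 w * ((2 * M)%:C - f0 w)^-1.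
have hg : hol (disc 0 r) 3 g.
  apply: holM => //; apply: holV => //; apply: holB => //; exact: hol_cst.
have g0 : g 0 = 0 by rewrite /g /f0 addr0 subrr mul0r.
have gb w : cn w < r -> cn (g w) <= 1.
  move=> wr; have Dw : disc 0 r w by rewrite /disc subr0.
  have d0 := den _ Dw.
  rewrite /g cnM cnV ler_pdivrMr ?cn_gt0// mul1r.
  move: (f0 w) (bf0 _ Dw) => v vM.
  rewrite -(@ler_pXn2r _ 2)// ?nnegrE ?cn_ge0// !sqr_cn !(ReD, ImD, ReN, ImN) ReR ImR.
  move: (Re v) (Im v) vM => a b aM.
  have -> : (2 * M - a) ^+ 2 + (0 - b) ^+ 2 = a ^+ 2 + b ^+ 2 + 4 * M * (M - a) by ring.
  by rewrite lerDl mulr_ge0 ?subr_ge0// mulr_ge0// ltW.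
pose w := z - c; have wr : cn w < r by [].
have Dw : disc 0 r w by rewrite /disc subr0.
have sg := schwarz r0 ler01 hg g0 gb wr.
have d0 := den _ Dw.
have fE : f z - f c = f0 w by rewrite /f0 /w (_ : c + (z - c) = z)//; ring.
rewrite fE -/w.
have rw : 0 < r - cn w by rewrite subr_gt0.
have E : f0 w = g w * ((2 * M)%:C - f0 w) by rewrite /g mulfVK.
have : cn (f0 w) <= cn w / r * (2 * M + cn (f0 w)).
  rewrite {1}E cnM ler_pM ?cn_ge0//; first by rewrite mulrC -[r^-1]mul1r.
  by rewrite (le_trans (cn_subD _ _))// cn_real_ge0// mulr_ge0// ltW.
rewrite ler_pdivlMr// mulrAC ler_pdivlMr//; lra.
Qed.

Definition locally_dominated D (u : nat -> C -> C) :=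
  forall s, D s -> exists2 r : R, 0 < r & exists M B, bsum M B /\
    forall z, cn (z - s) < r -> D z /\ forall n, cn (u n z) <= M n.

(** * Termwise differentiation of dominated series *)

Section Weierstrass.
Variables (D : C -> Prop) (u u' : nat -> C -> C).
Hypotheses (oD : copen D) (hu : forall n k, hol D k (u n)).
Hypothesis Hu' : forall n s, D s -> cder (u n) s (u' n s).

Let bd s (r : R) M : 0 < r ->
  (forall z, cn (z - s) < r -> D z /\ forall n, cn (u n z) <= M n) ->
  forall z, cn (z - s) < r / 2 -> forall n, cn (u' n z) <= 4 / r * M n.
Proof.
move=> r0 H z zr n.
have sub : forall w, disc z (r / 2) w -> disc s r w by apply: disc_sub; lra.
have -> : 4 / r * M n = 2 * M n / (r / 2) by field; rewrite gt_eqF.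
apply: (cauchy_estimate (f := u n)); first by rewrite divr_gt0.
- by apply: (hol_sub _ (hu n 3%N)) => w /sub/H[].
- by move=> w /sub/H[_]; apply.
- by apply: Hu'; have [] := H z _ => //; lra.
Qed.

(** The Cauchy estimate on discs of radius r/2 turns a majorant M of the terms into the majorant
    4M/r of their derivatives. *)
Lemma locally_dominated_der : locally_dominated D u -> locally_dominated D u'.
Proof.
move=> bu s Ds; have [r r0 [M [B [MB H]]]] := bu _ Ds.
exists (r / 2); first by rewrite divr_gt0.
exists (fun n => 4 / r * M n), (4 / r * B); split.
  by apply: bsumZ => //; rewrite divr_ge0// ltW.
move=> z zr; split; last exact: bd zr.
by have [] := H z _ => //; lra.
Qed.

(** Each term has a quadratic remainder of at most 32 M_n/r^2 |h|^2 with the same radius, and these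
    bounds can be summed. *)
Lemma weierstrass_cder : locally_dominated D u ->
  forall s, D s -> cder (fun z => CS (fun n => u n z)) s (CS (fun n => u' n s)).
Proof.
move=> bu s Ds; have [r r0 [M [B [MB H]]]] := bu _ Ds.
have r4 : 0 < r / 4 by rewrite divr_gt0.
have Mn n : 0 <= M n.
  have Ss : cn (s - s) < r by rewrite subrr cn0.
  by have [_ /(_ n)] := H s Ss; exact: le_trans (cn_ge0 _).
have B0 : 0 <= B by rewrite (le_trans _ (MB 0%N))// big_geq.
have K0 : 0 <= 32 * B / r ^+ 2 by rewrite divr_ge0 ?mulr_ge0 ?exprn_ge0 ?(ltW r0).
have est h : cn h < r / 4 -> cn (CS (fun n => u n (s + h)) - CS (fun n => u n s)
    - CS (fun n => u' n s) * h) <= 32 * B / r ^+ 2 * cn h ^+ 2.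
  move=> hr; have Ss : cn (s - s) < r by rewrite subrr cn0.
  have Sh : cn (s + h - s) < r by rewrite addrC addKr; lra.
  have Ss2 : cn (s - s) < r / 2 by rewrite subrr cn0 divr_gt0.
  have c1 := CSP (H _ Ss).2 MB; have c2 := CSP (H _ Sh).2 MB.
  have r4' : 0 <= 4 / r by rewrite divr_ge0// ltW.
  have c3 := CSP (bd r0 H Ss2) (bsumZ r4' MB).
  have c4 := cvsB (cvsB c2 c1) (cvsZ h c3).
  rewrite [_ * h]mulrC.
  apply: (cvs_le (M := fun n => 32 / r ^+ 2 * cn h ^+ 2 * M n) _ _ c4); last first.
    have -> : 32 * B / r ^+ 2 * cn h ^+ 2 = 32 / r ^+ 2 * cn h ^+ 2 * B by ring.
    by apply: bsumZ => //; rewrite mulr_ge0 ?divr_ge0 ?exprn_ge0 ?cn_ge0 ?(ltW r0).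
  move=> n; rewrite [h * _]mulrC.
  have -> : 32 / r ^+ 2 * cn h ^+ 2 * M n = 32 * M n / r ^+ 2 * cn h ^+ 2 by ring.
  apply: (cauchy_remainder r0 _ _ (Hu' n Ds) hr).
    by apply: (hol_sub _ (hu n 4%N)) => w /H[].
  by move=> z /H[_]; apply.
move=> e e0; pose K := 32 * B / r ^+ 2 + 1.
have K1 : 0 < K by rewrite ltr_wpDl.
exists (Num.min (r / 4) (e / K)); first by rewrite lt_min r4 divr_gt0.
move=> h; rewrite lt_min => /andP[/est h1]; rewrite ltr_pdivlMr// => h2.
rewrite (le_trans h1)// expr2 mulrA ler_wpM2r ?cn_ge0//.
rewrite (le_trans _ (ltW h2))// mulrC ler_wpM2l ?cn_ge0// /K; lra.
Qed.

End Weierstrass.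

Lemma weierstrass D (u : nat -> C -> C) : copen D ->
  (forall n k, hol D k (u n)) -> locally_dominated D u ->
  forall k, hol D k (fun z => CS (fun n => u n z)).
Proof.
move=> oD hu bu k; elim: k u hu bu => [//|k IH] u hu bu.
have /choice[u' Hu'] : forall n, exists u' : C -> C, forall s, D s -> cder (u n) s (u' s).
  by move=> n; have [u' [H _]] := hu n 1%N; exists u'.
have hu' n j : hol D j (u' n) by apply: (hol_der oD (Hu' n)); exact: hu.
exists (fun z => CS (fun n => u' n z)); split; first exact: weierstrass_cder.
by apply: IH => //; exact: (locally_dominated_der hu Hu').
Qed.

(** Compactness of the segment, by continuation: the supremum of the parameters up to which a
    uniform radius and bound exist can be passed unless it equals 1. *)
Lemma segment_locally_bounded D f c w :
  (forall t : R, 0 <= t <= 1 -> exists2 r : R, 0 < r & exists K : R,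
    forall z, cn (z - (c + t%:C * w)) < r -> D z /\ cn (f z) <= K) ->
  exists2 r : R, 0 < r & exists K : R, forall t : R, 0 <= t <= 1 ->
    forall z, cn (z - (c + t%:C * w)) < r -> D z /\ cn (f z) <= K.
Proof.
move=> loc.
pose good (x r K : R) := forall t : R, 0 <= t <= x ->
    forall z, cn (z - (c + t%:C * w)) < r -> D z /\ cn (f z) <= K.
pose E := [set x : R | 0 <= x <= 1 /\ exists2 r : R, 0 < r & exists K, good x r K].
have E0 : E 0.
  split; first by rewrite lexx ler01.
  have [|r r0 [K H]] := loc 0; first by rewrite lexx ler01.
  by exists r => //; exists K => t /le_anti <-.
have ubE : ubound E 1 by move=> x [/andP[]].
have hsE : has_sup E by split; [exists 0|exists 1].
set s := sup E.
have s1 : s <= 1 by apply: ge_sup => //; exists 0.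
have s0 : 0 <= s by apply: (ub_le_sup _ E0); exists 1.
have [|r r0 [K H]] := loc s; first by rewrite s0.
have w1 : 0 < cn w + 1 by rewrite ltr_wpDl ?cn_ge0.
(* Parameters within d of s move the point by at most r/2, which leaves a radius r/2 around each of
   them. *)
pose d := r / (2 * (cn w + 1)).
have d0 : 0 < d by rewrite divr_gt0// mulr_gt0.
have [x Ex sx] := sup_adherent d0 hsE.
have [/andP[x0 x1] [r' r'0 [K' H']]] := Ex.
pose y := Num.min 1 (s + d).
have Hy : good y (Num.min r' (r / 2)) (Num.max K K').
  move=> t /andP[t0 ty] z; rewrite lt_min => /andP[z1 z2].
  have [tx|xt] := leP t x.
    by have [|Dz fz] := H' t _ z z1; [rewrite t0|split=> //; rewrite le_max fz orbT].
  have ts : `|t - s| <= d.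
    rewrite ler_norml; move: ty; rewrite le_min => /andP[_ ts].
    by move: sx; rewrite -/s; lra.
  have [|Dz fz] := H z; last by split=> //; rewrite le_max fz.
  rewrite (le_lt_trans (cn_distD _ _ (c + t%:C * w)))//.
  have -> : c + t%:C * w - (c + s%:C * w) = (t - s)%:C * w by rewrite realcD realcN; ring.
  rewrite cnM cn_real.
  have : `|t - s| * cn w <= d * (cn w + 1).
    by rewrite ler_pM ?cn_ge0// lerDl.
  have : d * (cn w + 1) = r / 2 by rewrite /d; field; rewrite gt_eqF.
  lra.
have Ey : E y.
  split; first by rewrite le_min ler01 ge_min lexx addr_ge0// ltW.
  exists (Num.min r' (r / 2)); first by rewrite lt_min r'0 divr_gt0.
  by exists (Num.max K K').
have ys : y <= s by apply: (ub_le_sup _ Ey); exists 1.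
have y1 : y = 1.
  by apply/eqP; move: ys; rewrite /y minEle; case: ifP => // _; rewrite gerDl leNgt d0.
rewrite y1 in Hy.
exists (Num.min r' (r / 2)); first by rewrite lt_min r'0 divr_gt0.
by exists (Num.max K K').
Qed.

Lemma real_antiderivative (f : R -> R) : continuous f ->
  exists F : R -> R, forall x : R, 0 <= x <= 1 -> rder F x (f x).
Proof.
(* The lower limit is -1 so that every x in [0, 1] lies inside the interval of integration. *)
move=> cf; exists (fun x => \int[lebesgue_measure]_(t in `[-1, x]) (f t))%R => x /andP[x0 x1].
have := @continuous_FTC1_closed R f (-1) x (x + 1).
case=> //.
- by rewrite ltrDl.
- apply: continuous_compact_integrable; first exact: segment_compact.
  exact: continuous_subspaceT.
- by rewrite (lt_le_trans _ x0)// ltrN10.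
- exact: cf.
move=> dF EF; apply/rderP.
exact: (DeriveDef dF (etrans (esym (derive1E _ _)) EF)).
Qed.

Lemma path_antiderivative (p : R -> C) :
  (forall x (e : R), 0 < e -> exists2 r : R, 0 < r & forall h : R, `|h| < r ->
    cn (p (x + h) - p x) <= e) ->
  exists P : R -> C, forall x : R, 0 <= x <= 1 -> pder P x (p x).
Proof.
move=> cp.
have cc (f : R -> R) : (forall x (e : R), 0 < e -> exists2 r : R, 0 < r &
    forall h : R, `|h| < r -> `|f (x + h) - f x| <= e) -> continuous f.
  move=> H x; apply/cvgrPdist_le => e e0; have [r r0 Hr] := H x e e0.
  have nb : nbhs x (ball x r) by apply: nbhsx_ballx.
  apply: filterS nb => y; rewrite /ball /= /ball_ distrC => yx.
  by rewrite distrC -[y](subrK x) [_ + x]addrC; apply: Hr.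
have [|F1 H1] := @real_antiderivative (fun t => Re (p t)).
  apply: cc => x e /(cp x)[r r0 Hr]; exists r => // h /Hr.
  by apply: le_trans; rewrite -ReN -ReD Re_le_cn.
have [|F2 H2] := @real_antiderivative (fun t => Im (p t)).
  apply: cc => x e /(cp x)[r r0 Hr]; exists r => // h /Hr.
  by apply: le_trans; rewrite -ImN -ImD Im_le_cn.
exists (fun t => Complex (F1 t) (F2 t)) => x x01 e e0.
have e2 : 0 < e / 2 by rewrite divr_gt0.
have [r1 r10 R1] := H1 _ x01 _ e2; have [r2 r20 R2] := H2 _ x01 _ e2.
exists (Num.min r1 r2); first by rewrite lt_min r10.
move=> h; rewrite lt_min => /andP[/R1 h1 /R2 h2].
rewrite (le_trans (cn_le_ReIm _))// !cpE /=; move: h1 h2.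
by rewrite !mulr0 subr0 add0r; lra.
Qed.

Lemma pderD (p q : R -> C) (x : R) (d1 d2 : C) : pder p x d1 -> pder q x d2 ->
  pder (fun t : R => p t + q t) x (d1 + d2 : C).
Proof.
move=> Hf Hg e e0; have e2 : 0 < e / 2 by rewrite divr_gt0.
have [r1 r10 H1] := Hf _ e2; have [r2 r20 H2] := Hg _ e2.
exists (Num.min r1 r2); first by rewrite lt_min r10.
move=> h; rewrite lt_min => /andP[h1 h2].
have -> : p (x + h) + q (x + h) - (p x + q x) - (d1 + d2) * h%:C =
  (p (x + h) - p x - d1 * h%:C) + (q (x + h) - q x - d2 * h%:C) by ring.
rewrite (le_trans (cnD _ _))// (le_trans (lerD (H1 _ h1) (H2 _ h2)))//.
by rewrite -mulrDl -splitr.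
Qed.

Lemma pderZ (p : R -> C) (x : R) (d k : C) : pder p x d -> pder (fun t : R => k * p t) x (k * d).
Proof.
move=> H e e0; have k1 : 0 < cn k + 1 by rewrite ltr_wpDl ?cn_ge0.
have [r r0 Hr] := H _ (divr_gt0 e0 k1); exists r => // h /Hr {}Hr.
have -> : k * p (x + h) - k * p x - k * d * h%:C = k * (p (x + h) - p x - d * h%:C) by ring.
rewrite cnM (le_trans (ler_wpM2l (cn_ge0 _) Hr))// mulrA ler_wpM2r//.
by rewrite mulrCA ler_piMr ?(ltW e0)// ler_pdivrMr// mul1r lerDl.
Qed.

(* The primitive is G(s) = (s - c) int_0^1 g(c + t (s - c)) dt. *)
Lemma primitive D g c : copen D ->
  (forall s (t : R), D s -> 0 <= t <= 1 -> D (c + t%:C * (s - c))) -> hol D 4 g ->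
  exists G, forall s, D s -> cder G s (g s).
Proof.
move=> oD star hg.
have loc s : D s -> forall t : R, 0 <= t <= 1 -> exists2 r : R, 0 < r & exists K : R,
    forall z, cn (z - (c + t%:C * (s - c))) < r -> D z /\ cn (g z) <= K.
  move=> Ds t t01; have Dt := star _ _ Ds t01; set z0 := c + _ in Dt *.
  have [r r0 Hr] := oD _ Dt; have [g1 [H1 _]] := hg.
  have [r' r'0 Hr'] := cder_cont (H1 _ Dt) ltr01.
  exists (Num.min r r'); first by rewrite lt_min r0.
  exists (cn (g z0) + 1) => z; rewrite lt_min => /andP[/Hr Dz zr']; split=> //.
  have := Hr' _ zr'; have -> : z0 + (z - z0) = z by ring.
  move=> h.
  by have := cn_lerB (g z) (g z0); lra.
(* Star-shapedness controls g only for parameters in [0, 1]; the path is extended by constants to be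
   continuous on the whole line. *)
pose clamp (t : R) := Num.max 0 (Num.min t 1).
have cl01 t : 0 <= clamp t <= 1.
  by rewrite /clamp le_max lexx /= ge_max ler01 ge_min lexx orbT.
have clE t : 0 <= t <= 1 -> clamp t = t.
  by move=> /andP[t0 t1]; rewrite /clamp (min_idPl t1) (max_idPr t0).
have cllip t h : `|clamp (t + h) - clamp t| <= `|h|.
  have h1 := ler_norm h; have h2 := ler_norm (- h); rewrite normrN in h2.
  rewrite /clamp ler_norml /Num.max /Num.min.
  by case: (ltP (t + h) 1) => a1; case: (ltP t 1) => a2;
    case: ltP => a3; case: ltP => a4; lra.
have /choice[Phi HPhi] : forall s, exists P : R -> C, D s -> forall t : R, 0 <= t <= 1 ->
    pder P t (g (c + t%:C * (s - c))).
  move=> s.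
  have [Ds|nDs] := pselect (D s); last by exists (fun=> 0).
  have [|P HP] := @path_antiderivative (fun t => g (c + (clamp t)%:C * (s - c))).
    move=> x e e0; have [g1 [H1 _]] := hg.
    have [r r0 Hr] := cder_cont (H1 _ (star _ _ Ds (cl01 x))) e0.
    have w1 : 0 < cn (s - c) + 1 by rewrite ltr_wpDl ?cn_ge0.
    exists (r / (cn (s - c) + 1)); first by rewrite divr_gt0.
    move=> h; rewrite ltr_pdivlMr// => hr.
    have := Hr ((clamp (x + h) - clamp x)%:C * (s - c)).
    rewrite cnM cn_real.
    have -> : c + (clamp x)%:C * (s - c) + (clamp (x + h) - clamp x)%:C * (s - c) =
      c + (clamp (x + h))%:C * (s - c) by rewrite realcD realcN; ring.
    apply; rewrite (le_lt_trans _ hr)// ler_pM ?cn_ge0//.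
    by rewrite lerDl.
  by exists P => _ t t01; have := HP _ t01; rewrite clE.
exists (fun s => (s - c) * (Phi s 1 - Phi s 0)) => s Ds.
have [r r0 [K HK]] := segment_locally_bounded (loc _ Ds).
have [rD rD0 HrD] := oD _ Ds.
have [g1 [H1 _]] := hg.
have K0 : 0 <= K.
  have Sz : cn (c + 0%:C * (s - c) - (c + 0%:C * (s - c))) < r by rewrite subrr cn0.
  by have [_] := HK 0 (itv01_0 R) _ Sz; exact: le_trans (cn_ge0 _).
set w := s - c.
have est h : cn h < Num.min (Num.min 1 rD) (r / 4) ->
    cn ((s + h - c) * (Phi (s + h) 1 - Phi (s + h) 0) - w * (Phi s 1 - Phi s 0) - g s * h)
    <= ((cn w + 1) * (32 * K / r ^+ 2) + 2 * K / r) * cn h ^+ 2.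
  rewrite !lt_min => /andP[/andP[h1 hD] hr].
  have Dsh : D (s + h) by apply: HrD; rewrite addrC addKr.
  (* The summand t g(c + t w) equals g(s) at t = 1 and 0 at t = 0. With it the derivative of [Psi]
     collapses to a second-order Taylor remainder of g, plus h times a first-order term, so the
     increment is O(|h|^2). *)
  pose Psi (t : R) := (w + h) * Phi (s + h) t + (- w) * Phi s t + (- h) * (t%:C * g (c + t%:C * w)).
  have -> : (s + h - c) * (Phi (s + h) 1 - Phi (s + h) 0) - w * (Phi s 1 - Phi s 0) - g s * h
      = Psi 1 - Psi 0.
    rewrite /Psi; have -> : c + 1%:C * w = s by rewrite /w mul1r addrC subrK.
    have -> : s + h - c = w + h by rewrite /w; ring.
    by rewrite (_ : 1%:C = 1)// (_ : 0%:C = 0)//; ring.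
  set L := (_ + _) * cn h ^+ 2.
  have := @pder_le R Psi (fun t => (w + h) * g (c + t%:C * (w + h)) + (- w) * g (c + t%:C * w)
     + (- h) * (g (c + t%:C * w) + t%:C * (g1 (c + t%:C * w) * w))) (fun t => L * t + 0) (fun=> L) 0 1 ler01.
  rewrite mulr1 mulr0 !addr0 subr0; apply.
  - move=> t t01; apply: pderD; first apply: pderD.
    + apply: pderZ; have := HPhi _ Dsh _ t01.
      by have -> : s + h - c = w + h by rewrite /w; ring.
    + by apply: pderZ; exact: HPhi.
    + apply: pderZ; apply: (fun H => H).
      have Dt : D (c + t%:C * w) by exact: star.
      have := pder_cder (H1 _ Dt) => P1.
      move=> e e0.
      have [A [A0 A1 A2]] : exists A : R, [/\ 0 < A, cn (g1 (c + t%:C * w) * w) + 1 <= A & True].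
        by exists (cn (g1 (c + t%:C * w) * w) + 1); split => //; rewrite ltr_wpDl ?cn_ge0.
      pose e' := Num.min 1 (e / 3).
      have e'0 : 0 < e' by rewrite lt_min ltr01 divr_gt0.
      have e'1 : e' <= 1 by rewrite ge_min lexx.
      have e'e : e' <= e / 3 by rewrite ge_min lexx orbT.
      have [r1 r10 R1] := P1 _ e'0.
      exists (Num.min r1 (Num.min 1 (e' / A))); first by rewrite !lt_min r10 ltr01 divr_gt0.
      move=> k; rewrite !lt_min ltr_pdivlMr// => /and3P[/R1 k1 k2 k3].
      case/andP: t01 => t0 t1.
      set X := g (c + (t + k)%:C * w) in k1 *; set Y := g (c + t%:C * w) in k1 *.
      set d := g1 _ * w in k1 A1 *.
      have -> : (t + k)%:C * X - t%:C * Y - (Y + t%:C * d) * k%:C =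
         t%:C * (X - Y - d * k%:C) + k%:C * (X - Y - d * k%:C) + k%:C * (d * k%:C).
        by rewrite realcD; ring.
      rewrite (le_trans (cnD _ _))// (le_trans (lerD (cnD _ _) (lexx _)))//.
      rewrite [cn (t%:C * _)]cnM [cn (k%:C * (X - Y - _))]cnM [cn (k%:C * (d * _))]cnM [cn (d * _)]cnM !cn_real.
      have q1 : `|t| * cn (X - Y - d * k%:C) <= e / 3 * `|k|.
        rewrite ger0_norm// (le_trans _ (le_trans k1 _))//; first by rewrite ler_piMl ?cn_ge0.
        by rewrite ler_wpM2r.
      have q2 : `|k| * cn (X - Y - d * k%:C) <= e / 3 * `|k|.
        rewrite (le_trans _ (le_trans k1 _))//; first by rewrite ler_piMl ?cn_ge0// ltW.
        by rewrite ler_wpM2r.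
      have q3 : `|k| * (cn d * `|k|) <= e / 3 * `|k|.
        rewrite mulrA ler_wpM2r// (le_trans _ e'e)// (le_trans _ (ltW k3))//.
        by rewrite ler_wpM2l//; lra.
      lra.
  - by move=> t _; exact: rder_lin.
  - move=> t t01; have Dt : D (c + t%:C * w) by exact: star.
    have Ds' : forall z, disc (c + t%:C * w) r z -> D z /\ cn (g z) <= K by move=> z; exact: HK.
    have th : cn (t%:C * h) <= cn h.
      by case/andP: t01 => t0 t1; rewrite cnM cn_real_ge0// ler_piMl ?cn_ge0.
    have hg' : hol (disc (c + t%:C * w) r) 4 g by apply: (hol_sub _ hg) => z /Ds'[].
    have bg z : disc (c + t%:C * w) r z -> cn (g z) <= K by move=> /Ds'[].
    have rem := cauchy_remainder r0 hg' bg (H1 _ Dt) (le_lt_trans th hr).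
    have est1 := cauchy_estimate r0 (holW hg') bg (H1 _ Dt).
    set X := g (c + t%:C * w) in rem *; set d := g1 _ in rem est1 *.
    have -> : c + t%:C * (w + h) = c + t%:C * w + t%:C * h by ring.
    set Y := g (_ + t%:C * h) in rem *.
    have -> : (w + h) * Y + - w * X + - h * (X + t%:C * (d * w)) =
      (w + h) * (Y - X - d * (t%:C * h)) + h * (d * (t%:C * h)) by ring.
    rewrite (le_trans (cnD _ _))// cnM [cn (h * _)]cnM [cn (d * _)]cnM /L mulrDl lerD//.
      rewrite -mulrA ler_pM ?cn_ge0//; first by rewrite (le_trans (cnD _ _))// lerD2l ltW.
      rewrite (le_trans rem)// ler_wpM2l//.
        by rewrite divr_ge0 ?mulr_ge0 ?exprn_ge0 ?(ltW r0).
      by rewrite ler_pXn2r ?nnegrE ?cn_ge0.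
    have -> : 2 * K / r * cn h ^+ 2 = cn h * (2 * K / r * cn h) by ring.
    by rewrite ler_wpM2l ?cn_ge0// ler_pM ?cn_ge0.
move=> e e0; set L := _ + 2 * K / r in est.
have L0 : 0 <= L.
  by rewrite addr_ge0 ?mulr_ge0 ?addr_ge0 ?cn_ge0 ?mulr_ge0 ?invr_ge0 ?exprn_ge0 ?(ltW r0).
have L1 : 0 < L + 1 by rewrite ltr_wpDl.
exists (Num.min (Num.min (Num.min 1 rD) (r / 4)) (e / (L + 1))).
  by rewrite !lt_min ltr01 rD0 !divr_gt0.
move=> h; rewrite lt_min => /andP[/est h1]; rewrite ltr_pdivlMr// => h2.
rewrite (le_trans h1)// expr2 mulrA ler_wpM2r ?cn_ge0//.
rewrite (le_trans _ (ltW h2))// mulrC ler_wpM2l ?cn_ge0//; lra.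
Qed.

End CauchyEstimates.

(** * A Perron formula with kernel X^s/s^2 *)

Section Perron.
Variable R : realType.
Local Notation C := R[i].
Implicit Types (f g F G : C -> C) (s z : C) (v : R).

Definition HP (x : R) : C -> Prop := fun s => x < Re s.

Lemma HP_open x : copen (HP x).
Proof.
move=> s; rewrite /HP => xs; exists (Re s - x); first by rewrite subr_gt0.
move=> z zs; have := le_lt_trans (Re_le_cn _) zs.
by rewrite ReD ReN ltr_norml; lra.
Qed.

Lemma HP_star x c : HP x c -> forall s (t : R), HP x s -> 0 <= t <= 1 ->
  HP x (c + t%:C * (s - c)).
Proof.
rewrite /HP => xc s t xs /andP[t0 t1].
rewrite !cpE mul0r subr0.
have : 0 <= t * (Re s - x) by rewrite mulr_ge0// subr_ge0 ltW.
have : 0 <= (1 - t) * (Re c - x) by rewrite mulr_ge0// subr_ge0// ltW.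
have [->|t0'] := eqVneq t 0; first by lra.
have : 0 < t * (Re s - x) by rewrite mulr_gt0 ?subr_gt0// lt_neqAle eq_sym t0'.
lra.
Qed.

Lemma HP_primitive x g : hol (HP x) 4 g ->
  exists G, forall s, HP x s -> cder G s (g s).
Proof.
move=> hg; apply: (@primitive R (HP x) g ((x + 1)%:C)) => //; first exact: HP_open.
by apply: HP_star; rewrite /HP ReR ltrDl.
Qed.

Definition pt (x y : R) : C := Complex x y.

Lemma ptE x y : pt x y = x%:C + y%:C * pt 0 1.
Proof. by apply: complexP; rewrite /= ?mulr0 ?mul0r ?mulr1 ?subr0 ?addr0 ?add0r. Qed.

Lemma cn_pt_re x y : `|x| <= cn (pt x y). Proof. exact: (Re_le_cn (pt x y)). Qed.
Lemma cn_pt_im x y : `|y| <= cn (pt x y). Proof. exact: (Im_le_cn (pt x y)). Qed.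

Lemma cn_i : cn (pt 0 1) = 1.
Proof. by rewrite /cn /= expr0n add0r expr1n sqrtr1. Qed.

Lemma horizontal_le G g (x1 x2 y K : R) : x1 <= x2 ->
  (forall x, x1 <= x <= x2 -> cder G (pt x y) (g (pt x y))) ->
  (forall x, x1 <= x <= x2 -> cn (g (pt x y)) <= K) ->
  cn (G (pt x2 y) - G (pt x1 y)) <= K * (x2 - x1).
Proof.
move=> x12 HG HK.
have := @cder_segment_le R G g (pt x1 y) (x2 - x1)%:C K.
have E (t : R) : pt x1 y + t%:C * (x2 - x1)%:C = pt (x1 + t * (x2 - x1)) y.
  by apply: complexP; rewrite /= ?mulr0 ?mul0r ?subr0 ?addr0.
have E1 : pt x1 y + (x2 - x1)%:C = pt x2 y.
  by have := E 1; rewrite !mul1r => ->; congr pt; ring.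
rewrite E1 cn_real_ge0 ?subr_ge0//; apply=> t /andP[t0 t1]; rewrite E.
  by apply: HG; nra.
by apply: HK; nra.
Qed.

Lemma vertical_pder G x y d : cder G (pt x y) d ->
  pder (fun t => G (pt x t)) y (d * pt 0 1).
Proof.
rewrite ptE => /(@pder_cder R G x%:C (pt 0 1) y d).
by congr pder; apply/funext => t; rewrite -ptE.
Qed.

Lemma vertical_le G g (x y1 y2 : R) (H H' : R -> R) : y1 <= y2 ->
  (forall y, y1 <= y <= y2 -> cder G (pt x y) (g (pt x y))) ->
  (forall y, y1 <= y <= y2 -> rder H y (H' y)) ->
  (forall y, y1 <= y <= y2 -> cn (g (pt x y)) <= H' y) ->
  cn (G (pt x y2) - G (pt x y1)) <= H y2 - H y1.
Proof.
move=> y12 HG HH Hle.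
apply: (@pder_le R (fun t => G (pt x t)) (fun t => g (pt x t) * pt 0 1) H H' y1 y2) => //.
  by move=> y yy; apply: vertical_pder; exact: HG.
by move=> y yy; rewrite cnM cn_i mulr1 Hle.
Qed.

Lemma vertical_cst_le G g (x y1 y2 K : R) : y1 <= y2 ->
  (forall y, y1 <= y <= y2 -> cder G (pt x y) (g (pt x y))) ->
  (forall y, y1 <= y <= y2 -> cn (g (pt x y)) <= K) ->
  cn (G (pt x y2) - G (pt x y1)) <= K * (y2 - y1).
Proof.
move=> y12 HG HK.
have := @vertical_le G g x y1 y2 (fun t => K * t + 0) (fun=> K) y12 HG.
rewrite !addr0 -mulrBr; apply=> // y _; exact: rder_lin.
Qed.

Lemma rder_atan (x A y : R) : 0 < x ->
  rder (fun t => A / x * atan (t / x)) y (A / (x ^+ 2 + y ^+ 2)).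
Proof.
move=> x0; apply/rderP.
have x00 : x != 0 by rewrite gt_eqF.
have s0 : x ^+ 2 + y ^+ 2 != 0.
  by rewrite gt_eqF// ltr_pwDl ?exprn_gt0 ?sqr_ge0.
have d1 : is_derive y 1 (fun t : R => t / x) x^-1.
  have : is_derive y 1 (fun t : R => x^-1 * t + 0) x^-1 by apply/rderP; exact: rder_lin.
  by congr is_derive; apply/funext => t; rewrite addr0 mulrC.
have d2 := @is_derive1_comp R _ _ y _ _ (is_derive1_atan (y / x)) d1.
have d3 := is_deriveZ (A / x) d2.
apply: is_derive_eq d3 _.
rewrite /GRing.scale /=; field.
by rewrite x00 s0.
Qed.

Lemma vertical_atan_le G g (x T A : R) : 0 < x -> 0 <= T -> 0 <= A ->
  (forall y : R, - T <= y <= T -> cder G (pt x y) (g (pt x y))) ->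
  (forall y : R, - T <= y <= T -> cn (g (pt x y)) <= A / cn (pt x y) ^+ 2) ->
  cn (G (pt x T) - G (pt x (- T))) <= 4 * A / x.
Proof.
move=> x0 T0 A0 HG Hg.
have TT : - T <= T by lra.
have := @vertical_le G g x (- T) T (fun t => A / x * atan (t / x))
  (fun y => A / (x ^+ 2 + y ^+ 2)) TT HG.
have Ha (y : R) : `|atan y| <= 2.
  rewrite ler_norml; have := atan_ltpi2 y; have := atan_gtNpi2 y; have /andP[_] := @pihalf_02 R.
  lra.
have AB : A / x * atan (T / x) - A / x * atan (- T / x) <= 4 * A / x.
  have -> : 4 * A / x = A / x * 2 + A / x * 2 by ring.
  have Ax : 0 <= A / x by rewrite divr_ge0// ltW.
  have := Ha (T / x); have := Ha (- T / x); rewrite !ler_norml => /andP[a1 a2] /andP[a3 a4].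
  have := ler_wpM2l Ax a4; have := ler_wpM2l Ax a1; lra.
move=> H; apply: le_trans (H _ _) AB.
  by move=> y _; exact: rder_atan.
by move=> y yT; rewrite (le_trans (Hg _ yT))// sqr_cn.
Qed.

Lemma hol_kernel v n : hol (HP 0) n (fun s => cexp (v%:C * s) / s ^+ 2).
Proof.
apply: holM; first by apply: hol_cexp; apply: holZ; exact: hol_id.
apply: holV; first by move=> s s0; rewrite expf_neq0//; apply/eqP => E;
  move: s0; rewrite /HP E ltxx.
by apply: (hol_ext (G := fun s => s * s)) => //; apply: holM; exact: hol_id.
Qed.

(** A primitive of the Perron kernel on Re s > 0, taken by choice; its additive constant disappears
    from the increments that are used. *)
Definition Ker v : C -> C := xget (fun=> 0)
  [set G | forall s, HP 0 s -> cder G s (cexp (v%:C * s) / s ^+ 2)].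

Lemma KerP v s : HP 0 s -> cder (Ker v) s (cexp (v%:C * s) / s ^+ 2).
Proof.
move=> Hs; have [G HG] := HP_primitive (hol_kernel v 4).
have : [set G | forall s, HP 0 s -> cder G s (cexp (v%:C * s) / s ^+ 2)] (Ker v).
  exact: xgetI HG.
exact.
Qed.

(** The truncated Perron integral of e^(vs)/s^2 along Re s = 2, between the heights -T and T. *)
Definition KT v (T : R) := Ker v (pt 2 T) - Ker v (pt 2 (- T)).

Lemma cn_kernel v s : cn (cexp (v%:C * s) / s ^+ 2) = expR (v * Re s) / cn s ^+ 2.
Proof. by rewrite cnM cnV cnX cn_cexp !cpE mul0r subr0. Qed.

Lemma KT_le v (T : R) : 0 <= T -> cn (KT v T) <= 2 * expR (v * 2).
Proof.
move=> T0; have -> : 2 * expR (v * 2) = 4 * expR (v * 2) / 2 by field.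
apply: (@vertical_atan_le _ (fun s => cexp (v%:C * s) / s ^+ 2)) => //.
- by move=> y _; apply: KerP; rewrite /HP /=.
- by move=> y _; rewrite cn_kernel.
Qed.

(** For v <= 0 the kernel is at most 1/|s|^2 to the right, and the contour can be pushed as far in
    that direction as desired. *)
Lemma KT_neg v (e : R) : v <= 0 -> 0 < e -> exists T0 : R, forall T, T0 <= T -> cn (KT v T) <= e.
Proof.
(* With this abscissa the vertical side costs 4/x <= e/2; the height [T0] below makes each
   horizontal side cost at most e/4. *)
move=> v0 e0; pose x : R := 8 / e + 2.
have x2 : 2 <= x by rewrite lerDr divr_ge0// ltW.
have x0 : 0 < x by lra.
pose T0 : R := 4 * x / e + 1.
have T01 : 1 <= T0 by rewrite lerDr divr_ge0 ?mulr_ge0// ltW.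
exists T0 => T T0T; have T1 : 1 <= T by lra.
have T0' : 0 <= T by lra.
have e1 s : 0 < Re s -> expR (v * Re s) <= 1.
  by move=> s0; rewrite -expR0 ler_expR mulr_le0_ge0// ltW.
have hor y : `|y| = T -> cn (Ker v (pt x y) - Ker v (pt 2 y)) <= e / 4.
  move=> yT.
  have := @horizontal_le (Ker v) (fun s => cexp (v%:C * s) / s ^+ 2) 2 x y (T ^+ 2)^-1 x2.
  move=> H; apply: (le_trans (H _ _)).
  - by move=> t /andP[t2 _]; apply: KerP; rewrite /HP /=; lra.
  - move=> t /andP[t2 _]; rewrite cn_kernel -[leRHS]mul1r ler_pM ?expR_ge0 ?invr_ge0 ?sqr_ge0//.
      by apply: e1 => /=; lra.
    have cT : T <= cn (pt t y) by rewrite -yT cn_pt_im.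
    have T0'' : 0 < T by lra.
    by rewrite lef_pV2 ?posrE ?exprn_gt0 ?(lt_le_trans T0'' cT)// ler_pXn2r ?nnegrE ?cn_ge0.
  - have TT : T <= T ^+ 2 by rewrite expr2 ler_peMl.
    have xT : 4 * x / e <= T by rewrite /T0 in T0T; lra.
    rewrite mulrC ler_pdivrMr; last by rewrite exprn_gt0//; lra.
    move: xT; rewrite ler_pdivrMr// => xT.
    have : T * e <= T ^+ 2 * e by rewrite ler_wpM2r// ltW.
    lra.
have ver : cn (Ker v (pt x T) - Ker v (pt x (- T))) <= e / 2.
  have := @vertical_atan_le (Ker v) (fun s => cexp (v%:C * s) / s ^+ 2) x T 1 x0 T0' ler01.
  move=> H; apply: (le_trans (H _ _)).
  - by move=> y _; apply: KerP; rewrite /HP /=.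
  - by move=> y _; rewrite cn_kernel ler_wpM2r ?invr_ge0 ?sqr_ge0// e1.
  - rewrite mulr1 ler_pdivrMr// /x mulrDr.
    have -> : e / 2 * (8 / e) = 4 by field; rewrite gt_eqF.
    lra.
have h1 := hor T; have h2 := hor (- T); rewrite normrN ger0_norm// in h1 h2.
have {}h1 := h1 erefl; have {}h2 := h2 erefl.
rewrite /KT.
have -> : Ker v (pt 2 T) - Ker v (pt 2 (- T)) = - (Ker v (pt x T) - Ker v (pt 2 T))
  + (Ker v (pt x T) - Ker v (pt x (- T))) + (Ker v (pt x (- T)) - Ker v (pt 2 (- T))) by ring.
rewrite (le_trans (cnD _ _))// (le_trans (lerD (cnD _ _) (lexx _)))// cnN; lra.
Qed.

Lemma cder_X s k : cder (fun z => z ^+ k.+1) s (k.+1%:R * s ^+ k).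
Proof.
elim: k => [|k IH].
  by rewrite expr0 mulr1; apply: (cder_ext (G := id)) (cder_id s) => z; rewrite expr1.
apply: (cder_ext (G := fun z => z * z ^+ k.+1)) => [z|]; first by rewrite exprS.
apply: (cder_eqd _ (cderM (cder_id s) IH)).
by rewrite mul1r mulrCA -exprS -[k.+2%:R]natr1 mulrDl mul1r addrC.
Qed.

Lemma hol_X (D : C -> Prop) n k : hol D n (fun z => z ^+ k).
Proof.
elim: k => [|k IH]; first by apply: (hol_ext (G := fun=> 1)) => //; exact: hol_cst.
apply: (hol_ext (G := fun z => z * z ^+ k)) => [z|]; first by rewrite exprS.
by apply: holM => //; exact: hol_id.
Qed.

(** Induction on n: the derivative of the remainder of order n + 1 is the remainder of order n, and
    the mean value inequality on the segment from 0 to z adds one factor |z|. *)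
Lemma cexp_taylor n z :
  cn (cexp z - \sum_(0 <= k < n) (k`!%:R)^-1 * z ^+ k) <= cn z ^+ n * expR (cn z).
Proof.
elim: n z => [|n IH] z.
  rewrite big_geq// subr0 expr0 mul1r cn_cexp ler_expR.
  exact: le_trans (ler_norm _) (Re_le_cn _).
pose S m w := \sum_(0 <= k < m) (k`!%:R)^-1 * w ^+ k : C.
have dS m w : cder (S m.+1) w (S m w).
  apply: (cder_ext (G := fun w => 1 + \sum_(0 <= k < m) (k.+1`!%:R)^-1 * w ^+ k.+1)).
    by move=> x; rewrite /S big_nat_recl//= fact0 invr1 expr0 mulr1.
  rewrite /S -[X in cder _ _ X]add0r; apply: cderD; first exact: cder_cst.
  apply: (@cder_sum R nat _ (fun k w => (k.+1`!%:R)^-1 * w ^+ k.+1)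
     (fun k w => (k`!%:R)^-1 * w ^+ k)) => k.
  apply: (cder_eqd _ (cderZ _ (cder_X w k))).
  rewrite factS natrM; field.
  by rewrite nat1r !pnatr_eq0 -lt0n fact_gt0.
have := @cder_segment_le R (fun w => cexp w - S n.+1 w) (fun w => cexp w - S n w) 0 z
  (cn z ^+ n * expR (cn z)).
rewrite add0r -/(S n.+1 z) cexp0.
have -> : S n.+1 0 = 1.
  rewrite /S big_nat_recl// fact0 invr1 expr0 mulr1 big1 ?addr0// => k _.
  by rewrite expr0n mulr0.
rewrite subrr subr0 => H; apply: (le_trans (H _ _)).
- by move=> t _; apply: cderB; [exact: cder_cexp|exact: dS].
- move=> t /andP[t0 t1]; rewrite add0r (le_trans (IH _))//.
  have tz : cn (t%:C * z) <= cn z by rewrite cnM cn_real_ge0// ler_piMl ?cn_ge0.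
  by rewrite ler_pM ?exprn_ge0 ?cn_ge0 ?expR_ge0 ?ler_expR// lerXn2r ?nnegrE ?cn_ge0.
- by rewrite exprSr mulrAC.
Qed.

(** The two derivatives agree on the overlap by uniqueness, so they glue at every order. *)
Lemma hol_union (D1 D2 : C -> Prop) n F : copen D1 -> copen D2 ->
  hol D1 n F -> hol D2 n F -> hol (fun s => D1 s \/ D2 s) n F.
Proof.
move=> o1 o2; elim: n F => [//|n IH] F [F1 [H1 h1]] [F2 [H2 h2]].
pose F' s := if pselect (D1 s) then F1 s else F2 s.
have E1 s : D1 s -> F' s = F1 s by rewrite /F'; case: pselect.
have E2 s : D2 s -> F' s = F2 s.
  move=> D2s; rewrite /F'; case: pselect => // D1s.
  exact: (cder_uniq (H1 _ D1s) (H2 _ D2s)).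
exists F'; split.
  by move=> s [D1s|D2s]; [rewrite (E1 _ D1s); exact: H1|rewrite (E2 _ D2s); exact: H2].
by apply: IH; [exact: (hol_eq o1 E1 h1)|exact: (hol_eq o2 E2 h2)].
Qed.

Lemma bsum_geometric : bsum (fun k => (2^-1 : R) ^+ k) 2.
Proof.
move=> n; suff -> : \sum_(0 <= k < n) (2^-1 : R) ^+ k = 2 - 2 * 2^-1 ^+ n.
  by rewrite gerBl mulr_ge0// exprn_ge0// invr_ge0.
elim: n => [|n IH]; first by rewrite big_geq// expr0 mulr1 subrr.
by rewrite big_nat_recr//= IH exprS; field.
Qed.

(** The entire function (e^z - 1 - z)/z^2, with its removable singularity filled by 1/2. *)
Definition remexp (z : C) : C := if z == 0 then 2^-1 else (cexp z - 1 - z) / z ^+ 2.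

(** Near 0 the function is the sum of z^k/(k+2)!, a dominated series; elsewhere it is a quotient.
    The two domains overlap. *)
Lemma hol_remexp n : hol (fun=> True) n remexp.
Proof.
have o1 : copen (disc 0 (2^-1 : R)) := @disc_open R 0 _.
have o2 : copen (fun z : C => z != 0).
  move=> z z0; exists (cn z); first by rewrite cn_gt0.
  by move=> w wz; apply/eqP => w0; move: wz; rewrite w0 sub0r cnN ltxx.
apply: (@hol_sub R (fun s => disc 0 2^-1 s \/ s != 0)).
  move=> s _; have [->|s0] := eqVneq s 0; last by right.
  by left; apply: disc_center; rewrite invr_gt0.
apply: hol_union => //; last first.
  apply: (hol_eq o2 (G := fun z => (cexp z - 1 - z) * (z * z)^-1)).
    by move=> s /negbTE s0; rewrite /remexp s0 expr2.
  apply: holM.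
    apply: holB; last exact: hol_id.
    by apply: holB; [apply: hol_cexp; exact: hol_id|exact: hol_cst].
  apply: holV; first by move=> s s0; rewrite mulf_neq0.
  by apply: holM; exact: hol_id.
pose u k z := (k.+2`!%:R)^-1 * z ^+ k : C.
have bu k z : cn z < 2^-1 -> cn (u k z) <= 2^-1 ^+ k.
  move=> z2; rewrite cnM cnV cn_nat cnX -[leRHS]mul1r ler_pM ?exprn_ge0 ?cn_ge0 ?invr_ge0//.
    by rewrite invf_le1 ?ltr0n ?fact_gt0// ler1n fact_gt0.
  by rewrite lerXn2r ?nnegrE ?cn_ge0// ?invr_ge0// ltW.
apply: (hol_eq o1 (G := fun z => CS (fun k => u k z))).
  move=> z; rewrite /disc subr0 => z2; apply/esym/CS_eq => e e0.
  have [z0|z0] := eqVneq z 0.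
    rewrite z0 /remexp eqxx; exists 1%N => -[//|m] _.
    rewrite big_nat_recl// big1 => [|k _]; last by rewrite /u expr0n mulr0.
    by rewrite /u expr0 mulr1 addr0 subrr cn0 ltW.
  have [N _ HN] : exists2 N, True & forall m, (N <= m)%N -> (2^-1 : R) ^+ m * expR 1 <= e.
    have q1 : `|2^-1 : R| < 1 by rewrite ger0_norm ?invr_ge0// invf_lt1// ltr1n.
    have := cvg_expr q1 => /cvgrPdist_le/(_ (e / expR 1)).
    rewrite divr_gt0 ?expR_gt0// => /(_ isT)[N _ HN]; exists N => // m /HN /=.
    by rewrite sub0r normrN normrX ger0_norm ?invr_ge0// ler_pdivlMr ?expR_gt0.
  exists N => m /HN {}HN; rewrite /remexp (negbTE z0).
  have z20 : z ^+ 2 != 0 by rewrite expf_neq0.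
  have E : \sum_(0 <= k < m) u k z - (cexp z - 1 - z) / z ^+ 2 =
     - (cexp z - \sum_(0 <= k < m.+2) (k`!%:R)^-1 * z ^+ k) / z ^+ 2.
    apply: (mulIf z20); rewrite [RHS]mulfVK// mulrBl [X in _ - X]mulfVK//.
    rewrite big_nat_recl// big_nat_recl//= !fact0 invr1 expr0 expr1 !mul1r mulr_suml.
    have -> : \sum_(0 <= i < m) u i z * z ^+ 2 = \sum_(0 <= i < m) (i.+2`!%:R)^-1 * z ^+ i.+2.
      by apply: eq_bigr => i _; rewrite /u -mulrA -exprD addn2.
    by ring.
  rewrite E cnM cnN cnV cnX ler_pdivrMr ?exprn_gt0 ?cn_gt0//.
  rewrite (le_trans (cexp_taylor _ _))//.
  have zm : cn z ^+ m <= 2^-1 ^+ m by rewrite lerXn2r ?nnegrE ?cn_ge0 ?invr_ge0// ltW.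
  have -> : cn z ^+ m.+2 * expR (cn z) = cn z ^+ m * expR (cn z) * cn z ^+ 2.
    by rewrite -addn2 exprD; ring.
  rewrite ler_wpM2r ?sqr_ge0// (le_trans _ HN)// ler_pM ?exprn_ge0 ?cn_ge0 ?expR_ge0//.
  by rewrite ler_expR (le_trans (ltW z2))// invf_le1// ler1n.
apply: weierstrass => //.
  by move=> k j; apply: holZ; exact: hol_X.
move=> s; rewrite /disc subr0 => s2; exists (2^-1 - cn s); first by rewrite subr_gt0.
exists (fun k => 2^-1 ^+ k), 2; split; first exact: bsum_geometric.
move=> z zs; have z2 : cn z < 2^-1.
  by have := cnD (z - s) s; rewrite subrK; lra.
by split=> [|k]; [rewrite /disc subr0|exact: bu].
Qed.

Lemma hol_lin n k F : hol (fun=> True) n F -> hol (fun=> True) n (fun s => F (k * s)).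
Proof.
elim: n F => [//|n IH] F [F' [H1 H2]]; exists (fun s => F' (k * s) * k); split.
  move=> s _; have := cder_comp (cderZ k (cder_id s)) (H1 _ I).
  by rewrite mulr1.
by apply: holM; [exact: IH|exact: hol_cst].
Qed.

Lemma atan_homo (x y : R) : x <= y -> atan x <= atan y.
Proof.
move=> xy.
have := @rder_nondecreasing R (fun t => 1 / 1 * atan (t / 1)) (fun y => 1 / (1 ^+ 2 + y ^+ 2)) x y xy.
move=> H; have := H (fun t _ => rder_atan 1 t ltr01) _; rewrite !divr1 !mul1r; apply=> t _.
by rewrite divr_ge0// addr_ge0 ?sqr_ge0.
Qed.

Lemma atan_near_pihalf (e : R) : 0 < e -> exists T0 : R, forall T, T0 <= T -> pi / 2 - e <= atan T.
Proof.
move=> e0; have [eb|be] := leP (pi / 2) e.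
  by exists 0 => T T0; rewrite (@le_trans _ _ 0)// ?subr_le0// -atan0 atan_homo.
have p2 : 0 < pi / 2 :> R by rewrite divr_gt0// pi_gt0.
exists (tan (pi / 2 - e)) => T HT.
rewrite -[leLHS]tanK; first by rewrite atan_homo.
by rewrite in_itv /=; apply/andP; split; lra.
Qed.

(* Moving the line Re s = 2 to Re s = -2 crosses the double pole at 0, and
   remexp carries the holomorphic part of e^(vs)/s^2 there. *)
Lemma KT_residue v (e : R) : 0 < v -> 0 < e -> exists T0 : R, forall T, T0 <= T ->
  cn (KT v T - KT (- v) T - Complex 0 (2 * pi * v)) <= e.
Proof.
move=> v0 e0.
pose h s := v%:C ^+ 2 * remexp (v%:C * s).
have hh : hol (fun=> True) 4 h by apply: holZ; apply: hol_lin; exact: hol_remexp.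
have vC0 : v%:C != 0 :> C by rewrite -cn_gt0 cn_real gtr0_norm.
have hE s : s != 0 -> h s = (cexp (v%:C * s) - 1 - v%:C * s) / s ^+ 2.
  by move=> s0; rewrite /h /remexp mulf_eq0 (negbTE s0) (negbTE vC0) /=; field; rewrite s0 vC0.
have [H HH] : exists H, forall s, cder H s (h s).
  have [|||H HH] := @primitive R (fun=> True) h 0; last by exists H => s; exact: HH.
  - by move=> s _; exists 1.
  - by [].
  - exact: hh.
have hb y : 0 < `|y| -> forall x : R, -2 <= x <= 2 ->
    cn (h (pt x y)) <= (expR (v * 2) + 1) / `|y| ^+ 2 + v / `|y|.
  move=> y0 x /andP[x1 x2].
  have cy : `|y| <= cn (pt x y) := cn_pt_im _ _.
  have c0 : 0 < cn (pt x y) by rewrite (lt_le_trans y0).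
  have p0 : pt x y != 0 by rewrite -cn_gt0.
  rewrite hE//.
  have -> : (cexp (v%:C * pt x y) - 1 - v%:C * pt x y) / pt x y ^+ 2 =
     (cexp (v%:C * pt x y) - 1) / pt x y ^+ 2 - v%:C / pt x y by field.
  rewrite (le_trans (cn_subD _ _))// lerD//.
    rewrite cnM cnV cnX ler_pM ?cn_ge0 ?invr_ge0 ?sqr_ge0//.
      rewrite (le_trans (cn_subD _ _))// cn1 lerD2r cn_cexp ler_expR !cpE mul0r subr0 /=.
      by rewrite ler_pM2l.
    by rewrite lef_pV2 ?posrE ?exprn_gt0// ler_pXn2r ?nnegrE ?cn_ge0.
  by rewrite cnM cnV cn_real gtr0_norm// ler_pM2l// lef_pV2 ?posrE.
have e6 : 0 < e / (12 * v) by rewrite divr_gt0// mulr_gt0.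
have [T1 HT1] := atan_near_pihalf e6.
pose B := expR (v * 2) + 1 + v.
have B0 : 0 < B by rewrite !addr_gt0// expR_gt0.
pose T0 := Num.max (Num.max 1 (2 * T1)) ((24 * B + 24) / e).
exists T0 => T; rewrite !ge_max => /andP[/andP[T1' T1T] TB].
have T0' : 0 < T by lra.
have TBe : (24 * B + 24) <= T * e by rewrite -ler_pdivrMr.
have invT : T^-1 <= e / (24 * B + 24).
  by rewrite -[leLHS]mul1r ler_pdivrMr// mulrAC ler_pdivlMr ?mul1r// ?[e * T]mulrC//; lra.
have hor y : `|y| = T -> cn (H (pt 2 y) - H (pt (-2) y)) <= e / 6.
  move=> yT; have := @horizontal_le H h (-2) 2 y (B / T).
  have -> : B / T * (2 - -2) = 4 * B * T^-1 by ring.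
  move=> HL; apply: (le_trans (HL _ _ _)).
  - lra.
  - by move=> x _; exact: HH.
  - move=> x xx; have y0 : 0 < `|y| by rewrite yT.
    rewrite (le_trans (hb _ y0 _ xx))// yT /B !mulrDl lerD2r lerD//.
      by rewrite ler_pM2l ?expR_gt0// lef_pV2 ?posrE ?exprn_gt0// expr2 ler_peMl// ltW.
    by rewrite !mul1r lef_pV2 ?posrE ?exprn_gt0// expr2 ler_peMl// ltW.
  - have := ler_wpM2l (mulr_ge0 (ler0n R 4) (ltW B0)) invT.
    move=> /le_trans; apply.
    have d0 : 0 < 24 * B + 24 by lra.
    rewrite mulrA ler_pdivrMr//; nra.
(* Under s -> -s the line Re s = -2 becomes Re s = 2 with -v in place of v, so the increment of [P]
   compares the two lines. [Q] computes the same increment from e^(vs)/s^2 = h(s) + 1/s^2 + v/s: the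
   two contributions of v/s combine into an arctangent, whose total variation produces the residue 2
   pi v. *)
pose P t := Ker v (pt 2 t) + Ker (- v) (pt 2 (- t)).
pose Q t := H (pt 2 t) + (-1) * H (pt (-2) t) + (-1) * (pt 2 t)^-1 + (pt (-2) t)^-1
   + (4 * v)%:C * (pt 0 1 * (2^-1 * atan (t / 2))%:C).
have PQ : P T - P (- T) = Q T - Q (- T).
  have dQ t : pder Q t (h (pt 2 t) * pt 0 1 + (-1) * (h (pt (-2) t) * pt 0 1)
     + (-1) * (- (pt 2 t) ^- 2 * pt 0 1) + - (pt (-2) t) ^- 2 * pt 0 1
     + (4 * v)%:C * (pt 0 1 * (1 / (2 ^+ 2 + t ^+ 2))%:C)).
    have n2 : pt 2 t != 0 by rewrite -cn_gt0 (lt_le_trans _ (cn_pt_re _ _))// normr_gt0.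
    have n2' : pt (-2) t != 0.
      by rewrite -cn_gt0 (lt_le_trans _ (cn_pt_re _ _))// normr_gt0 oppr_eq0.
    apply: pderD; first apply: pderD; first apply: pderD; first apply: pderD.
    - exact: vertical_pder.
    - by apply: pderZ; exact: vertical_pder.
    - by apply: pderZ; apply: (@vertical_pder (fun s => s^-1)); exact: cder_inv.
    - by apply: (@vertical_pder (fun s => s^-1)); exact: cder_inv.
    - apply: pderZ; apply: pderZ => k k0.
      have [r r0 Hr] := @rder_atan 2 1 t (ltr0Sn _ 1) k k0; exists r => // w /Hr.
      by rewrite !div1r -!realcM -!realcN -!realcD cn_real.
  have dP t : pder P t (cexp (v%:C * pt 2 t) / pt 2 t ^+ 2 * pt 0 1
      + (- (cexp ((- v)%:C * pt 2 (- t)) / pt 2 (- t) ^+ 2 * pt 0 1))).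
    apply: pderD; first by apply: vertical_pder; apply: KerP; rewrite /HP /=.
    have := @vertical_pder (Ker (- v)) 2 (- t) _ (KerP (- v) (s := pt 2 (- t)) _).
    rewrite /HP /= ltr0n => /(_ isT) HP' k k0; have [r r0 Hr] := HP' _ k0.
    exists r => // w wr; have := Hr (- w); rewrite normrN opprD => /(_ wr).
    by rewrite realcN mulrN mulNr.
  apply/eqP; rewrite -subr_eq0 -cn_eq0 eq_le cn_ge0 andbT.
  have TT : - T <= T by lra.
  have -> : P T - P (- T) - (Q T - Q (- T)) = (P T + (-1) * Q T) - (P (- T) + (-1) * Q (- T)) by ring.
  have := @pder_le R (fun t => P t + (-1) * Q t) _ (fun t => 0 * t + 0) (fun=> 0) (- T) T TT
    (fun t _ => pderD (dP t) (pderZ (-1) (dQ t))).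
  rewrite !mul0r subrr; apply; first by move=> t _; exact: rder_lin.
  move=> t _; set Z := (X in cn X); suff -> : Z = 0 by rewrite cn0.
  have n2 : pt 2 t != 0 by rewrite -cn_gt0 (lt_le_trans _ (cn_pt_re _ _))// normr_gt0.
  have n2' : pt (-2) t != 0.
    by rewrite -cn_gt0 (lt_le_trans _ (cn_pt_re _ _))// normr_gt0 oppr_eq0.
  rewrite /Z !hE//.
  have E1 : pt 2 (- t) = - pt (-2) t by apply: complexP; rewrite /= ?opprK.
  have E2 : (- v)%:C * pt 2 (- t) = v%:C * pt (-2) t by rewrite E1 realcN mulrNN.
  have s0 : 2 ^+ 2 + t ^+ 2 != 0 :> R by rewrite gt_eqF// ltr_pwDl ?exprn_gt0 ?sqr_ge0.
  have E3 : (1 / (2 ^+ 2 + t ^+ 2))%:C = - (pt 2 t * pt (-2) t)^-1.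
    rewrite div1r -invrN realcV; congr (_^-1).
    by apply: complexP; rewrite /= ; ring.
  have E4 : (4 * v)%:C = v%:C * (pt 2 t - pt (-2) t) by apply: complexP; rewrite /=; ring.
  rewrite E3 E4 E2 E1 sqrrN.
  by field; rewrite n2 n2'.
have -> : KT v T - KT (- v) T = Q T - Q (- T) by rewrite -PQ /P /KT opprK; ring.
have aN : atan (- T / 2) = - atan (T / 2) by rewrite mulNr atanN.
have aT : pi / 2 - e / (12 * v) <= atan (T / 2).
  by apply: HT1; rewrite ler_pdivlMr//; lra.
have aT2 : atan (T / 2) <= pi / 2 by rewrite ltW// atan_ltpi2.
have -> : Q T - Q (- T) - Complex 0 (2 * pi * v) = (H (pt 2 T) - H (pt (-2) T))
  - (H (pt 2 (- T)) - H (pt (-2) (- T))) - (pt 2 T)^-1 + (pt (-2) T)^-1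
  + (pt 2 (- T))^-1 - (pt (-2) (- T))^-1 + Complex 0 (4 * v * (atan (T / 2) - pi / 2)).
  rewrite /Q aN; set X := (4 * v)%:C * (pt 0 1 * (2^-1 * atan (T / 2))%:C).
  set Y := (4 * v)%:C * (pt 0 1 * (2^-1 * - atan (T / 2))%:C).
  have XY : X - Y - Complex 0 (2 * pi * v) = Complex 0 (4 * v * (atan (T / 2) - pi / 2)).
    by apply: complexP; rewrite /=; field.
  by rewrite -XY; ring.
have i1 x y : `|y| = T -> cn (pt x y)^-1 <= e / 24.
  move=> yT; rewrite cnV (@le_trans _ _ T^-1)//.
    have cT : T <= cn (pt x y) by rewrite -yT cn_pt_im.
    by rewrite lef_pV2 ?posrE// (lt_le_trans T0' cT).
  rewrite (le_trans invT)// ler_wpM2l ?(ltW e0)// lef_pV2 ?posrE//; lra.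
have TN : `|- T| = T by rewrite normrN gtr0_norm.
have TP : `|T| = T by rewrite gtr0_norm.
have j1 := i1 2 T TP; have j2 := i1 (-2) T TP; have j3 := i1 2 (- T) TN; have j4 := i1 (-2) (- T) TN.
have k1 := hor T TP; have k2 := hor (- T) TN.
have j5 : cn (Complex 0 (4 * v * (atan (T / 2) - pi / 2))) <= e / 3.
  rewrite (le_trans (cn_le_ReIm _))//= normr0 add0r normrM gtr0_norm ?mulr_gt0//.
  rewrite ler0_norm ?subr_le0//.
  have -> : e / 3 = 4 * v * (e / (12 * v)) by field; rewrite gt_eqF.
  rewrite ler_wpM2l ?mulr_ge0 ?(ltW v0)//; lra.
have c7 (x1 x2 x3 x4 x5 x6 x7 : C) : cn (x1 - x2 - x3 + x4 + x5 - x6 + x7) <=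
    cn x1 + cn x2 + cn x3 + cn x4 + cn x5 + cn x6 + cn x7.
  apply: (le_trans (cnD _ _)); rewrite lerD2r; apply: (le_trans (cn_subD _ _)); rewrite lerD2r.
  apply: (le_trans (cnD _ _)); rewrite lerD2r; apply: (le_trans (cnD _ _)); rewrite lerD2r.
  by apply: (le_trans (cn_subD _ _)); rewrite lerD2r; exact: cn_subD.
apply: (le_trans (c7 _ _ _ _ _ _ _)); lra.
Qed.

Lemma KT_lim v (e : R) : 0 < e -> exists T0 : R, forall T, T0 <= T ->
  cn (KT v T - Complex 0 (2 * pi * Num.max 0 v)) <= e.
Proof.
move=> e0; have [v0|v0] := leP v 0.
  have [T0 H] := KT_neg v0 e0; exists T0 => T /H.
  by rewrite mulr0 (_ : Complex 0 0 = 0)// subr0.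
have e2 : 0 < e / 2 by rewrite divr_gt0.
have Nv : - v <= 0 by rewrite oppr_le0 ltW.
have [T1 H1] := KT_neg Nv e2; have [T2 H2] := KT_residue v0 e2.
exists (Num.max T1 T2) => T; rewrite ge_max => /andP[/H1 h1 /H2 h2].
set w := Complex _ _ in h2 *.
have -> : KT v T - w = KT v T - KT (- v) T - w + KT (- v) T by ring.
rewrite (le_trans (cnD _ _))//; lra.
Qed.

Lemma expR_ln2 (x : R) : 0 < x -> expR (ln x * 2) = x ^+ 2.
Proof. by move=> x0; rewrite mulrDr mulr1 expRD lnK ?posrE// expr2. Qed.

Definition npow (n : nat) s : C := cexp ((- ln n%:R)%:C * s).

Lemma cn_npow n s : cn (npow n s) = expR (- ln n%:R * Re s).
Proof. by rewrite /npow cn_cexp !cpE mul0r subr0. Qed.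

Lemma cn_npow2 n y : (0 < n)%N -> cn (npow n (pt 2 y)) = (n%:R ^+ 2)^-1.
Proof.
by move=> n0; rewrite cn_npow /= mulNr expRN expR_ln2// ltr0n.
Qed.

Lemma inv_sqr_ge0 k : 0 <= (k.+1%:R ^+ 2)^-1 :> R.
Proof. by rewrite invr_ge0 sqr_ge0. Qed.

Lemma bsum_inv_sqr : bsum (fun k => (k.+1%:R ^+ 2)^-1 : R) 2.
Proof.
move=> n; case: n => [|n]; first by rewrite big_geq.
suff : \sum_(0 <= k < n.+1) (k.+1%:R ^+ 2)^-1 <= 2 - n.+1%:R^-1 :> R.
  by move=> /le_trans; apply; rewrite gerBl invr_ge0.
elim: n => [|n IH]; first by rewrite big_nat1 expr1n invr1; lra.
rewrite big_nat_recr//= (le_trans (lerD IH (lexx _)))//.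
have n1 : 0 < n.+1%:R :> R by rewrite ltr0n.
have n2 : n.+2%:R = n.+1%:R + 1 :> R by rewrite -natr1.
rewrite n2; move: (n.+1%:R) n1 => x x0; rewrite -addrA lerD2l.
rewrite -subr_ge0 (_ : _ - _ = (x * (x + 1) ^+ 2)^-1); last by field; rewrite !gt_eqF//; lra.
by rewrite invr_ge0 mulr_ge0 ?sqr_ge0// ltW.
Qed.

Lemma cvs_tail (u : nat -> C) l (M : nat -> R) (e : R) n : cvs u l ->
  (forall k, cn (u k) <= M k) -> (forall m, \sum_(n <= k < m) M k <= e) ->
  cn (l - \sum_(0 <= k < n) u k) <= e.
Proof.
move=> H uM ht; apply/ler_addgt0Pr => d d0; have [N HN] := H _ d0.
have := HN _ (leq_maxl N n); set m := maxn N n => h1.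
have nm : (n <= m)%N by exact: leq_maxr.
have E : \sum_(0 <= k < m) u k = \sum_(0 <= k < n) u k + \sum_(n <= k < m) u k.
  by rewrite (big_cat_nat _ nm).
have h2 : cn (\sum_(n <= k < m) u k) <= e.
  by rewrite (le_trans (cn_sum _ _ _))// (le_trans _ (ht m))// ler_sum.
have -> : l - \sum_(0 <= k < n) u k = - (\sum_(0 <= k < m) u k - l) + \sum_(n <= k < m) u k.
  by rewrite E; ring.
rewrite (le_trans (cnD _ _))// cnN addrC lerD//.
Qed.

(** A function of size sqrt|s| divided by s^2 is of size |s|^(-3/2), which is integrable along a
    vertical line; k plays the part of sqrt|s|. *)
Lemma sqrt_over_sqr (c k : R) : 0 < k -> k ^+ 2 <= c ->
  Num.sqrt c / c ^+ 2 <= (k ^+ 3)^-1.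
Proof.
move=> k0 kc; have c0 : 0 < c by rewrite (lt_le_trans _ kc)// exprn_gt0.
have r0 : 0 < Num.sqrt c by rewrite sqrtr_gt0.
have -> : Num.sqrt c / c ^+ 2 = (Num.sqrt c ^+ 3)^-1.
  rewrite -[in c ^+ 2](sqr_sqrtr (ltW c0)); field; exact: lt0r_neq0.
rewrite lef_pV2 ?posrE ?exprn_gt0// ler_pXn2r ?nnegrE ?(ltW k0) ?(ltW r0)//.
by rewrite -(ger0_norm (ltW k0)) -sqrtr_sqr ler_sqrt// ltW.
Qed.

(** On Re s = 2 the series of f may be integrated term by term, and the limits of [KT] select the
    weights. The integral is then moved to Re s = x without crossing a pole, as s = 0 lies to the
    left. The shifted integral is at most 18 A X^x, and 2 pi >= 4 turns this into 5 A X^x. *)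
Theorem perron (a : nat -> C) f (x A X : R) : (forall n, cn (a n) <= 1) ->
  hol (HP 2^-1) 4 f ->
  (forall y, cvs (fun k => a k.+1 * npow k.+1 (pt 2 y)) (f (pt 2 y))) ->
  2^-1 < x -> x <= 1 -> 0 <= A ->
  (forall s, x <= Re s <= 2 -> cn (f s) <= A * Num.sqrt (cn s)) -> 1 <= X ->
  forall N, X <= N%:R ->
  cn (\sum_(0 <= k < N) a k.+1 * (Num.max 0 (ln X - ln k.+1%:R))%:C) <= 5 * A * expR (x * ln X).
Proof.
move=> a1 hf fS xh x1 A0 fA X1 N XN.
pose u := ln X; have u0 : 0 <= u by rewrite ln_ge0.
pose g s := f s * (cexp (u%:C * s) / s ^+ 2).
have half0 : 0 < 2^-1 :> R by rewrite invr_gt0.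
have hg : hol (HP 2^-1) 4 g.
  apply: holM => //; apply: (hol_sub _ (hol_kernel u 4)) => s; rewrite /HP; lra.
have [G HG] := HP_primitive hg.
have gle s (K : R) : x <= Re s <= 2 -> 0 < K -> K ^+ 2 <= cn s ->
    cn (g s) <= A * expR (u * Re s) * (K ^+ 3)^-1.
  move=> xs K0 Ks; rewrite /g cnM cn_kernel.
  apply: (le_trans (ler_wpM2r _ (fA _ xs))); first by rewrite divr_ge0 ?expR_ge0 ?sqr_ge0.
  have -> : A * Num.sqrt (cn s) * (expR (u * Re s) / cn s ^+ 2) =
    A * expR (u * Re s) * (Num.sqrt (cn s) / cn s ^+ 2) by ring.
  by rewrite ler_wpM2l ?mulr_ge0 ?expR_ge0// sqrt_over_sqr.
(* Blocks of ratio 4: between the heights 4^j and 4^(j+1) the integrand is at most A X^x 8^(-j) over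
   a length 3 * 4^j, so the block contributes 3 * 2^(-j) A X^x. *)
pose T j : R := 4 ^+ j.
have T2 j : T j = (2 ^+ j) ^+ 2 by rewrite /T -exprM mulnC exprM; congr (_ ^+ _); ring.
have T1 j : 1 <= T j by rewrite exprn_ege1// ler1n.
have Px0 : 0 <= A * expR (u * x) by rewrite mulr_ge0 ?expR_ge0.
have dyad (sg : R) j : `|sg| = 1 ->
    cn (G (pt x (sg * T j.+1)) - G (pt x (sg * T j))) <= A * expR (u * x) * (3 * 2^-1 ^+ j).
  move=> sg1; have p2 : 0 < 2 ^+ j :> R by rewrite exprn_gt0.
  have TT : T j <= T j.+1 by rewrite /T exprS ler_peMl ?exprn_ge0// ler1n.
  have key y : T j <= `|y| -> cn (g (pt x y)) <= A * expR (u * x) * ((2 ^+ j) ^+ 3)^-1.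
    move=> yT; apply: gle => //=; first by rewrite lexx; lra.
    by rewrite -T2 (le_trans yT)// cn_pt_im.
  have dG y : cder G (pt x y) (g (pt x y)) by apply: HG; rewrite /HP /=.
  have E : A * expR (u * x) * ((2 ^+ j) ^+ 3)^-1 * (T j.+1 - T j) = A * expR (u * x) * (3 * 2^-1 ^+ j).
    have -> : T j.+1 = 4 * T j by rewrite /T exprS.
    by rewrite T2 exprVn; field; exact: lt0r_neq0.
  rewrite -E; have T0 : 0 <= T j by rewrite exprn_ge0.
  have [sg0|sg0] := leP 0 sg.
    rewrite ger0_norm// in sg1; rewrite sg1 !mul1r.
    apply: (@vertical_cst_le G g) => // y /andP[y1 _]; apply: key.
    by rewrite ger0_norm// (le_trans T0).
  rewrite ltr0_norm// in sg1; have -> : sg = -1 by lra.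
  rewrite !mulN1r cnB.
  have -> : T j.+1 - T j = - T j - - T j.+1 by ring.
  apply: (@vertical_cst_le G g) => //; first by rewrite lerN2.
  move=> y /andP[_ y1]; apply: key; rewrite ler0_norm; lra.
have side (sg : R) J : `|sg| = 1 ->
    cn (G (pt x (sg * T J)) - G (pt x sg)) <= A * expR (u * x) * 6.
  move=> sg1; apply: (@le_trans _ _ (A * expR (u * x) * (3 * \sum_(0 <= j < J) 2^-1 ^+ j))).
    elim: J => [|J IH]; first by rewrite /T expr0 mulr1 subrr cn0 big_geq// !mulr0.
    rewrite big_nat_recr//= [3 * _]mulrDr mulrDr.
    have -> : G (pt x (sg * T J.+1)) - G (pt x sg) =
      (G (pt x (sg * T J)) - G (pt x sg)) + (G (pt x (sg * T J.+1)) - G (pt x (sg * T J))) by ring.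
    by rewrite (le_trans (cnD _ _))// lerD// dyad.
  by rewrite ler_wpM2l//; have := bsum_geometric J; lra.
have mid : cn (G (pt x 1) - G (pt x (-1))) <= A * expR (u * x) * 6.
  have -> : A * expR (u * x) * 6 = A * expR (u * x) * 3 * (1 - -1) by ring.
  apply: (@vertical_cst_le G g) => [|y _|y _]; first by lra.
    by apply: HG; rewrite /HP /=.
  (* For |y| <= 1 one has |s| >= x > 1/2 >= K^2, and K^(-3) = 1000/343 is at most 3. *)
  pose K : R := 7 / 10.
  have := @gle (pt x y) K; rewrite /= lexx => H; apply: (le_trans (H _ _ _)).
  - by apply/andP; split=> //; lra.
  - by rewrite /K; lra.
  - rewrite (le_trans _ (cn_pt_re _ _))// gtr0_norm; last by lra.
    by rewrite /K expr2; lra.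
  - rewrite ler_wpM2l// /K.
    have -> : ((7 / 10) ^+ 3)^-1 = 1000 / 343 :> R by field.
    by lra.
have vert J : cn (G (pt x (T J)) - G (pt x (- T J))) <= 18 * A * expR (u * x).
  have -> : G (pt x (T J)) - G (pt x (- T J)) = (G (pt x (1 * T J)) - G (pt x 1))
    + (G (pt x 1) - G (pt x (-1))) - (G (pt x (-1 * T J)) - G (pt x (-1))).
    by rewrite mul1r mulN1r; ring.
  have s1 := side 1 J (normr1 _); have s2 := side (-1) J (normrN1 _).
  apply: (le_trans (cn_subD _ _)).
  have := cnD (G (pt x (1 * T J)) - G (pt x 1)) (G (pt x 1) - G (pt x (-1))).
  lra.
have hor (y : R) J : `|y| = T J -> cn (G (pt 2 y) - G (pt x y)) <= 2 * A * expR (u * 2) * 2^-1 ^+ J.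
  move=> yT; have p2 : 0 < 2 ^+ J :> R by rewrite exprn_gt0.
  have p21 : 1 <= 2 ^+ J :> R by rewrite exprn_ege1// ler1n.
  have A20 : 0 <= A * expR (u * 2) by rewrite mulr_ge0// expR_ge0.
  apply: (@le_trans _ _ (A * expR (u * 2) * ((2 ^+ J) ^+ 3)^-1 * (2 - x))).
    apply: (@horizontal_le G g); first by lra.
      by move=> t /andP[t1 _]; apply: HG; rewrite /HP /=; lra.
    move=> t tt; have := @gle (pt t y) (2 ^+ J) tt p2.
    rewrite -T2 -yT cn_pt_im => /(_ isT) /le_trans; apply=> /=.
    by rewrite ler_wpM2r ?invr_ge0 ?exprn_ge0// ler_wpM2l// ler_expR ler_wpM2l//; lra.
  have -> : 2 * A * expR (u * 2) * 2^-1 ^+ J = A * expR (u * 2) * 2^-1 ^+ J * 2 by ring.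
  apply: ler_pM; [|lra| |lra].
    by rewrite mulr_ge0// invr_ge0 exprn_ge0// ltW.
  rewrite ler_wpM2l// exprVn lef_pV2 ?posrE ?exprn_gt0//.
  by rewrite exprS ler_peMr ?(ltW p2)// exprn_ege1.
have ser (T' : R) : 0 <= T' -> cvs (fun k => a k.+1 * KT (u - ln k.+1%:R) T') (G (pt 2 T') - G (pt 2 (- T'))).
  (* The truncated series is within e' of f on the line; the kernel bound X^2/4 and the length 2T'
     of the segment keep the total below e. *)
  move=> T0 e e0; pose e' := e / (expR (u * 2) * T' + 1).
  have d0 : 0 < expR (u * 2) * T' + 1 by rewrite ltr_wpDl ?mulr_ge0 ?expR_ge0.
  have e'0 : 0 < e' by rewrite divr_gt0.
  have [M HM] := bsum_tail inv_sqr_ge0 bsum_inv_sqr e'0; exists M => n Mn.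
  pose Psi s := G s - \sum_(0 <= k < n) a k.+1 * Ker (u - ln k.+1%:R) s.
  have -> : \sum_(0 <= k < n) a k.+1 * KT (u - ln k.+1%:R) T' - (G (pt 2 T') - G (pt 2 (- T')))
      = - (Psi (pt 2 T') - Psi (pt 2 (- T'))).
    rewrite /Psi; have -> : \sum_(0 <= k < n) a k.+1 * KT (u - ln k.+1%:R) T' =
       \sum_(0 <= k < n) a k.+1 * Ker (u - ln k.+1%:R) (pt 2 T')
       - \sum_(0 <= k < n) a k.+1 * Ker (u - ln k.+1%:R) (pt 2 (- T')).
      by rewrite -sumrB; apply: eq_bigr => k _; rewrite /KT mulrBr.
    by ring.
  rewrite cnN.
  pose psi s := (f s - \sum_(0 <= k < n) a k.+1 * npow k.+1 s) * (cexp (u%:C * s) / s ^+ 2).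
  have dPsi y : cder Psi (pt 2 y) (psi (pt 2 y)).
    have -> : psi (pt 2 y) = g (pt 2 y) - \sum_(0 <= k < n) a k.+1 *
       (cexp ((u - ln k.+1%:R)%:C * pt 2 y) / pt 2 y ^+ 2).
      rewrite /psi mulrBl -/(g _) mulr_suml; congr (_ - _); apply: eq_bigr => k _.
      by rewrite realcD mulrDl cexpD /npow; ring.
    apply: cderB; first by apply: HG; rewrite /HP /=; lra.
    apply: (@cder_sum R nat _ (fun k s => a k.+1 * Ker (u - ln k.+1%:R) s)
      (fun k s => a k.+1 * (cexp ((u - ln k.+1%:R)%:C * s) / s ^+ 2))) => k.
    by apply: cderZ; apply: KerP; rewrite /HP /=.
  have psile y : cn (psi (pt 2 y)) <= e' * expR (u * 2) / 4.
    rewrite /psi cnM cn_kernel /= -mulrA; apply: ler_pM; rewrite ?cn_ge0 ?divr_ge0 ?expR_ge0 ?sqr_ge0//.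
      apply: (cvs_tail (fS y) (M := fun k => (k.+1%:R ^+ 2)^-1)) => [k|m].
        by rewrite cnM cn_npow2// ler_piMl ?invr_ge0 ?sqr_ge0.
      exact: HM.
    rewrite ler_wpM2l ?expR_ge0// lef_pV2 ?posrE//.
      have c2 := cn_pt_re 2 y; rewrite ger0_norm// in c2.
      by have := cn_ge0 (pt 2 y); rewrite expr2; nra.
    by rewrite exprn_gt0// (lt_le_trans _ (cn_pt_re _ _))// gtr0_norm.
  apply: (le_trans (@vertical_cst_le Psi psi 2 (- T') T' _ _ (fun y _ => dPsi y) (fun y _ => psile y))).
    by lra.
  have ee : e' * (expR (u * 2) * T' + 1) = e by rewrite /e' mulfVK// gt_eqF.
  have q : 0 <= e' * (expR (u * 2) * T') by rewrite mulr_ge0 ?(ltW e'0)// mulr_ge0// expR_ge0.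
  have -> : e' * expR (u * 2) / 4 * (T' - - T') = e' * (expR (u * 2) * T') / 2 by field.
  by move: ee; rewrite mulrDr mulr1; lra.
set S := \sum_(0 <= k < N) _.
have tp : 4 <= 2 * pi :> R by have := @pi_ge2 R; lra.
suff main (e : R) : 0 < e -> 2 * pi * cn S <= 18 * A * expR (u * x) + 5 * e.
  have : 2 * pi * cn S <= 18 * A * expR (u * x).
    apply/ler_addgt0Pr => e e0; have e5 : 0 < e / 5 by rewrite divr_gt0.
    by have := main _ e5; lra.
  rewrite [x * _]mulrC -/u.
  have : 4 * cn S <= 2 * pi * cn S by rewrite ler_wpM2r ?cn_ge0.
  have : 0 <= A * expR (u * x) by [].
  lra.
move=> e0.
have X20 : 0 < expR (u * 2) by exact: expR_gt0.
have e'0 : 0 < e / (2 * expR (u * 2)) by rewrite divr_gt0// mulr_gt0.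
have [M HM] := bsum_tail inv_sqr_ge0 bsum_inv_sqr e'0.
(* The terms beyond N have weight 0, so the finite sum can be extended until the tail of the series
   is small. *)
pose n := maxn M N.
have tail0 : \sum_(N <= k < n) a k.+1 * (Num.max 0 (ln X - ln k.+1%:R))%:C = 0.
  rewrite big_nat_cond big1// => k /andP[/andP[Nk _] _].
  have XK : X <= k.+1%:R by rewrite (le_trans XN)// ler_nat ltnW.
  have -> : Num.max 0 (ln X - ln k.+1%:R) = 0; last by rewrite mulr0.
  by apply/max_idPl; rewrite subr_le0 ler_ln ?posrE//; lra.
have SE : S = \sum_(0 <= k < n) a k.+1 * (Num.max 0 (ln X - ln k.+1%:R))%:C.
  by rewrite (big_cat_nat _ (leq_maxr M N))//= -/n tail0 addr0.
have [J0 HJ0] : exists J0, forall J, (J0 <= J)%N ->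
    cn (\sum_(0 <= k < n) a k.+1 * KT (u - ln k.+1%:R) (T J)
      - \sum_(0 <= k < n) a k.+1 * Complex 0 (2 * pi * Num.max 0 (u - ln k.+1%:R))) <= e
    /\ 2 * A * expR (u * 2) * 2^-1 ^+ J <= e.
  have Tinf (B : R) : exists J0, forall J, (J0 <= J)%N -> B <= T J.
    exists (`|Num.ceil B|).+1 => J BJ; have [B0|B0] := leP B 0.
      by rewrite (le_trans B0)// exprn_ge0.
    apply: (@le_trans _ _ J%:R).
      rewrite (le_trans (ceil_ge _))// -(gez0_abs (_ : 0 <= Num.ceil B)%R); last by rewrite ceil_ge0; lra.
      by rewrite -pmulrn ler_nat ltnW.
    by rewrite /T -natrX ler_nat ltnW// ltn_expl.
  have [J1 HJ1] : exists J1, forall J, (J1 <= J)%N -> 2 * A * expR (u * 2) * 2^-1 ^+ J <= e.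
    have [J1 H1] := Tinf ((2 * A * expR (u * 2) / e) ^+ 2).
    exists J1 => J /H1; rewrite T2 ler_pXn2r ?nnegrE ?exprn_ge0 ?divr_ge0 ?mulr_ge0 ?(ltW e0) ?expR_ge0//.
    rewrite ler_pdivrMr// => h; rewrite exprVn ler_pdivrMr ?exprn_gt0//.
    by rewrite [e * _]mulrC.
  have [J2 HJ2] : exists J2, forall J, (J2 <= J)%N -> forall k, (k < n)%N ->
     cn (KT (u - ln k.+1%:R) (T J) - Complex 0 (2 * pi * Num.max 0 (u - ln k.+1%:R))) <= e / n.+1%:R.
    have : 0 < e / n.+1%:R by rewrite divr_gt0.
    move: (e / n.+1%:R) => e1 en; elim: (n) => [|m [J2 IH]]; first by exists 0%N.
    have [T0 HT0] := KT_lim (u - ln m.+1%:R) en; have [J3 HJ3] := Tinf T0.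
    exists (maxn J2 J3) => J; rewrite geq_max => /andP[j2 j3] k; rewrite ltnS leq_eqVlt.
    move=> /orP[/eqP ->|km]; [exact/HT0/HJ3|exact: IH].
  exists (maxn J1 J2) => J; rewrite geq_max => /andP[j1 j2]; split; last exact: HJ1.
  rewrite -sumrB (le_trans (cn_sum _ _ _))// (@le_trans _ _ (\sum_(0 <= k < n) e / n.+1%:R))//.
    rewrite big_nat_cond [leRHS]big_nat_cond; apply: ler_sum => k /andP[/andP[_ kn] _].
    rewrite -mulrBr cnM -[leRHS]mul1r ler_pM ?cn_ge0//.
    exact: HJ2.
  rewrite sumr_const_nat subn0 -[_ *+ n]mulr_natr mulrAC ler_pdivrMr// ler_wpM2l ?(ltW e0)//.
  by rewrite ler_nat.
have [h1 h2] := HJ0 _ (leqnn J0).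
have T0 : 0 <= T J0 by rewrite exprn_ge0.
have tail := @cvs_tail _ _ (fun k => 2 * expR (u * 2) * (k.+1%:R ^+ 2)^-1) e n (ser _ T0).
have {}tail : cn (G (pt 2 (T J0)) - G (pt 2 (- T J0))
   - \sum_(0 <= k < n) a k.+1 * KT (u - ln k.+1%:R) (T J0)) <= e.
  apply: tail => [k|m].
    rewrite cnM -[leRHS]mul1r ler_pM ?cn_ge0// (le_trans (KT_le _ T0))//.
    rewrite mulrBl expRD -mulrA ler_pM2l// ler_pM2l ?expR_gt0//.
    by rewrite expRN expR_ln2.
  rewrite -mulr_sumr; have := HM n m (leq_maxl _ _).
  by rewrite ler_pdivlMr ?mulr_gt0// mulrC.
have Epi : \sum_(0 <= k < n) a k.+1 * Complex 0 (2 * pi * Num.max 0 (u - ln k.+1%:R))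
   = Complex 0 (2 * pi) * S.
  rewrite SE mulr_sumr; apply: eq_bigr => k _.
  have -> : Complex 0 (2 * pi * Num.max 0 (u - ln k.+1%:R)) =
     Complex 0 (2 * pi) * (Num.max 0 (u - ln k.+1%:R))%:C.
    by apply: complexP; rewrite /=; ring.
  by rewrite mulrCA.
have cpi : cn (Complex 0 (2 * pi) : C) = 2 * pi.
  by rewrite /cn /= expr0n add0r sqrtr_sqr ger0_norm//; lra.
rewrite -cpi -cnM -Epi; rewrite Epi in h1 *.
have TN : `|- T J0| = T J0 by rewrite normrN ger0_norm.
have TP : `|T J0| = T J0 by rewrite ger0_norm.
have k1 := hor _ _ TP; have k2 := hor _ _ TN; have k3 := vert J0.
move: h1 tail k1 k2 k3; set Y := \sum_(0 <= k < n) _; set W := _ * S.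
set g1 := G (pt 2 (T J0)); set g2 := G (pt 2 (- T J0)).
set g3 := G (pt x (T J0)); set g4 := G (pt x (- T J0)) => h1 tail k1 k2 k3.
have -> : W = - (Y - W) - (g1 - g2 - Y) + (g1 - g3) - (g2 - g4) + (g3 - g4) by ring.
apply: (le_trans (cnD _ _)); apply: (@le_trans _ _ (e + e + e + e + 18 * A * expR (u * x))); last by lra.
rewrite lerD//; apply: (le_trans (cn_subD _ _)); rewrite lerD ?(le_trans k2 h2)//.
apply: (le_trans (cnD _ _)); rewrite lerD ?(le_trans k1 h2)//.
by apply: (le_trans (cn_subD _ _)); rewrite cnN lerD.
Qed.

End Perron.

(** * Dirichlet series and L-functions *)

Section Mangoldt.
Variable R : realType.

(** The von Mangoldt function: n has exactly one prime divisor precisely when it is a prime power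
    with positive exponent. *)
Definition Lam (n : nat) : R := if primes n is [:: p] then ln p%:R else 0.

Lemma ln_nat_ge0 n : 0 <= ln n%:R :> R.
Proof. by case: n => [|n]; [rewrite ln0|rewrite ln_ge0// ler1n]. Qed.

Lemma Lam_ge0 n : 0 <= Lam n.
Proof. by rewrite /Lam; case: (primes n) => [|p [|]]//; exact: ln_nat_ge0. Qed.

Lemma Lam_le n : (0 < n)%N -> Lam n <= ln n%:R.
Proof.
move=> n0; rewrite /Lam; case E: (primes n) => [|p [|]]; try exact: ln_nat_ge0.
have : p \in primes n by rewrite E inE.
rewrite mem_primes => /and3P[pp _ pn].
have p0 := prime_gt0 pp.
by rewrite ler_ln ?posrE ?ltr0n// ler_nat dvdn_leq.
Qed.

Lemma Lam1 : Lam 1 = 0. Proof. by []. Qed.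

Lemma Lam_prime p : prime p -> Lam p = ln p%:R.
Proof. by move=> pp; rewrite /Lam primes_prime. Qed.

Lemma primes_prime_power n p : primes n = [:: p] -> exists2 k, (0 < k)%N & n = (p ^ k)%N.
Proof.
move=> E; have n0 : (0 < n)%N by case: n E.
have : p \in primes n by rewrite E inE.
rewrite mem_primes => /and3P[pp _ pn].
have : p.-nat n.
  rewrite /pnat n0; apply/allP => q; rewrite E inE => /eqP ->.
  by rewrite inE /=.
move=> /p_natP[k nk]; exists k => //; rewrite lt0n; apply/eqP => k0.
by move: pn; rewrite nk k0 expn0 dvdn1 => /eqP p1; rewrite p1 in pp.
Qed.

(** Divisors are grouped by their prime p: those that are powers of p are p, ..., p^v with v the
    p-adic valuation of n, and each weighs log p. *)
Lemma sum_Lam n : (0 < n)%N -> \sum_(1 <= d < n.+1 | (d %| n)%N) Lam d = ln n%:R.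
Proof.
move=> n0.
have -> : \sum_(1 <= d < n.+1 | (d %| n)%N) Lam d =
   \sum_(p <- primes n) \sum_(1 <= d < n.+1 | (d %| n)%N && (primes d == [:: p])) ln p%:R.
  rewrite (exchange_big_dep (fun d => d %| n)%N)//=; last by move=> p d _ /andP[].
  rewrite big_nat_cond [RHS]big_nat_cond; apply: eq_bigr => d /andP[/andP[d0 _] dn].
  rewrite big_mkcond /=; under eq_bigr => p _ do rewrite dn /=.
  rewrite /Lam; case E: (primes d) => [|p [|p' l]].
  - by rewrite big1_seq// => p _; case: eqP.
  - have pn : p \in primes n.
      have : p \in primes d by rewrite E inE.
      rewrite !mem_primes n0 => /and3P[pp _ pd]; rewrite pp /=; exact: dvdn_trans dn.
    rewrite -big_mkcond /= (eq_bigl (pred1 p)) => [|q].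
      by rewrite -big_filter filter_pred1_uniq ?primes_uniq// big_seq1.
    by rewrite /= eqseq_cons andbT eq_sym.
  - by rewrite big1_seq// => q _; case: eqP.
have Eln : ln n%:R = \sum_(p <- primes n) ln (p ^ logn p n)%N%:R :> R.
  rewrite {1}(prod_prime_decomp n0) prime_decompE big_map /= big_seq [in RHS]big_seq.
  pose K (x : nat) (y : R) := (0 < x)%N /\ ln x%:R = y.
  apply: (proj2 (_ : K _ _)); apply: (big_rec2 K); first by split=> //; rewrite ln1.
  move=> p x y pn [x0 E].
  have p0 : (0 < p ^ logn p n)%N.
    by rewrite expn_gt0 prime_gt0//; move: pn; rewrite mem_primes => /and3P[].
  by split; [rewrite muln_gt0 p0|rewrite natrM lnM ?posrE ?ltr0n// E].
rewrite Eln; apply: eq_big_seq => p; rewrite mem_primes => /and3P[pp _ pn].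
rewrite -big_filter (perm_big [seq (p ^ k)%N | k <- index_iota 1 (logn p n).+1]).
  have p0 : 0 < p%:R :> R by rewrite ltr0n prime_gt0.
  by rewrite big_map sumr_const_nat subSS subn0 natrX lnXn.
apply: uniq_perm.
- by rewrite filter_uniq// iota_uniq.
- rewrite map_inj_uniq ?iota_uniq// => a b; apply: expnI; exact: prime_gt1.
- move=> d; rewrite mem_filter mem_index_iota ltnS; apply/idP/mapP.
    move=> /and3P[/andP[dn /eqP/primes_prime_power[k k0 dk]] _ _].
    by exists k => //; rewrite mem_index_iota k0 ltnS -pfactor_dvdn// -dk.
  move=> [k]; rewrite mem_index_iota ltnS => /andP[k0 kn] ->.
  have dn : (p ^ k %| n)%N by rewrite pfactor_dvdn.
  by rewrite dn primesX// primes_prime// eqxx /= expn_gt0 prime_gt0//= dvdn_leq.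
Qed.

End Mangoldt.

(** * Absolutely convergent Dirichlet series and their logarithms *)

Section DirichletSeries.
Variable R : realType.
Local Notation C := R[i].
Implicit Types (a u v : nat -> C) (s : C).

(** This is (k+1)^(-x): series are indexed from 0, so the integer n sits at index n - 1. *)
Definition nb (x : R) (k : nat) : R := expR (- x * ln k.+1%:R).

Lemma nb_ge0 x k : 0 <= nb x k. Proof. exact: expR_ge0. Qed.

(** The integral test in telescoping form: log(1 + 1/n) >= 1/(n+1) and e^w >= 1 + w. *)
Lemma nb_step (x : R) n : 0 < x ->
  x * nb (x + 1) n.+1 <= nb x n - nb x n.+1.
Proof.
move=> x0; have n2 : 0 < n.+2%:R :> R by [].
have n1 : 0 < n.+1%:R :> R by [].
have -> : nb (x + 1) n.+1 = nb x n.+1 / n.+2%:R.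
  by rewrite /nb opprD mulrDl expRD mulN1r expRN lnK.
have E : nb x n = nb x n.+1 * expR (x * (ln n.+2%:R - ln n.+1%:R)).
  by rewrite /nb -expRD; congr expR; ring.
rewrite E -[X in _ - X]mulr1 -mulrBr mulrCA ler_wpM2l ?nb_ge0//.
have le : x / n.+2%:R <= x * (ln n.+2%:R - ln n.+1%:R).
  rewrite ler_pM2l// -lerN2 opprB -ln_div// ?posrE//.
  have -> : n.+1%:R / n.+2%:R = 1 + - (n.+2%:R)^-1 :> R.
    by rewrite -[n.+2%:R]natr1; field; rewrite gt_eqF// natr1.
  rewrite le_ln1Dx// ltrN2 invf_lt1// ltr1n//.
move: (x * (ln n.+2%:R - ln n.+1%:R)) le => w le.
by rewrite (le_trans le)// lerBrDl expR_ge1Dx.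
Qed.

Lemma bsum_nb (x : R) : 1 < x -> bsum (nb x) (1 + (x - 1)^-1).
Proof.
move=> x1; have x0 : 0 < x - 1 by rewrite subr_gt0.
move=> n; case: n => [|n]; first by rewrite big_geq// addr_ge0// invr_ge0 ltW.
suff : \sum_(0 <= k < n.+1) nb x k <= 1 + (x - 1)^-1 * (1 - nb (x - 1) n).
  move=> /le_trans; apply; rewrite lerD2l ler_piMr ?invr_ge0 ?(ltW x0)//.
  by have := nb_ge0 (x - 1) n; lra.
elim: n => [|n IH].
  by rewrite big_nat1 /nb ln1 !mulr0 expR0 subrr mulr0 addr0.
rewrite big_nat_recr//= (le_trans (lerD IH (lexx _)))//.
have := nb_step n x0; rewrite subrK -ler_pdivlMl//; lra.
Qed.

Lemma cn_npow_le (x : R) k s : x <= Re s -> cn (npow k.+1 s) <= nb x k.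
Proof.
move=> xs; rewrite cn_npow ler_expR mulrC mulrN -mulNr ler_wpM2r ?ln_nat_ge0//.
by rewrite lerN2.
Qed.

Lemma ln_le_pow (y : R) k : 0 < y -> ln k.+1%:R <= y^-1 * expR (y * ln k.+1%:R).
Proof.
move=> y0; rewrite -ler_pdivrMl ?invr_gt0// invrK.
by have := expR_ge1Dx (y * ln k.+1%:R); lra.
Qed.

(** Logarithmic growth admits chi together with chi Lambda, hence L and the product of L with its
    logarithmic derivative. *)
Definition adm a := forall n, (0 < n)%N -> cn (a n) <= 1 + ln n%:R.

Definition Ds a s : C := CS (fun k => a k.+1 * npow k.+1 s).

Lemma adm_bound a (y : R) : adm a -> 0 < y -> forall s k, 1 + 2 * y <= Re s ->
  cn (a k.+1 * npow k.+1 s) <= (1 + y^-1) * nb (1 + y) k.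
Proof.
move=> aa y0 s k ys; rewrite cnM.
apply: (le_trans (ler_pM (cn_ge0 _) (cn_ge0 _) (aa _ (ltn0Sn k)) (cn_npow_le k ys))).
have -> : nb (1 + 2 * y) k = expR (- (y * ln k.+1%:R)) * nb (1 + y) k.
  by rewrite /nb -expRD; congr expR; ring.
rewrite mulrA ler_wpM2r ?nb_ge0// expRN ler_pdivrMr ?expR_gt0//.
have := ln_le_pow k y0; rewrite mulrDl mul1r.
have : 1 <= expR (y * ln k.+1%:R).
  by rewrite -[X in X <= _]expR0 ler_expR mulr_ge0 ?ln_nat_ge0 ?(ltW y0).
lra.
Qed.

Lemma adm_dominated a : adm a ->
  locally_dominated (HP 1) (fun k s => a k.+1 * npow k.+1 s).
Proof.
move=> aa s; rewrite /HP => s1; pose y := (Re s - 1) / 4.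
have y0 : 0 < y by rewrite divr_gt0// subr_gt0.
exists (2 * y); first by rewrite mulr_gt0.
exists (fun k => (1 + y^-1) * nb (1 + y) k), ((1 + y^-1) * (1 + y^-1)); split.
  have -> : (1 + y^-1) * (1 + y^-1) = (1 + y^-1) * (1 + (1 + y - 1)^-1).
    by congr (_ * (_ + _^-1)); ring.
  by apply: bsumZ; [rewrite addr_ge0// invr_ge0 ltW|apply: bsum_nb; rewrite ltrDl].
move=> z zs; have := le_lt_trans (Re_le_cn _) zs; rewrite ReD ReN ltr_norml => /andP[z1 _].
have yE : Re s = 1 + 4 * y by rewrite /y; field.
by split; [lra|move=> n; apply: adm_bound => //; lra].
Qed.

Lemma Ds_cvs a s : adm a -> 1 < Re s -> cvs (fun k => a k.+1 * npow k.+1 s) (Ds a s).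
Proof.
move=> aa s1; have [r r0 [M [B [MB H]]]] := adm_dominated aa s1.
have [|_ Hs] := H s; first by rewrite subrr cn0.
exact: CSP Hs MB.
Qed.

Lemma Ds_abs a s : adm a -> 1 < Re s -> exists M B, bsum M B /\
  forall k, cn (a k.+1 * npow k.+1 s) <= M k.
Proof.
move=> aa s1; have [r r0 [M [B [MB H]]]] := adm_dominated aa s1.
have [|_ Hs] := H s; first by rewrite subrr cn0.
by exists M, B.
Qed.

Lemma cder_npow n s : cder (npow n) s ((- ln n%:R)%:C * npow n s).
Proof. exact: cder_cexp_lin. Qed.

Lemma hol_npow D n k : hol D k (@npow R n).
Proof. by apply: hol_cexp; apply: holZ; exact: hol_id. Qed.

Lemma Ds_der a s : adm a -> 1 < Re s ->
  cder (Ds a) s (Ds (fun n => (- ln n%:R)%:C * a n) s).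
Proof.
move=> aa s1.
have := @weierstrass_cder R (HP 1) (fun k s => a k.+1 * npow k.+1 s)
  (fun k s => (- ln k.+1%:R)%:C * a k.+1 * npow k.+1 s) _ _ (adm_dominated aa) s s1.
apply=> [n j|n z _]; first by apply: holZ; exact: hol_npow.
by apply: (cder_eqd _ (cderZ _ (cder_npow _ _))); ring.
Qed.

Lemma npowM m n s : (0 < m)%N -> (0 < n)%N -> npow (m * n) s = npow m s * npow n s :> C.
Proof.
move=> m0 n0; rewrite /npow -cexpD natrM lnM ?posrE ?ltr0n//.
by rewrite opprD realcD mulrDl.
Qed.

Lemma npow1 s : npow 1 s = 1 :> C.
Proof. by rewrite /npow ln1 oppr0 mul0r cexp0. Qed.

Definition dconv u v n := \sum_(1 <= d < n.+1 | (d %| n)%N) u d * v (n %/ d)%N.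

Lemma sum_divisors (f : nat -> nat -> C) N :
  \sum_(1 <= k < N.+1) \sum_(1 <= d < k.+1 | (d %| k)%N) f d (k %/ d)%N =
  \sum_(1 <= d < N.+1) \sum_(1 <= e < N.+1 | (d * e <= N)%N) f d e.
Proof.
have -> : \sum_(1 <= k < N.+1) \sum_(1 <= d < k.+1 | (d %| k)%N) f d (k %/ d)%N = \sum_(1 <= k < N.+1)
   \sum_(1 <= d < N.+1) \sum_(1 <= e < N.+1 | (d * e == k)%N) f d e.
  rewrite big_nat_cond [RHS]big_nat_cond; apply: eq_bigr => k /andP[/andP[k0 kN] _].
  rewrite (@big_nat_widen _ _ _ 1 k.+1 N.+1)//.
  rewrite big_mkcond [LHS]big_nat_cond [RHS]big_nat_cond; apply: eq_bigr => d /andP[/andP[d0 dN] _].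
  case: ifP => [/andP[dk _]|ndk].
    rewrite (big_rem (k %/ d)%N) /=; last first.
      by rewrite mem_index_iota divn_gt0// dvdn_leq//= ltnS (leq_trans (leq_div _ _)).
    rewrite mulnC divnK// eqxx big1_seq ?addr0// => e /andP[/eqP de].
    by rewrite mem_rem_uniq ?iota_uniq// inE -de mulKn// eqxx.
  rewrite big1_seq// => e /andP[/eqP de]; rewrite mem_index_iota => /andP[e0 _].
  by move: ndk; rewrite -de dvdn_mulr//= ltnS leq_pmulr.
rewrite exchange_big /= big_nat_cond [RHS]big_nat_cond; apply: eq_bigr => d /andP[/andP[d0 _] _].
rewrite (exchange_big_dep xpredT)//= [RHS]big_mkcond big_nat_cond [RHS]big_nat_cond.
apply: eq_bigr => e /andP[/andP[e0 _] _].
case: ifP => deN.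
  rewrite (big_rem (d * e)%N) /=; last by rewrite mem_index_iota muln_gt0 d0 e0.
  rewrite eqxx big1_seq ?addr0// => k /andP[/eqP <-].
  by rewrite mem_rem_uniq ?iota_uniq// inE eqxx.
rewrite big1_seq// => k /andP[/eqP <-]; rewrite mem_index_iota ltnS => /andP[_ h].
by rewrite h in deN.
Qed.

Lemma sum_dconv u v N : \sum_(1 <= k < N.+1) dconv u v k =
  \sum_(1 <= d < N.+1) \sum_(1 <= e < N.+1 | (d * e <= N)%N) u d * v e.
Proof. exact: (sum_divisors (fun d e => u d * v e)). Qed.

Lemma tail_ite_le (M : nat -> R) (d : R) K N : (K <= N)%N ->
  (forall m, \sum_(K <= k < m) M k <= d) ->
  \sum_(1 <= i < N.+1) (if (K < i)%N then M i.-1 else 0) <= d.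
Proof.
move=> KN H; rewrite big_add1 /= (big_cat_nat (leq0n K) KN) /= big_nat_cond big1 ?add0r; last first.
  by move=> i /andP[/andP[_ iK] _]; rewrite ltnS leqNgt iK.
rewrite (le_trans _ (H N))// big_nat_cond [leRHS]big_nat_cond ler_sum// => i /andP[/andP[Ki _] _].
by rewrite ltnS Ki.
Qed.

(** In the discarded pairs d e exceeds N >= K^2, so d > K or e > K; their total is bounded by a tail
    of one series times a bound for the other. *)
Lemma dirichlet_mul u v U V (M M' : nat -> R) B B' :
  cvs (fun k => u k.+1) U -> cvs (fun k => v k.+1) V ->
  bsum M B -> bsum M' B' -> (forall k, cn (u k.+1) <= M k) -> (forall k, cn (v k.+1) <= M' k) ->
  cvs (fun k => dconv u v k.+1) (U * V).
Proof.
move=> cu cv MB MB' uM vM e e0.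
have M0 k : 0 <= M k := le_trans (cn_ge0 _) (uM k).
have M0' k : 0 <= M' k := le_trans (cn_ge0 _) (vM k).
have B0 : 0 <= B by rewrite (le_trans _ (MB 0%N))// big_geq.
have B0' : 0 <= B' by rewrite (le_trans _ (MB' 0%N))// big_geq.
have E0 : 0 < B + B' + 1 by rewrite ltr_wpDl// addr_ge0.
pose d := e / (4 * (B + B' + 1)).
have d0 : 0 < d by rewrite divr_gt0// mulr_gt0.
have [K1 H1] := bsum_tail M0 MB d0; have [K2 H2] := bsum_tail M0' MB' d0.
pose K := maxn K1 K2; exists (K * K)%N => N KN.
have KN' : (K <= N)%N.
  by rewrite (leq_trans _ KN)//; case: (K) => // k; rewrite leq_pmulr.
pose SU := \sum_(0 <= k < N) u k.+1; pose SV := \sum_(0 <= k < N) v k.+1.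
have tU : cn (U - SU) <= d.
  by apply: (cvs_tail cu uM) => m; apply: H1; rewrite (leq_trans (leq_maxl _ _) KN').
have tV : cn (V - SV) <= d.
  by apply: (cvs_tail cv vM) => m; apply: H2; rewrite (leq_trans (leq_maxr _ _) KN').
have bU : cn U <= B by exact: (cvs_le uM MB cu).
have bSV : cn SV <= B' by rewrite (le_trans (cn_sum _ _ _))// (le_trans _ (MB' N))// ler_sum.
have shift (w : nat -> C) n : \sum_(0 <= k < n) w k.+1 = \sum_(1 <= k < n.+1) w k.
  by rewrite big_add1.
have shiftR (w : nat -> R) m n : \sum_(m <= k < n) w k = \sum_(m.+1 <= k < n.+1) w k.-1.
  by rewrite big_add1.
rewrite shift sum_dconv.
have EP : \sum_(1 <= d < N.+1) \sum_(1 <= e < N.+1 | (d * e <= N)%N) u d * v e = SU * SV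
   - \sum_(1 <= d < N.+1) \sum_(1 <= e < N.+1 | ~~ (d * e <= N)%N) u d * v e.
  rewrite /SU /SV !shift mulr_suml -sumrB; apply: eq_bigr => i _.
  by rewrite mulr_sumr [X in _ = X - _](bigID (fun e => i * e <= N)%N) /= addrK.
have rest : cn (\sum_(1 <= d < N.+1) \sum_(1 <= e < N.+1 | ~~ (d * e <= N)%N) u d * v e)
    <= d * B' + B * d.
  have step : cn (\sum_(1 <= d < N.+1) \sum_(1 <= e < N.+1 | ~~ (d * e <= N)%N) u d * v e) <=
      \sum_(1 <= d < N.+1) \sum_(1 <= e < N.+1) ((if (K < d)%N then M d.-1 * M' e.-1 else 0)
        + (if (K < e)%N then M d.-1 * M' e.-1 else 0)).
    rewrite (le_trans (cn_sum _ _ _))// big_nat_cond [leRHS]big_nat_cond; apply: ler_sum.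
    move=> i /andP[/andP[i0 _] _]; rewrite (le_trans (cn_sum _ _ _))// [leLHS]big_mkcond.
    rewrite [leLHS]big_nat_cond [leRHS]big_nat_cond; apply: ler_sum => j /andP[/andP[j0 _] _].
    have p0 : 0 <= M i.-1 * M' j.-1 by rewrite mulr_ge0.
    case: ifP => [ij|_]; last by rewrite addr_ge0//; case: ifP.
    have uv : cn (u i * v j) <= M i.-1 * M' j.-1.
      rewrite cnM ler_pM ?cn_ge0//; first by rewrite -{1}(prednK i0).
      by rewrite -{1}(prednK j0).
    case: (ltnP K i) => [_|iK]; first by rewrite (le_trans uv)// lerDl; case: ifP.
    case: (ltnP K j) => [_|jK]; first by rewrite add0r.
    by move: ij; rewrite (leq_trans (leq_mul iK jK) KN).
  apply: (le_trans step); under eq_bigr => i _ do rewrite big_split /=.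
  rewrite big_split /= lerD//.
    have -> : \sum_(1 <= i < N.+1) \sum_(1 <= i0 < N.+1) (if (K < i)%N then M i.-1 * M' i0.-1 else 0)
       = (\sum_(1 <= i < N.+1) (if (K < i)%N then M i.-1 else 0)) * \sum_(0 <= j < N) M' j.
      rewrite mulr_suml; apply: eq_bigr => i _; rewrite (shiftR M') mulr_sumr.
      by apply: eq_bigr => j _; case: ifP => //; rewrite mul0r.
    apply: ler_pM => //; [by apply: sumr_ge0 => i _; case: ifP|exact: sumr_ge0|].
    by apply: tail_ite_le => // m; apply: H1; exact: leq_maxl.
  have -> : \sum_(1 <= i < N.+1) \sum_(1 <= i0 < N.+1) (if (K < i0)%N then M i.-1 * M' i0.-1 else 0)
       = (\sum_(0 <= j < N) M j) * (\sum_(1 <= i < N.+1) (if (K < i)%N then M' i.-1 else 0)).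
    rewrite (shiftR M) mulr_suml; apply: eq_bigr => i _; rewrite mulr_sumr.
    by apply: eq_bigr => j _; case: ifP => //; rewrite mulr0.
  apply: ler_pM => //; [exact: sumr_ge0|by apply: sumr_ge0 => i _; case: ifP|].
  by apply: tail_ite_le => // m; apply: H2; exact: leq_maxr.
rewrite EP; set Z := \sum_(1 <= d < N.+1) _ in rest *.
have -> : SU * SV - Z - U * V = - (U - SU) * SV - U * (V - SV) - Z by ring.
apply: (le_trans (cn_subD _ _)); apply: (@le_trans _ _ (d * B' + B * d + (d * B' + B * d))).
  rewrite lerD//; apply: (le_trans (cn_subD _ _)).
  by rewrite !cnM cnN lerD// ler_pM ?cn_ge0.
have : d * (4 * (B + B' + 1)) = e by rewrite /d mulfVK// gt_eqF// mulr_gt0.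
lra.
Qed.

Lemma HP_const F (x : R) : (forall s, HP x s -> cder F s (0 : C)) ->
  forall s z, HP x s -> HP x z -> F s = F z.
Proof.
move=> H s z xs xz; apply/eqP; rewrite -subr_eq0 -cn_eq0 eq_le cn_ge0 andbT.
have := @cder_segment_le R F (fun=> 0) z (s - z) 0.
have -> : z + (s - z) = s by ring.
rewrite mul0r; apply=> t t01; last by rewrite cn0.
by apply: H; exact: HP_star.
Qed.

Section Multiplicative.
Variable chi : nat -> C.
Hypotheses (chi1 : chi 1%N = 1) (chiM : forall m n, chi (m * n)%N = chi m * chi n).
Hypothesis chib : forall n, cn (chi n) <= 1.

Definition logc n : C := chi n * (Lam R n / ln n%:R)%:C.

Lemma Lam_div_ln_le1 n : 0 <= Lam R n / ln n%:R <= 1.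
Proof.
case: n => [|[|n]]; first by rewrite /Lam /= mul0r lexx ler01.
  by rewrite Lam1 mul0r lexx ler01.
have l0 : 0 < ln n.+2%:R :> R by rewrite ln_gt0// ltr1n.
by rewrite divr_ge0 ?Lam_ge0 ?(ltW l0)//= ler_pdivrMr// mul1r Lam_le.
Qed.

Lemma logc_le1 n : cn (logc n) <= 1.
Proof.
have /andP[l0 l1] := Lam_div_ln_le1 n.
by rewrite cnM cn_real_ge0// -[leRHS]mulr1 ler_pM ?cn_ge0.
Qed.

Lemma adm_le1 a : (forall n, cn (a n) <= 1) -> adm a.
Proof. by move=> H n n0; rewrite (le_trans (H n))// lerDl ln_nat_ge0. Qed.

Lemma adm_chiLam : adm (fun n => chi n * (Lam R n)%:C).
Proof.
move=> n n0; rewrite cnM cn_real_ge0 ?Lam_ge0//.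
apply: (@le_trans _ _ (1 * ln n%:R)); last by rewrite mul1r lerDr.
by rewrite ler_pM ?cn_ge0 ?Lam_ge0// Lam_le.
Qed.

(** This is the convolution identity chi Lambda * chi = chi log, which is [sum_Lam] multiplied by
    chi(n). *)
Lemma Ds_chi_der s : 1 < Re s ->
  cder (Ds chi) s (- (Ds chi s * Ds (fun n => chi n * (Lam R n)%:C) s)).
Proof.
move=> s1; apply: (cder_eqd _ (Ds_der (adm_le1 chib) s1)).
have [M [B [MB HM]]] := Ds_abs adm_chiLam s1.
have [M' [B' [MB' HM']]] := Ds_abs (adm_le1 chib) s1.
have H := @dirichlet_mul (fun n => chi n * (Lam R n)%:C * npow n s) (fun n => chi n * npow n s)
  _ _ M M' B B' (Ds_cvs adm_chiLam s1) (Ds_cvs (adm_le1 chib) s1) MB MB' HM HM'.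
apply: CS_eq; rewrite -mulN1r [_ * Ds _ s]mulrC; apply: eq_cvs (cvsZ (-1) H) => k.
rewrite /dconv mulr_sumr.
have -> : \sum_(1 <= d < k.+2 | (d %| k.+1)%N) -1 * (chi d * (Lam R d)%:C * npow d s *
     (chi (k.+1 %/ d)%N * npow (k.+1 %/ d)%N s)) =
   - (\sum_(1 <= d < k.+2 | (d %| k.+1)%N) (Lam R d)%:C) * (chi k.+1 * npow k.+1 s).
  rewrite mulNr mulr_suml -sumrN; rewrite big_nat_cond [RHS]big_nat_cond.
  apply: eq_bigr => d /andP[/andP[d0 _] dk].
  have e0 : (0 < k.+1 %/ d)%N by rewrite divn_gt0// dvdn_leq.
  have E : k.+1 = (d * (k.+1 %/ d))%N by rewrite mulnC divnK.
  by rewrite {3 4}E chiM npowM//; ring.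
have -> : \sum_(1 <= d < k.+2 | (d %| k.+1)%N) (Lam R d)%:C = (ln k.+1%:R)%:C :> C.
  by rewrite -(sum_Lam R (ltn0Sn k)) (big_morph _ (@realcD R) (erefl : 0%:C = 0)).
by rewrite realcN !mulNr mulrA.
Qed.

Lemma Ds_logc_der s : 1 < Re s ->
  cder (Ds logc) s (- Ds (fun n => chi n * (Lam R n)%:C) s).
Proof.
move=> s1; apply: (cder_eqd _ (Ds_der (adm_le1 logc_le1) s1)).
apply: CS_eq; rewrite -mulN1r; apply: eq_cvs (cvsZ (-1) (Ds_cvs adm_chiLam s1)) => k.
rewrite /logc !mulrA; congr (_ * _); rewrite mulN1r.
have [l0|l0] := eqVneq (ln k.+1%:R : R) 0.
  have -> : Lam R k.+1 = 0.
    by apply/eqP; rewrite eq_le Lam_ge0 andbT -l0 Lam_le.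
  by rewrite mul0r !mulr0.
by rewrite realcM realcN realcV; field; rewrite -cn_gt0 cn_real normr_gt0.
Qed.

(** On Re s = 2 the terms with n >= 2 add up to at most 1/4 + 1/2: the second part is the
    telescoping bound for the sum of 1/n^2 over n >= 3. *)
Lemma Ds_chi_lower y : 1 / 4 <= cn (Ds chi (pt 2 y)).
Proof.
have s1 : 1 < Re (pt 2 y) by rewrite /= ltr1n.
have := @cvs_tail R _ _ (fun k => (k.+1%:R ^+ 2)^-1) (3 / 4) 1 (Ds_cvs (adm_le1 chib) s1).
rewrite big_nat1 chi1 npow1 mul1r => H.
have : cn (Ds chi (pt 2 y) - 1) <= 3 / 4.
  apply: H => [k|m].
    by rewrite cnM cn_npow2// ler_piMl ?invr_ge0 ?sqr_ge0.
  case: m => [|[|m]]; try by rewrite big_geq//; lra.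
  suff : \sum_(1 <= k < m.+2) (k.+1%:R ^+ 2)^-1 <= 3 / 4 - m.+2%:R^-1 :> R.
    by move=> /le_trans; apply; rewrite gerBl invr_ge0.
  elim: m => [|m IH]; first by rewrite big_nat1; lra.
  rewrite big_nat_recr//= (le_trans (lerD IH (lexx _)))//.
  have n1 : 0 < m.+2%:R :> R by rewrite ltr0n.
  have n2 : m.+3%:R = m.+2%:R + 1 :> R by rewrite -natr1.
  rewrite n2; move: (m.+2%:R) n1 => x x0; rewrite -addrA lerD2l.
  rewrite -subr_ge0 (_ : _ - _ = (x * (x + 1) ^+ 2)^-1); last by field; rewrite !gt_eqF//; lra.
  by rewrite invr_ge0 mulr_ge0 ?sqr_ge0// ltW.
have := cn_lerB 1 (1 - Ds chi (pt 2 y)).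
have -> : 1 - (1 - Ds chi (pt 2 y)) = Ds chi (pt 2 y) by ring.
by rewrite cn1 [cn (1 - _)]cnB; lra.
Qed.

(** This plays the role of the Euler product: L times the exponential of minus its log series has
    derivative 0. The constant is left unevaluated; it is nonzero by the lower bound at s = 2. *)
Lemma Ds_chi_exp : exists2 c : C, c != 0 &
  forall s, 1 < Re s -> Ds chi s = c * cexp (Ds logc s).
Proof.
pose F s := Ds chi s * cexp (- Ds logc s).
have dF s : HP 1 s -> cder F s 0.
  move=> s1; have d1 := Ds_chi_der s1; have d2 := Ds_logc_der s1.
  have d3 := cder_comp (cderN d2) (cder_cexp _).
  by apply: (cder_eqd _ (cderM d1 d3)); ring.
have FE s : 1 < Re s -> F s = F 2%:C by move=> s1; apply: (HP_const dF); rewrite /HP ?ReR ?ltr1n.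
exists (F 2%:C); last first.
  by move=> s s1; rewrite -(FE s s1) /F -mulrA -cexpD addNr cexp0 mulr1.
rewrite /F mulf_neq0 ?cexp_neq0//.
by have := Ds_chi_lower 0; rewrite -cn_gt0 (_ : pt 2 0 = 2%:C)//; lra.
Qed.

Lemma Ds_chi_neq0 s : 1 < Re s -> Ds chi s != 0.
Proof.
by have [c c0 H] := Ds_chi_exp => /H ->; rewrite mulf_neq0 ?cexp_neq0.
Qed.

End Multiplicative.

End DirichletSeries.

(** * Continuation of L(s, chi) and of zeta to Re s > 0 *)

Section Continuation.
Variable R : realType.
Local Notation C := R[i].
Implicit Types s z : C.

Lemma npowNE n s : npowN n s = npow n s.
Proof.
by rewrite /npowN /npow /cexp !cpE !mul0r subr0 addr0 ![Re s * _]mulrC ![Im s * _]mulrC !mulNr.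
Qed.

Lemma cvs_cvg (u : nat -> C) (l : C) : cvs u l ->
  (series (u : nat -> R[i]^o) @ \oo --> (l : R[i]^o))%classic.
Proof.
move=> H; apply/cvgrPdist_le => e e0.
have [eR eE] : exists e' : R, e = e'%:C.
  by exists (Re e); apply: complexP => //=; move: e0; rewrite ltcE /= => /andP[/eqP ->].
rewrite eE ltcR in e0; have [N HN] := H _ e0; exists N => // n /= Nn.
by rewrite cnE eE lecR cnB; exact: HN.
Qed.

Lemma cder_derivable (F : C -> C) s d : cder F s d ->
  derivable (F : R[i]^o -> R[i]^o) s (1 : R[i]^o).
Proof.
move=> H; apply/cvg_ex; exists d; apply/cvgrPdist_le => e e0.
have [eR eE] : exists e' : R, e = e'%:C.
  by exists (Re e); apply: complexP => //=; move: e0; rewrite ltcE /= => /andP[/eqP ->].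
rewrite eE ltcR in e0; have [r r0 Hr] := H _ e0.
have r0' : 0 < r%:C :> C by rewrite ltcR.
near=> h.
have h0 : h != 0 by near: h; exact: nbhs_dnbhs_neq.
have hr : `|h| < r%:C by near: h; apply: dnbhs0_lt.
move: hr; rewrite cnE ltcR => /Hr.
rewrite /GRing.scale /= mulr1 (addrC h) => Hh.
have -> : d - h^-1 * (F (s + h) - F s) = - (h^-1 * (F (s + h) - F s - d * h)).
  by field.
by rewrite cnE eE lecR cnN cnM cnV mulrC ler_pdivrMr ?cn_gt0.
Unshelve. all: by end_near. Qed.

(** The bridge to the hypothesis: convergence and differentiability in epsilon form are translated
    into the notions in which [is_Lfunction] is stated. *)
Lemma grh_neq0 q (chi : nat -> C) (F : C -> C) : generalized_riemann_hypothesis R ->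
  (0 < q)%N -> @dirichlet_character R q chi ->
  (forall s, 1 < Re s -> cvs (fun k => chi k.+1 * npow k.+1 s) (F s)) ->
  (forall s, 0 < Re s -> s != 1 -> exists d, cder F s d) ->
  forall s, 2^-1 < Re s < 1 -> F s != 0.
Proof.
move=> grh q0 dch H1 H2 s /andP[s1 s2]; apply/eqP => Fs.
have s0 : 0 < Re s by rewrite (lt_trans _ s1)// invr_gt0.
suff : Re s = 2^-1 by move=> E; rewrite E ltxx in s1.
apply: (grh q chi F q0 dch) => //; last by rewrite s0.
split=> [z z1|z z0 z1]; last by have [d /cder_derivable] := H2 _ z0 z1.
rewrite (_ : (fun k => _) = (fun k => chi k.+1 * npow k.+1 z)); first exact: cvs_cvg (H1 _ z1).
by apply/funext => k; rewrite npowNE.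
Qed.

Lemma ln_step k : 0 <= (ln k.+2%:R - ln k.+1%:R : R) <= k.+1%:R^-1.
Proof.
rewrite -ln_div ?posrE//.
have -> : k.+2%:R / k.+1%:R = 1 + k.+1%:R^-1 :> R.
  by rewrite -[k.+2%:R]natr1 mulrDl mul1r divff.
have i0 : 0 < k.+1%:R^-1 :> R by rewrite invr_gt0.
by rewrite ln_ge0 ?lerDl ?(ltW i0)//= le_ln1Dx// (lt_trans _ i0)// ltrN10.
Qed.

Lemma npowS k s : npow k.+2 s = npow k.+1 s * cexp (- (ln k.+2%:R - ln k.+1%:R)%:C * s) :> C.
Proof.
by rewrite /npow -cexpD; congr cexp; rewrite -mulrDl !(realcD, realcN); congr (_ * _); ring.
Qed.

Lemma nb_inv (x : R) k : nb x k * k.+1%:R^-1 = nb (x + 1) k.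
Proof. by rewrite /nb opprD mulrDl expRD mulN1r [expR (- ln _)]expRN lnK ?posrE. Qed.

Lemma cn_npowE k s : cn (npow k.+1 s) = nb (Re s) k.
Proof. by rewrite cn_npow /nb mulrC mulrN mulNr. Qed.

Lemma npow_diff_le k s : 0 <= Re s ->
  cn (npow k.+1 s - npow k.+2 s) <= cn s * nb (Re s + 1) k.
Proof.
move=> s0; rewrite npowS -[X in X - _]mulr1 -mulrBr cnM cn_npowE cnB.
have /andP[l0 l1] := ln_step k; set l := ln _ - ln _ in l0 l1 *.
rewrite -nb_inv mulrCA ler_wpM2l ?nb_ge0//.
apply: (le_trans (@cexp_sub1_le R _ 0 (lexx 0) _)).
  by rewrite !cpE oppr0 mul0r subr0 mulNr oppr_le0 mulr_ge0.
by rewrite expR0 mulr1 cnM cnN cn_real_ge0// mulrC ler_wpM2l ?cn_ge0.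
Qed.

Lemma nb_lim (x e : R) : 0 < x -> 0 < e -> exists N, forall n, (N <= n)%N -> nb x n <= e.
Proof.
move=> x0 e0; pose B := expR (- ln e / x).
exists (`|Num.ceil B|)%N => n Bn.
have Bn' : B <= n.+1%:R.
  have B0 : 0 < B by exact: expR_gt0.
  rewrite (le_trans (ceil_ge _))// -(gez0_abs (_ : 0 <= Num.ceil B)%R); last by rewrite ceil_ge0; lra.
  by rewrite -pmulrn ler_nat ltnW.
rewrite /nb -[leRHS](@lnK R e) ?posrE// ler_expR mulNr lerNl.
have : ln B <= ln n.+1%:R by rewrite ler_ln ?posrE ?expR_gt0.
by rewrite /B expRK ler_pdivrMr// mulrC.
Qed.

Section Character.
Variables (q : nat) (chi : nat -> C).
Hypotheses (q0 : (0 < q)%N) (dch : @dirichlet_character R q chi).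

Lemma chi_mulr m n : chi (m * n)%N = chi m * chi n. Proof. by case: dch. Qed.

Lemma chi_modn n : chi (n %% q)%N = chi n.
Proof.
rewrite {2}(divn_eq n q); elim: (n %/ q)%N => [|k IH]; first by rewrite mul0n add0n.
by case: dch => H _ _; rewrite mulSn -addnA addnC H.
Qed.

Lemma chi_1 : chi 1%N = 1.
Proof.
have c0 : chi 1%N != 0 by case: dch => _ _ ->; rewrite coprime1n.
by apply: (mulfI c0); rewrite -chi_mulr muln1 mulr1.
Qed.

Lemma chi_eq0 n : ~~ coprime n q -> chi n = 0.
Proof. by case: dch => _ _ H nq; apply/eqP; rewrite -[_ == 0]negbK H. Qed.

Lemma chi_expn n k : chi (n ^ k)%N = chi n ^+ k.
Proof. by elim: k => [|k IH]; rewrite ?chi_1// expnS chi_mulr IH exprS. Qed.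

Lemma chi_totient n : coprime n q -> chi n ^+ totient q = 1.
Proof.
move=> nq; rewrite -chi_expn -chi_modn; rewrite Euler_exp_totient//.
by rewrite chi_modn chi_1.
Qed.

Lemma cn_chi n : coprime n q -> cn (chi n) = 1.
Proof.
move=> nq; have : cn (chi n) ^+ totient q = 1 by rewrite -cnX chi_totient// cn1.
move=> /eqP; rewrite pexprn_eq1 ?cn_ge0//; case/orP => [|/eqP//].
by have := totient_gt0 q; rewrite q0 => /lt0n_neq0/negPf ->.
Qed.

Lemma cn_chi_le1 n : cn (chi n) <= 1.
Proof.
by have [/cn_chi ->|/chi_eq0 ->] := boolP (coprime n q); rewrite ?cn0.
Qed.

Hypothesis chi_np : exists2 a, coprime a q & chi a != 1.

Definition charsum N : C := \sum_(0 <= k < N) chi k.+1.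

(** Multiplication by a permutes the residues modulo q and multiplies the sum by chi(a), which
    differs from 1. *)
Lemma sum_period : \sum_(0 <= k < q) chi k = 0.
Proof.
have [a aq a1] := chi_np.
have qP : (0 < q)%N := q0.
pose f (i : 'I_q) := Ordinal (ltn_pmod (a * i) qP).
have fI : injective f.
  have key (i j : 'I_q) : (i <= j)%N -> f i = f j -> i = j.
    move=> ij [] /esym/eqP; rewrite eqn_mod_dvd ?leq_mul2l ?ij ?orbT// -mulnBr.
    rewrite Gauss_dvdr 1?coprime_sym// => /dvdn_leq; rewrite subn_gt0 => H.
    apply: val_inj; apply/eqP; rewrite /= eqn_leq ij leqNgt; apply/negP => /H.
    by rewrite leqNgt (leq_ltn_trans (leq_subr _ _))// ltn_ord.
  by move=> i j; case/orP: (leq_total i j) => [/key//|/key + /esym h] => /(_ h).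
have E : \sum_(i < q) chi i = chi a * \sum_(i < q) chi i.
  rewrite {1}(reindex_inj fI) mulr_sumr; apply: eq_bigr => i _.
  by rewrite /= chi_modn chi_mulr.
rewrite big_mkord; apply/eqP; move/eqP: E; rewrite -subr_eq0 -{1}[\sum_(i < q) _]mul1r -mulrBl.
by rewrite mulf_eq0 subr_eq0 eq_sym (negPf a1).
Qed.

Lemma charsum_period N : charsum (N + q)%N = charsum N.
Proof.
elim: N => [|N IH]; last first.
  rewrite /charsum addSn !big_nat_recr//= -!/(charsum _) IH; congr (_ + _).
  by case: dch => H _ _; rewrite -addSn H.
rewrite add0n /charsum [RHS]big_geq//.
have : \sum_(0 <= k < q.+1) chi k = chi q by rewrite big_nat_recr//= sum_period add0r.
rewrite big_nat_recl//=; case: dch => /(_ 0%N); rewrite add0n => -> _ _ /eqP.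
by rewrite -subr_eq0 addrAC subrr add0r => /eqP.
Qed.

Lemma charsum_le N : cn (charsum N) <= q%:R.
Proof.
have -> : charsum N = charsum (N %% q)%N.
  rewrite {1}(divn_eq N q); elim: (N %/ q)%N => [|k IH]; first by rewrite mul0n add0n.
  by rewrite mulSn -addnA addnC charsum_period.
rewrite (le_trans (cn_sum _ _ _))// (@le_trans _ _ (\sum_(0 <= k < N %% q) 1))//.
  by apply: ler_sum => k _; exact: cn_chi_le1.
by rewrite sumr_const_nat subn0 ler_nat ltnW// ltn_mod.
Qed.

(** Summation by parts: the partial sums of chi are bounded by q, and the differences of n^(-s) make
    the series converge absolutely for Re s > 0. *)
Definition Lf s : C := CS (fun k => charsum k.+1 * (npow k.+1 s - npow k.+2 s)).

Lemma Lterm_le k s (x : R) : 0 <= x -> x <= Re s ->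
  cn (charsum k.+1 * (npow k.+1 s - npow k.+2 s)) <= q%:R * cn s * nb (x + 1) k.
Proof.
move=> x0 xs; rewrite cnM -mulrA ler_pM ?cn_ge0 ?charsum_le//.
apply: (le_trans (npow_diff_le k (le_trans x0 xs))); rewrite ler_wpM2l ?cn_ge0//.
by rewrite /nb ler_expR ler_wpM2r ?ln_nat_ge0// lerN2 lerD2r.
Qed.

Lemma Lf_dominated : locally_dominated (HP 0)
  (fun k s => charsum k.+1 * (npow k.+1 s - npow k.+2 s)).
Proof.
move=> s; rewrite /HP => s0; have s20 : 0 < Re s / 2 by rewrite divr_gt0.
exists (Re s / 2) => //.
exists (fun k => q%:R * (cn s + Re s / 2) * nb (Re s / 2 + 1) k).
exists (q%:R * (cn s + Re s / 2) * (1 + (Re s / 2 + 1 - 1)^-1)); split.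
  apply: bsumZ; first by rewrite mulr_ge0// addr_ge0 ?cn_ge0// ltW.
  by apply: bsum_nb; rewrite ltrDr.
move=> z zs; have := le_lt_trans (Re_le_cn _) zs; rewrite ReD ReN ltr_norml => /andP[z1 _].
split; first by lra.
move=> k; apply: (le_trans (@Lterm_le k z (Re s / 2) (ltW s20) _)); first by lra.
rewrite ler_wpM2r ?nb_ge0// ler_wpM2l//.
have -> : z = s + (z - s) by ring.
by rewrite (le_trans (cnD _ _))// lerD2l ltW.
Qed.

Lemma Lf_hol k : hol (HP 0) k Lf.
Proof.
apply: weierstrass; [exact: HP_open| |exact: Lf_dominated].
by move=> n j; apply: holZ; apply: holB; exact: hol_npow.
Qed.

Lemma Lf_le s : 2^-1 <= Re s -> cn (Lf s) <= 3 * q%:R * cn s.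
Proof.
move=> s1; have b3 : bsum (fun k => q%:R * cn s * nb (2^-1 + 1) k) (q%:R * cn s * (1 + (2^-1 + 1 - 1)^-1)).
  apply: bsumZ; first by rewrite mulr_ge0 ?cn_ge0.
  by apply: bsum_nb; rewrite ltrDr invr_gt0.
have T k : cn (charsum k.+1 * (npow k.+1 s - npow k.+2 s)) <= q%:R * cn s * nb (2^-1 + 1) k.
  by apply: Lterm_le => //; rewrite invr_ge0.
apply: (le_trans (cvs_le T b3 (CSP T b3))).
by rewrite addrK invrK -[1 + 2]/(1 + 2%:R) mulrC -mulrA ler_wpM2r ?mulr_ge0 ?cn_ge0//; lra.
Qed.

Lemma Lf_cvs s : 0 < Re s -> cvs (fun k => chi k.+1 * npow k.+1 s) (Lf s).
Proof.
move=> s0; have [r r0 [M [B [MB H]]]] := Lf_dominated s0.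
have [|_ Hs] := H s; first by rewrite subrr cn0.
have cL := CSP Hs MB; rewrite -/(Lf s) in cL.
have abel N : \sum_(0 <= k < N) chi k.+1 * npow k.+1 s =
    \sum_(0 <= k < N) charsum k.+1 * (npow k.+1 s - npow k.+2 s) + charsum N * npow N.+1 s.
  elim: N => [|N IH]; first by rewrite !big_geq// add0r /charsum big_geq// mul0r.
  rewrite !big_nat_recr//= IH [charsum N.+1]/charsum big_nat_recr//= -/(charsum N).
  by ring.
move=> e e0; have e2 : 0 < e / 2 by rewrite divr_gt0.
have eq2 : 0 < e / 2 / q%:R by rewrite divr_gt0// ltr0n.
have [N1 H1] := cL _ e2; have [N2 H2] := nb_lim s0 eq2.
exists (maxn N1 N2) => n; rewrite geq_max => /andP[/H1 h1 /H2 h2].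
rewrite abel (_ : _ + _ - _ = (\sum_(0 <= k < n) charsum k.+1 * (npow k.+1 s - npow k.+2 s) - Lf s)
   + charsum n * npow n.+1 s); last by ring.
rewrite (le_trans (cnD _ _))//.
have : cn (charsum n * npow n.+1 s) <= q%:R * (e / 2 / q%:R).
  by rewrite cnM cn_npowE ler_pM ?cn_ge0 ?nb_ge0 ?charsum_le.
rewrite [q%:R * _]mulrC divfK ?pnatr_eq0 -?lt0n//; lra.
Qed.

Lemma Lf_Ds s : 1 < Re s -> Lf s = Ds chi s.
Proof. by move=> s1; symmetry; apply: CS_eq; apply: Lf_cvs; rewrite (lt_trans ltr01). Qed.

End Character.

Definition zlam k : R := ln k.+2%:R - ln k.+1%:R.

(** With n = k + 1 this is n^(-s) minus the integral of x^(-s) over [n, n+1]. Written through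
    [remexp] it makes sense at s = 1, so that [zreg] is zeta(s) - 1/(s-1), [zZ] is (s-1) zeta(s),
    and both are regular there. *)
Definition zterm k s : C := npow k.+1 (s - 1) * ((k.+1%:R^-1 - zlam k)%:C
  - (zlam k)%:C * (- (zlam k)%:C * (s - 1)) * remexp (- (zlam k)%:C * (s - 1))).

Definition zreg s : C := CS (fun k => zterm k s).

Definition zZ s : C := 1 + (s - 1) * zreg s.

Definition zeta s : C := zreg s + (s - 1)^-1.

Lemma zlam_lower k : k.+1%:R^-1 - zlam k <= (k.+1%:R ^+ 2)^-1.
Proof.
have x0 : 0 < k.+1%:R :> R by [].
have : k.+2%:R^-1 <= zlam k.
  rewrite /zlam -lerN2 opprB -ln_div ?posrE//.
  have -> : k.+1%:R / k.+2%:R = 1 + - k.+2%:R^-1 :> R.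
    by rewrite -[k.+2%:R]natr1; field; rewrite gt_eqF// natr1.
  by rewrite le_ln1Dx// ltrN2 invf_lt1 ?ltr1n.
rewrite -[k.+2%:R]natr1; move: (k.+1%:R) x0 => x x0 h.
rewrite lerBlDr (le_trans _ (lerD (lexx _) h))// -subr_ge0.
rewrite (_ : _ - _ = (x ^+ 2 * (x + 1))^-1); last by field; rewrite !gt_eqF//; lra.
by rewrite invr_ge0 mulr_ge0 ?sqr_ge0//; lra.
Qed.

Lemma zlam_inv k : 0 <= zlam k <= k.+1%:R^-1. Proof. exact: ln_step. Qed.

Lemma zlam_le1 k : zlam k <= 1.
Proof. by have /andP[_ /le_trans] := zlam_inv k; apply; rewrite invf_le1// ler1n. Qed.

Lemma remexpE (z : C) : cexp z = 1 + z + z ^+ 2 * remexp z.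
Proof.
rewrite /remexp; case: eqVneq => [->|z0]; first by rewrite cexp0 expr0n /= mul0r !addr0.
by rewrite mulrC divfK ?expf_neq0//; ring.
Qed.

Lemma zterm_mul k s : (s - 1) * zterm k s =
  (s - 1) * npow k.+1 s + (npow k.+2 (s - 1) - npow k.+1 (s - 1)).
Proof.
have -> : npow k.+1 s = npow k.+1 (s - 1) * k.+1%:R^-1.
  have -> : npow k.+1 s = npow k.+1 (s - 1) * npow k.+1 1 by rewrite /npow -cexpD; congr cexp; ring.
  by congr (_ * _); rewrite /npow mulr1 cexp_real expRN lnK ?posrE// realcV realc_nat.
rewrite npowS -/(zlam k) remexpE /zterm !(realcD, realcN, realcV, realc_nat).
by ring.
Qed.

Lemma wRe_le1 k s : 0 <= Re s -> Re (- (zlam k)%:C * (s - 1)) <= 1.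
Proof.
move=> s0; have /andP[l0 _] := zlam_inv k; have l1 := zlam_le1 k.
rewrite !cpE oppr0 mul0r subr0; nra.
Qed.

Lemma cn_zlam k s : cn (- (zlam k)%:C * (s - 1)) = zlam k * cn (s - 1).
Proof. by have /andP[l0 _] := zlam_inv k; rewrite cnM cnN cn_real_ge0. Qed.

Lemma expR1_le4 : expR 1 <= 4 :> R.
Proof.
have : 2^-1 <= expR (- 2^-1) :> R by have := @expR_ge1Dx R (- 2^-1); lra.
rewrite expRN lef_pV2 ?posrE ?expR_gt0// => h.
by rewrite (_ : 1 = 2^-1 + 2^-1) ?expRD; [have := expR_ge0 (2^-1 : R); nra|field].
Qed.

Lemma remexp_le (z : C) : Re z <= 1 -> cn (z * remexp z) <= 4 * cn z.
Proof.
move=> z1; have [->|z0] := eqVneq z 0; first by rewrite mul0r cn0 mulr0.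
have H := cexp_sub1D_le ler01 z1.
have E : cexp z - 1 - z = z * (z * remexp z) by rewrite {1}remexpE; ring.
rewrite E cnM expr2 -mulrA in H; have c0 : 0 < cn z by rewrite cn_gt0.
rewrite ler_pM2l// in H; apply: (le_trans H); rewrite mulrC ler_wpM2r ?cn_ge0//.
exact: expR1_le4.
Qed.

Lemma remexp1_le (z : C) : Re z <= 1 -> cn (1 + z * remexp z) <= 4.
Proof.
move=> z1; have [->|z0] := eqVneq z 0; first by rewrite mul0r addr0 cn1 ler1n.
have H := cexp_sub1_le ler01 z1.
have E : cexp z - 1 = z * (1 + z * remexp z) by rewrite {1}remexpE; ring.
rewrite E cnM in H; have c0 : 0 < cn z by rewrite cn_gt0.
rewrite ler_pM2l// in H; exact: (le_trans H expR1_le4).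
Qed.

Lemma nb_shift k s : cn (npow k.+1 (s - 1)) = nb (Re s - 1) k.
Proof. by rewrite cn_npowE ReD ReN Re1. Qed.

Lemma zterm_le1 k s : 0 <= Re s -> cn (zterm k s) <= (1 + 4 * cn (s - 1)) * nb (Re s + 1) k.
Proof.
move=> s0; rewrite /zterm cnM nb_shift.
have w1 := wRe_le1 k s0; have cw := cn_zlam k s.
set w := _ * (s - 1) in w1 cw *.
have /andP[l0 l1] := zlam_inv k.
have -> : nb (Re s + 1) k = nb (Re s - 1) k * (k.+1%:R ^+ 2)^-1.
  have -> : Re s + 1 = Re s - 1 + 1 + 1 by ring.
  by rewrite -!nb_inv -mulrA -invfM expr2.
rewrite [leRHS]mulrCA ler_wpM2l ?nb_ge0//.
apply: (le_trans (cn_subD _ _)); rewrite mulrDl mul1r lerD//.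
  by rewrite cn_real_ge0 ?subr_ge0 ?zlam_lower.
rewrite -mulrA cnM cn_real_ge0//.
apply: (@le_trans _ _ (zlam k * (4 * (zlam k * cn (s - 1))))).
  by rewrite ler_wpM2l// -cw remexp_le.
have -> : zlam k * (4 * (zlam k * cn (s - 1))) = 4 * cn (s - 1) * zlam k ^+ 2 by ring.
by rewrite ler_wpM2l ?mulr_ge0 ?cn_ge0// -exprVn ler_pXn2r ?nnegrE ?invr_ge0.
Qed.

Lemma zterm_le2 k s : 0 <= Re s -> cn (zterm k s) <= 5 * nb (Re s) k.
Proof.
move=> s0; have w1 := wRe_le1 k s0.
have /andP[l0 l1] := zlam_inv k.
have -> : zterm k s = npow k.+1 (s - 1) * (k.+1%:R^-1%:C
   - (zlam k)%:C * (1 + - (zlam k)%:C * (s - 1) * remexp (- (zlam k)%:C * (s - 1)))).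
  by rewrite /zterm realcD realcN; ring.
set w := _ * (s - 1) in w1 *.
have -> : nb (Re s) k = nb (Re s - 1) k * k.+1%:R^-1 by rewrite nb_inv subrK.
rewrite cnM nb_shift [leRHS]mulrCA ler_wpM2l ?nb_ge0//.
apply: (le_trans (cn_subD _ _)); rewrite cn_real_ge0 ?invr_ge0// cnM cn_real_ge0//.
have := remexp1_le w1; have := cn_ge0 (1 + w * remexp w); move: (cn _) (k.+1%:R^-1) l1 => c i l1.
by have : zlam k * c <= i * 4 -> i + zlam k * c <= 5 * i; [lra|move=> + c0 c3; apply; apply: ler_pM].
Qed.

Lemma zreg_dominated : locally_dominated (HP 0) zterm.
Proof.
move=> s; rewrite /HP => s0; have s20 : 0 < Re s / 2 by rewrite divr_gt0.
exists (Re s / 2) => //.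
exists (fun k => (1 + 4 * (cn (s - 1) + Re s / 2)) * nb (Re s / 2 + 1) k).
exists ((1 + 4 * (cn (s - 1) + Re s / 2)) * (1 + (Re s / 2 + 1 - 1)^-1)); split.
  apply: bsumZ; first by rewrite addr_ge0// mulr_ge0// addr_ge0 ?cn_ge0// ltW.
  by apply: bsum_nb; rewrite ltrDr.
move=> z zs; have := le_lt_trans (Re_le_cn _) zs; rewrite ReD ReN ltr_norml => /andP[z1 _].
have z0 : Re s / 2 <= Re z by lra.
split; first by lra.
move=> k; apply: (le_trans (zterm_le1 k (le_trans (ltW s20) z0))); apply: ler_pM.
- by rewrite addr_ge0// mulr_ge0 ?cn_ge0.
- exact: nb_ge0.
- rewrite lerD2l ler_wpM2l//; have -> : z - 1 = (s - 1) + (z - s) by ring.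
  by rewrite (le_trans (cnD _ _))// lerD2l ltW.
- by rewrite /nb ler_expR ler_wpM2r ?ln_nat_ge0// lerN2 lerD2r.
Qed.

Lemma hol_zterm D n k : hol D k (zterm n).
Proof.
apply: (@hol_sub _ (fun=> True)) => //.
have h1 : hol (fun=> True) k (fun s : C => s - 1) by apply: holB; [exact: hol_id|exact: hol_cst].
have comp m F : hol (fun=> True) m F -> hol (fun=> True) m (fun s : C => F (s - 1)).
  move=> hF; apply: (hol_ext (G := fun s => F (-1 + s))) => [s|]; first by rewrite addrC.
  exact: (@hol_shift _ (fun=> True) m F (-1) hF).
apply: holM; first by apply: (comp k (npow n.+1)); exact: hol_npow.
apply: holB; first exact: hol_cst.
apply: holM; first by apply: holZ; apply: holZ.
have H := @hol_lin R k (- (zlam n)%:C) _ (@hol_remexp R k).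
exact: (comp k _ H).
Qed.

Lemma zreg_hol k : hol (HP 0) k zreg.
Proof.
apply: weierstrass; [exact: HP_open| |exact: zreg_dominated].
by move=> n j; exact: hol_zterm.
Qed.

Lemma zZ_hol k : hol (HP 0) k zZ.
Proof.
apply: holD; first exact: hol_cst.
by apply: holM; [apply: holB; [exact: hol_id|exact: hol_cst]|exact: zreg_hol].
Qed.

Lemma zreg_cvs s : 0 < Re s -> cvs (fun k => zterm k s) (zreg s).
Proof.
move=> s0; have [r r0 [M [B [MB H]]]] := zreg_dominated s0.
have [|_ Hs] := H s; first by rewrite subrr cn0.
exact: CSP Hs MB.
Qed.

(** Multiplied by s - 1 the integrals telescope, leaving N^(1-s), which tends to 0. *)
Lemma zeta_cvs s : 1 < Re s -> cvs (fun k => 1 * npow k.+1 s) (zeta s).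
Proof.
move=> s1; have s0 : 0 < Re s - 1 by rewrite subr_gt0.
have sn : s - 1 != 0.
  by apply/eqP => /(congr1 (@complex.Re R)); rewrite ReD ReN Re1 Re0 => E; rewrite E ltxx in s0.
have cs : 0 < cn (s - 1) by rewrite cn_gt0.
have H := zreg_cvs (lt_trans ltr01 s1).
have tel N : \sum_(0 <= k < N) zterm k s = \sum_(0 <= k < N) 1 * npow k.+1 s
    + (npow N.+1 (s - 1) - 1) / (s - 1).
  apply: (mulfI sn); rewrite mulrDr [_ * (_ / _)]mulrC divfK//.
  elim: N => [|N IH]; first by rewrite !big_geq// npow1; ring.
  by rewrite !big_nat_recr//= mulrDr IH zterm_mul; ring.
move=> e e0; have e2 : 0 < e / 2 by rewrite divr_gt0.
have ec : 0 < e / 2 * cn (s - 1) by rewrite mulr_gt0.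
have [N1 H1] := H _ e2; have [N2 H2] := nb_lim s0 ec.
exists (maxn N1 N2) => n; rewrite geq_max => /andP[/H1 h1 /H2 h2].
rewrite tel in h1.
rewrite /zeta (_ : _ - _ = (\sum_(0 <= k < n) 1 * npow k.+1 s + (npow n.+1 (s - 1) - 1) / (s - 1)
  - zreg s) - npow n.+1 (s - 1) / (s - 1)); last by field.
rewrite (le_trans (cn_subD _ _))//.
have : cn (npow n.+1 (s - 1) / (s - 1)) <= e / 2 by rewrite cnM cnV nb_shift ler_pdivrMr.
lra.
Qed.

Lemma zeta_Ds s : 1 < Re s -> Ds (fun=> 1) s = zeta s.
Proof. by move=> s1; apply: CS_eq; exact: zeta_cvs. Qed.

Lemma zZ_zeta s : s != 1 -> zZ s = (s - 1) * zeta s.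
Proof. by move=> s1; rewrite /zZ /zeta mulrDr divff ?subr_eq0// addrC. Qed.

Lemma zZ_1 : zZ 1 = 1. Proof. by rewrite /zZ subrr mul0r addr0. Qed.

Lemma zreg_le s : 2^-1 <= Re s -> cn (zreg s) <= 3 * (1 + 4 * cn (s - 1)).
Proof.
move=> s1; have s0 : 0 < Re s by rewrite (lt_le_trans _ s1)// invr_gt0.
have b3 : bsum (fun k => (1 + 4 * cn (s - 1)) * nb (2^-1 + 1) k) ((1 + 4 * cn (s - 1)) * (1 + (2^-1 + 1 - 1)^-1)).
  apply: bsumZ; first by rewrite addr_ge0// mulr_ge0 ?cn_ge0.
  by apply: bsum_nb; rewrite ltrDr invr_gt0.
have T k : cn (zterm k s) <= (1 + 4 * cn (s - 1)) * nb (2^-1 + 1) k.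
  apply: (le_trans (zterm_le1 k (ltW s0))); rewrite ler_wpM2l//; first by rewrite addr_ge0// mulr_ge0 ?cn_ge0.
  by rewrite /nb ler_expR ler_wpM2r ?ln_nat_ge0// lerN2 lerD2r.
apply: (le_trans (cvs_le T b3 (zreg_cvs s0))).
by rewrite addrK invrK mulrC; have := cn_ge0 (s - 1); lra.
Qed.

(** The terms satisfy a bound linear in |s| with exponent Re s + 1 and one free of |s| with exponent
    Re s. Their geometric mean grows like sqrt|s|, and its exponent Re s + 1/2 >= 5/4 still gives
    convergence. *)
Lemma zreg_le_sqrt s : 3 / 4 <= Re s -> cn (zreg s) <= 40 * Num.sqrt (cn s).
Proof.
move=> s1; have s0 : 0 < Re s by lra.
have c1 : 3 / 4 <= cn s by rewrite (le_trans s1)// (le_trans (ler_norm _))// Re_le_cn.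
have T k : cn (zterm k s) <= 8 * Num.sqrt (cn s) * nb (5 / 4) k.
  have h1 := zterm_le1 k (ltW s0); have h2 := zterm_le2 k (ltW s0).
  have t0 := cn_ge0 (zterm k s).
  rewrite -ler_sqr ?nnegrE//; last by rewrite !mulr_ge0 ?sqrtr_ge0 ?nb_ge0.
  rewrite expr2; apply: (le_trans (ler_pM t0 t0 h1 h2)).
  rewrite !exprMn sqr_sqrtr ?cn_ge0//.
  have -> : (1 + 4 * cn (s - 1)) * nb (Re s + 1) k * (5 * nb (Re s) k) =
    5 * (1 + 4 * cn (s - 1)) * (nb (Re s + 1) k * nb (Re s) k) by ring.
  apply: ler_pM; rewrite ?mulr_ge0 ?addr_ge0 ?mulr_ge0 ?cn_ge0 ?nb_ge0//.
    have := cn_subD s 1; rewrite cn1; lra.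
  rewrite expr2 /nb -!expRD ler_expR -!mulrDl ler_wpM2r ?ln_nat_ge0//; lra.
have b5 : bsum (fun k => 8 * Num.sqrt (cn s) * nb (5 / 4) k) (8 * Num.sqrt (cn s) * (1 + (5 / 4 - 1)^-1)).
  apply: bsumZ; first by rewrite mulr_ge0 ?sqrtr_ge0.
  by apply: bsum_nb; lra.
apply: (le_trans (cvs_le T b5 (zreg_cvs s0))).
have -> : 1 + (5 / 4 - 1)^-1 = 5 :> R by field.
by have := sqrtr_ge0 (cn s); lra.
Qed.

End Continuation.

(** * Nonvanishing on the line Re s = 1 *)

Section Nonvanishing.
Variable R : realType.
Local Notation C := R[i].
Implicit Types (s z : C) (chi psi : nat -> C).

Lemma cvs_Re_ge0 (u : nat -> C) l : (forall k, 0 <= Re (u k)) -> cvs u l -> 0 <= Re l.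
Proof.
move=> u0 H; rewrite leNgt; apply/negP => l0.
have e0 : 0 < - Re l / 2 by rewrite divr_gt0// oppr_gt0.
have [N /(_ N (leqnn N))] := H _ e0.
move=> /(le_trans (Re_le_cn _)) /(le_trans (ler_norm _)); rewrite ReD ReN Re_sum.
have : 0 <= \sum_(0 <= k < N) Re (u k) by apply: sumr_ge0.
lra.
Qed.

Definition cmult chi := [/\ chi 1%N = 1, forall m n, chi (m * n)%N = chi m * chi n &
  forall n, cn (chi n) <= 1].

Lemma cmult1 : cmult (fun=> 1).
Proof. by split=> // *; rewrite ?mulr1 ?cn1. Qed.

Lemma pt_split (x t : R) n : npow n (pt x t) = npow n (pt x 0) * npow n (pt 0 t) :> C.
Proof.
rewrite /npow -cexpD -mulrDr; congr (cexp (_ * _)).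
by apply: complexP; rewrite /= ?addr0 ?add0r.
Qed.

Lemma npow_x0 (x : R) n : npow n (pt x 0) = (expR (- ln n%:R * x))%:C :> C.
Proof. by rewrite /npow -realcM cexp_real. Qed.

Lemma expR_341 (a b c x y z : R) : (a * expR x) ^+ 3 * (b * expR y) ^+ 4 * (c * expR z) =
  a ^+ 3 * b ^+ 4 * c * expR (3 * x + 4 * y + z).
Proof. by rewrite !expRD !expRM_natl !exprMn; ring. Qed.

Lemma Re_341 (u w : C) : cn u <= 1 -> cn w <= 1 -> u = 0 \/ w = u ^+ 2 ->
  0 <= Re (3%:R + 4%:R * u + w).
Proof.
move=> u1 w1 uw; rewrite [Re (_ + w)]ReD [Re (_ + _)]ReD [Re (_ * u)]ReM !Renat !Imnat mul0r subr0.
case: uw => [->|wE].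
  rewrite Re0 mulr0 addr0; have := le_trans (Re_le_cn _) w1.
  by rewrite ler_norml => /andP[]; lra.
have : cn u ^+ 2 <= 1 by rewrite expr_le1// cn_ge0.
rewrite sqr_cn wE [u ^+ 2]expr2 [Re (u * u)]ReM; set a := Re u; set b := Im u => h.
by have := sqr_ge0 (1 + a); rewrite sqrrD expr1n !expr2 in h *; lra.
Qed.

(** The inequality 3 + 4 cos t + cos 2t >= 0 is applied to each term of the log series. Requiring
    psi = chi^2 only where chi is nonzero lets psi = 1 accompany a quadratic character; where chi
    vanishes the term is 3 + Re w with |w| <= 1. The constant c collects the unevaluated constants
    of the three exponential forms. *)
Lemma three_four_one chi psi (t : R) : cmult chi -> cmult psi ->
  (forall n, chi n = 0 \/ psi n = chi n ^+ 2) ->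
  exists2 c : R, 0 < c & forall x : R, 1 < x -> c <= cn (Ds (fun=> 1) (pt x 0)) ^+ 3 *
    cn (Ds chi (pt x t)) ^+ 4 * cn (Ds psi (pt x (2 * t))).
Proof.
move=> [c1 cM cb] [p1 pM pb] H; have [w1 wM wb] := cmult1.
have [k1 k10 E1] := Ds_chi_exp w1 wM wb.
have [k2 k20 E2] := Ds_chi_exp c1 cM cb.
have [k3 k30 E3] := Ds_chi_exp p1 pM pb.
exists (cn k1 ^+ 3 * cn k2 ^+ 4 * cn k3); first by rewrite !mulr_gt0 ?exprn_gt0 ?cn_gt0.
move=> x x1; rewrite E1// E2// E3//.
set f1 := Ds _ (pt x 0); set f2 := Ds _ (pt x t); set f3 := Ds _ (pt x (2 * t)).
have cE (c f : C) : cn (c * cexp f) = cn c * expR (Re f) by rewrite cnM cn_cexp.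
rewrite !cE expR_341.
have -> : 3 * Re f1 + 4 * Re f2 + Re f3 = Re (3%:R * f1 + 4%:R * f2 + f3).
  by rewrite !(ReD, ReM, Renat, Imnat) !mul0r !subr0.
rewrite ler_peMr//; first by rewrite !mulr_ge0 ?exprn_ge0 ?cn_ge0.
rewrite -[X in X <= _]expR0 ler_expR.
have v1 := Ds_cvs (adm_le1 (logc_le1 wb)) (x1 : 1 < Re (pt x 0)).
have v2 := Ds_cvs (adm_le1 (logc_le1 cb)) (x1 : 1 < Re (pt x t)).
have v3 := Ds_cvs (adm_le1 (logc_le1 pb)) (x1 : 1 < Re (pt x (2 * t))).
apply: (cvs_Re_ge0 _ (cvsD (cvsD (cvsZ 3%:R v1) (cvsZ 4%:R v2)) v3)) => k.
have E t' : npow k.+1 (pt x t') = (expR (- ln k.+1%:R * x))%:C * npow k.+1 (pt 0 t') :> C.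
  by rewrite pt_split npow_x0.
have v2E : npow k.+1 (pt 0 (2 * t)) = npow k.+1 (pt 0 t) ^+ 2 :> C.
  rewrite expr2 /npow -cexpD -mulrDr; congr (cexp (_ * _)).
  by apply: complexP; rewrite /= ?addr0//; ring.
rewrite (E t) (E (2 * t)) npow_x0 v2E /logc; set r := expR _; set v := npow _ _.
have v1' : cn v = 1 by rewrite cn_npow /= mulr0 expR0.
set l := _ / _; have l0 : 0 <= l by rewrite divr_ge0 ?Lam_ge0 ?ln_nat_ge0.
have -> : 3%:R * (1 * l%:C * r%:C) + 4%:R * (chi k.+1 * l%:C * (r%:C * v)) + psi k.+1 * l%:C * (r%:C * v ^+ 2)
  = (l * r)%:C * (3%:R + 4%:R * (chi k.+1 * v) + psi k.+1 * v ^+ 2).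
  by rewrite [X in _ = X * _]realcM; ring.
rewrite ReM ImR mul0r subr0 ReR; apply: mulr_ge0.
  by apply: mulr_ge0 => //; exact: expR_ge0.
apply: Re_341; [by rewrite cnM v1' mulr1|by rewrite cnM cnX v1' expr1n mulr1|].
by case: (H k.+1) => ->; [left; rewrite mul0r|right; rewrite exprMn].
Qed.

Lemma Ds1_le (x : R) : 1 < x -> x <= 2 -> cn (Ds (fun=> 1) (pt x 0)) <= 2 / (x - 1).
Proof.
move=> x1 x2; have x0 : 0 < x - 1 by rewrite subr_gt0.
have T k : cn (1 * npow k.+1 (pt x 0)) <= nb x k by rewrite mul1r cn_npowE.
have a1 : adm (fun=> 1 : C) by apply: adm_le1 => n; rewrite cn1.
apply: (le_trans (cvs_le T (bsum_nb x1) (Ds_cvs a1 (x1 : 1 < Re (pt x 0))))); clear T a1.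
by rewrite -[X in X + _](divff (lt0r_neq0 x0)) -[X in _ + X]mul1r -mulrDl ler_wpM2r ?invr_ge0 ?(ltW x0)//; lra.
Qed.

(** At distance h from the line a zero of F would make the 3-4-1 product O(h^(-3) h^4) = O(h), below
    its positive lower bound. F may differ from the series of chi by a bounded factor, which covers
    (s-1) zeta(s). *)
Lemma line1_neq0 chi psi (t : R) (F : C -> C) d (K K' r : R) : cmult chi -> cmult psi ->
  (forall n, chi n = 0 \/ psi n = chi n ^+ 2) ->
  cder F (pt 1 t) d -> 0 <= K ->
  (forall x : R, 1 < x -> cn (Ds chi (pt x t)) <= K * cn (F (pt x t))) -> 0 < r ->
  (forall x : R, 1 < x -> x < 1 + r -> cn (Ds psi (pt x (2 * t))) <= K') ->
  F (pt 1 t) != 0.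
Proof.
move=> mc mp H dF K0 HF r0 HK'; apply/eqP => F0.
have [c c0 Hc] := three_four_one t mc mp H.
have [r1 r10 Hr] := cder_lip dF.
pose A := 8 * K ^+ 4 * (cn d + 1) ^+ 4 * `|K'| + 1.
have d1 : 0 <= cn d + 1 by rewrite addr_ge0 ?cn_ge0.
have A0 : 0 < A by rewrite ltr_wpDl// !mulr_ge0 ?exprn_ge0.
pose h := Num.min (Num.min 1 (r1 / 2)) (Num.min (r / 2) (c / (2 * A))).
have h0 : 0 < h by rewrite !lt_min ltr01 !divr_gt0 ?mulr_gt0.
have [h1 h2 h3 h4] : [/\ h <= 1, h < r1, h < r & h * A < c].
  split; first by rewrite !ge_min lexx.
  - by apply: (@le_lt_trans _ _ (r1 / 2)); [rewrite !ge_min lexx !orbT|lra].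
  - by apply: (@le_lt_trans _ _ (r / 2)); [rewrite !ge_min lexx !orbT|lra].
  - have : h <= c / (2 * A) by rewrite !ge_min lexx !orbT.
    by rewrite ler_pdivlMr ?mulr_gt0//; nra.
pose x := 1 + h; have x1 : 1 < x by rewrite ltrDl.
have xh : x - 1 = h by rewrite /x addrC addKr.
have := Hc x x1; apply/negP; rewrite -ltNge.
have b1 : cn (Ds (fun=> 1) (pt x 0)) <= 2 / h by rewrite -xh Ds1_le//; rewrite /x; lra.
have b2 : cn (Ds chi (pt x t)) <= K * ((cn d + 1) * h).
  apply: (le_trans (HF x x1)); rewrite ler_wpM2l//.
  have := Hr h%:C; rewrite cn_real gtr0_norm// F0 subr0 => /(_ h2).
  by rewrite (_ : pt 1 t + h%:C = pt x t)//; apply: complexP; rewrite /= ?addr0.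
have b3 : cn (Ds psi (pt x (2 * t))) <= `|K'|.
  by apply: le_trans (ler_norm _); apply: HK' => //; rewrite /x; lra.
apply: (@le_lt_trans _ _ ((2 / h) ^+ 3 * (K * ((cn d + 1) * h)) ^+ 4 * `|K'|)).
  by do !apply: ler_pM; rewrite ?mulr_ge0 ?exprn_ge0 ?cn_ge0//; rewrite ler_pXn2r ?nnegrE ?cn_ge0 ?mulr_ge0 ?(ltW h0)// ?divr_ge0 ?(ltW h0).
have -> : (2 / h) ^+ 3 * (K * ((cn d + 1) * h)) ^+ 4 * `|K'| = h * (A - 1).
  by rewrite /A; field; exact: lt0r_neq0.
by apply: le_lt_trans h4; rewrite ler_pM2l//; lra.
Qed.

Lemma bounded_right (F : C -> C) (t : R) : hol (HP 0) 1 F ->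
  exists2 r : R, 0 < r & exists K : R, forall x : R, 1 < x -> x < 1 + r -> cn (F (pt x t)) <= K.
Proof.
move=> [F' [H _]]; have := H (pt 1 t); rewrite /HP /= => /(_ ltr01) /cder_cont /(_ 1 ltr01) [r r0 Hr].
exists r => //; exists (cn (F (pt 1 t)) + 1) => x x1 xr.
have := Hr (x - 1)%:C; rewrite cn_real gtr0_norm ?subr_gt0// ltrBlDl => /(_ xr).
rewrite (_ : pt 1 t + _ = pt x t); last by apply: complexP; rewrite /= ?addr0//; ring.
by have := cn_lerB (F (pt x t)) (F (pt 1 t)); lra.
Qed.

Lemma pt_neq1 (x t : R) : t != 0 -> pt x t != 1 :> C.
Proof. by move=> t0; apply/eqP => /(congr1 (@complex.Im R)) /= E; rewrite E eqxx in t0. Qed.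

Lemma zeta_bounded_right (t : R) : t != 0 ->
  exists2 r : R, 0 < r & exists K : R, forall x : R, 1 < x -> x < 1 + r -> cn (Ds (fun=> 1) (pt x t)) <= K.
Proof.
move=> t0; have [r r0 [K HK]] := bounded_right t (zreg_hol R 1).
exists r => //; exists (K + `|t|^-1) => x x1 xr; rewrite zeta_Ds//.
rewrite (le_trans (cnD _ _))// lerD ?HK// cnV lef_pV2 ?posrE ?normr_gt0 ?cn_gt0 ?subr_eq0 ?pt_neq1//.
by have := Im_le_cn (pt x t - 1); rewrite /= subr0.
Qed.

Lemma zZ_line1 (t : R) : zZ (pt 1 t) != 0.
Proof.
have [->|t0] := eqVneq t 0; first by rewrite zZ_1 oner_eq0.
have t20 : 2 * t != 0 by rewrite mulf_neq0.
have [r r0 [K HK]] := zeta_bounded_right t20.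
have [F' [HF _]] := zZ_hol R 1.
apply: (@line1_neq0 (fun=> 1) (fun=> 1) t _ (F' (pt 1 t)) `|t|^-1 K r) => //.
- exact: cmult1.
- exact: cmult1.
- by move=> _; right; rewrite expr1n.
- by apply: HF; rewrite /HP.
- move=> x x1; rewrite zeta_Ds// zZ_zeta ?pt_neq1// cnM mulrA ler_peMl ?cn_ge0//.
  rewrite mulrC ler_pdivlMr ?normr_gt0// mul1r.
  by have := Im_le_cn (pt x t - 1); rewrite /= subr0.
Qed.

Lemma dch_cmult q chi : (0 < q)%N -> @dirichlet_character R q chi -> cmult chi.
Proof.
by move=> q0 d; split; [exact: chi_1 d|exact: chi_mulr d|exact: cn_chi_le1 d].
Qed.

Lemma dch_sqr q chi : @dirichlet_character R q chi -> @dirichlet_character R q (fun n => chi n ^+ 2).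
Proof.
move=> [H1 H2 H3]; split=> [n|m n|n]; rewrite ?H1 ?H2 ?exprMn//.
by rewrite expf_eq0 /= H3.
Qed.

(** If chi^2 is nonprincipal, psi = chi^2 has an L-function bounded near 1 + 2it for every t. If
    chi^2 is principal, psi = 1 is used and zeta is bounded near 1 + 2it because t is nonzero. The
    point s = 1 for quadratic chi remains. *)
Lemma Lf_line1 q chi (t : R) : (0 < q)%N -> @dirichlet_character R q chi ->
  (exists2 a, coprime a q & chi a != 1) ->
  (exists2 a, coprime a q & chi a ^+ 2 != 1) \/ t != 0 -> Lf chi (pt 1 t) != 0.
Proof.
move=> q0 dch np hyp; have [F' [HF _]] := Lf_hol q0 dch np 1.
have [c2|c2] := pselect (exists2 a, coprime a q & chi a ^+ 2 != 1).
  have d2 := dch_sqr dch; have [r r0 [K HK]] := bounded_right (2 * t) (Lf_hol q0 d2 c2 1).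
  apply: (@line1_neq0 chi (fun n => chi n ^+ 2) t _ (F' (pt 1 t)) 1 K r) => //.
  - exact: dch_cmult dch.
  - exact: dch_cmult d2.
  - by right.
  - by apply: HF; rewrite /HP.
  - by move=> x x1; rewrite mul1r (Lf_Ds q0 dch np).
  - by move=> x x1 xr; rewrite -(Lf_Ds q0 d2 c2)// HK.
have t0 : t != 0 by case: hyp => // /c2.
have t20 : 2 * t != 0 by rewrite mulf_neq0.
have [r r0 [K HK]] := zeta_bounded_right t20.
apply: (@line1_neq0 chi (fun=> 1) t _ (F' (pt 1 t)) 1 K r) => //.
- exact: dch_cmult dch.
- exact: cmult1.
- move=> n; have [nq|/(chi_eq0 dch)] := boolP (coprime n q); [right|by left].
  by apply/eqP; rewrite eq_sym; apply/negPn/negP => h; apply: c2; exists n.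
- by apply: HF; rewrite /HP.
- by move=> x x1; rewrite mul1r (Lf_Ds q0 dch np).
Qed.

(** * Nonvanishing of L(1, chi) for quadratic characters *)

Section RealCharacter.
Variables (q : nat) (chi : nat -> C).
Hypotheses (q0 : (0 < q)%N) (dch : @dirichlet_character R q chi).
Hypothesis np : exists2 a, coprime a q & chi a != 1.
Hypothesis chi2 : forall n, coprime n q -> chi n ^+ 2 = 1.

Definition cdiv n : C := \sum_(1 <= d < n.+1 | (d %| n)%N) chi d.
Definition csub p n : C := \sum_(1 <= d < n.+1 | (d %| n)%N && ~~ (p %| d)%N) chi d.

Lemma chi_cases n : [\/ chi n = 0, chi n = 1 | chi n = -1].
Proof.
have [nq|/(chi_eq0 dch)] := boolP (coprime n q); last by constructor 1.
by have /eqP := chi2 nq; rewrite sqrf_eq1 => /orP[]/eqP ->; [constructor 2|constructor 3].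
Qed.

Lemma csub_mul p m : prime p -> (0 < m)%N -> csub p (p * m) = csub p m.
Proof.
move=> pp m0; have p0 := prime_gt0 pp.
rewrite /csub -[LHS]big_filter -[RHS]big_filter; apply: perm_big; apply: uniq_perm.
- by rewrite filter_uniq// iota_uniq.
- by rewrite filter_uniq// iota_uniq.
move=> d; rewrite !mem_filter !mem_index_iota !ltnS.
have [pd|pd] /= := boolP (p %| d)%N; first by rewrite !andbF.
have dp : coprime d p by rewrite coprime_sym prime_coprime.
rewrite !andbT Gauss_dvdr//; case: (boolP (d %| m)%N) => //= dm.
by rewrite (dvdn_leq m0 dm) (leq_trans (dvdn_leq m0 dm))// leq_pmull.
Qed.

(** A divisor of p m is either p times a divisor of m, or prime to p and then a divisor of m. *)
Lemma cdiv_rec p m : prime p -> (0 < m)%N -> cdiv (p * m) = chi p * cdiv m + csub p m.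
Proof.
move=> pp m0; have p0 := prime_gt0 pp.
rewrite /cdiv (bigID (fun d => p %| d)%N) /= -/(csub p (p * m)) csub_mul//; congr (_ + _).
rewrite mulr_sumr -[LHS]big_filter (perm_big [seq (p * d)%N | d <- index_iota 1 m.+1 & (d %| m)%N]).
  by rewrite big_map big_filter; apply: eq_bigr => d _; rewrite (chi_mulr dch).
apply: uniq_perm.
- by rewrite filter_uniq// iota_uniq.
- rewrite map_inj_uniq ?filter_uniq ?iota_uniq// => a b /eqP.
  by rewrite eqn_pmul2l// => /eqP.
move=> d; rewrite mem_filter mem_index_iota ltnS; apply/idP/mapP.
  move=> /andP[/andP[dpm /dvdnP[e de]] /andP[d1 _]].
  have e0 : (0 < e)%N by case: e de d1 => //; rewrite mul0n => ->.
  have em : (e %| m)%N by move: dpm; rewrite de mulnC dvdn_pmul2l.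
  by exists e; rewrite 1?mulnC// mem_filter mem_index_iota em e0 ltnS dvdn_leq.
move=> [e]; rewrite mem_filter mem_index_iota ltnS => /and3P[em e0 eM] ->.
by rewrite dvdn_pmul2l// em dvdn_mulr//= muln_gt0 p0 e0 leq_pmul2l.
Qed.

Lemma csub_coprime p m : (0 < m)%N -> ~~ (p %| m)%N -> csub p m = cdiv m.
Proof.
move=> m0 pm; apply: eq_bigl => d; case: (boolP (d %| m)%N) => //= dm.
by apply: contraNN pm => /dvdn_trans; apply.
Qed.

(** Removing all factors p from m turns the restricted sum into a full divisor sum, at an argument
    that a strong induction has already reached. *)
Lemma csub_ex p m : prime p -> (0 < m)%N ->
  exists r, [/\ (0 < r)%N, (r <= m)%N & csub p m = cdiv r].
Proof.
move=> pp; have [k] := ubnP m; elim: k m => // k IH m mk m0.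
have [/dvdnP[e me]|pm] := boolP (p %| m)%N; last by exists m; rewrite csub_coprime.
have e0 : (0 < e)%N by case: e me m0 => // ->.
have em : (e < m)%N by rewrite me ltn_Pmulr// prime_gt1.
have [r [r0 re E]] := IH e (leq_trans em mk) e0.
by exists r; rewrite r0 (leq_trans re (ltnW em)) -E me mulnC csub_mul.
Qed.

Lemma cdiv1 : cdiv 1 = 1.
Proof. by rewrite /cdiv big_mkcond big_nat1 dvdn1 eqxx (chi_1 dch). Qed.

(** Induction through the least prime factor p. The delicate value is chi(p) = -1: there the
    recursion gives 0 when n contains p once, and [cdiv] at n/p^2 otherwise. The order is that of
    R[i], so reality of the sum is included. *)
Lemma cdiv_ge0 n : (0 < n)%N -> 0 <= cdiv n.
Proof.
have [k] := ubnP n; elim: k n => // k IH n nk n0.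
have [n1|n1] := leqP n 1.
  have -> : n = 1%N by apply/eqP; rewrite eqn_leq n1 n0.
  by rewrite cdiv1 ler01.
have pp := pdiv_prime n1; set p := pdiv n in pp.
have /dvdnP[m] : (p %| n)%N by exact: pdiv_dvd.
rewrite mulnC => nE; have m0 : (0 < m)%N by case: m nE n0 => [->|//]; rewrite muln0.
have mn : (m < n)%N by rewrite nE ltn_Pmull// prime_gt1.
have IHm r : (0 < r)%N -> (r <= m)%N -> 0 <= cdiv r.
  by move=> r0 rm; apply: IH => //; rewrite -ltnS (leq_trans _ nk)// ltnS (leq_ltn_trans rm).
have s0 : 0 <= csub p m by have [r [r0 rm ->]] := csub_ex pp m0; exact: IHm.
rewrite nE cdiv_rec//; have [->|->|E] := chi_cases p.
- by rewrite mul0r add0r.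
- by rewrite mul1r addr_ge0// IHm.
rewrite E mulN1r; have [/dvdnP[e]|pm] := boolP (p %| m)%N; last first.
  by rewrite csub_coprime// addNr.
rewrite mulnC => mE; have e0 : (0 < e)%N by case: e mE m0 => // ->; rewrite muln0.
have em : (e <= m)%N by rewrite mE leq_pmull// prime_gt0.
by rewrite mE cdiv_rec// csub_mul// E mulN1r opprD opprK subrK IHm.
Qed.

(** The recursion is applied twice to n^2 = p (p m^2); for each of the three values of chi(p) the
    result is at least [cdiv (m ^ 2)]. *)
Lemma cdiv_sqr_ge1 n : (0 < n)%N -> 1 <= cdiv (n ^ 2).
Proof.
have [k] := ubnP n; elim: k n => // k IH n nk n0.
have [n1|n1] := leqP n 1.
  have -> : n = 1%N by apply/eqP; rewrite eqn_leq n1 n0.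
  by rewrite exp1n cdiv1.
have pp := pdiv_prime n1; set p := pdiv n in pp.
have /dvdnP[m] : (p %| n)%N by exact: pdiv_dvd.
rewrite mulnC => nE; have m0 : (0 < m)%N by case: m nE n0 => [->|//]; rewrite muln0.
have mn : (m < n)%N by rewrite nE ltn_Pmull// prime_gt1.
have H := IH m (leq_trans mn nk) m0.
have m20 : (0 < m ^ 2)%N by rewrite expn_gt0 m0.
have -> : (n ^ 2 = p * (p * m ^ 2))%N by rewrite nE expnMn -mulnA.
have pm0 : (0 < p * m ^ 2)%N by rewrite muln_gt0 prime_gt0.
have [r [r0 _ Er]] := csub_ex pp m20; have s0 := cdiv_ge0 r0; rewrite -Er in s0.
rewrite cdiv_rec// csub_mul// cdiv_rec//; have [E|->|->] := chi_cases p.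
- rewrite E !mul0r add0r; apply: (le_trans H); rewrite le_eqVlt; apply/orP; left; apply/eqP.
  rewrite /csub /cdiv big_mkcond [RHS]big_mkcond; apply: eq_bigr => d _.
  case: (boolP (d %| m ^ 2)%N) => //= _; case: (boolP (p %| d)%N) => //= /dvdnP[e ->].
  by rewrite (chi_mulr dch) E mulr0.
- by rewrite !mul1r (le_trans H)// -addrA lerDl addr_ge0.
- by rewrite !mulN1r opprD opprK -addrA addNr addr0.
Qed.

Lemma charsum_abel_le (g : nat -> R) N : (forall k, 0 <= g k) -> (forall k, g k.+1 <= g k) ->
  cn (\sum_(0 <= k < N) chi k.+1 * (g k)%:C) <= q%:R * g 0%N.
Proof.
move=> g0 gd.
have abel : \sum_(0 <= k < N) chi k.+1 * (g k)%:C =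
    \sum_(0 <= k < N) charsum chi k.+1 * (g k - g k.+1)%:C + charsum chi N * (g N)%:C.
  elim: N => [|N IH]; first by rewrite !big_geq// add0r /charsum big_geq// mul0r.
  rewrite !big_nat_recr//= IH [charsum _ N.+1]/charsum big_nat_recr//= -/(charsum chi N).
  by rewrite realcD realcN; ring.
have tel : g 0%N = \sum_(0 <= k < N) (g k - g k.+1) + g N.
  elim: (N) => [|n IH]; first by rewrite big_geq// add0r.
  by rewrite big_nat_recr//= {1}IH; ring.
rewrite abel tel mulrDr (le_trans (cnD _ _))// lerD//.
  rewrite (le_trans (cn_sum _ _ _))// mulr_sumr; apply: ler_sum => k _.
  by rewrite cnM cn_real_ge0 ?subr_ge0// ler_wpM2r ?subr_ge0// charsum_le.
by rewrite cnM cn_real_ge0// ler_wpM2r// charsum_le.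
Qed.

Definition gsum (x : R) n : R := \sum_(0 <= k < n) x ^+ k.

Lemma gsumE (x : R) n : (1 - x) * gsum x n = 1 - x ^+ n.
Proof.
rewrite /gsum; elim: n => [|n IH]; first by rewrite big_geq// mulr0 expr0 subrr.
by rewrite big_nat_recr//= mulrDr IH exprS; ring.
Qed.

(** The powers of exponents k and n - k are paired: each pair has geometric mean y^n. *)
Lemma gsum_amgm (y : R) n : 0 <= y -> n.+1%:R * y ^+ n <= gsum (y ^+ 2) n.+1.
Proof.
move=> y0; have E : gsum (y ^+ 2) n.+1 = \sum_(0 <= k < n.+1) (y ^+ 2) ^+ (n - k).
  rewrite /gsum big_nat_rev /= add0n; apply: eq_bigr => k _; congr (_ ^+ _).
have : 2 * (n.+1%:R * y ^+ n) <= gsum (y ^+ 2) n.+1 + gsum (y ^+ 2) n.+1; last by lra.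
rewrite {2}E /gsum -big_split /= (_ : 2 * _ = \sum_(0 <= k < n.+1) 2 * y ^+ n); last first.
  by rewrite sumr_const_nat subn0 -[RHS]mulr_natl; ring.
apply: ler_sum_nat => k /andP[_]; rewrite ltnS => kn.
rewrite -!exprM ![(2 * _)%N]mulnC !exprM -{1}(subnKC kn) exprD.
have := sqr_ge0 (y ^+ k - y ^+ (n - k)); rewrite sqrrB; lra.
Qed.

(** Monsky's argument, truncated at M. The Lambert series of the terms chi(d) x^d/(1 - x^d)
    generates [cdiv]. Up to truncation, 1 - x times it is the partial sum of L(1, chi) minus a sum
    of chi against the decreasing weights [g], which Abel's inequality bounds by q(1 - x). The base
    is x = y^2 so that [gsum_amgm] applies. *)
Lemma monsky (y : R) M : 0 < y -> y < 1 -> (0 < M)%N ->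
  cn (\sum_(1 <= k < M.+1) cdiv k * ((y ^+ 2) ^+ k)%:C) <= q%:R +
   (cn (\sum_(0 <= k < M) chi k.+1 * (k.+1%:R^-1)%:C) + (M%:R * (1 - y) ^+ 2)^-1) / (1 - y ^+ 2).
Proof.
move=> y0 y1 M0; set x := y ^+ 2; have x0 : 0 < x by rewrite exprn_gt0.
have x1 : x < 1 by rewrite exprn_ilt1 ?(ltW y0).
have dx : 0 < 1 - x by rewrite subr_gt0.
have dy : 0 < 1 - y by rewrite subr_gt0.
have MR : 0 < M%:R :> R by rewrite ltr0n.
have xd d : (0 < d)%N -> x ^+ d <= x by case: d => // d _; rewrite exprS ler_piMr ?(ltW x0)// exprn_ile1 ?(ltW x0) ?(ltW x1).
have My : M%:R * y ^+ M * (1 - y) <= 1.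
  have h : M%:R * y ^+ M <= gsum y M.
    rewrite /gsum (_ : M%:R * _ = \sum_(0 <= k < M) y ^+ M); last by rewrite sumr_const_nat subn0 mulr_natl.
    rewrite big_nat_cond [leRHS]big_nat_cond; apply: ler_sum => k /andP[/andP[_ kM] _].
    by rewrite ler_wiXn2l ?(ltW y0) ?(ltW y1)// ltnW.
  have := ler_wpM2r (ltW dy) h; rewrite [gsum _ _ * _]mulrC gsumE => /le_trans; apply.
  by rewrite gerBl exprn_ge0// ltW.
have Mx : M%:R * x ^+ M <= (M%:R * (1 - y) ^+ 2)^-1.
  rewrite -[leRHS]mul1r ler_pdivlMr ?mulr_gt0 ?exprn_gt0//.
  have -> : M%:R * x ^+ M * (M%:R * (1 - y) ^+ 2) = (M%:R * y ^+ M * (1 - y)) ^+ 2.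
    by rewrite /x -exprM mulnC exprM; ring.
  by rewrite expr_le1// !mulr_ge0 ?exprn_ge0 ?(ltW y0) ?(ltW dy).
have -> : \sum_(1 <= k < M.+1) cdiv k * (x ^+ k)%:C =
   \sum_(1 <= d < M.+1) chi d * (\sum_(1 <= e < (M %/ d).+1) (x ^+ d) ^+ e)%:C.
  transitivity (\sum_(1 <= k < M.+1) \sum_(1 <= d < k.+1 | (d %| k)%N) chi d * (x ^+ (d * (k %/ d)))%:C).
    apply: eq_bigr => k _; rewrite /cdiv mulr_suml; apply: eq_bigr => d dk.
    by rewrite mulnC divnK.
  rewrite (sum_divisors (fun d e => chi d * (x ^+ (d * e))%:C)) big_nat_cond [RHS]big_nat_cond.
  apply: eq_bigr => d /andP[/andP[d0 dM] _]; rewrite -mulr_sumr; congr (_ * _).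
  rewrite (big_morph _ (@realcD R) (erefl : 0%:C = 0)) [RHS](@big_nat_widen _ _ _ 1 (M %/ d).+1 M.+1) ?ltnS ?leq_div//.
  by apply: eq_big => [e|e _]; rewrite -?exprM// ltnS leq_divRL// mulnC.
have geo d : (0 < d)%N -> \sum_(1 <= e < (M %/ d).+1) (x ^+ d) ^+ e =
    x ^+ d / (1 - x ^+ d) - x ^+ (d * (M %/ d).+1) / (1 - x ^+ d).
  move=> d0; have n0 : 1 - x ^+ d != 0.
    by rewrite gt_eqF// subr_gt0 (le_lt_trans (xd _ d0)).
  rewrite -mulrBl; apply: (mulIf n0); rewrite divfK//.
  elim: (M %/ d)%N => [|n IH]; first by rewrite big_geq// muln1 subrr mul0r.
  by rewrite big_nat_recr//= mulrDl IH [(d * n.+2)%N]mulnS exprD exprM; ring.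
(* This is 1/n - (1-x) x^n/(1-x^n) with n = k + 1. It is nonnegative, decreases by the AM-GM
   inequality, and starts at 1 - x. *)
pose g k : R := k.+1%:R^-1 - x ^+ k.+1 / gsum x k.+1.
have gs k : 0 < gsum x k.+1.
  by rewrite /gsum big_nat_recl//= expr0 ltr_pwDl// sumr_ge0// => i _; rewrite exprn_ge0// ltW.
have g0 k : 0 <= g k.
  rewrite subr_ge0 ler_pdivrMr// mulrC ler_pdivlMr// mulrC.
  rewrite (_ : _ * _ = \sum_(0 <= i < k.+1) x ^+ k.+1); last by rewrite sumr_const_nat subn0 mulr_natl.
  rewrite big_nat_cond [leRHS]big_nat_cond; apply: ler_sum => i /andP[/andP[_ ik] _].
  by rewrite ler_wiXn2l ?(ltW x0) ?(ltW x1)// ltnW.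
have gd k : g k.+1 <= g k.
  have sS : gsum x k.+2 = gsum x k.+1 + x ^+ k.+1 by rewrite /gsum big_nat_recr.
  have sE : gsum x k.+2 - x * gsum x k.+1 = 1.
    by have := gsumE x k.+1; rewrite sS; lra.
  rewrite -subr_ge0; have k1 : 0 < k.+1%:R :> R by [].
  have -> : g k - g k.+1 = (k.+1%:R * k.+2%:R)^-1 - x ^+ k.+1 / (gsum x k.+1 * gsum x k.+2).
    rewrite /g [x ^+ k.+2]exprS -[in X in _ = _ - X](mulr1 (x ^+ k.+1)) -[in X in _ = _ - X]sE -natr1.
    by field; rewrite !gt_eqF//= natr1.
  rewrite subr_ge0 ler_pdivrMr ?mulr_gt0// mulrC ler_pdivlMr ?mulr_gt0//.
  apply: (@le_trans _ _ (k.+1%:R * y ^+ k * (k.+2%:R * y ^+ k.+1))).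
    have -> : k.+1%:R * y ^+ k * (k.+2%:R * y ^+ k.+1) = (y ^+ k * y ^+ k.+1) * (k.+1%:R * k.+2%:R) by ring.
    rewrite ler_wpM2r// -exprD /x -exprM ler_wiXn2l ?(ltW y0) ?(ltW y1)//.
    lia.
  by apply: ler_pM; rewrite ?mulr_ge0 ?exprn_ge0 ?(ltW y0)// gsum_amgm ?(ltW y0).
have -> : \sum_(1 <= d < M.+1) chi d * (\sum_(1 <= e < (M %/ d).+1) (x ^+ d) ^+ e)%:C =
   (1 - x)^-1%:C * (\sum_(0 <= k < M) chi k.+1 * (k.+1%:R^-1)%:C - \sum_(0 <= k < M) chi k.+1 * (g k)%:C)
   - \sum_(0 <= k < M) chi k.+1 * (x ^+ (k.+1 * (M %/ k.+1).+1) / (1 - x ^+ k.+1))%:C.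
  rewrite big_add1 /= -sumrB mulr_sumr -sumrB; apply: eq_bigr => k _.
  rewrite geo// realcD realcN mulrDr mulrN; congr (_ - _); rewrite -mulrBr mulrCA -realcN -realcD -realcM; congr (_ * _%:C).
  rewrite /g opprB addrCA subrr addr0 mulrCA -invfM.
  by rewrite gsumE.
apply: (le_trans (cn_subD _ _)).
have b1 : cn (\sum_(0 <= k < M) chi k.+1 * (x ^+ (k.+1 * (M %/ k.+1).+1) / (1 - x ^+ k.+1))%:C)
    <= (M%:R * (1 - y) ^+ 2)^-1 / (1 - x).
  apply: (@le_trans _ _ (M%:R * x ^+ M / (1 - x))); last by rewrite ler_wpM2r// invr_ge0 ltW.
  rewrite (le_trans (cn_sum _ _ _))// (_ : M%:R * _ / _ = \sum_(0 <= k < M) (x ^+ M / (1 - x))); last first.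
    by rewrite sumr_const_nat subn0 -[RHS]mulr_natl mulrA.
  apply: ler_sum => k _; have d1 : 0 < 1 - x ^+ k.+1 by rewrite subr_gt0 (le_lt_trans (xd _ _)).
  set e := (k.+1 * _)%N; have p1 : 0 <= x ^+ e := exprn_ge0 _ (ltW x0).
  have p2 : 0 <= (1 - x ^+ k.+1)^-1 by rewrite invr_ge0 ltW.
  have p0 : 0 <= x ^+ e / (1 - x ^+ k.+1) := mulr_ge0 p1 p2.
  rewrite cnM -[leRHS]mul1r (cn_real_ge0 p0).
  apply: ler_pM (cn_ge0 _) p0 (cn_chi_le1 q0 dch _) _; apply: ler_pM p1 p2 _ _.
    by rewrite ler_wiXn2l ?(ltW x0) ?(ltW x1)// /e mulnC ltnW// ltn_ceil.
  by rewrite lef_pV2 ?posrE// lerD2l lerN2 xd.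
have b2 := charsum_abel_le M g0 gd.
have g0E : g 0%N = 1 - x.
  by rewrite /g /gsum big_nat1 expr0 expr1 !invr1 mulr1.
rewrite g0E in b2.
rewrite cnM cn_real_ge0 ?invr_ge0 ?(ltW dx)//.
set S1 := \sum_(0 <= k < M) _ in b1 b2 *; set S2 := \sum_(0 <= k < M) _ in b1 b2 *.
set S3 := \sum_(0 <= k < M) _ in b1 b2 *.
have b3 : (1 - x)^-1 * cn (S3 - S2) <= cn S3 / (1 - x) + q%:R.
  rewrite mulrC ler_pdivrMr// mulrDl divfK ?gt_eqF//.
  by rewrite (le_trans (cn_subD _ _))// lerD2l.
by rewrite mulrDl addrA [q%:R + _]addrC lerD.
Qed.

Lemma bernoulli (d : R) m : 0 <= d <= 1 -> 1 - m%:R * d <= (1 - d) ^+ m.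
Proof.
move=> /andP[d0 d1]; elim: m => [|m IH]; first by rewrite mul0r subr0 expr0.
have d2 : 0 <= 1 - d by rewrite subr_ge0.
have := ler_wpM2l d2 IH; rewrite -exprS => /(le_trans _); apply.
have : 0 <= m%:R * d * d by rewrite !mulr_ge0.
by rewrite -natr1; lra.
Qed.

Lemma sum_squares_le (f : nat -> R) n : (forall k, (0 < k)%N -> 0 <= f k) ->
  \sum_(1 <= j < n.+1) f (j ^ 2)%N <= \sum_(1 <= k < (n ^ 2).+1) f k.
Proof.
move=> f0; elim: n => [|n IH]; first by rewrite !big_geq.
have nn : (n ^ 2 < n.+1 ^ 2)%N by rewrite ltn_sqr.
rewrite big_nat_recr//= [leRHS]big_nat_recr ?expn_gt0//= lerD2r (le_trans IH)//.
rewrite [leRHS](big_cat_nat (n := (n ^ 2).+1))//= lerDl big_nat_cond sumr_ge0// => k /andP[/andP[k0 _] _].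
by apply: f0; exact: leq_trans k0.
Qed.

(** If L(1, chi) were 0, [monsky] would keep the generating series of [cdiv] below q + 1 as x tends
    to 1. The squares alone contribute n0/2 = 2q + 4, which is more. *)
Lemma Lf1_neq0 : Lf chi 1 != 0.
Proof.
apply/eqP => L0.
pose n0 := (4 * q + 8)%N; pose M0 := (n0 ^ 2)%N.
have n00 : (0 < n0)%N by rewrite /n0 addn_gt0 orbT.
have M00 : (0 < M0)%N by rewrite expn_gt0 n00.
have M0R : 0 < M0%:R :> R by rewrite ltr0n.
(* By Bernoulli's inequality x^M0 >= 1 - 2 M0 dl = 1/2, so each of the n0 squares up to M0
   contributes at least 1/2. *)
pose dl : R := (4 * M0%:R)^-1.
have dl0 : 0 < dl by rewrite invr_gt0 mulr_gt0.
have dlM : dl * M0%:R = 4^-1 by rewrite /dl invfM mulrVK// unitfE gt_eqF.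
have dl1 : dl <= 4^-1.
  by rewrite lef_pV2 ?posrE ?mulr_gt0// ler_peMr// ler1n.
pose y := 1 - dl.
have y0 : 0 < y by rewrite /y; lra.
have y1 : y < 1 by rewrite /y; lra.
have yd : 1 - y = dl by rewrite /y; ring.
have x1 : y ^+ 2 < 1 by rewrite exprn_ilt1 ?(ltW y0).
have dx : 0 < 1 - y ^+ 2 by rewrite subr_gt0.
have yM : 2^-1 <= (y ^+ 2) ^+ M0.
  rewrite -exprM; apply: le_trans (bernoulli (2 * M0) _); last by rewrite (ltW dl0); lra.
  by rewrite natrM -mulrA [_ * dl]mulrC dlM; lra.
have e0 : 0 < (1 - y ^+ 2) / 2 by rewrite divr_gt0.
have r1 : 0 < Re (1 : C) by rewrite Re1.
have [N1 H1] := Lf_cvs q0 dch np r1 e0.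
pose B := (dl ^+ 2 * ((1 - y ^+ 2) / 2))^-1.
have B0 : 0 < B by rewrite invr_gt0 mulr_gt0// exprn_gt0.
pose N2 := (`|Num.ceil B|)%N.
pose M := maxn M0 (maxn N1 N2).
have [h1 h2 h3] : [/\ (M0 <= M)%N, (N1 <= M)%N & (N2 <= M)%N].
  by rewrite /M !leq_max !leqnn !orbT.
have M0' : (0 < M)%N := leq_trans M00 h1.
have MR : 0 < M%:R :> R by rewrite ltr0n.
have BM : B <= M%:R.
  rewrite (le_trans (ceil_ge _))// -(gez0_abs (_ : 0 <= Num.ceil B)%R); last by rewrite ceil_ge0; lra.
  by rewrite -pmulrn ler_nat.
have := monsky y0 y1 M0'; apply/negP; rewrite -ltNge.
have t1 : cn (\sum_(0 <= k < M) chi k.+1 * (k.+1%:R^-1)%:C) <= (1 - y ^+ 2) / 2.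
  have := H1 _ h2; rewrite L0 subr0; congr (cn _ <= _); apply: eq_bigr => k _; congr (_ * _).
  by rewrite /npow mulr1 cexp_real expRN lnK ?posrE.
have t2 : (M%:R * (1 - y) ^+ 2)^-1 <= (1 - y ^+ 2) / 2.
  rewrite yd; move: BM; rewrite /B -[X in X <= _]mul1r ler_pdivrMr ?mulr_gt0 ?exprn_gt0//.
  by rewrite mulrA mulrC -ler_pdivrMr ?mulr_gt0 ?exprn_gt0// mul1r.
have t3 : (cn (\sum_(0 <= k < M) chi k.+1 * (k.+1%:R^-1)%:C) + (M%:R * (1 - y) ^+ 2)^-1) / (1 - y ^+ 2) <= 1.
  by rewrite ler_pdivrMr// mul1r; lra.
apply: (@le_lt_trans _ _ (q%:R + 1)); first by rewrite lerD2l.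
apply: (@lt_le_trans _ _ (n0%:R * 2^-1)).
  by rewrite /n0 natrD natrM; have : 0 <= q%:R :> R by []; lra.
apply: (le_trans _ (Re_le_cn _)); apply: (le_trans _ (ler_norm _)); rewrite Re_sum.
have pos k : (0 < k)%N -> 0 <= Re (cdiv k * ((y ^+ 2) ^+ k)%:C).
  move=> k0; rewrite ReM ImR mulr0 subr0 ReR; apply: mulr_ge0; last by rewrite exprn_ge0// sqr_ge0.
  by have := cdiv_ge0 k0; rewrite lecE => /andP[].
apply: (@le_trans _ _ (\sum_(1 <= k < M0.+1) Re (cdiv k * ((y ^+ 2) ^+ k)%:C))); last first.
  rewrite [leRHS](big_cat_nat (n := M0.+1))//= lerDl big_nat_cond sumr_ge0// => k /andP[/andP[k0 _] _].
  by apply: pos; exact: leq_trans k0.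
apply: le_trans (sum_squares_le n0 pos).
rewrite mulr_natl (_ : _ *+ _ = \sum_(1 <= j < n0.+1) 2^-1); last by rewrite sumr_const_nat subn1.
rewrite big_nat_cond [leRHS]big_nat_cond; apply: ler_sum => j /andP[/andP[j0 jn] _].
rewrite ReM ImR mulr0 subr0 ReR -[leLHS]mul1r; apply: ler_pM => //.
  by have := cdiv_sqr_ge1 j0; rewrite lecE => /andP[].
apply: (le_trans yM); rewrite ler_wiXn2l ?sqr_ge0 ?(ltW x1)//.
by rewrite leq_sqr -ltnS.
Qed.

End RealCharacter.

(** * The zero-free half plane Re s > 1/2 *)

Section GRH.
Hypothesis grh : generalized_riemann_hypothesis R.

Lemma dch1 : @dirichlet_character R 1 (fun=> 1).
Proof. by split=> // *; rewrite ?mulr1// oner_eq0 coprimen1. Qed.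

Lemma zZ_neq0 s : 2^-1 < Re s -> zZ s != 0.
Proof.
move=> s2; have [s1|s1|s1] := ltgtP (Re s) 1.
- have sn : s != 1 by apply/eqP => E; rewrite E Re1 ltxx in s1.
  rewrite zZ_zeta// mulf_neq0 ?subr_eq0//.
  apply: (grh_neq0 grh (isT : (0 < 1)%N) dch1 (@zeta_cvs R)); last by rewrite s2.
  move=> z z0 z1; have [F' [HF _]] := zreg_hol R 1.
  exists (F' z + - (z - 1) ^- 2 * 1); apply: cderD; first exact: HF.
  have := cder_comp (G := fun z => z - 1) (cderB (cder_id z) (cder_cst 1 z)) (cder_inv (_ : z - 1 != 0)).
  by rewrite subr0; apply; rewrite subr_eq0.
- have sn : s != 1 by apply/eqP => E; rewrite E Re1 ltxx in s1.
  rewrite zZ_zeta// mulf_neq0 ?subr_eq0// -zeta_Ds//.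
  by have [w1 wM wb] := cmult1; exact: Ds_chi_neq0.
- have -> : s = pt 1 (Im s) by apply: complexP.
  exact: zZ_line1.
Qed.

(** Three regions: the hypothesis for Re s < 1, the exponential form for Re s > 1, and the line Re s
    = 1, where the quadratic case at s = 1 is [Lf1_neq0]. *)
Lemma Lf_neq0 q chi s : (0 < q)%N -> @dirichlet_character R q chi ->
  (exists2 a, coprime a q & chi a != 1) -> 2^-1 < Re s -> Lf chi s != 0.
Proof.
move=> q0 dch np s2; have [s1|s1|s1] := ltgtP (Re s) 1.
- apply: (grh_neq0 grh q0 dch (F := Lf chi)); last by rewrite s2.
    by move=> z z1; apply: (Lf_cvs q0 dch np); rewrite (lt_trans ltr01).
  by move=> z z0 _; have [F' [HF _]] := Lf_hol q0 dch np 1; exists (F' z); exact: HF.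
- by have [w1 wM wb] := dch_cmult q0 dch; rewrite (Lf_Ds q0 dch np)// Ds_chi_neq0.
have -> : s = pt 1 (Im s) by apply: complexP.
have [c2|c2] := pselect (exists2 a, coprime a q & chi a ^+ 2 != 1).
  by apply: (Lf_line1 q0 dch np); left.
have [->|t0] := eqVneq (Im s) 0; last by apply: (Lf_line1 q0 dch np); right.
apply: (Lf1_neq0 q0 dch np) => n nq.
by apply/eqP/negPn/negP => h; apply: c2; exists n.
Qed.

End GRH.

End Nonvanishing.

(** * Sums over primes under GRH *)

Section LogBounds.
Variable R : realType.
Local Notation C := R[i].
Implicit Types (s z : C) (chi : nat -> C) (F G : C -> C).

(** G is a primitive of F'/F on the half plane; F e^(-G) has derivative 0, so G is a logarithm of F
    up to a constant. *)
Lemma log_branch F F' : hol (HP 2^-1) 6 F -> (forall s, HP 2^-1 s -> F s != 0) ->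
  (forall s, HP 2^-1 s -> cder F s (F' s)) ->
  exists G, [/\ hol (HP 2^-1) 5 G, forall s, HP 2^-1 s -> cder G s (F' s / F s) &
    exists2 c : C, c != 0 & forall s, HP 2^-1 s -> F s = c * cexp (G s)].
Proof.
move=> hF F0 dF; have hF' : hol (HP 2^-1) 5 F' by exact: hol_der (@HP_open R 2^-1) dF hF.
have hq : hol (HP 2^-1) 4 (fun s => F' s / F s).
  apply: holM; first exact: holW.
  by apply: holV => //; apply: hol_leq hF.
have [G HG] := HP_primitive hq; exists G; split=> //; first exact: hol_primitive HG hq.
pose E s := F s * cexp (- G s).
have dE s : HP 2^-1 s -> cder E s 0.
  move=> hs; have d3 := cder_comp (cderN (HG _ hs)) (cder_cexp _).
  by apply: (cder_eqd _ (cderM (dF _ hs) d3)); field; exact: F0.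
have h1 : HP 2^-1 (1 : C) by rewrite /HP Re1 invf_lt1 ?ltr1n.
exists (E 1); first by rewrite /E mulf_neq0 ?cexp_neq0 ?F0.
move=> s hs; rewrite -(HP_const dE hs h1) /E -mulrA -cexpD addNr cexp0 mulr1//.
Qed.

Lemma ln_le_sqrt (x : R) : 0 < x -> ln x <= 2 * Num.sqrt x.
Proof.
move=> x0; have r0 : 0 < Num.sqrt x by rewrite sqrtr_gt0.
rewrite -{1}(sqr_sqrtr (ltW x0)) lnXn// mulr2n.
have : ln (1 + (Num.sqrt x - 1)) <= Num.sqrt x - 1 by apply: le_ln1Dx; lra.
by rewrite [1 + _]addrC subrK; lra.
Qed.

Lemma half_le_cn s : 2^-1 < Re s -> 2^-1 < cn s.
Proof. by move=> h; rewrite (lt_le_trans h)// (le_trans (ler_norm _))// Re_le_cn. Qed.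

(** Borel-Caratheodory on the disc of centre 2 + i Im s and radius 3/2, which touches Re s = 1/2. On
    it |z| <= 8|s|, so Re(G(z) - G(w)) is at most the logarithm of Q (8|s|)^2/c0. The factor 3 is
    twice the bound 3/2 for 2 - Re s, and log|s|^2 is weakened to 4 sqrt|s|. *)
Lemma log_bound F G (c : C) (Q c0 : R) : 1 <= Q -> 0 < c0 -> c0 <= 1 -> c != 0 ->
  hol (HP 2^-1) 5 G -> (forall s, HP 2^-1 s -> F s = c * cexp (G s)) ->
  (forall s, HP 2^-1 s -> cn (F s) <= Q * cn s ^+ 2) ->
  (forall y : R, c0 <= cn (F (pt 2 y))) ->
  forall s, 2^-1 < Re s -> Re s <= 2 ->
  cn (G s - G (pt 2 (Im s))) <= 3 * (ln (64 * Q / c0) + 4 * Num.sqrt (cn s)) / (Re s - 2^-1).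
Proof.
move=> Q1 c00 c01 cne hG FE FQ Fc s s1 s2.
have cs := half_le_cn s1; have cs0 : 0 < cn s by rewrite (lt_trans _ cs)// invr_gt0.
set w := pt 2 (Im s).
have ws : s - w = (Re s - 2)%:C by apply: complexP; rewrite !cpE /= ?subrr.
have cws : cn (s - w) = 2 - Re s by rewrite ws cn_real ler0_norm ?subr_le0// opprB.
have Q0 : 0 < Q by lra.
have A0 : 0 < 64 * Q / c0 by rewrite divr_gt0// mulr_gt0.
pose M := ln (64 * Q / c0 * cn s ^+ 2).
have P0 : 0 < 64 * Q / c0 * cn s ^+ 2 by rewrite mulr_gt0// exprn_gt0.
have M1 : 1 < 64 * Q / c0 * cn s ^+ 2.
  apply: (@lt_le_trans _ _ (64 * cn s ^+ 2)); first by rewrite expr2; nra.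
  rewrite ler_wpM2r ?sqr_ge0// ler_pdivlMr//; nra.
have M0 : 0 < M by rewrite ln_gt0.
have sub z : disc w (3 / 2) z -> HP 2^-1 z.
  rewrite /disc /HP => zw; have := le_lt_trans (Re_le_cn _) zw.
  by rewrite ReD ReN /= ltr_norml => /andP[]; lra.
have wz : disc w (3 / 2) w by rewrite /disc subrr cn0; lra.
have r0 : (0 : R) < 3 / 2 by lra.
have hz z : disc w (3 / 2) z -> Re (G z - G w) <= M.
  move=> zw; rewrite /M -ler_expR lnK ?posrE//.
  have cc : 0 < cn c by rewrite cn_gt0.
  have E v : disc w (3 / 2) v -> expR (Re (G v)) = cn (F v) / cn c.
    by move=> vw; rewrite (FE _ (sub _ vw)) cnM cn_cexp mulrAC divff ?mul1r// gt_eqF.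
  have zs : cn z <= 8 * cn s.
    have -> : z = (z - w) - (s - w) + s by ring.
    apply: (le_trans (cnD _ _)); move: zw; rewrite /disc => zw.
    by have := cn_subD (z - w) (s - w); rewrite cws; lra.
  rewrite ReD ReN expRD expRN !E//.
  have Fw : 0 < cn (F w) by rewrite (lt_le_trans c00)// Fc.
  have -> : cn (F z) / cn c * (cn (F w) / cn c)^-1 = cn (F z) / cn (F w).
    by field; rewrite !gt_eqF.
  rewrite ler_pdivrMr//; apply: (le_trans (FQ _ (sub _ zw))).
  apply: (@le_trans _ _ (64 * Q / c0 * cn s ^+ 2 * c0)); last first.
    by rewrite ler_wpM2l ?Fc// ltW.
  have -> : 64 * Q / c0 * cn s ^+ 2 * c0 = Q * (8 * cn s) ^+ 2 by field; rewrite gt_eqF.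
  by rewrite ler_wpM2l ?(ltW Q0)// ler_pXn2r ?nnegrE ?cn_ge0// mulr_ge0 ?cn_ge0.
have hG3 : hol (disc w (3 / 2)) 3 G by apply: hol_sub sub _; apply: hol_leq hG.
have zs : cn (s - w) < 3 / 2 by rewrite cws; lra.
apply: (le_trans (borel_caratheodory r0 M0 hG3 hz zs)).
have -> : 3 / 2 - cn (s - w) = Re s - 2^-1 by rewrite cws; lra.
have d0 : 0 < Re s - 2^-1 by rewrite subr_gt0.
rewrite ler_wpM2r ?invr_ge0 ?(ltW d0)//.
have ME : M <= ln (64 * Q / c0) + 4 * Num.sqrt (cn s).
  rewrite /M lnM ?posrE// ?exprn_gt0// lerD2l lnXn// mulr2n.
  by have := ln_le_sqrt cs0; lra.
apply: (@le_trans _ _ (3 * M)); last by rewrite ler_wpM2l.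
rewrite mulrAC ler_wpM2r ?(ltW M0)// cws; lra.
Qed.

Lemma expR_half (x : R) : 0 < x -> expR (ln x / 2) = Num.sqrt x.
Proof.
move=> x0; apply/eqP; rewrite -(@eqrXn2 _ 2) ?expR_ge0 ?sqrtr_ge0// sqr_sqrtr ?(ltW x0)//.
by rewrite -expRM_natl mulrC divfK// lnK.
Qed.

Lemma ln2_gt : 2^-1 < ln 2 :> R.
Proof.
have e4 := @expR1_le4 R.
rewrite -ltr_expR lnK ?posrE//.
have : expR 2^-1 ^+ 2 = expR 1 :> R by rewrite -expRM_natl; congr expR; field.
have := @expR_gt0 R 2^-1; set x := expR 2^-1 => x0 xE.
have : x <= 2 by rewrite -ler_sqr ?nnegrE ?(ltW x0)// xE; rewrite expr2; lra.
rewrite le_eqVlt => /orP[/eqP x2|//].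
have : (expR (2^-1) : R) < 2; last by rewrite -/x x2 ltxx.
have h : 1 - 4^-1 < expR (- 4^-1) :> R by have := @expR_gt1Dx R (- 4^-1); apply; lra.
rewrite expRN in h; have y0 := @expR_gt0 R 4^-1.
have : expR 4^-1 < (1 - 4^-1)^-1 :> R by rewrite -[ltLHS]invrK ltf_pV2 ?posrE ?invr_gt0//; lra.
have -> : (1 - 4^-1)^-1 = 4 / 3 :> R by field.
have -> : expR 2^-1 = expR 4^-1 * expR 4^-1 :> R by rewrite -expRD; congr expR; field.
nra.
Qed.

Lemma bsum2 (a : nat -> C) (f : C -> C) (y : R) (A : R) : 0 <= A -> (forall n, cn (a n) <= A) ->
  cvs (fun k => a k.+1 * npow k.+1 (pt 2 y)) (f (pt 2 y)) -> cn (f (pt 2 y)) <= A * 2.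
Proof.
move=> A0 aA; apply: (@cvs_le R _ _ (fun k => A * (k.+1%:R ^+ 2)^-1)); last first.
  exact: bsumZ (@bsum_inv_sqr R).
by move=> k; rewrite cnM cn_npow2// ler_wpM2r// inv_sqr_ge0.
Qed.

(** * Weighted sums of prime powers under the hypothesis *)

Section GRH.
Hypothesis grh : generalized_riemann_hypothesis R.

(** The abscissa x = 1/2 + 1/log X makes X^x = e sqrt(X). The constant is 5 * 104 * 4: the factor of
    [perron], that of the bound on log L, and e <= 4. *)
Theorem char_sum_bound q chi (X : R) N : (1 < q)%N -> @dirichlet_character R q chi ->
  (exists2 a, coprime a q & chi a != 1) -> 2 <= ln X -> 0 < X -> X <= N%:R ->
  cn (\sum_(0 <= k < N) logc chi k.+1 * (Num.max 0 (ln X - ln k.+1%:R))%:C)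
    <= 2080 * ln q%:R * ln X * Num.sqrt X.
Proof.
move=> q1 dch np X2 X0 XN; have q0 := ltnW q1.
have hL k : hol (HP 2^-1) k (Lf chi).
  by apply: hol_sub (Lf_hol q0 dch np k) => s; rewrite /HP; apply: lt_trans; rewrite invr_gt0.
have [F' [dF _]] := hL 1%N.
have F0 s : HP 2^-1 s -> Lf chi s != 0 by exact: (Lf_neq0 grh q0 dch np).
have [G [hG dG [c c0 Gc]]] := log_branch (hL 6%N) F0 dF.
have [w1 wM wb] := dch_cmult q0 dch.
have G1 s : HP 1 s -> cder (fun s => G s - Ds (logc chi) s) s 0.
  move=> hs; have hs' : HP 2^-1 s by rewrite /HP; apply: lt_trans hs; rewrite invf_lt1 ?ltr1n.
  apply: (cder_eqd _ (cderB (dG _ hs') (Ds_logc_der wb hs))).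
  have [r r0 Hr] := HP_open hs.
  have d1 : cder (Lf chi) s (- (Ds chi s * Ds (fun n => chi n * (Lam R n)%:C) s)).
    by apply: cder_eq r0 _ (Ds_chi_der wM wb hs) => z /Hr; exact: Lf_Ds q0 dch np z.
  have -> := cder_uniq (dF _ hs') d1; rewrite (Lf_Ds q0 dch np)//.
  by field; exact: Ds_chi_neq0.
pose k0 := G 2%:R - Ds (logc chi) 2%:R; pose f s := G s - k0.
have h2 : HP 1 (2%:R : C) by rewrite /HP Renat ltr1n.
have fE s : 1 < Re s -> f s = Ds (logc chi) s.
  by move=> hs; have := HP_const G1 hs h2; rewrite /f /k0 => <-; ring.
have fS y : cvs (fun k => logc chi k.+1 * npow k.+1 (pt 2 y)) (f (pt 2 y)).
  by rewrite fE ?ltr1n//; apply: Ds_cvs; [exact: adm_le1 (logc_le1 wb)|rewrite /= ltr1n].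
have hf : hol (HP 2^-1) 4 f by apply: holB; [exact: holW|exact: hol_cst].
have lq : 2^-1 < ln q%:R :> R by rewrite (lt_le_trans ln2_gt)// ler_ln ?posrE ?ltr0n// ler_nat.
have lX : 0 < ln X by lra.
pose x := 2^-1 + (ln X)^-1.
have xi : 0 < (ln X)^-1 <= 2^-1 by rewrite invr_gt0 lX lef_pV2 ?posrE.
have [x1 x2] : 2^-1 < x /\ x <= 1 by rewrite /x; lra.
pose A := 104 * ln q%:R * ln X.
have A0 : 0 <= A by rewrite !mulr_ge0 ?ltW//; lra.
have X1 : 1 <= X by rewrite -[X in X <= _]expR0 -[leRHS](lnK X0) ler_expR ltW.
have fA s : x <= Re s <= 2 -> cn (f s) <= A * Num.sqrt (cn s).
  move=> /andP[s1 s2]; have s12 : 2^-1 < Re s by exact: lt_le_trans s1.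
  have cs := half_le_cn s12; have sq0 := sqrtr_ge0 (cn s).
  have sq : 2^-1 <= Num.sqrt (cn s).
    by rewrite -ler_sqr ?nnegrE// sqr_sqrtr ?cn_ge0// expr2; lra.
  have -> : f s = f (pt 2 (Im s)) + (G s - G (pt 2 (Im s))) by rewrite /f; ring.
  apply: (le_trans (cnD _ _)).
  have b1 : cn (f (pt 2 (Im s))) <= 1 * 2 by apply: bsum2 (fS _) => //; exact: logc_le1.
  have qR : 1 <= q%:R :> R by rewrite ler1n.
  have FQ z : HP 2^-1 z -> cn (Lf chi z) <= 6 * q%:R * cn z ^+ 2.
    move=> hz; apply: (le_trans (Lf_le q0 dch np (ltW hz))).
    have := half_le_cn hz; have := cn_ge0 z; move: (cn z) => m m0 m1.
    by have : 0 <= q%:R * m * (m - 2^-1); [rewrite !mulr_ge0//; lra|rewrite expr2; lra].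
  have Fc y : 1 / 4 <= cn (Lf chi (pt 2 y)).
    by rewrite (Lf_Ds q0 dch np) ?ltr1n//; exact: Ds_chi_lower.
  have Q1 : 1 <= 6 * q%:R :> R by lra.
  have c00 : 0 < 1 / 4 :> R by lra.
  have c01 : 1 / 4 <= 1 :> R by lra.
  have b2 := log_bound Q1 c00 c01 c0 hG Gc FQ Fc s12 s2.
  have lb : ln (64 * (6 * q%:R) / (1 / 4)) <= 12 * ln q%:R :> R.
    have -> : 12 * ln q%:R = ln (q%:R ^+ 12) :> R by rewrite lnXn ?ltr0n// mulr_natl.
    rewrite ler_ln ?posrE ?exprn_gt0 ?ltr0n//; last first.
      by rewrite divr_gt0// !mulr_gt0// ltr0n.
    have q2 : 2 <= q%:R :> R by rewrite ler_nat.
    have : 2 ^+ 11 <= q%:R ^+ 11 :> R by rewrite ler_pXn2r ?nnegrE.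
    rewrite [q%:R ^+ 12]exprS => h.
    have := ler_wpM2l (_ : 0 <= q%:R) h; rewrite (_ : 2 ^+ 11 = 2048 :> R); last by rewrite !exprS expr0; lra.
    by move=> /(_ (ler0n _ _)); lra.
  have b3 : 3 * (ln (64 * (6 * q%:R) / (1 / 4)) + 4 * Num.sqrt (cn s)) / (Re s - 2^-1)
     <= 96 * ln q%:R * Num.sqrt (cn s) * ln X.
    apply: ler_pM.
    - rewrite mulr_ge0// addr_ge0 ?mulr_ge0// ln_ge0//.
      by rewrite -[1]mul1r ler_pM//; lra.
    - by rewrite invr_ge0 subr_ge0 ltW.
    - move: (Num.sqrt _) sq sq0 lb lq => m sq sq0; move: (ln (_ / _)) (ln q%:R) => a b ab b0; nra.
    - rewrite -[leRHS]invrK lef_pV2 ?posrE ?subr_gt0 ?invr_gt0//; rewrite /x in s1; lra.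
  have b4 : 2 <= 8 * ln q%:R * Num.sqrt (cn s) * ln X.
    have h1 : 2^-1 * 2^-1 <= ln q%:R * Num.sqrt (cn s) by rewrite ler_pM ?invr_ge0// ltW.
    have h3 : 2^-1 * 2^-1 * 2 <= ln q%:R * Num.sqrt (cn s) * ln X.
      by apply: ler_pM => //; rewrite mulr_ge0 ?invr_ge0.
    by lra.
  by rewrite /A; lra.
have := perron (logc_le1 wb) hf fS x1 x2 A0 fA X1 XN.
move=> /le_trans; apply.
have -> : x * ln X = ln X / 2 + 1 by rewrite /x; field; rewrite gt_eqF.
rewrite expRD expR_half//.
have e4 := @expR1_le4 R; have sX := sqrtr_ge0 X.
have : Num.sqrt X * expR 1 <= Num.sqrt X * 4 by rewrite ler_wpM2l.
move=> h; have := ler_wpM2l (_ : 0 <= 5 * A) h; rewrite mulr_ge0// => /(_ isT).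
by rewrite /A; lra.
Qed.

(** Subtracting 1 from Lambda removes the singularity of log zeta at s = 1, so that no main term
    arises in the sums; it is restored later through the sum of 1/log n. *)
Definition pnt_coef n : R := (Lam R n - 1) / ln n%:R.

Lemma pnt_coef_le n : `|pnt_coef n| <= 2.
Proof.
case: n => [|[|n]]; first by rewrite /pnt_coef ln0// invr0 mulr0 normr0.
  by rewrite /pnt_coef ln1 invr0 mulr0 normr0.
have l0 : 2^-1 < ln n.+2%:R :> R by rewrite (lt_le_trans ln2_gt)// ler_ln ?posrE// ler_nat.
have l1 : 0 < ln n.+2%:R :> R by rewrite (lt_trans _ l0)// invr_gt0.
rewrite /pnt_coef normrM normfV [`|ln _|]gtr0_norm// ler_pdivrMr//.
have := Lam_ge0 R n.+2; have := Lam_le R (ltn0Sn n.+1).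
by rewrite ler_norml; move: (Lam _ _) (ln _) l0 => a b *; apply/andP; split; lra.
Qed.

Lemma cvs_delta (c : C) : cvs (fun k => (k == 0%N)%:R * c) c.
Proof.
move=> e e0; exists 1%N => n n1; rewrite -(prednK n1) big_nat_recl//= mul1r.
rewrite big1 ?addr0 ?subrr ?cn0 ?(ltW e0)// => i _.
by rewrite mul0r.
Qed.

(** Halved so that the coefficients have modulus at most 1, as [perron] requires. *)
Definition pntc n : C := (pnt_coef n / 2)%:C.

Lemma pntc_le1 n : cn (pntc n) <= 1.
Proof.
have h := pnt_coef_le n.
by rewrite /pntc cn_real normrM [`|2^-1|]ger0_norm ?invr_ge0//; lra.
Qed.

(** Differentiating brings back log n and leaves (1 - Lambda(n))/2. The term -1 corrects n = 1,
    whose coefficient is 0 because ln 1 = 0. *)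
Lemma pntc_der s : 1 < Re s -> cder (Ds pntc) s
  ((- Ds (fun n => 1 * (Lam R n)%:C) s + zeta s - 1) / 2).
Proof.
move=> s1; apply: (cder_eqd _ (Ds_der (adm_le1 pntc_le1) s1)).
have wb (n : nat) : cn (1 : C) <= 1 by rewrite cn1.
have H1 := Ds_cvs (adm_chiLam wb) s1; have H2 := zeta_cvs s1.
have H := cvsZ 2^-1 (cvsB (cvsD (cvsZ (-1) H1) H2) (cvs_delta 1)).
have -> : (- Ds (fun n => 1 * (Lam R n)%:C) s + zeta s - 1) / 2 =
    2^-1 * (-1 * Ds (fun n => 1 * (Lam R n)%:C) s + zeta s - 1) by rewrite mulN1r mulrC.
apply: CS_eq; apply: eq_cvs H => k.
rewrite /pntc /pnt_coef; case: k => [|k].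
  have -> : (Lam R 1)%:C = 0 :> C by rewrite Lam1.
  have -> : (- ln 1%:R)%:C = 0 :> C by rewrite ln1 oppr0.
  by rewrite npow1 eqxx !mul0r mulr0 mul0r mulr0 add0r !mulr1 subrr mulr0.
have l0 : ln k.+2%:R != 0 :> R by rewrite gt_eqF// ln_gt0// ltr1n.
have -> : (- ln k.+2%:R)%:C * ((Lam R k.+2 - 1) / ln k.+2%:R / 2)%:C = (2^-1 * (1 - Lam R k.+2))%:C :> C.
  by rewrite -realcM; congr (_%:C); field.
rewrite realcM realcD realcN realcV realc_nat /= mul0r subr0; ring.
Qed.

(** The function is half of log((s-1) zeta(s)) plus half of a primitive of zeta(s) - 1/(s-1) - 1: in
    the derivative the two poles cancel. The contour stops at Re s = 3/4, where [zreg] is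
    O(sqrt|s|); any fixed exponent below 1 serves. *)
Theorem pnt_smooth : exists2 K : R, 0 < K & forall (X : R) N, 1 <= X -> X <= N%:R ->
  `|\sum_(0 <= k < N) pnt_coef k.+1 * Num.max 0 (ln X - ln k.+1%:R)| <= K * expR (3 / 4 * ln X).
Proof.
have hZ k : hol (HP 2^-1) k (@zZ R).
  by apply: hol_sub (zZ_hol R k) => s; rewrite /HP; apply: lt_trans; rewrite invr_gt0.
have hB k : hol (HP 2^-1) k (@zreg R).
  by apply: hol_sub (zreg_hol R k) => s; rewrite /HP; apply: lt_trans; rewrite invr_gt0.
have [F' [dF _]] := hZ 1%N.
have F0 s : HP 2^-1 s -> zZ s != 0 by exact: zZ_neq0.
have [G [hG dG [c c0 Gc]]] := log_branch (hZ 6%N) F0 dF.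
have hB1 : hol (HP 2^-1) 4 (fun s => zreg s - 1) by apply: holB => //; exact: hol_cst.
have [P dP] := HP_primitive hB1.
have hP : hol (HP 2^-1) 5 P by exact: hol_primitive dP hB1.
have wb (n : nat) : cn (1 : C) <= 1 by rewrite cn1.
have G1 s : HP 1 s -> cder (fun s => 2^-1 * (G s + P s) - Ds pntc s) s 0.
  move=> hs; have hs' : HP 2^-1 s by rewrite /HP; apply: lt_trans hs; rewrite invf_lt1 ?ltr1n.
  have sn : s - 1 != 0.
    by rewrite subr_eq0; apply/eqP => E; move: hs; rewrite /HP E Re1 ltxx.
  apply: (cder_eqd _ (cderB (cderZ 2^-1 (cderD (dG _ hs') (dP _ hs'))) (pntc_der hs))).
  have [r r0 Hr] := HP_open hs.
  have d1 : cder (@zZ R) s (Ds (fun=> 1) s + (s - 1) *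
      - (Ds (fun=> 1) s * Ds (fun n => 1 * (Lam R n)%:C) s)).
    have dd := @Ds_chi_der R (fun=> 1) (fun _ _ => esym (mulr1 1)) wb _ hs.
    apply: (cder_eq r0) (cder_eqd _ (cderM (cderB (cder_id s) (cder_cst 1 s)) dd)).
      move=> z /Hr hz; rewrite zZ_zeta ?zeta_Ds//.
      by apply/eqP => E; move: hz; rewrite /HP E Re1 ltxx.
    by rewrite subr0 mul1r.
  have z0 : zeta s != 0.
    by rewrite -zeta_Ds//; apply: Ds_chi_neq0 => // *; rewrite mulr1.
  have -> := cder_uniq (dF _ hs') d1.
  have s1 : s != 1 by rewrite -subr_eq0.
  rewrite (zZ_zeta s1) (zeta_Ds hs); set D := Ds _ s; rewrite /zeta in z0 *.
  have -> : zreg s - 1 = (zreg s + (s - 1)^-1) - (s - 1)^-1 - 1 by ring.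
  move: (zreg s + _) z0 => Zt z0; by field; rewrite ?z0 ?sn.
pose k0 := 2^-1 * (G 2%:R + P 2%:R) - Ds pntc 2%:R; pose f s := 2^-1 * (G s + P s) - k0.
have h2 : HP 1 (2%:R : C) by rewrite /HP Renat ltr1n.
have fE s : 1 < Re s -> f s = Ds pntc s.
  by move=> hs; have := HP_const G1 hs h2; rewrite /f /k0 => <-; ring.
have fS y : cvs (fun k => pntc k.+1 * npow k.+1 (pt 2 y)) (f (pt 2 y)).
  by rewrite fE ?ltr1n//; apply: Ds_cvs; [exact: adm_le1 pntc_le1|rewrite /= ltr1n].
have hf : hol (HP 2^-1) 4 f.
  apply: holB; last exact: hol_cst.
  by apply: holZ; apply: holD; exact: holW.
(* The growth constant 130 of (s-1) zeta(s) is 126 + 4: the product (s-1) [zreg] is at most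
   126|s|^2, and 1 <= 4|s|^2 for Re s > 1/2. The bound 1/4 is that of [Ds_chi_lower]. *)
clear wb; pose C1 : R := ln (64 * 130 / (1 / 4)).
have C10 : 0 <= C1 by rewrite ln_ge0//; lra.
pose A : R := 200 + 12 * (2 * C1 + 4).
have A0 : 0 <= A by rewrite /A; lra.
have fA s : 3 / 4 <= Re s <= 2 -> cn (f s) <= A * Num.sqrt (cn s).
  move=> /andP[s1 s2]; have s12 : 2^-1 < Re s by lra.
  have cs := half_le_cn s12; have sq0 := sqrtr_ge0 (cn s).
  have sq : 2^-1 <= Num.sqrt (cn s).
    by rewrite -ler_sqr ?nnegrE// sqr_sqrtr ?cn_ge0// expr2; lra.
  have b1 : cn (f (pt 2 (Im s))) <= 1 * 2 by apply: bsum2 (fS _) => //; exact: pntc_le1.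
  have FQ z : HP 2^-1 z -> cn (zZ z) <= 130 * cn z ^+ 2.
    move=> hz; have m1 := half_le_cn hz; have h3 := zreg_le (ltW hz).
    apply: (le_trans (cnD _ _)); rewrite cn1 cnM.
    have z1 := cn_subD z 1; rewrite cn1 in z1.
    have a0 := cn_ge0 (z - 1).
    have h4 : cn (z - 1) * cn (zreg z) <= cn (z - 1) * (3 * (1 + 4 * cn (z - 1))) by rewrite ler_wpM2l.
    have h5 : cn (z - 1) * (3 * (1 + 4 * cn (z - 1))) <= (3 * cn z) * (3 * (14 * cn z)).
      by apply: ler_pM => //; lra.
    have h6 : 2^-1 * 2^-1 <= cn z * cn z by rewrite ler_pM ?invr_ge0// ltW.
    by rewrite expr2; lra.
  have Fc (y : R) : 1 / 4 <= cn (zZ (pt 2 y)).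
    rewrite zZ_zeta; last first.
      apply/eqP => /(congr1 (@complex.Re R)) /= /eqP; rewrite -subr_eq0 (_ : 2 - 1 = 1) ?oner_eq0//; ring.
    rewrite -zeta_Ds ?ltr1n// cnM -[leLHS]mul1r ler_pM//.
      have := Re_le_cn (pt 2 y - 1); rewrite /= (_ : 2 - 1 = 1 :> R) ?normr1//; ring.
    by apply: Ds_chi_lower => // n; rewrite cn1.
  have Q1 : 1 <= 130 :> R by lra.
  have c00 : 0 < 1 / 4 :> R by lra.
  have c01 : 1 / 4 <= 1 :> R by lra.
  have b2 := log_bound Q1 c00 c01 c0 hG Gc FQ Fc s12 s2; rewrite -/C1 in b2.
  have b3 : 3 * (C1 + 4 * Num.sqrt (cn s)) / (Re s - 2^-1) <= 12 * (2 * C1 + 4) * Num.sqrt (cn s).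
    apply: (@le_trans _ _ (3 * (C1 + 4 * Num.sqrt (cn s)) * 4)).
      rewrite ler_wpM2l ?mulr_ge0 ?addr_ge0 ?mulr_ge0//.
      rewrite -[leRHS]invrK lef_pV2 ?posrE ?subr_gt0//; lra.
    move: (Num.sqrt _) sq sq0 => m sq sq0; nra.
  have b4 : cn (P (pt 2 (Im s)) - P (pt (Re s) (Im s))) <= 82 * Num.sqrt (cn s) * (2 - Re s).
    apply: (@horizontal_le R P (fun z => zreg z - 1)) => // t /andP[t1 t2].
      by apply: dP; rewrite /HP /=; lra.
    apply: le_trans (cn_subD _ _) _; rewrite cn1.
    have t3 : 3 / 4 <= Re (pt t (Im s)) by rewrite /=; lra.
    have := zreg_le_sqrt t3; set m := cn (pt t (Im s)).
    have m4 : Num.sqrt m <= 2 * Num.sqrt (cn s).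
      have -> : 2 * Num.sqrt (cn s) = Num.sqrt (4 * cn s).
        by rewrite sqrtrM// (_ : 4 = 2 ^+ 2) ?sqrtr_sqr ?ger0_norm// expr2; lra.
      rewrite ler_sqrt ?mulr_ge0 ?cn_ge0// /m.
      have -> : pt t (Im s) = s + (t - Re s)%:C.
        by apply: complexP; rewrite /= ?addr0//; case: (s) => ? ? /=; ring.
      apply: le_trans (cnD _ _) _; rewrite cn_real ger0_norm ?subr_ge0//; lra.
    by lra.
  have sE : pt (Re s) (Im s) = s by case: (s).
  rewrite sE in b4.
  have -> : f s = f (pt 2 (Im s)) + 2^-1 * ((G s - G (pt 2 (Im s))) - (P (pt 2 (Im s)) - P s)).
    by rewrite /f; ring.
  apply: (le_trans (cnD _ _)).
  have b5 : cn (2^-1 * ((G s - G (pt 2 (Im s))) - (P (pt 2 (Im s)) - P s))) <=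
      2^-1 * (3 * (C1 + 4 * Num.sqrt (cn s)) / (Re s - 2^-1) + 82 * Num.sqrt (cn s) * (2 - Re s)).
    rewrite cnM cnV cn_nat ler_wpM2l ?invr_ge0//.
    by apply: (le_trans (cn_subD _ _)); exact: lerD.
  have b6 : 82 * Num.sqrt (cn s) * (2 - Re s) <= 82 * Num.sqrt (cn s) * 2.
    by rewrite ler_wpM2l ?mulr_ge0//; lra.
  have b7 : 0 <= C1 * Num.sqrt (cn s) by rewrite mulr_ge0.
  by rewrite /A; lra.
exists (10 * A + 1); first by rewrite ltr_wpDl ?mulr_ge0.
move=> X N X1 XN.
have x1 : 2^-1 < 3 / 4 :> R by lra.
have x2 : 3 / 4 <= 1 :> R by lra.
have := perron pntc_le1 hf fS x1 x2 A0 fA X1 XN.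
have -> : \sum_(0 <= k < N) pntc k.+1 * (Num.max 0 (ln X - ln k.+1%:R))%:C =
   (2^-1 * \sum_(0 <= k < N) pnt_coef k.+1 * Num.max 0 (ln X - ln k.+1%:R))%:C.
  rewrite mulr_sumr (big_morph _ (@realcD R) (erefl : 0%:C = 0)); apply: eq_bigr => k _.
  by rewrite /pntc -realcM; congr (_%:C); ring.
rewrite cn_real normrM ger0_norm ?invr_ge0//; have := expR_ge0 (3 / 4 * ln X : R).
by move: (expR _) => e e0 h; rewrite mulrDl mul1r; lra.
Qed.

End GRH.
End LogBounds.

(** * The prime number theorem and Mertens' bound *)

Section PrimeNumberTheorem.
Variable R : realType.

Lemma pow_exp k (a : R) : 0 < a -> exists2 C : R, 0 < C &
  forall l : R, 0 <= l -> l ^+ k <= C * expR (a * l).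
Proof.
move=> a0; case: k => [|k].
  exists 1 => // l l0; rewrite expr0 mul1r -[X in X <= _]expR0 ler_expR.
  by apply: mulr_ge0 => //; exact: ltW.
have k0 : 0 < k.+1%:R :> R by [].
exists ((k.+1%:R / a) ^+ k.+1); first by rewrite exprn_gt0// divr_gt0.
move=> l l0; have -> : expR (a * l) = expR (a * l / k.+1%:R) ^+ k.+1.
  by rewrite -expRM_natl [k.+1%:R * _]mulrC divfK// gt_eqF.
have ka : 0 <= k.+1%:R / a by rewrite divr_ge0// ltW.
rewrite -exprMn ler_pXn2r ?nnegrE//; last by rewrite mulr_ge0 ?expR_ge0.
have -> : k.+1%:R / a * expR (a * l / k.+1%:R) = l + k.+1%:R / a * (expR (a * l / k.+1%:R) - a * l / k.+1%:R).
  by field; rewrite !gt_eqF.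
rewrite lerDl mulr_ge0// subr_ge0; move: (_ / _) => x.
by have := expR_ge1Dx x; lra.
Qed.

(** A cutoff equal to 1 up to e^u, to 0 beyond e^(u+d), and linear in log n between. It is a
    difference quotient of two Perron weights, which brings unweighted sums within reach. *)
Definition ramp (u d : R) (n : nat) : R :=
  (Num.max 0 (u + d - ln n%:R) - Num.max 0 (u - ln n%:R)) / d.

Lemma ramp_itv u d n : 0 < d -> 0 <= ramp u d n <= 1.
Proof.
move=> d0; rewrite /ramp divr_ge0 ?(ltW d0)//=; last first.
  by rewrite subr_ge0 ge_max !le_max lexx lerD2r lerDl (ltW d0) !orbT.
rewrite ler_pdivrMr// mul1r lerBlDr ge_max addr_ge0 ?(ltW d0) ?le_max ?lexx//=.
by rewrite -lerBlDl le_max; apply/orP; right; lra.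
Qed.

Lemma ramp1 u d n : 0 < d -> ln n%:R <= u -> ramp u d n = 1.
Proof.
move=> d0 nu; rewrite /ramp !max_r ?subr_ge0//; last by rewrite (le_trans nu)// lerDl ltW.
by rewrite (_ : _ - _ = d) ?divff ?gt_eqF//; ring.
Qed.

Lemma ramp0 u d n : 0 < d -> u + d <= ln n%:R -> ramp u d n = 0.
Proof.
move=> d0 nu; rewrite /ramp !max_l ?subr_le0 ?subrr ?mul0r//.
by rewrite (le_trans _ nu)// lerDl ltW.
Qed.

Lemma expR_sub1_le (d : R) : 0 <= d -> d <= 2^-1 -> expR d - 1 <= 2 * d.
Proof.
move=> d0 d2; have h := @expR_ge1Dx R (- d); rewrite expRN in h.
have e0 := expR_gt0 d; have : (1 - d) * expR d <= 1.
  by have := ler_wpM2r (ltW e0) h; rewrite mulVf ?gt_eqF.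
nra.
Qed.

Lemma sum_ind_le (P : pred nat) N M : (N <= M)%N ->
  \sum_(N <= k < M) (P k)%:R <= (M%:R - N%:R : R).
Proof.
move=> NM; rewrite -natrB// (@le_trans _ _ (\sum_(N <= k < M) 1))//.
  by apply: ler_sum => k _; case: (P k).
by rewrite sumr_const_nat.
Qed.

Lemma count_lt (Y : R) N M : N%:R <= Y ->
  \sum_(N <= k < M) ((k.+1%:R : R) < Y)%R%:R <= Y - N%:R.
Proof.
move=> NY; elim: M => [|M IH]; first by rewrite big_geq// subr_ge0.
have [NM|NM] := leqP N M; last by rewrite big_geq// subr_ge0.
have [MY|MY] := ltP (M.+1%:R : R) Y.
  by apply: (le_trans (sum_ind_le _ (leqW NM))); rewrite lerD2r ltW.
by rewrite big_nat_recr//= ltNge MY addr0.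
Qed.

Lemma ramp_tail (N M : nat) (d : R) : (0 < N)%N -> 0 < d -> d <= 2^-1 ->
  \sum_(N <= k < M) ramp (ln N%:R) d k.+1 <= 2 * d * N%:R.
Proof.
move=> N0 d0 d2; have NR : 0 < N%:R :> R by rewrite ltr0n.
pose Y := N%:R * expR d.
have NY : N%:R <= Y by rewrite ler_peMr ?(ltW NR)// -[X in X <= _]expR0 ler_expR ltW.
apply: (@le_trans _ _ (Y - N%:R)); last first.
  rewrite /Y -[X in _ - X]mulr1 -mulrBr mulrC ler_wpM2r ?(ltW NR)//.
  by apply: expR_sub1_le => //; exact: ltW.
apply: (le_trans _ (count_lt M NY)); apply: ler_sum => k _.
have [kY|Yk] := ltP (k.+1%:R : R) Y; first by have /andP[] := ramp_itv (ln N%:R) k.+1 d0.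
rewrite ramp0//; have -> : ln N%:R + d = ln Y by rewrite /Y lnM ?posrE ?expR_gt0// expRK.
by rewrite ler_ln ?posrE// (lt_le_trans NR).
Qed.

Lemma ramp_sum (a : nat -> R) u d N : 0 < d ->
  \sum_(0 <= k < N) a k.+1 * ramp u d k.+1 =
  (\sum_(0 <= k < N) a k.+1 * Num.max 0 (u + d - ln k.+1%:R)
   - \sum_(0 <= k < N) a k.+1 * Num.max 0 (u - ln k.+1%:R)) / d.
Proof.
by move=> d0; rewrite -sumrB mulr_suml; apply: eq_bigr => k _; rewrite /ramp; ring.
Qed.

Lemma pnt_coef_sum : generalized_riemann_hypothesis R -> exists2 K : R, 0 < K &
  forall N, (0 < N)%N -> `|\sum_(0 <= k < N) pnt_coef R k.+1| <= K * expR (7 / 8 * ln N%:R).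
Proof.
move=> grh; have [K K0 HK] := pnt_smooth grh.
exists (6 * K + 2); first by rewrite ltr_wpDl// mulr_ge0// ltW.
move=> N N0; have NR : 0 < N%:R :> R by rewrite ltr0n.
pose l : R := ln N%:R; have l0 : 0 <= l by rewrite ln_nat_ge0.
(* The width N^(-1/8)/2 balances the Perron error N^(3/4)/d against the transition range of length
   about d N: both become N^(7/8). *)
pose d : R := expR (- (l / 8)) / 2.
have e1 : expR (- (l / 8)) <= 1 by rewrite -[leRHS]expR0 ler_expR oppr_le0 divr_ge0.
have ep := expR_gt0 (- (l / 8)).
have d0 : 0 < d by rewrite divr_gt0.
have d2 : d <= 2^-1 by rewrite /d; lra.
have ed2 : expR d <= 2 by have := expR_sub1_le (ltW d0) d2; lra.
have X1 : 1 <= N%:R :> R by rewrite ler1n.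
have XN : N%:R <= (2 * N)%:R :> R by rewrite ler_nat leq_pmull.
have h1 := HK _ _ X1 XN.
have Y1 : 1 <= N%:R * expR d.
  by rewrite (le_trans X1)// ler_peMr ?(ltW NR)// -[X in X <= _]expR0 ler_expR ltW.
have YN : N%:R * expR d <= (2 * N)%:R by rewrite natrM mulrC ler_wpM2r ?(ltW NR).
have h2 := HK _ _ Y1 YN.
have lY : ln (N%:R * expR d) = l + d by rewrite lnM ?posrE ?expR_gt0// expRK.
rewrite lY in h2; rewrite -/l in h1.
have rs := ramp_sum (pnt_coef R) l (2 * N) d0.
have NN : (N <= 2 * N)%N by rewrite leq_pmull.
have E : \sum_(0 <= k < 2 * N) pnt_coef R k.+1 * ramp l d k.+1 =
   \sum_(0 <= k < N) pnt_coef R k.+1 + \sum_(N <= k < 2 * N) pnt_coef R k.+1 * ramp l d k.+1.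
  rewrite (big_cat_nat (leq0n N) NN) /=; congr (_ + _).
  apply: eq_big_nat => k /andP[_ kN]; rewrite ramp1 ?mulr1//.
  by rewrite ler_ln ?posrE// ler_nat.
have t1 : `|\sum_(N <= k < 2 * N) pnt_coef R k.+1 * ramp l d k.+1| <= 2 * (2 * d * N%:R).
  rewrite (le_trans (ler_norm_sum _ _ _))// (@le_trans _ _ (\sum_(N <= k < 2 * N) 2 * ramp l d k.+1))//.
    apply: ler_sum => k _; have /andP[r0 _] := ramp_itv l k.+1 d0.
    by rewrite normrM [X in _ * X]ger0_norm// ler_wpM2r// pnt_coef_le.
  by rewrite -mulr_sumr ler_wpM2l// ramp_tail.
have Np : N%:R = expR l by rewrite lnK.
have t2 : `|\sum_(0 <= k < 2 * N) pnt_coef R k.+1 * ramp l d k.+1| <= 6 * K * expR (7 / 8 * l).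
  rewrite rs normrM normfV [`|d|]gtr0_norm// ler_pdivrMr//.
  have -> : 6 * K * expR (7 / 8 * l) * d = 3 * K * expR (3 / 4 * l).
    rewrite /d (_ : 7 / 8 * l = 3 / 4 * l + l / 8); last by field.
    by rewrite expRD expRN; field; rewrite gt_eqF// expR_gt0.
  apply: (le_trans (ler_normB _ _)).
  have : expR (3 / 4 * (l + d)) <= 2 * expR (3 / 4 * l).
    rewrite mulrDr expRD mulrC ler_wpM2r ?expR_ge0// (le_trans _ ed2)// ler_expR; lra.
  move=> h3; have := ler_wpM2l (ltW K0) h3; lra.
have -> : \sum_(0 <= k < N) pnt_coef R k.+1 = \sum_(0 <= k < 2 * N) pnt_coef R k.+1 * ramp l d k.+1
   - \sum_(N <= k < 2 * N) pnt_coef R k.+1 * ramp l d k.+1 by rewrite E addrK.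
rewrite (le_trans (ler_normB _ _))// mulrDl lerD//; apply: (le_trans t1).
rewrite -/l Np /d le_eqVlt; apply/orP; left; apply/eqP.
have -> : 2 * (2 * (expR (- (l / 8)) / 2) * expR l) = 2 * (expR (- (l / 8)) * expR l) by field.
by rewrite -expRD; congr (_ * expR _); field.
Qed.

Lemma sum_inv_sqrt N : \sum_(0 <= k < N) (Num.sqrt k.+1%:R)^-1 <= 2 * Num.sqrt N%:R :> R.
Proof.
elim: N => [|N IH]; first by rewrite big_geq// mulr_ge0 ?sqrtr_ge0.
rewrite big_nat_recr//= (le_trans (lerD IH (lexx _)))//.
have a0 := sqrtr_ge0 (N%:R : R); have b0 : 0 < Num.sqrt N.+1%:R :> R by rewrite sqrtr_gt0.
have aa : Num.sqrt N%:R ^+ 2 = N%:R :> R by rewrite sqr_sqrtr.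
have bb : Num.sqrt N.+1%:R ^+ 2 = N%:R + 1 :> R by rewrite sqr_sqrtr// natr1.
move: (Num.sqrt N%:R) (Num.sqrt N.+1%:R) a0 b0 aa bb => a b a0 b0 aa bb.
rewrite -lerBrDl -[leLHS]mul1r ler_pdivrMr//.
have : (b - a) ^+ 2 >= 0 by exact: sqr_ge0.
rewrite sqrrB; nra.
Qed.

Lemma sqrt_succ_sub (a b : R) : 1 <= a -> 0 < b -> b ^+ 2 = a ^+ 2 + 1 ->
  (a ^+ 2)^-1 <= 3 * b - 3 * a.
Proof.
move=> a1 b0 bb; have a0 : 0 < a by lra.
have aa := exprn_ege1 2 a1.
have ab : b <= 2 * a by rewrite -ler_sqr ?nnegrE ?mulr_ge0 ?(ltW b0) ?(ltW a0)// exprMn bb; lra.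
rewrite -[leLHS]mul1r ler_pdivrMr ?exprn_gt0// -mulrBr.
have h : (b - a) * (b + a) = 1 by rewrite -subr_sqr bb; ring.
have ba : a < b by nra.
by rewrite -[leLHS]h expr2; nra.
Qed.

(** Induction: the increment (N+1) log((N+2)/(N+1)) lies between 1 - 1/(N+1) and 1, and the
    accumulated losses are covered by 3 sqrt(N). *)
Lemma stirling N : (0 < N)%N ->
  N%:R - 3 * Num.sqrt N%:R <= (\sum_(0 <= k < N) (ln N%:R - ln k.+1%:R) : R) <= N%:R.
Proof.
elim: N => // -[|N] IH _.
  by rewrite big_nat1 subrr sqrtr1; apply/andP; split; lra.
have {IH}/andP[h1 h2] := IH isT.
have E : \sum_(0 <= k < N.+2) (ln N.+2%:R - ln k.+1%:R) =
   \sum_(0 <= k < N.+1) (ln N.+1%:R - ln k.+1%:R) + N.+1%:R * zlam R N.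
  rewrite big_nat_recr//= subrr addr0.
  rewrite (_ : N.+1%:R * _ = \sum_(0 <= k < N.+1) zlam R N); last first.
    by rewrite sumr_const_nat subn0 mulr_natl.
  by rewrite -big_split /=; apply: eq_bigr => k _; rewrite /zlam; ring.
have /andP[l0 l1] := zlam_inv R N; have l2 := zlam_lower R N.
have n0 : 0 < N.+1%:R :> R by [].
have m1 : N.+1%:R * zlam R N <= 1 by rewrite mulrC -ler_pdivlMr// div1r.
have m2 : 1 - N.+1%:R^-1 <= N.+1%:R * zlam R N.
  have := ler_wpM2l (ltW n0) l2; rewrite mulrBr mulfV ?gt_eqF//.
  have -> : N.+1%:R * (N.+1%:R ^+ 2)^-1 = N.+1%:R^-1 :> R by field; rewrite gt_eqF.
  by rewrite lerBlDr addrC -lerBlDr.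
have a0 : 0 < Num.sqrt N.+1%:R :> R by rewrite sqrtr_gt0.
have b0 : 0 < Num.sqrt N.+2%:R :> R by rewrite sqrtr_gt0.
have aa : Num.sqrt N.+1%:R ^+ 2 = N.+1%:R :> R by rewrite sqr_sqrtr.
have bb : Num.sqrt N.+2%:R ^+ 2 = N.+1%:R + 1 :> R by rewrite sqr_sqrtr// natr1.
have a1 : 1 <= Num.sqrt N.+1%:R :> R by rewrite -[X in X <= _]sqrtr1 ler_sqrt// ler1n.
rewrite -aa in bb; have := sqrt_succ_sub a1 b0 bb; rewrite {1}aa => key.
rewrite E; move: key h1 h2 m1 m2.
move: (Num.sqrt N.+2%:R) (Num.sqrt N.+1%:R) (\sum_(0 <= k < N.+1) _) (N.+1%:R * zlam R N) => b a S z.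
rewrite -[N.+2%:R]natr1; move: (N.+1%:R^-1 : R) (N.+1%:R : R) => i n *.
by apply/andP; split; lra.
Qed.

(** With l = log N and v = l - log n, one has 1/log n = 1/l + v/l^2 + v^2/(l^2 log n). Stirling's
    formula evaluates the sum of v, and the last sum is split at log n = l/2. *)
Lemma li_sum : exists2 C : R, 0 < C & forall N, (1 < N)%N ->
  `|\sum_(0 <= k < N) (ln k.+1%:R)^-1 - N%:R / ln N%:R - N%:R / ln N%:R ^+ 2|
   <= C * (N%:R / ln N%:R ^+ 3).
Proof.
have q4 : 0 < 4^-1 :> R by rewrite invr_gt0.
have [C3 C30 H3] := pow_exp 3 q4.
exists (64 + 32 * C3); first by rewrite ltr_wpDr// mulr_ge0// ltW.
move=> N N1; have N0 := ltnW N1; have NR : 0 < N%:R :> R by rewrite ltr0n.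
set l : R := ln N%:R.
have lh : 2^-1 < l by rewrite (lt_le_trans (@ln2_gt R))// ler_ln ?posrE// ler_nat.
have l0 : 0 < l by lra.
have Np : N%:R = expR l by rewrite lnK.
pose v k : R := l - ln k.+1%:R.
have v0 k : (k < N)%N -> 0 <= v k by move=> kN; rewrite subr_ge0 ler_ln ?posrE// ler_nat.
(* The correction -2/l belongs to n = 1: there the inverse of ln 1 is 0, whereas 1/l + v/l^2 equals
   2/l. *)
have sE : \sum_(0 <= k < N) (ln k.+1%:R)^-1 = N%:R / l + (\sum_(0 <= k < N) v k) / l ^+ 2 - 2 / l
   + (\sum_(1 <= k < N) v k ^+ 2 / ln k.+1%:R) / l ^+ 2.
  have -> : N%:R / l + (\sum_(0 <= k < N) v k) / l ^+ 2 = \sum_(0 <= k < N) (l^-1 + v k / l ^+ 2).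
    by rewrite [in RHS]big_split /= -mulr_suml sumr_const_nat subn0 -[in RHS]mulr_natl.
  rewrite !(big_ltn N0) ln1 invr0 add0r {1}/v ln1 subr0.
  have -> : l^-1 + l / l ^+ 2 = 2 / l by field; rewrite gt_eqF.
  rewrite [2 / l + _]addrC addrK mulr_suml -big_split /=; apply: eq_big_nat => k /andP[k1 kN].
  have k0 : 0 < ln k.+1%:R :> R by rewrite ln_gt0// ltr1n.
  by rewrite /v; field; rewrite !gt_eqF.
have /andP[st1 st2] := stirling N0; rewrite -/l in st1 st2.
have q0 := expR_gt0 (l / 4); have sN : Num.sqrt N%:R = expR (l / 2) by rewrite -expR_half.
have qq : expR (l / 2) = expR (l / 4) * expR (l / 4) by rewrite -expRD; congr expR; field.
have NE : N%:R = expR (l / 2) * expR (l / 2) by rewrite Np -expRD; congr expR; field.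
have r1 : \sum_(1 <= k < N) v k ^+ 2 / ln k.+1%:R <=
    (32 * expR (l / 2) / l + 2 * l ^+ 2 * expR (l / 4)) * (2 * expR (l / 2)).
  have A0 : 0 <= 32 * expR (l / 2) / l + 2 * l ^+ 2 * expR (l / 4).
    by rewrite addr_ge0// ?divr_ge0 ?mulr_ge0 ?expR_ge0 ?sqr_ge0 ?ltW.
  apply: (@le_trans _ _ (\sum_(0 <= k < N)
     (32 * expR (l / 2) / l + 2 * l ^+ 2 * expR (l / 4)) * (Num.sqrt k.+1%:R)^-1)); last first.
    by rewrite -mulr_sumr ler_wpM2l// -sN sum_inv_sqrt.
  rewrite [leRHS](big_ltn N0) -[leLHS]add0r lerD//; first by rewrite mulr_ge0// invr_ge0 sqrtr_ge0.
  apply: ler_sum_nat => k /andP[k1 kN].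
  have k0 : 2^-1 < ln k.+1%:R :> R by rewrite (lt_le_trans (@ln2_gt R))// ler_ln ?posrE// ler_nat.
  have k0' : 0 < ln k.+1%:R :> R by lra.
  have sk : (Num.sqrt k.+1%:R)^-1 = expR (- (ln k.+1%:R / 2)) :> R by rewrite -expR_half// expRN.
  have s0 : 0 < (Num.sqrt k.+1%:R)^-1 :> R by rewrite invr_gt0 sqrtr_gt0.
  have vk := v0 _ kN.
  rewrite mulrDl; have [lk|lk] := leP (l / 2) (ln k.+1%:R).
    apply: (@le_trans _ _ (32 * expR (l / 2) / l * (Num.sqrt k.+1%:R)^-1)); last first.
      by rewrite lerDl !mulr_ge0 ?expR_ge0 ?(ltW l0) ?(ltW s0).
    have v16 : v k ^+ 2 <= 16 * (expR (l / 2) * (Num.sqrt k.+1%:R)^-1).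
      rewrite sk -expRD (_ : l / 2 - _ = v k / 4 + v k / 4); last by rewrite /v; field.
      rewrite expRD; have := expR_ge1Dx (v k / 4); move: (expR _) => e.
      by rewrite expr2; nra.
    rewrite ler_pdivrMr//; apply: (le_trans v16).
    have w0 : 0 <= expR (l / 2) * (Num.sqrt k.+1%:R)^-1 by rewrite mulr_ge0 ?expR_ge0 ?(ltW s0).
    have -> : 32 * expR (l / 2) / l * (Num.sqrt k.+1%:R)^-1 * ln k.+1%:R =
      expR (l / 2) * (Num.sqrt k.+1%:R)^-1 * (32 * (ln k.+1%:R / l)) by ring.
    rewrite mulrC ler_wpM2l//.
    have : 2^-1 <= ln k.+1%:R / l by rewrite ler_pdivlMr//; lra.
    lra.
  apply: (@le_trans _ _ (2 * l ^+ 2 * expR (l / 4) * (Num.sqrt k.+1%:R)^-1)); last first.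
    by rewrite lerDr !mulr_ge0 ?invr_ge0 ?expR_ge0 ?(ltW l0) ?sqrtr_ge0.
  have e1 : 1 <= expR (l / 4) * (Num.sqrt k.+1%:R)^-1.
    by rewrite sk -expRD -[X in X <= _]expR0 ler_expR; lra.
  rewrite -mulrA; apply: (@le_trans _ _ (2 * l ^+ 2)).
    rewrite mulrC; apply: ler_pM; rewrite ?sqr_ge0 ?invr_ge0 ?(ltW k0')//.
      by rewrite -[leRHS]invrK lef_pV2 ?posrE// ?invr_gt0// ltW.
    by rewrite ler_pXn2r ?nnegrE ?(ltW l0)// gerBl ltW.
  by rewrite ler_peMr// mulr_ge0 ?sqr_ge0.
have r0 : 0 <= \sum_(1 <= k < N) v k ^+ 2 / ln k.+1%:R.
  by rewrite sumr_ge0// => k _; rewrite divr_ge0 ?sqr_ge0// ln_nat_ge0.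
rewrite sE; set V := \sum_(0 <= k < N) v k; set W := \sum_(1 <= k < N) _ in r0 r1 *.
have -> : N%:R / l + V / l ^+ 2 - 2 / l + W / l ^+ 2 - N%:R / l - N%:R / l ^+ 2 =
   ((V - N%:R) - 2 * l + W) / l ^+ 2 by field; rewrite gt_eqF.
have -> : (64 + 32 * C3) * (N%:R / l ^+ 3) = ((64 + 32 * C3) * (N%:R / l)) / l ^+ 2.
  by field; rewrite gt_eqF.
rewrite normrM [`|(l ^+ 2)^-1|]ger0_norm ?invr_ge0 ?sqr_ge0// ler_wpM2r ?invr_ge0 ?sqr_ge0//.
have c3 := H3 _ (ltW l0).
have e1 : 1 <= expR (l / 4) by rewrite -[X in X <= _]expR0 ler_expR divr_ge0// ltW.
have eE : 4^-1 * l = l / 4 by rewrite mulrC.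
rewrite eE in c3.
have Wb : W <= 64 * (N%:R / l) + 4 * C3 * (N%:R / l).
  apply: (le_trans r1).
  have -> : (32 * expR (l / 2) / l + 2 * l ^+ 2 * expR (l / 4)) * (2 * expR (l / 2)) =
     64 * (N%:R / l) + 4 * (l ^+ 3 * expR (l / 4) * expR (l / 2)) / l.
    by rewrite NE; field; rewrite gt_eqF.
  rewrite lerD2l [leRHS]mulrA ler_wpM2r ?invr_ge0 ?(ltW l0)//.
  suff : l ^+ 3 * expR (l / 4) * expR (l / 2) <= C3 * N%:R by lra.
  rewrite NE [leRHS]mulrA ler_wpM2r ?expR_ge0// [in leRHS]qq [leRHS]mulrA ler_wpM2r ?expR_ge0//.
have Lb : 3 * expR (l / 2) + 2 * l <= 28 * C3 * (N%:R / l).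
  rewrite mulrA ler_pdivlMr//.
  have h1 : l ^+ 3 * expR (l / 2) <= C3 * N%:R.
    rewrite NE mulrA ler_wpM2r ?expR_ge0// (le_trans c3)// ler_wpM2l ?(ltW C30)// qq.
    by rewrite ler_peMr ?(ltW q0).
  have h2 : l <= 2 * expR (l / 2) by have := expR_ge1Dx (l / 2); lra.
  have h3 : l <= 4 * l ^+ 3.
    have : 1 <= 4 * l ^+ 2 by rewrite expr2; nra.
    by move=> ?; rewrite exprS; nra.
  have h4 : (3 * expR (l / 2) + 2 * l) * l <= 7 * expR (l / 2) * (4 * l ^+ 3).
    apply: ler_pM; rewrite ?(ltW l0)//; last by lra.
    by rewrite addr_ge0 ?mulr_ge0 ?expR_ge0 ?(ltW l0).
  by lra.
rewrite sN in st1; have N0' : 0 <= N%:R / l by rewrite divr_ge0 ?(ltW NR) ?(ltW l0).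
have := mulr_ge0 (ltW C30) N0'; rewrite -/V in st1 st2.
by rewrite ler_norml => h; apply/andP; split; lra.
Qed.

End PrimeNumberTheorem.

(** * Prime counting, Mertens' upper bound and the size of b/phi(b) *)

Section PrimeCounting.
Variable R : realType.

Definition lw n : R := Lam R n / ln n%:R.
(** The contribution of proper prime powers, which weigh 1/k at p^k. *)
Definition ppw n : R := lw n - (prime n)%:R.

Lemma ln_expn (x : R) n : 0 < x -> ln (x ^+ n) = n%:R * ln x.
Proof. by move=> x0; rewrite lnXn// mulr_natl. Qed.

Lemma ln_prime_gt0 p : prime p -> 0 < ln p%:R :> R.
Proof. by move=> pp; rewrite ln_gt0// ltr1n prime_gt1. Qed.

Lemma ppw_le n : 0 <= ppw n <= ((size (primes n) == 1%N) && ~~ prime n)%:R.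
Proof.
have /andP[l0 l1] := Lam_div_ln_le1 R n.
rewrite /ppw /lw; have [pn|pn] /= := boolP (prime n).
  by rewrite andbF (Lam_prime R pn) divff ?subrr ?lexx// gt_eqF// ln_prime_gt0.
rewrite subr0 andbT l0 /=; case: eqP => //= s1.
by rewrite /Lam; case: (primes n) s1 => [|p [|]]//=; rewrite mul0r.
Qed.

Lemma sum_ind_size (P : pred nat) m n :
  \sum_(m <= k < n) (P k)%:R = (size [seq k <- index_iota m n | P k])%:R :> R.
Proof.
rewrite size_filter -sum1_count natr_sum [RHS]big_mkcond.
by apply: eq_bigr => k _; case: (P k).
Qed.

Lemma nat_sqrt_ex N : exists s, (s * s <= N < s.+1 * s.+1)%N.
Proof.
elim: N => [|N [s /andP[s1 s2]]]; first by exists 0%N.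
have [h|h] := leqP (s.+1 * s.+1) N.+1; last by exists s; rewrite (leqW s1).
by exists s.+1; rewrite h /=; apply: (leq_ltn_trans s2); rewrite ltn_mul.
Qed.

Lemma trunc_log_le_ln N : (0 < N)%N -> (trunc_log 2 N)%:R <= 2 * ln N%:R :> R.
Proof.
move=> N0; have h := trunc_logP (isT : (1 < 2)%N) N0.
have : ln (2 ^ trunc_log 2 N)%:R <= ln N%:R :> R.
  by rewrite ler_ln ?posrE ?ltr0n ?expn_gt0// ler_nat.
rewrite natrX ln_expn//; have := @ln2_gt R.
have : 0 <= (trunc_log 2 N)%:R :> R by [].
move: (ln 2) (_%:R : R) => a t *; nra.
Qed.

(** A proper prime power p^k up to N has p <= sqrt(N) and k <= log_2 N, so these numbers embed in a
    box of pairs. *)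
Lemma ppw_sum_le N : (0 < N)%N ->
  \sum_(0 <= k < N) ppw k.+1 <= (Num.sqrt N%:R + 1) * (2 * ln N%:R + 1).
Proof.
move=> N0; have [s /andP[s1 s2]] := nat_sqrt_ex N; set t := trunc_log 2 N.
apply: (@le_trans _ _ ((s.+1 * t.+1)%N%:R)); last first.
  rewrite natrM -[s.+1%:R]natr1 -[t.+1%:R]natr1; apply: ler_pM; rewrite ?addr_ge0// lerD2r ?trunc_log_le_ln//.
  by rewrite -(ger0_norm (ler0n R s)) -sqrtr_sqr ler_sqrt// -natrX ler_nat expnS expn1.
pose P k := (size (primes k) == 1%N) && ~~ prime k.
apply: (@le_trans _ _ (\sum_(1 <= k < N.+1) (P k)%:R)).
  by rewrite big_add1; apply: ler_sum => k _; have /andP[] := ppw_le k.+1.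
rewrite sum_ind_size ler_nat.
have <- : size [seq (p ^ k)%N | p <- iota 0 s.+1, k <- iota 0 t.+1] = (s.+1 * t.+1)%N.
  by rewrite size_allpairs !size_iota.
apply: uniq_leq_size; first by rewrite filter_uniq// iota_uniq.
move=> n; rewrite mem_filter mem_index_iota ltnS => /andP[/andP[pn1 npn] /andP[n0 nN]].
case E: (primes n) pn1 => [|p [|]]// _.
have [k k0 nE] := primes_prime_power E.
have pp : prime p.
  have : p \in primes n by rewrite E inE.
  by rewrite mem_primes => /and3P[].
have k2 : (1 < k)%N by case: k k0 nE => [|[|]]// _ nE; move: npn; rewrite nE expn1 pp.
apply/allpairsP; exists (p, k); split=> //.
  rewrite mem_iota leq0n add0n [(p, k).1]/= ltnNge; apply/negP => sp; suff : (N < n)%N by rewrite ltnNge nN.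
  apply: (leq_trans s2); apply: (@leq_trans (p * p)); first by rewrite leq_mul.
  by rewrite nE mulnn leq_pexp2l// prime_gt0.
rewrite mem_iota leq0n add0n [(p, k).2]/= ltnS /t; apply: trunc_log_max => //; apply: leq_trans nN.
by rewrite nE leq_exp2r// prime_gt1.
Qed.

(** The count is of primes strictly below N, which suits residues modulo N. *)
Definition ppi N : R := \sum_(0 <= k < N) (prime k)%:R.

Lemma ppi_succ N : \sum_(0 <= k < N) (prime k.+1)%:R = ppi N + (prime N)%:R :> R.
Proof.
rewrite /ppi -[RHS](@big_nat_recr _ _ _ N 0 (fun k => (prime k)%:R))//= [RHS]big_nat_recl//=.
by rewrite add0r.
Qed.

Lemma lw_coef n : lw n = pnt_coef R n + (ln n%:R)^-1.
Proof. by rewrite /lw /pnt_coef mulrBl mul1r subrK. Qed.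

(** Lambda(n)/log n is [pnt_coef n] plus 1/log n: the first part sums to O(N^(7/8)), the second
    gives the two main terms, and prime powers cost about sqrt(N) log N. *)
Theorem pnt : generalized_riemann_hypothesis R -> exists2 C : R, 0 < C & forall N, (1 < N)%N ->
  `|ppi N - N%:R / ln N%:R - N%:R / ln N%:R ^+ 2| <= C * (N%:R / ln N%:R ^+ 3).
Proof.
move=> grh; have [K K0 HK] := pnt_coef_sum grh; have [C1 C10 H1] := li_sum R.
have q8 : 0 < 8^-1 :> R by rewrite invr_gt0.
have [C3 C30 H3] := pow_exp 3 q8.
exists (C1 + (K + 20) * C3); first by rewrite addr_gt0// mulr_gt0//; lra.
move=> N N1; have N0 := ltnW N1; have NR : 0 < N%:R :> R by rewrite ltr0n.
have h1 := H1 _ N1; have h2 := HK _ N0; have h3 := ppw_sum_le N0.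
have h30 : 0 <= \sum_(0 <= k < N) ppw k.+1.
  by apply: sumr_ge0 => k _; have /andP[] := ppw_le k.+1.
set l : R := ln N%:R in h1 h2 h3 *.
have lh : 2^-1 < l by rewrite (lt_le_trans (@ln2_gt R))// ler_ln ?posrE// ler_nat.
have l0 : 0 < l by lra.
have Np : N%:R = expR l by rewrite lnK.
have E : ppi N = \sum_(0 <= k < N) pnt_coef R k.+1 + \sum_(0 <= k < N) (ln k.+1%:R)^-1
   - \sum_(0 <= k < N) ppw k.+1 - (prime N)%:R.
  rewrite -big_split /= -sumrB; apply/eqP; rewrite eq_sym subr_eq -ppi_succ; apply/eqP.
  by apply: eq_bigr => k _; rewrite /ppw -lw_coef; ring.
have e7 : expR (7 / 8 * l) <= C3 * (N%:R / l ^+ 3).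
  rewrite mulrA ler_pdivlMr ?exprn_gt0// (le_trans (ler_wpM2l (expR_ge0 _) (H3 _ (ltW l0))))//.
  by rewrite mulrCA -expRD Np (_ : 7 / 8 * l + 8^-1 * l = l)//; field.
have ep : (Num.sqrt N%:R + 1) * (2 * l + 1) + 1 <= 20 * expR (7 / 8 * l).
  have sN : Num.sqrt N%:R = expR (l / 2) by rewrite -expR_half.
  have e34 : expR (l / 2) * expR (l / 4) <= expR (7 / 8 * l) by rewrite -expRD ler_expR; lra.
  have a1 : 1 <= expR (l / 2) by rewrite -[X in X <= _]expR0 ler_expR; lra.
  have b1 : 1 <= expR (l / 4) by rewrite -[X in X <= _]expR0 ler_expR; lra.
  have b2 : l <= 4 * expR (l / 4) by have := expR_ge1Dx (l / 4); lra.
  rewrite sN; move: (expR (l / 2)) (expR (l / 4)) e34 a1 b1 b2 => a b e34 a1 b1 b2.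
  have : (a + 1) * (2 * l + 1) <= (2 * a) * (9 * b) by apply: ler_pM; lra.
  have : 1 <= a * b by nra.
  lra.
have pN : 0 <= ((prime N)%:R : R) <= 1 by case: (prime N); rewrite ?lexx ?ler01.
have NL : 0 <= N%:R / l ^+ 3 by rewrite divr_ge0 ?exprn_ge0 ?(ltW l0).
have e7K := ler_wpM2l (ltW K0) e7.
rewrite E; move: h1 h2; rewrite !ler_norml => /andP[h1 h1'] /andP[h2 h2'].
by apply/andP; split; lra.
Qed.

Lemma ppi_le_N N : 0 <= ppi N <= N%:R.
Proof.
rewrite /ppi sumr_ge0//= (@le_trans _ _ (\sum_(0 <= k < N) 1))//.
  by apply: ler_sum => k _; case: (prime k).
by rewrite sumr_const_nat subn0.
Qed.

(** Partial summation from an upper bound n/log n + A n/log^2 n for the prime count, compared with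
    the increments of log log n - D/log n. *)
Lemma mertens : generalized_riemann_hypothesis R -> exists B : R, forall N, (1 < N)%N ->
  \sum_(0 <= k < N) (prime k.+1)%:R / k.+1%:R <= ln (ln N%:R) + B.
Proof.
move=> grh; have [C C0 HC] := pnt grh.
pose A := 5 + 2 * C; have A0 : 0 < A by rewrite /A; lra.
pose P n : R := \sum_(0 <= k < n) (prime k.+1)%:R.
have lng n : (1 < n)%N -> 2^-1 < ln n%:R :> R.
  by move=> n1; rewrite (lt_le_trans (@ln2_gt R))// ler_ln ?posrE ?ltr0n ?(ltnW n1)// ler_nat.
have Pb n : (1 < n)%N -> P n <= n%:R / ln n%:R + A * (n%:R / ln n%:R ^+ 2).
  move=> n1; have := HC _ n1; rewrite /P ppi_succ; have lh := lng _ n1; set l : R := ln n%:R in lh *.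
  have nR : 0 < n%:R :> R by rewrite ltr0n ltnW.
  have l0 : 0 < l by lra.
  have l2 : l ^+ 2 <= 4 * n%:R.
    have := ln_le_sqrt nR; rewrite -/l => h.
    rewrite -(sqr_sqrtr (ltW nR)) (_ : 4 * _ = (2 * Num.sqrt n%:R) ^+ 2); last by ring.
    by rewrite ler_pXn2r ?nnegrE ?mulr_ge0 ?sqrtr_ge0 ?(ltW l0).
  have d1 : 1 <= 4 * (n%:R / l ^+ 2) by rewrite mulrA ler_pdivlMr ?exprn_gt0// mul1r.
  have d2 : n%:R / l ^+ 3 <= 2 * (n%:R / l ^+ 2).
    have -> : n%:R / l ^+ 3 = l^-1 * (n%:R / l ^+ 2) by field; rewrite gt_eqF.
    apply: ler_wpM2r; first by rewrite divr_ge0 ?sqr_ge0 ?(ltW nR).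
    by rewrite -[leRHS]invrK lef_pV2 ?posrE ?invr_gt0// ltW.
  have pn : (prime n)%:R <= 1 :> R by case: (prime n).
  have d3 := ler_wpM2l (ltW C0) d2.
  by rewrite ler_norml => /andP[_]; rewrite /A; lra.
(* In the increments of [G], the part 1 pays for replacing log(n+1) by log n, and the part 2A for
   the second-order term of the prime count. *)
pose D := 1 + 2 * A.
pose G n : R := ln (ln n%:R) - D / ln n%:R.
have step n : (1 < n)%N -> P n / (n%:R * n.+1%:R) <= G n.+1 - G n.
  move=> n1; have n0 := ltnW n1; have nR : 0 < n%:R :> R by rewrite ltr0n.
  have l0 : 0 < ln n%:R :> R by have := lng _ n1; lra.
  have l0' : 0 < ln n.+1%:R :> R by have := lng _ (ltnW (n1 : (2 <= n)%N) : (1 < n.+1)%N); lra.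
  have [m nE] : exists m, n = m.+1 by case: (n) n0 => // m _; exists m.
  have lam1 := zlam_le1 R m; have /andP[lam0 lam2] := zlam_inv R m.
  have lam3 : n.+1%:R^-1 <= ln n.+1%:R - ln n%:R :> R.
    rewrite -lerN2 opprB -ln_div ?posrE//.
    have -> : n%:R / n.+1%:R = 1 + - n.+1%:R^-1 :> R.
      by rewrite -[n.+1%:R]natr1; field; rewrite gt_eqF// addr_gt0.
    by rewrite le_ln1Dx// ltrN2 invf_lt1 ?ltr1n// ltnS ltnW.
  have lam4 : ln n.+1%:R - ln n%:R <= 1 :> R by rewrite nE.
  have ll : ln n.+1%:R <= 2 * ln n%:R :> R.
    rewrite -ln_expn// ler_ln ?posrE ?exprn_gt0// -natrX ler_nat.
    by rewrite expnS expn1; case: (n) n1 => [|[|k]]// _; lia.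
  have i0 : 0 < n.+1%:R^-1 :> R by rewrite invr_gt0.
  have h1 : P n / (n%:R * n.+1%:R) <= n.+1%:R^-1 * ((ln n%:R)^-1 + A / ln n%:R ^+ 2).
    rewrite invfM mulrA mulrC; apply: ler_wpM2l; first exact: ltW.
    rewrite ler_pdivrMr//; apply: (le_trans (Pb _ n1)).
    by rewrite le_eqVlt; apply/orP; left; apply/eqP; field; rewrite gt_eqF.
  apply: (le_trans h1).
  have h2 : 1 - ln n%:R / ln n.+1%:R <= ln (ln n.+1%:R) - ln (ln n%:R) :> R.
    rewrite -lerN2 !opprB -ln_div ?posrE//.
    have := @le_ln1Dx R (ln n%:R / ln n.+1%:R - 1); rewrite [1 + _]addrC subrK; apply.
    by rewrite ltrBrDr addNr divr_gt0.
  rewrite /G; move: (ln n.+1%:R) (ln n%:R) (ln (ln n.+1%:R)) (ln (ln n%:R)) (n.+1%:R^-1) l0 l0' lam3 lam4 ll i0 h2.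
  move=> b a lb la i a0 b0 lam3 lam4' ll i0 h2.
  have h3 : i / b <= 1 - a / b.
    by rewrite -[1](divff (lt0r_neq0 b0)) -mulrBl ler_wpM2r ?invr_ge0 ?(ltW b0).
  have ab0 : 0 < a * b by rewrite mulr_gt0.
  have h4 : i / (a * b) <= a^-1 - b^-1.
    have -> : a^-1 - b^-1 = (b - a) / (a * b) by field; rewrite !gt_eqF.
    by rewrite ler_wpM2r// invr_ge0 ltW.
  have h5 : i / a - i / b <= i / (a * b).
    have -> : i / a - i / b = i * (b - a) / (a * b) by field; rewrite !gt_eqF.
    by rewrite ler_wpM2r ?invr_ge0 ?(ltW ab0)// ler_piMr// ltW.
  have h6 : i / a ^+ 2 <= 2 * (i / (a * b)).
    rewrite ler_pdivrMr ?exprn_gt0// (_ : _ * a ^+ 2 = i * (2 * a / b)); last by field; rewrite !gt_eqF.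
    by rewrite ler_peMr ?(ltW i0)// ler_pdivlMr// mul1r.
  have h6' := ler_wpM2l (ltW A0) h6.
  have D0 : 0 <= D by rewrite /D; lra.
  have h4' := ler_wpM2l D0 h4.
  by rewrite mulrDr /D in h4' *; lra.
have abel n : (1 < n)%N -> \sum_(0 <= k < n) (prime k.+1)%:R / k.+1%:R <= P n / n%:R + (G n - G 2%N).
  elim: n => // n IH; rewrite ltnS leq_eqVlt => /orP[/eqP <-|n1].
    by rewrite subrr addr0 /P !big_nat_recr//= !big_geq//= !mul0r !add0r.
  rewrite big_nat_recr//= (le_trans (lerD (IH n1) (lexx _)))//.
  have nR : 0 < n%:R :> R by rewrite ltr0n ltnW.
  have -> : P n.+1 = P n + (prime n.+1)%:R by rewrite /P big_nat_recr.
  have := step _ n1.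
  have -> : P n / (n%:R * n.+1%:R) = P n / n%:R - P n / n.+1%:R.
    by rewrite -[n.+1%:R]natr1; field; rewrite !gt_eqF// addr_gt0.
  by rewrite mulrDl; move: (_ / n.+1%:R) (_ / n.+1%:R) => x y; lra.
exists (2 - G 2%N) => N N1; apply: (le_trans (abel _ N1)).
have NR : 0 < N%:R :> R by rewrite ltr0n ltnW.
have P1 : P N / N%:R <= 2.
  rewrite ler_pdivrMr// /P ppi_succ; have /andP[_] := ppi_le_N N.
  have : (prime N)%:R <= 1 :> R by case: (prime N).
  have : 1 <= N%:R :> R by rewrite ler1n ltnW.
  lra.
have : 0 <= D / ln N%:R by rewrite divr_ge0 ?ln_nat_ge0// /D; lra.
by rewrite {1}/G; lra.
Qed.

Lemma sum_primes_range b (f : nat -> R) : (0 < b)%N ->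
  \sum_(p <- primes b) f p = \sum_(1 <= k < b.+1 | k \in primes b) f k.
Proof.
move=> b0; rewrite -[RHS]big_filter; apply: perm_big; apply: uniq_perm.
- exact: primes_uniq.
- by rewrite filter_uniq// iota_uniq.
move=> p; rewrite mem_filter mem_index_iota; case: (boolP (p \in primes b)) => //=.
by rewrite mem_primes => /and3P[pp _ pb]; rewrite prime_gt0// ltnS dvdn_leq.
Qed.

Lemma size_primes_le b : (0 < b)%N -> (size (primes b) <= trunc_log 2 b)%N.
Proof.
move=> b0; apply: trunc_log_max => //.
rewrite [X in (_ <= X)%N](prod_prime_decomp b0) prime_decompE big_map /=.
have H (s : seq nat) (F : nat -> nat) : (forall p, p \in s -> (1 < F p)%N) ->
    (2 ^ size s <= \prod_(p <- s) F p)%N.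
  elim: s => [|p s IH] sF; first by rewrite big_nil.
  rewrite big_cons expnS leq_mul ?sF ?mem_head ?IH// => x xs.
  by rewrite sF// inE xs orbT.
apply: H => p pb; have := pb; rewrite mem_primes => /and3P[pp _ _].
have l1 : (0 < logn p b)%N by rewrite logn_gt0.
by rewrite -(prednK l1) expnS (leq_trans (prime_gt1 pp))// leq_pmulr// expn_gt0 prime_gt0.
Qed.

Lemma totient_ratio_prod b : (0 < b)%N ->
  b%:R / (totient b)%:R = \prod_(p <- primes b) (p%:R / p.-1%:R) :> R.
Proof.
move=> b0; rewrite totientE// {1}(prod_prime_decomp b0) prime_decompE big_map /=.
rewrite !(big_morph (GRing.natmul (1 : R)) (@natrM R) (mulr1n 1)) -prodf_div /=.
apply: eq_big_seq => p; rewrite mem_primes => /and3P[pp _ pb].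
have lp : (0 < logn p b)%N by rewrite logn_gt0 mem_primes pp b0.
have p0 : p%:R != 0 :> R by rewrite pnatr_eq0 -lt0n prime_gt0.
have p1 : p.-1%:R != 0 :> R by rewrite pnatr_eq0 -lt0n -subn1 subn_gt0 prime_gt1.
rewrite -{1}(prednK lp) natrM !natrX exprS.
by field; rewrite p1 expf_neq0.
Qed.

(** The logarithm of b/phi(b) is at most the sum over p dividing b of 1/(p-1) = 1/p + 1/(p(p-1)).
    With t = log_2 b rounded down, primes up to t fall under Mertens' bound; b has at most t prime
    divisors, so those beyond t add at most 1. *)
Lemma totient_ratio : generalized_riemann_hypothesis R -> exists2 C : R, 0 < C &
  forall b, (16 <= b)%N -> b%:R / (totient b)%:R <= C * ln (ln b%:R) :> R.
Proof.
move=> grh; have [B HB] := mertens grh.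
exists (2 * expR (B + 2)); first by rewrite mulr_gt0 ?expR_gt0.
move=> b b16; have b0 : (0 < b)%N by exact: leq_trans b16.
have bR : 0 < b%:R :> R by rewrite ltr0n.
set t := trunc_log 2 b.
have t2 : (1 < t)%N.
  by apply: trunc_log_max => //; exact: leq_trans b16.
have tR : 0 < t%:R :> R by rewrite ltr0n ltnW.
have L2 : 2 <= ln b%:R :> R.
  have : ln 16%:R <= ln b%:R :> R by rewrite ler_ln ?posrE// ler_nat.
  rewrite (_ : 16%:R = 2 ^+ 4 :> R); last by rewrite -natrX.
  by rewrite ln_expn//; have := @ln2_gt R; lra.
have tL : t%:R <= 2 * ln b%:R :> R by exact: trunc_log_le_ln.
have ltb : ln t%:R <= 2 * ln (ln b%:R) :> R.
  have : ln t%:R <= ln (2 * ln b%:R) :> R by rewrite ler_ln ?posrE// (lt_le_trans tR).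
  rewrite lnM ?posrE//; last by lra.
  have : ln 2 <= ln (ln b%:R) :> R by rewrite ler_ln ?posrE//; lra.
  lra.
have s1 : \sum_(p <- primes b) (p%:R : R)^-1 <= ln (ln t%:R) + B + 1.
  rewrite sum_primes_range//.
  apply: (@le_trans _ _ (\sum_(1 <= k < b.+1) ((prime k && (k < t.+1)%N)%:R / k%:R + (k \in primes b)%:R / t%:R))).
    rewrite big_mkcond; apply: ler_sum_nat => k /andP[k0 kb].
    have a0 : 0 <= (prime k && (k < t.+1)%N)%:R / k%:R :> R by rewrite divr_ge0.
    have kR : 0 < k%:R :> R by rewrite ltr0n.
    case: ifP => [kp|_]; last by rewrite addr_ge0// divr_ge0.
    have -> : prime k by move: kp; rewrite mem_primes => /and3P[].
    case: (ltnP k t.+1) => /= kt; first by rewrite mul1r lerDl divr_ge0.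
    by rewrite mul0r add0r mul1r lef_pV2 ?posrE// ler_nat ltnW.
  rewrite big_split /= lerD//.
    have tb : (t <= b)%N.
      have := trunc_logP (isT : (1 < 2)%N) b0; apply: leq_trans; exact: ltnW (ltn_expl _ _).
    apply: (le_trans _ (HB _ t2)).
    rewrite (big_cat_nat (isT : (1 <= t.+1)%N) (tb : (t.+1 <= b.+1)%N)) /=.
    rewrite [X in _ + X]big_nat_cond [X in _ + X]big1 ?addr0.
      by rewrite big_add1 /=; apply: ler_sum_nat => k /andP[_ kt]; rewrite ltnS kt andbT.
    by move=> k /andP[/andP[tk _] _]; rewrite ltnNge tk andbF mul0r.
  rewrite -mulr_suml ler_pdivrMr// mul1r (sum_ind_size (mem (primes b))) ler_nat.
  rewrite (perm_size (_ : perm_eq _ (primes b))) ?size_primes_le//.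
  apply: uniq_perm; [by rewrite filter_uniq// iota_uniq|exact: primes_uniq|].
  move=> p; rewrite mem_filter /= mem_index_iota; apply/idP/idP => [/andP[]//|pb].
  rewrite pb /=; move: pb; rewrite mem_primes => /and3P[pp _ pb].
  by rewrite prime_gt0//= ltnS dvdn_leq.
have s2 : \sum_(p <- primes b) (p%:R * p.-1%:R : R)^-1 <= 1.
  rewrite sum_primes_range// big_mkcond.
  apply: (@le_trans _ _ (\sum_(1 <= k < b.+1) (if k == 1%N then 0 else (k%:R * k.-1%:R)^-1))).
    apply: ler_sum_nat => k _; case: eqP => [->|_]; last by case: ifP => //; rewrite invr_ge0.
    by rewrite mem_primes.
  have H n : \sum_(1 <= k < n.+2) (if k == 1%N then 0 else (k%:R * k.-1%:R)^-1) <= 1 - n.+1%:R^-1 :> R.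
    elim: n => [|n IH]; first by rewrite big_nat1 /= invr1 subrr.
    rewrite big_nat_recr//= (le_trans (lerD IH (lexx _)))//.
    rewrite -[n.+2%:R]natr1; have : 0 < n.+1%:R :> R by []; move: (n.+1%:R) => x x0.
    rewrite -subr_ge0 (_ : _ - _ = 0)//; field; rewrite !gt_eqF//; lra.
  by case: (b) b0 => // m _; apply: (le_trans (H m)); rewrite gerBl invr_ge0.
rewrite totient_ratio_prod//.
apply: (@le_trans _ _ (\prod_(p <- primes b) expR (p%:R^-1 + (p%:R * p.-1%:R)^-1))).
  rewrite big_seq [leRHS]big_seq; apply: ler_prod => p; rewrite mem_primes => /and3P[pp _ _].
  have p1 : 0 < p.-1%:R :> R by rewrite ltr0n -subn1 subn_gt0 prime_gt1.
  have p0 : p%:R = p.-1%:R + 1 :> R by rewrite natr1 prednK ?prime_gt0.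
  rewrite divr_ge0//= p0; move: (p.-1%:R) p1 => x x0.
  rewrite (_ : (x + 1) / x = 1 + x^-1); last by field; rewrite gt_eqF.
  rewrite (_ : (x + 1)^-1 + _ = x^-1); last by field; rewrite !gt_eqF//; lra.
  exact: expR_ge1Dx.
rewrite -expR_sum big_split /=.
have lt0 : 0 < ln t%:R :> R by rewrite ln_gt0// ltr1n.
apply: (@le_trans _ _ (expR (ln (ln t%:R) + (B + 2)))); first by rewrite ler_expR; lra.
rewrite expRD lnK ?posrE// mulrC [2 * _]mulrC -mulrA ler_wpM2l ?expR_ge0//.
Qed.

End PrimeCounting.

(** * Characters modulo q *)

Module DualGroup.
Import fingroup.fingroup algC cyclotomic classfun character.
Local Open Scope cfun_scope.

(** The kernels of the irreducible characters intersect trivially, and for an abelian group these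
    characters are linear. Their values are recorded as exponents of a primitive root of unity:
    exponents can be carried over from [algC] to R[i]. *)
Lemma separation q (u : {unit 'Z_q}) : u != 1%g ->
  exists e : {unit 'Z_q} -> nat,
    (forall v w, e (v * w)%g = (e v + e w)%N %[mod #|units_Zp q|]) /\
    (e u %% #|units_Zp q| != 0)%N.
Proof.
move=> u1; set G := [group of units_Zp q].
have uG v : v \in G by rewrite inE.
have [i ui] : exists i : Iirr G, u \notin cfker 'chi_i.
  apply/existsP; rewrite -negb_forall; apply: contra u1 => /forallP H.
  have : u \in [1]%g by rewrite -(TI_cfker_irr G); apply/finset.bigcapP => i _; exact: H.
  by rewrite inE.
have lin : 'chi_i \is a linear_char by apply/char_abelianP; exact: units_Zp_abelian.
have cu : 'chi_i u != (1%R : algC).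
  by apply: contra ui; rewrite cfkerEirr inE lin_char1.
have [z prim_z] := C_prim_root_exists (cardG_gt0 G).
have H v : 'chi_i v ^+ #|G| = (1%R : algC).
  have /dvdnP[k ->] := order_dvdG (uG v).
  by rewrite mulnC exprM lin_char_unity_root// expr1n.
pose e v := nat_of_ord (sval (prim_rootP prim_z (H v))).
have eE v : 'chi_i v = z ^+ e v by rewrite /e; case: (prim_rootP prim_z (H v)).
exists e; split.
  move=> v w; apply/eqP; rewrite -(eq_prim_root_expr prim_z) exprD -!eE.
  by rewrite lin_charM.
apply: contra cu => e0; rewrite eE -(expr0 z) (eq_prim_root_expr prim_z) mod0n.
exact: e0.
Qed.

End DualGroup.

Section Characters.
Variable R : realType.
Local Notation C := R[i].
Variables (q : nat) (q1 : (1 < q)%N).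

Let q0 : (0 < q)%N := ltnW q1.
(** The predecessor of phi(q), so that exponents live in ['I_phi1.+1], a cyclic group of order
    phi(q). It is also the exponent for which a^phi1 inverts a modulo q. *)
Definition phi1 := (totient q).-1.

Lemma phi1E : phi1.+1 = totient q.
Proof. by rewrite /phi1 prednK// totient_gt0 ltnW. Qed.

Definition zroot : C := cexp (Complex 0 (2 * pi / phi1.+1%:R)).

Lemma zrootX k : zroot ^+ k = cexp (Complex 0 (k%:R * (2 * pi / phi1.+1%:R))).
Proof.
rewrite /zroot -cexpMn; congr cexp; apply: complexP; rewrite !cpE /=; ring.
Qed.

Lemma zroot_order : zroot ^+ phi1.+1 = 1.
Proof.
rewrite zrootX mulrC divfK ?pnatr_eq0//; apply: complexP; rewrite /= expR0 mul1r.
  by rewrite [2 * pi]mulr_natl cos2pi.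
by rewrite [2 * pi]mulr_natl sin2pi.
Qed.

Lemma zrootX_mod k : zroot ^+ (k %% phi1.+1) = zroot ^+ k.
Proof. by rewrite {2}(divn_eq k phi1.+1) exprD mulnC exprM zroot_order expr1n mul1r. Qed.

Lemma zroot_neq1 k : (0 < k)%N -> (k < phi1.+1)%N -> zroot ^+ k != 1.
Proof.
move=> k0 kN; rewrite zrootX; apply/eqP => /(congr1 (@complex.Re R)); rewrite /= expR0 mul1r.
set t := _ * _; have t0 : 0 < t / 2 < pi.
  have n0 : phi1.+1%:R != 0 :> R by rewrite pnatr_eq0.
  have -> : t / 2 = k%:R / phi1.+1%:R * pi by rewrite /t; move: (phi1.+1%:R) n0 => N n0; field.
  rewrite mulr_gt0 ?divr_gt0 ?ltr0n ?pi_gt0//= -[ltRHS]mul1r ltr_pM2r ?pi_gt0//.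
  by rewrite ltr_pdivrMr// mul1r ltr_nat.
have -> : t = t / 2 + t / 2 by field.
rewrite cosD => h; have := cos2Dsin2 (t / 2); have := sin_gt0_pi t0.
by rewrite !expr2; nra.
Qed.

Definition resid n : 'I_q := Ordinal (ltn_pmod n q0).

(** A character modulo q is encoded by its exponents with respect to [zroot]. Sums over characters
    become sums over a finite type, and products of characters become pointwise addition. *)
Definition expo := {ffun 'I_q -> 'I_phi1.+1}.

(** The value 0 is imposed at residues not prime to q, so that every character has exactly one
    code. *)
Definition ishom (e : expo) := [forall x : 'I_q, if coprime x q then
  [forall y : 'I_q, coprime y q ==> (e (resid (x * y)) == e x + e y)] else e x == 0].

Definition chr (e : expo) (n : nat) : C :=
  if coprime n q then zroot ^+ e (resid n) else 0.

Lemma coprime_resid n : coprime (resid n) q = coprime n q.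
Proof. by rewrite /= coprime_modl. Qed.

Lemma resid_mul m n : resid (resid m * resid n) = resid (m * n).
Proof. by apply: val_inj; rewrite /= modnMm. Qed.

Lemma resid_val (x : 'I_q) : resid x = x.
Proof. by apply: val_inj; rewrite /= modn_small. Qed.

Lemma chr_dch e : ishom e -> @dirichlet_character R q (chr e).
Proof.
move=> /forallP he; split=> [n|m n|n].
- have -> : chr e (n + q) = chr e n; last by [].
  rewrite /chr -coprime_modl modnDr coprime_modl.
  by have -> : resid (n + q) = resid n by apply: val_inj; rewrite /= modnDr.
- rewrite /chr coprimeMl; have [mq|mq] /= := boolP (coprime m q); last by rewrite mul0r.
  have [nq|nq] /= := boolP (coprime n q); last by rewrite mulr0.
  have := he (resid m); rewrite coprime_resid mq => /forallP/(_ (resid n)).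
  rewrite coprime_resid nq resid_mul => /eqP ->.
  by rewrite -exprD /= zrootX_mod.
- rewrite /chr; case: (coprime n q); last by rewrite eqxx.
  by rewrite expf_neq0// cexp_neq0.
Qed.

Lemma ishom0 : ishom 0.
Proof.
apply/forallP => x; case: ifP => _; last by rewrite ffunE.
by apply/forallP => y; apply/implyP => _; rewrite !ffunE addr0.
Qed.

Lemma ishomD e e' : ishom e -> ishom e' -> ishom (e + e').
Proof.
move=> /forallP h /forallP h'; apply/forallP => x; have := h x; have := h' x.
case: ifP => [xq|_]; last by move=> /eqP H /eqP H'; rewrite ffunE H H' addr0.
move=> /forallP H /forallP H'; apply/forallP => y; have := H y; have := H' y.
by case: (coprime y q) => //= /eqP E /eqP E'; rewrite !ffunE E E' addrACA.
Qed.

Lemma ishomN e : ishom e -> ishom (- e).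
Proof.
move=> /forallP h; apply/forallP => x; have := h x.
case: ifP => [xq|_]; last by move=> /eqP H; rewrite ffunE H oppr0.
move=> /forallP H; apply/forallP => y; have := H y.
by case: (coprime y q) => //= /eqP E; rewrite !ffunE E opprD.
Qed.

Lemma chr0 n : coprime n q -> chr 0 n = 1.
Proof. by move=> nq; rewrite /chr nq ffunE expr0. Qed.

Lemma chrD e e' n : chr (e + e') n = chr e n * chr e' n.
Proof.
rewrite /chr; case: ifP => _; last by rewrite mulr0.
by rewrite ffunE -exprD /= zrootX_mod.
Qed.

Lemma chr_np e : ishom e -> e != 0 -> exists2 a, coprime a q & chr e a != 1.
Proof.
move=> /forallP he e0.
have [x ex] : exists x, e x != 0.
  apply/existsP; rewrite -negb_forall; apply: contra e0 => /forallP H.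
  by apply/eqP/ffunP => x; rewrite ffunE; exact/eqP.
exists x; first by have := he x; case: ifP => // _ /eqP E; rewrite E eqxx in ex.
have xq : coprime x q by have := he x; case: ifP => // _ /eqP E; rewrite E eqxx in ex.
rewrite /chr xq resid_val; apply: zroot_neq1; last exact: ltn_ord.
by rewrite lt0n; apply: contra ex => /eqP E; apply/eqP/val_inj.
Qed.

Lemma hom_separation n : coprime n q -> (n %% q != 1)%N -> exists2 e, ishom e & chr e n != 1.
Proof.
move=> nq n1.
have uE x : coprime x q -> ((x%:R : 'Z_q) \is a GRing.unit) by rewrite unitZpE// coprime_sym.
(* Residues not prime to q default to the unit 1; [f] below gives them the exponent 0 instead. *)
pose U (x : nat) : {unit 'Z_q} := insubd (1%g : {unit 'Z_q}) (x%:R : 'Z_q).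
have UE x : coprime x q -> val (U x) = x%:R :> 'Z_q.
  by move=> xq; rewrite val_insubd; have -> := uE _ xq.
have Un : U n != 1%g.
  apply: contra n1 => /eqP /(congr1 val); rewrite UE// => /(congr1 (@nat_of_ord _)).
  by rewrite val_Zp_nat// => ->; rewrite /= modn_small.
have [e [eM en]] := DualGroup.separation Un.
rewrite card_units_Zp// -phi1E in eM en.
pose f : expo := [ffun x : 'I_q => if coprime x q then inZp (e (U x)) else 0].
have UM x y : coprime x q -> coprime y q -> U (resid (x * y)) = (U x * U y)%g.
  move=> xq yq; apply: val_inj; rewrite /= UE ?coprime_resid ?coprimeMl ?xq//.
  by rewrite Zp_nat_mod// natrM -!UE.
exists f.
  apply/forallP => x; case: ifP => xq; last by rewrite ffunE xq.
  apply/forallP => y; apply/implyP => yq; rewrite !ffunE coprime_resid coprimeMl xq yq /=.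
  by apply/eqP/val_inj; rewrite /= UM// modnDm eM.
rewrite /chr nq ffunE coprime_resid nq; apply: zroot_neq1; last exact: ltn_ord.
have -> : U (resid n) = U n by rewrite /U; congr insubd; rewrite /= Zp_nat_mod.
by rewrite lt0n.
Qed.

Definition nhom : nat := #|[pred e : expo | ishom e]|.

(** Translation by a character whose value at n is not 1 permutes the summands and multiplies the
    sum by that value. *)
Lemma sum_chr n : coprime n q ->
  \sum_(e : expo | ishom e) chr e n = if (n %% q == 1)%N then nhom%:R else 0.
Proof.
move=> nq; case: ifPn => n1.
  rewrite (eq_bigr (fun=> 1)) ?sumr_const// => e he.
  rewrite -(chi_modn (chr_dch he)) (eqP n1); exact: chi_1 (chr_dch he).
have [e0 he0 c0] := hom_separation nq n1.
set S := \sum_(_ | _) _; have : S = chr e0 n * S.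
  rewrite /S mulr_sumr [LHS](reindex_inj (addrI e0)); apply: eq_big => e; last by move=> _; rewrite chrD.
  apply/idP/idP => [h|h]; last exact: ishomD.
  by rewrite -(addKr e0 e); apply: ishomD => //; exact: ishomN.
move=> /eqP; rewrite -subr_eq0 -{1}[S]mul1r -mulrBl mulf_eq0 subr_eq0 eq_sym (negPf c0).
by move=> /eqP.
Qed.

Lemma totient_sum : \sum_(0 <= n < q) (coprime n q)%:R = (totient q)%:R :> C.
Proof.
rewrite totient_count_coprime natr_sum; apply: eq_bigr => n _.
by rewrite coprime_sym.
Qed.

(** The sum of all characters over all residues is evaluated in both orders: for fixed n only n = 1
    survives, for fixed character only the principal one. *)
Lemma nhomE : nhom = totient q.
Proof.
apply/eqP; rewrite -(eqr_nat C); apply/eqP.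
pose D := \sum_(e : expo | ishom e) \sum_(0 <= n < q) chr e n.
have D1 : D = nhom%:R.
  rewrite /D exchange_big /= big_mkord (bigD1 (Ordinal q1))//= sum_chr ?coprime1n// modn_small// eqxx.
  rewrite big1 ?addr0// => i i1; have [iq|iq] := boolP (coprime i q).
    by rewrite sum_chr// modn_small// ifN.
  by rewrite big1// => e _; rewrite /chr (negPf iq).
have D2 : D = (totient q)%:R.
  rewrite /D (bigD1 (0 : expo)) ?ishom0//= [X in _ + X]big1 ?addr0.
    rewrite -totient_sum; apply: eq_bigr => n _; rewrite /chr; case: ifP => // _.
    by rewrite ffunE expr0.
  by move=> e /andP[he e0]; apply: sum_period (chr_dch he) _ => //; exact: chr_np.
by rewrite -D1 D2.
Qed.

Lemma inv_mod a : coprime a q -> (a * a ^ phi1 %% q = 1)%N.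
Proof.
move=> aq; rewrite -expnS phi1E; have := Euler_exp_totient aq => ->.
by rewrite modn_small.
Qed.

Lemma coprime_expn_phi1 a : coprime a q -> coprime (a ^ phi1) q.
Proof. by move=> aq; case: phi1 => [|k]; rewrite ?expn0 ?coprime1n// coprimeXl. Qed.

Lemma chr_inv e a : ishom e -> coprime a q -> (chr e a)^-1 = chr e (a ^ phi1).
Proof.
move=> he aq; have d := chr_dch he.
have c0 : chr e a != 0 by case: d => _ _ ->.
apply: (mulfI c0); rewrite mulfV// -(chi_mulr d) -(chi_modn d) inv_mod//.
by rewrite (chi_1 d).
Qed.

Lemma orthogonality n a : coprime a q -> \sum_(e : expo | ishom e) chr e n * (chr e a)^-1 =
  if (n %% q == a %% q)%N then (totient q)%:R else 0.
Proof.
move=> aq; have pq := coprime_expn_phi1 aq.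
have [nq|nq] := boolP (coprime n q); last first.
  rewrite big1 => [|e _]; last by rewrite /chr (negPf nq) mul0r.
  by case: eqP => // E; move: nq; rewrite -coprime_modl E coprime_modl aq.
have -> : \sum_(e : expo | ishom e) chr e n * (chr e a)^-1 = \sum_(e : expo | ishom e) chr e (n * a ^ phi1).
  by apply: eq_bigr => e he; rewrite chr_inv// (chi_mulr (chr_dch he)).
rewrite sum_chr ?coprimeMl ?nq// nhomE.
suff -> : (n * a ^ phi1 %% q == 1)%N = (n %% q == a %% q)%N by [].
apply/eqP/eqP => E.
  have -> : (n %% q = (a * (n * a ^ phi1 %% q)) %% q)%N by rewrite modnMmr mulnCA -modnMmr inv_mod// muln1.
  by rewrite E muln1.
by rewrite -modnMml E modnMml inv_mod.
Qed.

Lemma conjc_chr e a : ishom e -> coprime a q -> (chr e a)^-1 = ((chr e a)^*)%C.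
Proof.
move=> he aq; have c1 := cn_chi q0 (chr_dch he) aq.
have c0 : chr e a != 0 by rewrite -cn_gt0 c1.
apply: (mulfI c0); rewrite mulfV//; apply/esym.
have := sqr_cn (chr e a); rewrite c1 expr1n; case: (chr e a) => x y /= E.
by apply: complexP; rewrite /=; lra.
Qed.

Lemma sqr_cn_conj (z : C) : (cn z ^+ 2)%:C = z * (z^*)%C.
Proof.
by rewrite sqr_cn; case: z => x y; apply: complexP; rewrite /=; ring.
Qed.

Variable A : pred nat.
Hypothesis Aq : forall a, A a -> coprime a q.

Let nA : R := \sum_(0 <= a < q) (A a)%:R.

Definition dualsum e : C := \sum_(0 <= a < q | A a) (chr e a)^-1.

Lemma parseval : \sum_(e : expo | ishom e) cn (dualsum e) ^+ 2 = (totient q)%:R * nA.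
Proof.
suff : (\sum_(e : expo | ishom e) cn (dualsum e) ^+ 2)%:C = ((totient q)%:R * nA)%:C.
  by move=> /(congr1 (@complex.Re R)).
rewrite (big_morph _ (@realcD R) (erefl : 0%:C = 0)).
have -> : \sum_(e : expo | ishom e) (cn (dualsum e) ^+ 2)%:C = \sum_(e : expo | ishom e)
    \sum_(0 <= a < q | A a) \sum_(0 <= b < q | A b) chr e b * (chr e a)^-1.
  apply: eq_bigr => e he; rewrite sqr_cn_conj /dualsum mulr_suml; apply: eq_bigr => a Aa.
  rewrite rmorph_sum mulr_sumr; apply: eq_bigr => b Ab /=.
  by rewrite (conjc_chr he (Aq Ab)) conjcK mulrC.
rewrite exchange_big /= realcM realc_nat /nA (big_morph _ (@realcD R) (erefl : 0%:C = 0)) mulr_sumr.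
rewrite big_mkcond big_nat_cond [RHS]big_nat_cond; apply: eq_bigr => a /andP[/andP[_ aq] _].
case: ifP => Aa; last by rewrite mulr0.
rewrite exchange_big /= mulr1 big_mkcond (bigD1_seq a) ?mem_index_iota ?iota_uniq//= Aa.
rewrite orthogonality ?Aq// eqxx [X in _ + X]big1_seq ?addr0// => b /andP[ba].
rewrite mem_index_iota => /andP[_ bq]; case: ifP => // Ab.
by rewrite orthogonality ?Aq// !modn_small// (negPf ba).
Qed.

Lemma nA_ge0 : 0 <= nA. Proof. by apply: sumr_ge0 => a _. Qed.

Lemma dualsum_sum_le : 0 < nA ->
  \sum_(e : expo | ishom e) cn (dualsum e) <= (totient q)%:R * Num.sqrt nA.
Proof.
move=> n0; set t := Num.sqrt nA; have t0 : 0 < t by rewrite sqrtr_gt0.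
have tt : t ^+ 2 = nA by rewrite sqr_sqrtr// ltW.
(* AM-GM with the optimal weight t *)
apply: (@le_trans _ _ (\sum_(e : expo | ishom e) (t / 2 + cn (dualsum e) ^+ 2 / (2 * t)))).
  apply: ler_sum => e _; rewrite -subr_ge0.
  have -> : t / 2 + cn (dualsum e) ^+ 2 / (2 * t) - cn (dualsum e) = (t - cn (dualsum e)) ^+ 2 / (2 * t).
    by field; rewrite gt_eqF.
  by rewrite divr_ge0 ?sqr_ge0// mulr_ge0// ltW.
have cE : \sum_(e : expo | ishom e) t / 2 = (totient q)%:R * (t / 2) by rewrite sumr_const -nhomE mulr_natl.
rewrite big_split /= cE -mulr_suml parseval -tt.
by rewrite le_eqVlt; apply/orP; left; apply/eqP; field; rewrite gt_eqF.
Qed.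

(** Orthogonality expands the indicator of the classes in A. The principal character is the
    subtracted mean; the others are bounded by M times the sum of |[dualsum]|, for which Parseval
    gives phi(q) sqrt(nA) where the trivial bound would be phi(q) nA. *)
Theorem equidistribution (w : nat -> R) N (M : R) : 0 <= M ->
  (forall e, ishom e -> e != 0 -> cn (\sum_(0 <= k < N) chr e k.+1 * (w k.+1)%:C) <= M) ->
  `|\sum_(0 <= k < N) (A (k.+1 %% q)%N)%:R * w k.+1
    - nA / (totient q)%:R * \sum_(0 <= k < N) (coprime k.+1 q)%:R * w k.+1| <= M * Num.sqrt nA.
Proof.
move=> M0 HM; have phi0 : 0 < (totient q)%:R :> R by rewrite ltr0n totient_gt0.
have [n0|nN] := ltP 0 nA; last first.
  have nA0 : nA = 0 by apply/eqP; rewrite eq_le nN nA_ge0.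
  rewrite nA0 !mul0r subr0 sqrtr0 mulr0 big1 ?normr0// => k _.
  have := ltn_pmod k.+1 q0; move: (k.+1 %% q)%N => a aq.
  case Aa: (A a); last by rewrite mul0r.
  suff : 1 <= nA by rewrite nA0 ler10.
  rewrite /nA (bigD1_seq a) ?mem_index_iota ?iota_uniq//= Aa lerDl.
  by apply: sumr_ge0.
rewrite -(ler_pM2l phi0) -{1}(gtr0_norm phi0) -normrM mulrBr -cn_real.
have -> : ((totient q)%:R * (\sum_(0 <= k < N) (A (k.+1 %% q)%N)%:R * w k.+1) -
   (totient q)%:R * (nA / (totient q)%:R * \sum_(0 <= k < N) (coprime k.+1 q)%:R * w k.+1))%:C =
   \sum_(e : expo | ishom e && (e != 0)) (\sum_(0 <= k < N) chr e k.+1 * (w k.+1)%:C) * dualsum e.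
  have -> : (totient q)%:R * (nA / (totient q)%:R * \sum_(0 <= k < N) (coprime k.+1 q)%:R * w k.+1) =
     nA * \sum_(0 <= k < N) (coprime k.+1 q)%:R * w k.+1 by field; rewrite gt_eqF.
  have E0 : (\sum_(0 <= k < N) chr 0 k.+1 * (w k.+1)%:C) * dualsum 0 =
     (nA * \sum_(0 <= k < N) (coprime k.+1 q)%:R * w k.+1)%:C.
    rewrite realcM mulrC; congr (_ * _).
      rewrite /dualsum /nA (big_morph _ (@realcD R) (erefl : 0%:C = 0)) big_mkcond.
      by apply: eq_bigr => a _; case: ifP => // Aa; rewrite chr0 ?Aq// invr1.
    rewrite (big_morph _ (@realcD R) (erefl : 0%:C = 0)); apply: eq_bigr => k _.
    rewrite realcM; congr (_ * _); rewrite /chr; case: ifP => // _.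
    by rewrite ffunE expr0.
  have Eall : \sum_(e : expo | ishom e) (\sum_(0 <= k < N) chr e k.+1 * (w k.+1)%:C) * dualsum e =
     ((totient q)%:R * \sum_(0 <= k < N) (A (k.+1 %% q)%N)%:R * w k.+1)%:C.
    transitivity (\sum_(0 <= k < N) \sum_(0 <= a < q | A a)
       (w k.+1)%:C * \sum_(e : expo | ishom e) chr e k.+1 * (chr e a)^-1).
      under eq_bigr => e _ do rewrite mulr_suml.
      rewrite exchange_big /=; apply: eq_bigr => k _.
      under eq_bigr => e _ do rewrite /dualsum mulr_sumr.
      rewrite exchange_big /=; apply: eq_bigr => a _.
      by rewrite mulr_sumr; apply: eq_bigr => e _; ring.
    rewrite realcM realc_nat (big_morph _ (@realcD R) (erefl : 0%:C = 0)) mulr_sumr.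
    apply: eq_bigr => k _; have kq := ltn_pmod k.+1 q0; move: kq.
    have H a : (a < q)%N -> A a -> \sum_(e : expo | ishom e) chr e k.+1 * (chr e a)^-1 =
       if (k.+1 %% q == a)%N then (totient q)%:R else 0.
      by move=> aq Aa; rewrite orthogonality ?Aq// (modn_small aq).
    set r := (k.+1 %% q)%N in H * => rq.
    transitivity (\sum_(0 <= a < q) if a == r then (totient q)%:R * ((A r)%:R * w k.+1)%:C else 0).
      rewrite big_mkcond; apply: eq_big_nat => a /andP[_ aq]; case: ifP => Aa.
        rewrite H// [r == a]eq_sym; have [ar|_] := eqVneq a r; last by rewrite mulr0.
        by rewrite -ar Aa mul1r mulrC.
      by case: eqP => // <-; rewrite Aa mul0r mulr0.
    rewrite (bigD1_seq r) ?mem_index_iota ?iota_uniq//= eqxx big1 ?addr0// => a ar.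
    by rewrite (negPf ar).
  rewrite realcD realcN -Eall -E0 (bigD1 (0 : expo)) ?ishom0//= [LHS]addrC addKr.
  by apply: eq_bigl => e; rewrite andbC.
apply: (le_trans (cn_sum _ _ _)).
apply: (@le_trans _ _ (\sum_(e : expo | ishom e && (e != 0)) M * cn (dualsum e))).
  apply: ler_sum => e /andP[he e0]; rewrite cnM ler_wpM2r ?cn_ge0//; exact: HM.
apply: (@le_trans _ _ (\sum_(e : expo | ishom e) M * cn (dualsum e))).
  rewrite [leRHS](bigID (fun e => e != 0)) /= lerDl; apply: sumr_ge0 => e _.
  by rewrite mulr_ge0 ?cn_ge0.
rewrite -mulr_sumr [leRHS]mulrCA ler_wpM2l//; exact: dualsum_sum_le.
Qed.

End Characters.

(** * Correlations of prime residues *)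

Section Correlations.
Variable R : realType.
Local Notation C := R[i].

Lemma sum_blocks (F : nat -> R) q J X : (0 < q)%N -> (q %| X)%N ->
  \sum_(X <= n < X + J * q) F (n %% q)%N = J%:R * \sum_(0 <= a < q) F a.
Proof.
move=> q0 qX; elim: J => [|J IH]; first by rewrite mul0n addn0 big_geq// mul0r.
have h1 : (X <= X + J * q)%N by exact: leq_addr.
have h2 : (X + J * q <= X + J.+1 * q)%N by rewrite leq_add2l leq_mul2r leqnSn orbT.
rewrite (big_cat_nat h1 h2) /= IH -natr1 mulrDl mul1r; congr (_ + _).
rewrite -{1}[(X + J * q)%N]add0n big_addn mulSn addnCA addnK.
apply: eq_big_nat => a /andP[_ aq].
have /dvdnP[c cE] : (q %| X + J * q)%N by rewrite dvdn_add ?dvdn_mull.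
by rewrite cE addnC modnMDl modn_small.
Qed.

Lemma totient_ratio_expn b h : (0 < b)%N -> (0 < h)%N ->
  (b ^ h)%:R / (totient (b ^ h))%:R = b%:R / (totient b)%:R :> R.
Proof.
by move=> b0 h0; rewrite !totient_ratio_prod ?expn_gt0 ?b0// primesX.
Qed.

Lemma count_prime_divisors b N : (0 < b)%N ->
  \sum_(0 <= k < N) (prime k && (k %| b)%N)%:R <= 2 * ln b%:R :> R.
Proof.
move=> b0; rewrite sum_ind_size (le_trans _ (trunc_log_le_ln R b0))// ler_nat.
apply: (leq_trans _ (size_primes_le b0)); apply: uniq_leq_size.
  by rewrite filter_uniq// iota_uniq.
by move=> p; rewrite mem_filter mem_primes b0 /= => /andP[].
Qed.

Definition cprime q a := prime a && coprime a q.

Section Fixed.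
Hypothesis grh : generalized_riemann_hypothesis R.
Variables (q X : nat) (d : R).
Hypotheses (q1 : (1 < q)%N) (qX : (q %| X)%N) (X0 : (0 < X)%N) (d0 : 0 < d) (d2 : d <= 2^-1).
Local Notation u := (@ln R X%:R).
Hypothesis u4 : 4 <= @ln R X%:R.
Local Notation nA := (\sum_(0 <= a < q) @GRing.natmul R 1 (cprime q a)).
Local Notation PP := ((Num.sqrt (2 * X)%:R + 1) * (2 * @ln R (2 * X)%:R + 1)).

Let ed2 : expR d <= 2.
Proof. by have := expR_sub1_le (ltW d0) d2; have := d2; lra. Qed.

Definition weight n : R := lw R n * ramp u d n.

(** The smoothed sum is the difference of the bounds at X e^d and at X, divided by d. The factor 5
    is 4 + 1: u + d <= 2u and sqrt(X e^d) <= 2 sqrt(X). *)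
Lemma char_bound (e : expo q) : ishom q1 e -> e != 0 ->
  cn (\sum_(0 <= j < 2 * X) chr R q1 e j.+1 * (weight j.+1)%:C) <= 5 * 2080 * u ^+ 2 * Num.sqrt X%:R / d.
Proof.
have XR : 0 < X%:R :> R by rewrite ltr0n.
move=> he e0; have dch := chr_dch R he; have np := chr_np R he e0.
have lnq : ln q%:R <= u :> R by rewrite ler_ln ?posrE ?ltr0n ?(ltnW q1)// ler_nat dvdn_leq.
have lnq0 : 0 <= ln q%:R :> R by exact: ln_nat_ge0.
have h1 := @char_sum_bound R grh q (chr R q1 e) X%:R (2 * X) q1 dch np.
have h2 := @char_sum_bound R grh q (chr R q1 e) (X%:R * expR d) (2 * X) q1 dch np.
have K0 := ler0n R 2080.
move: K0 h1 h2; move: 2080%:R => K K0 h1 h2.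
have lY : ln (X%:R * expR d) = u + d by rewrite lnM ?posrE ?expR_gt0// expRK.
rewrite lY in h2; have u2 : 2 <= u by have := u4; lra.
have {}h1 := h1 u2 XR.
have -> : \sum_(0 <= j < 2 * X) chr R q1 e j.+1 * (weight j.+1)%:C =
  (\sum_(0 <= j < 2 * X) logc (chr R q1 e) j.+1 * (Num.max 0 (u + d - ln j.+1%:R))%:C
   - \sum_(0 <= j < 2 * X) logc (chr R q1 e) j.+1 * (Num.max 0 (u - ln j.+1%:R))%:C) * (d^-1)%:C.
  rewrite -sumrB mulr_suml; apply: eq_bigr => j _.
  by rewrite /logc -/(lw R j.+1) /weight /ramp !(realcM, realcD, realcN); ring.
rewrite cnM cn_real_ge0 ?invr_ge0 ?(ltW d0)// ler_wpM2r ?invr_ge0 ?(ltW d0)//.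
have s0 := sqrtr_ge0 (X%:R : R).
have X2 : X%:R <= (2 * X)%:R :> R by rewrite ler_nat leq_pmull.
have Y0 : 0 < X%:R * expR d by rewrite mulr_gt0 ?expR_gt0.
have Y2 : X%:R * expR d <= (2 * X)%:R by rewrite natrM mulrC ler_wpM2r ?(ltW XR).
have {}h1 := h1 X2.
have ud : 2 <= u + d by have := u4; have := d0; lra.
have {}h2 := h2 ud Y0 Y2.
have sY : Num.sqrt (X%:R * expR d) <= 2 * Num.sqrt X%:R.
  have -> : 2 * Num.sqrt X%:R = Num.sqrt (4 * X%:R) :> R.
    by rewrite sqrtrM// (_ : 4 = 2 ^+ 2) ?sqrtr_sqr ?ger0_norm// expr2; lra.
  rewrite ler_sqrt ?mulr_ge0 ?(ltW XR)// mulrC ler_wpM2r ?(ltW XR)//; have := ed2; lra.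
apply: (le_trans (cn_subD _ _)).
have u0 : 0 <= u by lra.
have h3 : ln q%:R * (u + d) * Num.sqrt (X%:R * expR d) <= u * (2 * u) * (2 * Num.sqrt X%:R).
  apply: ler_pM; rewrite ?sqrtr_ge0 ?mulr_ge0//; first by lra.
  by apply: ler_pM => //; have := d2; have := u4; lra.
have h4 : ln q%:R * u * Num.sqrt X%:R <= u * u * Num.sqrt X%:R.
  by rewrite ler_wpM2r// ler_wpM2r.
have {}h3 := ler_wpM2l K0 h3; have {}h4 := ler_wpM2l K0 h4.
rewrite -!mulrA in h1; rewrite -!mulrA in h2; rewrite -!mulrA in h3; rewrite -!mulrA in h4.
have -> : 5 * K * u ^+ 2 * Num.sqrt X%:R = K * (u * (2 * (u * (2 * Num.sqrt X%:R)))) + K * (u * (u * Num.sqrt X%:R)).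
  by ring.
by apply: lerD; [exact: le_trans h2 h3|exact: le_trans h1 h4].
Qed.

(** Passing from primes below the sharp cutoff to smoothed prime powers adds only nonnegative terms:
    proper prime powers, and primes in the range of the ramp. *)
Lemma ramp_weight (P : pred nat) :
  0 <= \sum_(0 <= j < 2 * X) (P j.+1)%:R * weight j.+1 - \sum_(0 <= j < X) (P j.+1 && prime j.+1)%:R
  <= PP + \sum_(X <= j < 2 * X) (P j.+1)%:R * ramp u d j.+1.
Proof.
have le_k_2X : (X <= 2 * X)%N by rewrite leq_pmull.
have ppw_tot : \sum_(0 <= j < 2 * X) ppw R j.+1 <= PP by apply: ppw_sum_le; rewrite muln_gt0.
have -> : \sum_(0 <= j < 2 * X) (P j.+1)%:R * weight j.+1 - \sum_(0 <= j < X) (P j.+1 && prime j.+1)%:R =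
  \sum_(0 <= j < 2 * X) (P j.+1)%:R * ppw R j.+1 * ramp u d j.+1
  + \sum_(X <= j < 2 * X) (P j.+1)%:R * (prime j.+1)%:R * ramp u d j.+1.
  have -> : \sum_(0 <= j < X) (P j.+1 && prime j.+1)%:R =
      \sum_(0 <= j < X) (P j.+1)%:R * (prime j.+1)%:R * ramp u d j.+1.
    apply: eq_big_nat => j /andP[_ jX]; rewrite ramp1 ?mulr1 ?ler_ln ?posrE ?ltr0n ?ler_nat//.
    by case: (P j.+1); rewrite ?mul1r ?mul0r.
  have -> : \sum_(0 <= j < 2 * X) (P j.+1)%:R * weight j.+1 =
     \sum_(0 <= j < 2 * X) (P j.+1)%:R * ppw R j.+1 * ramp u d j.+1 +
     \sum_(0 <= j < 2 * X) (P j.+1)%:R * (prime j.+1)%:R * ramp u d j.+1.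
    by rewrite -big_split /=; apply: eq_bigr => j _; rewrite /weight /ppw; ring.
  by rewrite [X in _ + X - _](big_cat_nat (leq0n X) le_k_2X) /=; ring.
have r01 j : 0 <= ramp u d j.+1 <= 1 by exact: ramp_itv.
have p0 j : 0 <= ppw R j.+1 by have /andP[] := ppw_le R j.+1.
apply/andP; split.
  apply: addr_ge0; apply: sumr_ge0 => j _; have /andP[r0 _] := r01 j.
    by rewrite mulr_ge0// mulr_ge0.
  by rewrite mulr_ge0// mulr_ge0.
apply: lerD.
  apply: (le_trans _ ppw_tot); apply: ler_sum => j _; have /andP[r0 r1] := r01 j.
  rewrite -[leRHS]mulr1; apply: ler_pM => //; first by rewrite mulr_ge0.
  by case: (P j.+1); rewrite ?mul1r ?mul0r.
apply: ler_sum => j _; have /andP[r0 r1] := r01 j.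
rewrite ler_wpM2r// -[leRHS]mulr1 ler_wpM2l//; by case: (prime j.+1).
Qed.

(** The range of the ramp is covered by whole periods of length q, aligned because q divides X. Each
    period contains nA admissible residues, so the bound keeps the density of the primes below q. *)
Lemma ramp_tail_class :
  \sum_(X <= j < 2 * X) (cprime q (j.+1 %% q))%:R * ramp u d j.+1 <= nA * (2 * d * X%:R / q%:R + 1).
Proof.
have qR : 0 < q%:R :> R by rewrite ltr0n ltnW.
have XR : 0 < X%:R :> R by rewrite ltr0n.
pose Y := X%:R * expR d.
have v0 : 0 <= 2 * d * X%:R / q%:R by rewrite divr_ge0 ?mulr_ge0 ?(ltW d0).
(* Enough periods to reach X e^d, which is at most X + 2dX. *)
pose J := (Num.truncn (2 * d * X%:R / q%:R)).+1.
have [J1 J2] : 2 * d * X%:R / q%:R <= J%:R /\ J%:R <= 2 * d * X%:R / q%:R + 1.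
  have /andP[h1 h2] := truncn_itv v0.
  by rewrite (ltW h2) /J -natr1 lerD2r.
pose F n : R := (cprime q (n %% q))%:R * (n < X + J * q)%N%:R.
apply: (@le_trans _ _ (\sum_(X.+1 <= n < (2 * X).+1) F n)).
  rewrite big_add1 /=; apply: ler_sum => j _; rewrite /F ler_wpM2l//.
  have /andP[r0 r1] := ramp_itv u j.+1 d0.
  case: ltnP => //= jX; rewrite ramp0//.
  have -> : u + d = ln Y by rewrite /Y lnM ?posrE ?expR_gt0// expRK.
  have Y0 : 0 < Y by rewrite mulr_gt0 ?expR_gt0.
  rewrite ler_ln ?posrE//; apply: (@le_trans _ _ (X + J * q)%N%:R); last by rewrite ler_nat.
  rewrite natrD natrM /Y; have := expR_sub1_le (ltW d0) d2 => hd.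
  have : X%:R * (expR d - 1) <= J%:R * q%:R.
    rewrite -ler_pdivrMr// (le_trans _ J1)// ler_wpM2r ?invr_ge0 ?(ltW qR)// mulrC.
    by rewrite ler_wpM2r ?(ltW XR).
  lra.
have -> : nA * (2 * d * X%:R / q%:R + 1) = (2 * d * X%:R / q%:R + 1) * nA by rewrite mulrC.
apply: (@le_trans _ _ (J%:R * nA)); last by rewrite ler_wpM2r//; apply: sumr_ge0 => a _.
rewrite -(sum_blocks (fun a => (cprime q a)%:R) J (ltnW q1) qX).
have F0 n : 0 <= F n by rewrite mulr_ge0.
set T := (X + J * q)%N; set U := maxn (2 * X).+1 T.
have hU1 : ((2 * X).+1 <= U)%N by exact: leq_maxl.
have hU2 : (T <= U)%N by exact: leq_maxr.
have hX : (X <= T)%N by exact: leq_addr.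
have hX1 : (X.+1 <= (2 * X).+1)%N by rewrite ltnS leq_pmull.
apply: (@le_trans _ _ (\sum_(X <= n < U) F n)).
  rewrite [leRHS](big_cat_nat (leqnSn X) (leq_trans hX1 hU1)) /= big_nat1.
  rewrite [X in _ <= _ + X](big_cat_nat hX1 hU1) /= addrCA lerDl.
  by rewrite addr_ge0//; apply: sumr_ge0.
rewrite (big_cat_nat hX hU2) /= [X in _ + X]big_nat_cond [X in _ + X]big1 ?addr0.
  by apply: ler_sum_nat => n /andP[_ nT]; rewrite /F nT mulr1.
by move=> n /andP[/andP[Tn _] _]; rewrite /F ltnNge Tn mulr0.
Qed.

Lemma prime_mod_not_coprime n : prime n -> prime (n %% q) -> ~~ coprime (n %% q) q -> (n %| q)%N.
Proof.
move=> pn pr; rewrite prime_coprime// negbK => rq.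
have : (n %% q %| n)%N by rewrite {2}(divn_eq n q) dvdn_add// dvdn_mull.
by rewrite dvdn_prime2// => /eqP E; rewrite -{1}E.
Qed.

Lemma ppi_coprime : `|ppi R q - nA| <= 2 * ln q%:R.
Proof.
rewrite /ppi -sumrB ger0_norm; last first.
  by apply: sumr_ge0 => a _; rewrite subr_ge0 /cprime; case: (prime a); case: (coprime a q).
apply: (le_trans _ (count_prime_divisors q (ltnW q1))); apply: ler_sum => a _; rewrite /cprime.
have [pa|_] /= := boolP (prime a); last by rewrite subrr.
by rewrite prime_coprime//; case: (a %| q)%N; rewrite /= ?subr0 ?subrr.
Qed.

Lemma main_sum_le : `|\sum_(0 <= n < X) (prime n)%:R * (prime (n %% q))%:R
    - \sum_(0 <= j < X) (cprime q (j.+1 %% q) && prime j.+1)%:R| <= 2 * ln q%:R + 1 :> R.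
Proof.
pose F n : R := (cprime q (n %% q) && prime n)%:R.
have E : \sum_(0 <= j < X) F j.+1 = \sum_(0 <= n < X) F n + F X.
  rewrite -[RHS](@big_nat_recr _ _ _ X 0 F)//= [RHS]big_nat_recl//=.
  by rewrite /F andbF add0r.
rewrite E opprD addrA; apply: (le_trans (ler_normB _ _)); apply: lerD.
  rewrite -sumrB ger0_norm; last first.
    apply: sumr_ge0 => n _; rewrite subr_ge0 /F /cprime.
    by case: (prime n); case: (prime (n %% q)); rewrite ?andbT ?andbF ?mulr1 ?mulr0//=; case: (coprime _ _).
  apply: (le_trans _ (count_prime_divisors X (ltnW q1))); apply: ler_sum => n _; rewrite /F /cprime.
  have [pn|_] /= := boolP (prime n); last by rewrite andbF mul0r subrr.
  have [pr|_] /= := boolP (prime (n %% q)); last by rewrite mulr0 subrr.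
  have [cr|cr] /= := boolP (coprime (n %% q) q); first by rewrite mulr1 subrr.
  by rewrite (prime_mod_not_coprime pn pr cr) mulr1 subr0.
by rewrite /F; case: (_ && _); rewrite ?normr1 ?normr0.
Qed.

Lemma coprime_sum_le : `|ppi R X - \sum_(0 <= j < X) (coprime j.+1 q && prime j.+1)%:R|
  <= 2 * ln q%:R + 1 :> R.
Proof.
have -> : ppi R X = \sum_(0 <= j < X) (prime j.+1)%:R - (prime X)%:R by rewrite ppi_succ addrK.
rewrite addrAC; apply: (le_trans (ler_normB _ _)); apply: lerD; last first.
  by case: (prime X); rewrite ?normr1 ?normr0.
rewrite -sumrB ger0_norm; last first.
  by apply: sumr_ge0 => j _; rewrite subr_ge0; case: (prime _); rewrite ?andbT ?andbF//; case: (coprime _ _).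
apply: (le_trans _ (count_prime_divisors X.+1 (ltnW q1))).
rewrite big_nat_recl//= add0r; apply: ler_sum => j _.
have [pj|_] /= := boolP (prime j.+1); last by rewrite andbF subrr.
by rewrite andbT prime_coprime//; case: (j.+1 %| q)%N; rewrite /= ?subr0 ?subrr.
Qed.

(* Smoothing the cutoff at X over a factor e^d costs O(d) times the density of
   primes below q; on the other side of the balance, GRH bounds each nonprincipal
   character sum by X^(1/2)/d, and Parseval's identity over the characters turns
   their sum over the prime residues into a factor q^(1/2). *)
Theorem correlation :
  `|(\sum_(0 <= n < X) (prime n)%:R * (prime (n %% q))%:R) / X%:R
    - q%:R / (totient q)%:R * (ppi R q / q%:R) * (ppi R X / X%:R)| <=
  (1 + q%:R / (totient q)%:R) * (12 * u / Num.sqrt X%:R + ppi R q / q%:R * (2 * d + q%:R / X%:R)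
     + 2 * ln q%:R / q%:R)
  + 5 * 2080 * u ^+ 2 * Num.sqrt q%:R / (Num.sqrt X%:R * d).
Proof.
have K0 := mulr_ge0 (ler0n R 5) (ler0n R 2080).
move: K0 char_bound; move: (5 * 2080%:R) => K K0 chb.
have qR : 0 < q%:R :> R by rewrite ltr0n ltnW.
have XR : 0 < X%:R :> R by rewrite ltr0n.
have phi0 : 0 < (totient q)%:R :> R by rewrite ltr0n totient_gt0 ltnW.
have sX : 0 < Num.sqrt X%:R :> R by rewrite sqrtr_gt0.
have ssX : Num.sqrt X%:R ^+ 2 = X%:R :> R by rewrite sqr_sqrtr// ltW.
have X1 : 1 <= X%:R :> R by rewrite ler1n.
have sX1 : 1 <= Num.sqrt X%:R :> R by rewrite -[X in X <= _]sqrtr1 ler_sqrt.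
have lnq : ln q%:R <= u :> R by rewrite ler_ln ?posrE// ler_nat dvdn_leq.
have lnq0 : 0 <= ln q%:R :> R by exact: ln_nat_ge0.
have PPb : 2 * ln q%:R + 1 + PP <= 12 * u * Num.sqrt X%:R.
  have s2 : Num.sqrt (2 * X)%:R + 1 <= 3 * Num.sqrt X%:R :> R.
    have : Num.sqrt (2 * X)%:R <= 2 * Num.sqrt X%:R :> R.
      have -> : 2 * Num.sqrt X%:R = Num.sqrt (4 * X%:R) :> R.
        by rewrite sqrtrM// (_ : 4 = 2 ^+ 2) ?sqrtr_sqr ?ger0_norm// expr2; lra.
      by rewrite ler_sqrt ?mulr_ge0 ?(ltW XR)// natrM; lra.
    lra.
  have l2 : 2 * ln (2 * X)%:R + 1 <= 3 * u.
    have l1 : ln 2%:R <= 1 :> R.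
      by have := @le_ln1Dx R 1; rewrite -natr1 => -> //; lra.
    rewrite natrM lnM ?posrE//; move: l1 u4; move: (@ln R 2%:R) (@ln R X%:R) => x y; lra.
  have l2' : 0 <= ln (2 * X)%:R :> R by exact: ln_nat_ge0.
  have : PP <= 3 * Num.sqrt X%:R * (3 * u).
    by apply: ler_pM; rewrite ?addr_ge0 ?mulr_ge0 ?sqrtr_ge0.
  have : 3 * u <= 3 * u * Num.sqrt X%:R by rewrite ler_peMr//; lra.
  move: lnq u4; move: (@ln R X%:R) (@ln R q%:R) PP (Num.sqrt X%:R) => x y z w; lra.
have PP0 : 0 <= PP by rewrite mulr_ge0 ?addr_ge0 ?mulr_ge0 ?sqrtr_ge0 ?ln_nat_ge0.
set E := \sum_(0 <= n < X) _.
have nA0 : 0 <= nA by apply: sumr_ge0.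
have nAp : nA <= ppi R q by apply: ler_sum => a _; rewrite /cprime; case: (prime a); rewrite ?andbT//=; case: (coprime _ _).
have nAq : nA <= q%:R by have /andP[_] := ppi_le_N R q; exact: le_trans.
have h1 := main_sum_le.
have /andP[h2 h2'] := ramp_weight (fun n => cprime q (n %% q)).
have h3 := ramp_tail_class.
have /andP[h4 h4'] := ramp_weight (fun n => coprime n q).
have h5 := coprime_sum_le.
have h6 : \sum_(X <= j < 2 * X) (coprime j.+1 q)%:R * ramp u d j.+1 <= 2 * d * X%:R.
  apply: (le_trans _ (ramp_tail (2 * X) X0 d0 d2)); apply: ler_sum => j _.
  have /andP[r0 _] := ramp_itv u j.+1 d0.
  by case: (coprime _ _); rewrite ?mul1r ?mul0r.
have M0 := divr_ge0 (mulr_ge0 (mulr_ge0 K0 (sqr_ge0 u)) (ltW sX)) (ltW d0).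
have cq a : cprime q a -> coprime a q by case/andP.
have h7 := equidistribution cq M0 chb.
have h8 := ppi_coprime.
move: h1 h2 h2' h3 h4 h4' h5 h6 h7 h8 => /=.
set W := \sum_(0 <= j < 2 * X) (cprime q (j.+1 %% q))%:R * weight j.+1.
set W0 := \sum_(0 <= j < 2 * X) (coprime j.+1 q)%:R * weight j.+1.
rewrite -/E.
set S1 := \sum_(0 <= j < X) @GRing.natmul R 1 (cprime q (j.+1 %% q) && prime j.+1).
set S2 := \sum_(0 <= j < X) @GRing.natmul R 1 (coprime j.+1 q && prime j.+1).
set T1 := \sum_(X <= j < 2 * X) _; set T2 := \sum_(X <= j < 2 * X) _.
move=> h1 h2 h2' h3 h4 h4' h5 h6 h7 h8.
have EW : `|E - W| <= 2 * ln q%:R + 1 + PP + nA * (2 * d * X%:R / q%:R + 1).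
  have -> : E - W = (E - S1) - (W - S1) by ring.
  apply: (le_trans (ler_normB _ _)); rewrite [`|W - S1|]ger0_norm//.
  move: h1 h2' h3; move: (nA * _) PP => x y; lra.
have W0b : `|W0 - ppi R X| <= 2 * ln q%:R + 1 + PP + 2 * d * X%:R.
  have -> : W0 - ppi R X = (W0 - S2) - (ppi R X - S2) by ring.
  apply: (le_trans (ler_normB _ _)); rewrite [`|W0 - S2|]ger0_norm//.
  move: h5 h4' h6; move: PP => y; lra.
have /andP[pX0 pXX] := ppi_le_N R X; have /andP[pq0 pqq] := ppi_le_N R q.
set rho := q%:R / (totient q)%:R.
have rho0 : 0 < rho by rewrite divr_gt0.
(* Four errors: unsmoothing the prime pairs, equidistribution under the hypothesis, unsmoothing the
   primes below X, and the primes below q that divide q. *)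
have -> : E / X%:R - rho * (ppi R q / q%:R) * (ppi R X / X%:R) =
   (E - W) / X%:R + (W - nA / (totient q)%:R * W0) / X%:R
   + rho * (nA / q%:R) * ((W0 - ppi R X) / X%:R) - rho * ((ppi R q - nA) / q%:R) * (ppi R X / X%:R).
  by rewrite /rho; field; rewrite !gt_eqF.
have iX : 0 <= X%:R^-1 :> R by rewrite invr_ge0 ltW.
have iq : 0 <= q%:R^-1 :> R by rewrite invr_ge0 ltW.
have nX : `|X%:R^-1| = X%:R^-1 :> R by rewrite ger0_norm.
have nq : `|q%:R^-1| = q%:R^-1 :> R by rewrite ger0_norm.
have sV : (Num.sqrt X%:R)^-1 = Num.sqrt X%:R / X%:R :> R.
  by move: ssX sX; move: (Num.sqrt X%:R) => s <- s0; field; rewrite gt_eqF.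
have p1 : `|(E - W) / X%:R| <= 12 * u / Num.sqrt X%:R + ppi R q / q%:R * (2 * d + q%:R / X%:R).
  rewrite normrM nX; apply: (le_trans (ler_wpM2r iX EW)).
  have -> : 12 * u / Num.sqrt X%:R = 12 * u * Num.sqrt X%:R / X%:R.
    by rewrite sV mulrA.
  rewrite mulrDl lerD ?ler_wpM2r//.
  have -> : nA * (2 * d * X%:R / q%:R + 1) / X%:R = nA / q%:R * (2 * d + q%:R / X%:R).
    by field; rewrite !gt_eqF.
  by rewrite ler_wpM2r ?ler_wpM2r// addr_ge0 ?divr_ge0 ?mulr_ge0 ?(ltW d0).
have p2 : `|(W - nA / (totient q)%:R * W0) / X%:R| <= K * u ^+ 2 * Num.sqrt q%:R / (Num.sqrt X%:R * d).
  rewrite normrM nX; apply: (le_trans (ler_wpM2r iX h7)).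
  have -> : K * u ^+ 2 * Num.sqrt q%:R / (Num.sqrt X%:R * d) =
     K * u ^+ 2 * Num.sqrt X%:R / d * Num.sqrt q%:R / X%:R.
    by rewrite invfM sV; field; rewrite !gt_eqF.
  by rewrite ler_wpM2r// ler_wpM2l// ler_sqrt.
have p3 : `|rho * (nA / q%:R) * ((W0 - ppi R X) / X%:R)| <=
    rho * (12 * u / Num.sqrt X%:R + ppi R q / q%:R * (2 * d)).
  rewrite -mulrA normrM (gtr0_norm rho0) ler_wpM2l ?(ltW rho0)// normrM.
  have nq0 : 0 <= nA / q%:R by rewrite mulr_ge0.
  rewrite (ger0_norm nq0) normrM nX.
  have w1 : `|W0 - ppi R X| / X%:R <= 12 * u / Num.sqrt X%:R + 2 * d.
    apply: (le_trans (ler_wpM2r iX W0b)).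
    have -> : 12 * u / Num.sqrt X%:R = 12 * u * Num.sqrt X%:R / X%:R.
      by rewrite sV mulrA.
    by rewrite mulrDl lerD ?ler_wpM2r// mulfK ?gt_eqF.
  apply: (le_trans (ler_wpM2l nq0 w1)); rewrite mulrDr lerD//.
    rewrite ler_piMl//; first by rewrite divr_ge0 ?mulr_ge0 ?(ltW sX)//; lra.
    by rewrite ler_pdivrMr// mul1r.
  by rewrite ler_wpM2r ?mulr_ge0 ?(ltW d0)// ler_wpM2r.
have p4 : `|rho * ((ppi R q - nA) / q%:R) * (ppi R X / X%:R)| <= rho * (2 * ln q%:R / q%:R).
  rewrite -mulrA normrM (gtr0_norm rho0) ler_wpM2l ?(ltW rho0)// normrM.
  rewrite -[leRHS]mulr1; apply: ler_pM => //; first by rewrite normrM nq ler_wpM2r.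
  by rewrite ger0_norm ?mulr_ge0// ler_pdivrMr// mul1r.
have m0 : 0 <= ppi R q / q%:R * (q%:R / X%:R) by rewrite !mulr_ge0.
have l0 : 0 <= 2 * ln q%:R / q%:R :> R by rewrite !mulr_ge0.
apply: (le_trans (ler_normB _ _)).
apply: (@le_trans _ _ (12 * u / Num.sqrt X%:R + ppi R q / q%:R * (2 * d + q%:R / X%:R)
  + K * u ^+ 2 * Num.sqrt q%:R / (Num.sqrt X%:R * d) +
  rho * (12 * u / Num.sqrt X%:R + ppi R q / q%:R * (2 * d)) + rho * (2 * ln q%:R / q%:R))).
  rewrite lerD//; apply: (le_trans (ler_normD _ _)); rewrite lerD//.
  by apply: (le_trans (ler_normD _ _)); exact: lerD.
have := mulr_ge0 (ltW rho0) m0; rewrite [ppi R q / q%:R * (2 * d + _)]mulrDr.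
move: (12 * u / _) (ppi R q / q%:R * (2 * d)) (ppi R q / q%:R * (q%:R / X%:R)) (2 * ln q%:R / q%:R) (_ / (_ * d)) m0 l0.
by move=> x1 x2 x3 x4 x5 *; lra.
Qed.

End Fixed.
End Correlations.

(** * The variance *)

Section Truncations.

Lemma sum_digits b n k : (0 < b)%N -> (\sum_(0 <= j < k) digit b n j * b ^ j = n %% b ^ k)%N.
Proof.
move=> b0; elim: k => [|k IH]; first by rewrite big_geq// expn0 modn1.
rewrite big_nat_recr//= IH /digit.
have e1 := divn_eq n (b ^ k); have e2 := divn_eq (n %/ b ^ k) b; have e3 := divn_eq n (b ^ k.+1).
have e4 : ((n %/ b ^ k) %/ b = n %/ b ^ k.+1)%N by rewrite -divnMA -expnSr.
rewrite e4 in e2; rewrite {}e2 in e1.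
apply/eqP; rewrite -(eqn_add2l (n %/ b ^ k.+1 * b ^ k.+1)) -e3; apply/eqP.
by rewrite {4}e1 expnSr; ring.
Qed.

Lemma digit_neq0 b n k : (1 < b)%N -> (digit b n k != 0%N) = (b ^ k <= n %% b ^ k.+1)%N.
Proof.
move=> b1; have b0 := ltnW b1.
have E : (n %% b ^ k.+1 = n %% b ^ k + digit b n k * b ^ k)%N.
  by rewrite -!sum_digits// big_nat_recr.
have lt : (n %% b ^ k < b ^ k)%N by rewrite ltn_mod expn_gt0 b0.
rewrite E; case: (digit b n k) => [|d]; first by rewrite mul0n addn0 leqNgt lt.
by rewrite mulSn; apply/esym; lia.
Qed.

(** Here h is the number of digits kept; the second condition says that the leading one among them
    is nonzero. *)
Definition trunc_prime b h n := prime (n %% b ^ h) && (b ^ h.-1 <= n %% b ^ h)%N.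

(** Truncations with nonzero leading digit have distinct lengths, so they are distinct and [undup]
    removes nothing. A length h beyond that of n contributes 0, because then n mod b^h = n <
    b^(h-1). *)
Lemma TrunL_sum b n l : (1 < b)%N -> (0 < n)%N -> (n < b ^ l)%N ->
  TrunL b n = (\sum_(1 <= h < l.+1) trunc_prime b h n)%N.
Proof.
move=> b1 n0 nl; have b0 := ltnW b1.
pose T := trunc_log b n; have nT : (n < b ^ T.+1)%N by exact: trunc_log_ltn.
have Tl : (T.+1 <= l)%N.
  by rewrite -(ltn_exp2l _ _ b1) (leq_ltn_trans _ nl)// trunc_logP.
rewrite /TrunL /truncations undup_id; last first.
  rewrite map_inj_in_uniq ?filter_uniq ?iota_uniq// => i j.
  rewrite !mem_filter !digit_neq0// !sum_digits// => /andP[hi _] /andP[hj _].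
  have [ij|ji|//] := ltngtP i j => E; exfalso.
    have : (n %% b ^ i.+1 < b ^ i.+1)%N by rewrite ltn_mod expn_gt0 b0.
    have : (b ^ i.+1 <= b ^ j)%N by rewrite leq_exp2l.
    lia.
  have : (n %% b ^ j.+1 < b ^ j.+1)%N by rewrite ltn_mod expn_gt0 b0.
  have : (b ^ j.+1 <= b ^ i)%N by rewrite leq_exp2l.
  lia.
rewrite count_map count_filter -sum1_count big_mkcond /=.
rewrite big_add1 /= (big_cat_nat (leq0n T.+1) Tl) /=.
rewrite [X in (_ + X)%N]big_nat_cond [X in (_ + X)%N]big1 ?addn0; last first.
  move=> k /andP[/andP[Tk _] _]; rewrite /trunc_prime /= andbC leqNgt.
  rewrite (leq_ltn_trans (leq_mod _ _))// (leq_trans nT)// leq_exp2l//.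
rewrite -[0%N :: _]/(index_iota 0 T.+1); apply: eq_bigr => k _.
rewrite /trunc_prime /= sum_digits// digit_neq0//; by case: (_ && _).
Qed.

End Truncations.

(** * Means and covariances of the truncation indicators *)

Section Variance.
Variable R : realType.
Variables (b l : nat).
Hypotheses (b1 : (1 < b)%N) (l0 : (0 < l)%N).

(** The mean includes n = 0, so that n mod b^h runs uniformly over all residues. *)
Definition avg (F : nat -> R) : R := (b ^ l)%:R^-1 * \sum_(0 <= n < b ^ l) F n.
Definition pdens h : R := ppi R (b ^ h) / (b ^ h)%:R.
Definition pcorr h k : R :=
  (\sum_(0 <= n < b ^ k) (prime n)%:R * (prime (n %% b ^ h))%:R) / (b ^ k)%:R.
Local Notation Y := (fun h n => (prime (n %% b ^ h))%:R : R).
Local Notation Z := (fun h n => (trunc_prime b h n)%:R : R).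
Local Notation m' := (fun h => avg (Z h)).
Local Notation c := (fun h k => avg (fun n => Z h n * Z k n)).

Let bn0 k : 0 < (b ^ k)%:R :> R.
Proof. by rewrite ltr0n expn_gt0 ltnW. Qed.

Lemma avgD F G : avg (fun n => F n + G n) = avg F + avg G.
Proof. by rewrite /avg big_split mulrDr. Qed.

Lemma avgB F G : avg (fun n => F n - G n) = avg F - avg G.
Proof. by rewrite /avg sumrB mulrBr. Qed.

Lemma avg_le F G : (forall n, F n <= G n) -> avg F <= avg G.
Proof. by move=> FG; rewrite /avg ler_wpM2l ?invr_ge0 ?(ltW (bn0 _))//; apply: ler_sum. Qed.

Lemma avg_cst x : avg (fun=> x) = x.
Proof. by rewrite /avg sumr_const_nat subn0 -[x *+ _]mulr_natl mulKf ?gt_eqF. Qed.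

Lemma avg_sum I (s : seq I) (F : I -> nat -> R) :
  avg (fun n => \sum_(i <- s) F i n) = \sum_(i <- s) avg (F i).
Proof. by rewrite /avg exchange_big /= mulr_sumr. Qed.

Lemma avg_mod F h : (h <= l)%N ->
  avg (fun n => F (n %% b ^ h)%N) = (\sum_(0 <= a < b ^ h) F a) / (b ^ h)%:R.
Proof.
move=> hl; have q0 : (0 < b ^ h)%N by rewrite expn_gt0 ltnW.
have := sum_blocks F (b ^ (l - h)) q0 (dvdn0 _); rewrite add0n -expnD subnK// /avg => ->.
rewrite -{1}(subnK hl) expnD natrM; field; by rewrite !gt_eqF.
Qed.

Lemma avg_prime h : (h <= l)%N -> avg (Y h) = pdens h.
Proof. by move=> hl; rewrite (avg_mod (fun a => (prime a)%:R)). Qed.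

Lemma avg_prime2 h k : (h <= k)%N -> (k <= l)%N -> avg (fun n => Y h n * Y k n) = pcorr h k.
Proof.
move=> hk kl; rewrite /pcorr -(avg_mod (fun n => (prime n)%:R * (prime (n %% b ^ h))%:R) kl).
by congr avg; apply/funext => n; rewrite modn_dvdm ?dvdn_exp2l// mulrC.
Qed.

Lemma pdens_itv h : 0 <= pdens h <= 1.
Proof.
have /andP[h1 h2] := ppi_le_N R (b ^ h).
by rewrite /pdens divr_ge0 ?ler_pdivrMr ?mul1r// ltW.
Qed.

(** The two indicators differ only when the leading digit among the h kept is 0, an event of
    probability 1/b. *)
Lemma avg_lead h : (0 < h <= l)%N -> 0 <= avg (fun n => Y h n - Z h n) <= b%:R^-1.
Proof.
move=> /andP[h0 hl]; apply/andP; split.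
  rewrite -(avg_cst 0); apply: avg_le => n; rewrite subr_ge0 /trunc_prime.
  by case: (prime _); case: (_ <= _)%N.
pose F a : R := (a < b ^ h.-1)%N%:R.
apply: (@le_trans _ _ (avg (fun n => F (n %% b ^ h)%N))).
  apply: avg_le => n; rewrite /F /trunc_prime ltnNge.
  by case: (prime _); case: (_ <= _)%N; rewrite /= ?subr0 ?subrr.
rewrite avg_mod//.
have hh : (b ^ h.-1 <= b ^ h)%N by rewrite leq_exp2l// leq_pred.
have E : (b ^ h)%:R = b%:R * (b ^ h.-1)%:R :> R by rewrite -natrM -expnS prednK.
have b0 : 0 < b%:R :> R by rewrite ltr0n ltnW.
rewrite (big_cat_nat (leq0n _) hh) /= [X in _ + X]big_nat_cond [X in _ + X]big1 ?addr0; last first.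
  by move=> a /andP[/andP[ha _] _]; rewrite /F ltnNge ha.
have -> : \sum_(0 <= a < b ^ h.-1) F a = (b ^ h.-1)%:R.
  rewrite (eq_big_nat _ _ (F2 := fun=> 1)); first by rewrite sumr_const_nat subn0.
  by move=> a /andP[_ ha]; rewrite /F ha.
by rewrite E invfM mulrCA divff ?mulr1// gt_eqF.
Qed.

Lemma avg_trunc h : (0 < h <= l)%N -> 0 <= m' h <= 1 /\ 0 <= pdens h - m' h <= b%:R^-1.
Proof.
move=> hh; have := avg_lead hh; have /andP[_ hl] := hh.
rewrite (avgB (Y h) (Z h)) avg_prime// => ->; split => //; apply/andP; split.
  by rewrite -(avg_cst 0); apply: avg_le.
by rewrite -[leRHS](avg_cst 1); apply: avg_le => n; case: (trunc_prime _ _ _).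
Qed.

Lemma avg_trunc2 h k : (0 < h)%N -> (h <= k <= l)%N -> 0 <= pcorr h k - c h k <= 2 / b%:R.
Proof.
move=> h0 /andP[hk kl]; rewrite -avg_prime2// -(avgB (fun n => Y h n * Y k n) (fun n => Z h n * Z k n)).
have ZY j n : (trunc_prime b j n ==> prime (n %% b ^ j)) by apply/implyP => /andP[].
apply/andP; split.
  rewrite -(avg_cst 0); apply: avg_le => n; rewrite subr_ge0.
  have := ZY h n; have := ZY k n.
  by case: (trunc_prime b h n); case: (trunc_prime b k n); case: (prime _); case: (prime _) => //= _ _;
    rewrite ?mulr1 ?mulr0 ?mul0r.
have /andP[_ e1] : 0 <= avg (fun n => Y h n - Z h n) <= b%:R^-1.
  by apply: avg_lead; rewrite h0 (leq_trans hk).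
have /andP[_ e2] : 0 <= avg (fun n => Y k n - Z k n) <= b%:R^-1.
  by apply: avg_lead; rewrite kl (leq_trans h0).
apply: (@le_trans _ _ (avg (fun n => (Y h n - Z h n) + (Y k n - Z k n)))); last first.
  rewrite (avgD (fun n => Y h n - Z h n) (fun n => Y k n - Z k n)).
  by rewrite mulr2n mulrDl mul1r lerD.
apply: avg_le => n.
have := ZY h n; have := ZY k n.
by case: (trunc_prime b h n); case: (trunc_prime b k n); case: (prime _); case: (prime _) => //= _ _;
  rewrite ?mulr1 ?mulr0 ?mul0r; lra.
Qed.

(** The subtracted square comes from n = 0: it belongs to [avg] but not to the variance, and there
    the number of truncations is 0. *)
Lemma var_TrunLE : var_TrunL R b l =
  \sum_(1 <= h < l.+1) \sum_(1 <= k < l.+1) (c h k - m' h * m' k)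
  - (\sum_(1 <= h < l.+1) m' h) ^+ 2 / (b ^ l)%:R.
Proof.
pose W n : R := \sum_(1 <= h < l.+1) Z h n.
have TW n : (1 <= n < b ^ l)%N -> (TrunL b n)%:R = W n.
  by move=> /andP[n0 nl]; rewrite (TrunL_sum b1 n0 nl) natr_sum.
have W0 : W 0%N = 0.
  by rewrite /W big1// => h _; rewrite /trunc_prime mod0n.
have bl0 : (0 < b ^ l)%N by rewrite expn_gt0 ltnW.
have muE : mean_TrunL R b l = avg W.
  rewrite /mean_TrunL /avg (eq_big_nat _ _ TW) [in RHS]big_ltn// W0 add0r //.
have aW : avg W = \sum_(1 <= h < l.+1) m' h by rewrite /W avg_sum.
have aWW : avg (fun n => W n ^+ 2) = \sum_(1 <= h < l.+1) \sum_(1 <= k < l.+1) c h k.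
  rewrite -(eq_bigr _ (fun h _ => avg_sum (index_iota 1 l.+1) (fun k n => Z h n * Z k n))).
  rewrite -(avg_sum (index_iota 1 l.+1) (fun h n => \sum_(1 <= k < l.+1) Z h n * Z k n)).
  congr avg; apply/funext => n; rewrite expr2 /W big_distrl /=; apply: eq_bigr => h _.
  by rewrite big_distrr.
rewrite /var_TrunL muE; set mu := avg W.
have -> : \sum_(1 <= n < b ^ l) ((TrunL b n)%:R - mu) ^+ 2 =
   \sum_(0 <= n < b ^ l) (W n - mu) ^+ 2 - mu ^+ 2.
  rewrite [in RHS]big_ltn// W0 add0r sqrrN addrAC subrr add0r.
  by apply: eq_big_nat => n hn; rewrite TW.
rewrite mulrBr -/(avg (fun n => (W n - mu) ^+ 2)).
have -> : avg (fun n => (W n - mu) ^+ 2) = avg (fun n => W n ^+ 2) - mu ^+ 2.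
  have -> : (fun n => (W n - mu) ^+ 2) = (fun n => W n ^+ 2 - (mu * W n *+ 2 - mu ^+ 2)).
    by apply/funext => n; rewrite sqrrB [W n * mu]mulrC opprB addrA addrAC.
  rewrite avgB (avgB (fun n => mu * W n *+ 2) (fun=> mu ^+ 2)) avg_cst.
  have -> : avg (fun n => mu * W n *+ 2) = mu * mu *+ 2.
    by rewrite {3}/mu /avg sumrMnl -mulr_sumr mulrnAr mulrCA.
  rewrite -expr2; ring.
rewrite aWW [_^-1 * _]mulrC /mu aW; congr (_ - _).
under [in RHS]eq_bigr => h _ do rewrite sumrB.
rewrite sumrB; congr (_ - _); rewrite expr2 big_distrl /=; apply: eq_bigr => h _.
by rewrite big_distrr.
Qed.

(** Discarding the leading-digit condition costs 2/b in a joint mean and 2/b in a product of means,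
    for each of the l^2 pairs; the term from n = 0 is at most l^2/b. *)
Lemma var_TrunL_approx (rho : R) (E : nat -> nat -> R) :
  (forall h k, (0 < h < k)%N -> (k <= l)%N -> `|pcorr h k - rho * pdens h * pdens k| <= E h k) ->
  `|var_TrunL R b l - (\sum_(1 <= h < l.+1) (pdens h - pdens h ^+ 2)
     + (rho - 1) * ((\sum_(1 <= h < l.+1) pdens h) ^+ 2 - \sum_(1 <= h < l.+1) pdens h ^+ 2))| <=
  \sum_(1 <= h < l.+1) \sum_(1 <= k < l.+1)
     ((h < k)%N%:R * E h k + (k < h)%N%:R * E k h) + 5 * l%:R ^+ 2 / b%:R.
Proof.
move=> HE; have b0 : 0 < b%:R :> R by rewrite ltr0n ltnW.
(* The target of each covariance: rho - 1 times the product of the densities off the diagonal, and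
   on it m - m^2, since (rho - 1) m^2 + m - rho m^2 = m - m^2. *)
pose G h k := (rho - 1) * (pdens h * pdens k) + (h == k)%:R * (pdens h - rho * pdens h ^+ 2).
have -> : \sum_(1 <= h < l.+1) (pdens h - pdens h ^+ 2)
     + (rho - 1) * ((\sum_(1 <= h < l.+1) pdens h) ^+ 2 - \sum_(1 <= h < l.+1) pdens h ^+ 2) =
   \sum_(1 <= h < l.+1) \sum_(1 <= k < l.+1) G h k.
  have -> : \sum_(1 <= h < l.+1) \sum_(1 <= k < l.+1) G h k =
     \sum_(1 <= h < l.+1) ((rho - 1) * (pdens h * \sum_(1 <= k < l.+1) pdens k)
       + (pdens h - rho * pdens h ^+ 2)).
    rewrite big_seq [in RHS]big_seq; apply: eq_bigr => h hi; rewrite big_split /=; congr (_ + _).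
      by rewrite -mulr_sumr -mulr_sumr.
    rewrite (bigD1_seq h) ?iota_uniq//= eqxx mul1r big1 ?addr0// => k.
    by rewrite eq_sym => /negbTE ->; rewrite mul0r.
  rewrite [in RHS]big_split /= -mulr_sumr -mulr_suml -expr2 !sumrB -mulr_sumr; ring.
rewrite var_TrunLE addrAC -sumrB; apply: (le_trans (ler_normB _ _)).
have -> : 5 * l%:R ^+ 2 / b%:R = 4 * l%:R ^+ 2 / b%:R + l%:R ^+ 2 / b%:R :> R by ring.
rewrite addrA lerD//; last first.
  rewrite ger0_norm; last by rewrite divr_ge0 ?sqr_ge0.
  apply: ler_pM; rewrite ?sqr_ge0 ?invr_ge0//.
    have s0 : 0 <= \sum_(1 <= h < l.+1) m' h.
      by apply: sumr_ge0 => h _; rewrite -(avg_cst 0); apply: avg_le.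
    rewrite ler_sqr ?nnegrE//.
    apply: (@le_trans _ _ (\sum_(1 <= h < l.+1) 1)); last by rewrite sumr_const_nat subn1.
    by apply: ler_sum_nat => h hi; have [/andP[_ ->]] := avg_trunc hi.
  by rewrite lef_pV2 ?posrE// ler_nat -{1}(expn1 b) leq_exp2l.
have -> : 4 * l%:R ^+ 2 / b%:R = \sum_(1 <= h < l.+1) \sum_(1 <= k < l.+1) (4 / b%:R) :> R.
  rewrite !sumr_const_nat subn1 /= -!mulrnA -[RHS]mulr_natr natrM; ring.
rewrite -big_split /=; apply: (le_trans (ler_norm_sum _ _ _)).
apply: ler_sum_nat => h hi; rewrite -sumrB -big_split /=; apply: (le_trans (ler_norm_sum _ _ _)).
apply: ler_sum_nat => k ki.
have [/andP[x0 x1] /andP[x2 x3]] := avg_trunc hi.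
have [/andP[y0 y1] /andP[y2 y3]] := avg_trunc ki.
have /andP[p0 p1] := pdens_itv h; have /andP[r0 r1] := pdens_itv k.
have pr : `|m' h * m' k - pdens h * pdens k| <= 2 / b%:R.
  have -> : m' h * m' k - pdens h * pdens k =
     - ((pdens h - m' h) * m' k + pdens h * (pdens k - m' k)) by ring.
  rewrite normrN; apply: (le_trans (ler_normD _ _)).
  have -> : 2 / b%:R = b%:R^-1 + b%:R^-1 :> R by ring.
  apply: lerD; rewrite normrM.
    by rewrite -[leRHS]mulr1; apply: ler_pM => //; rewrite ger0_norm.
  by rewrite -[leRHS]mul1r; apply: ler_pM => //; rewrite ger0_norm.
have cc j k' : c j k' = c k' j by congr avg; apply/funext => n; rewrite mulrC.
have off i j : (0 < i < j)%N -> (j <= l)%N -> `|pdens i * pdens j - m' i * m' j| <= 2 / b%:R ->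
   `|c i j - m' i * m' j - (rho - 1) * (pdens i * pdens j)| <= E i j + 4 / b%:R.
  move=> ij jl hp; have /andP[i0 ij'] := ij.
  have hij : (i <= j <= l)%N by rewrite jl ltnW.
  have /andP[z0 z1] := avg_trunc2 i0 hij; have hE := HE _ _ ij jl.
  have -> : c i j - m' i * m' j - (rho - 1) * (pdens i * pdens j) =
     (pcorr i j - rho * pdens i * pdens j) + (pdens i * pdens j - m' i * m' j)
     - (pcorr i j - c i j) by ring.
  apply: (le_trans (ler_normB _ _)); rewrite (ger0_norm z0).
  have := ler_normD (pcorr i j - rho * pdens i * pdens j) (pdens i * pdens j - m' i * m' j).
  move: hE hp z1; move: (pcorr i j - _) (pcorr i j - _) (pdens i * pdens j - _) (E i j) => t1 t2 t3 t4.
  lra.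
have /andP[h0 hl] := hi; have /andP[k0 kl] := ki.
rewrite /G; have [hk|kh|hk] := ltngtP h k.
- rewrite mul0r addr0 mul1r mul0r addr0; apply: off; rewrite ?h0// distrC//.
- rewrite mul0r addr0 mul1r mul0r add0r cc [m' h * _]mulrC [pdens h * _]mulrC.
  by apply: off; rewrite ?k0// distrC [m' k * _]mulrC [pdens k * _]mulrC// .
- subst k; rewrite !mul0r !add0r mul1r.
  have -> : c h h = m' h.
    by congr avg; apply/funext => n; case: (trunc_prime _ _ _); rewrite ?mulr1 ?mulr0.
  have -> : m' h - m' h * m' h - ((rho - 1) * (pdens h * pdens h) + (pdens h - rho * pdens h ^+ 2)) =
    - (pdens h - m' h) - (m' h * m' h - pdens h * pdens h) by ring.
  apply: (le_trans (ler_normB _ _)); rewrite normrN (ger0_norm x2).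
  have bi : 0 <= b%:R^-1 :> R by rewrite invr_ge0 ltW.
  move: x3 pr bi; move: (pdens h - _) `|_| (b%:R^-1) => t1 t2 t3; lra.
Qed.

End Variance.

(** * Summation of main terms and errors over all pairs of lengths *)

Section Assembly.
Variable R : realType.

Local Notation H1 l := (\sum_(1 <= h < l.+1) @GRing.inv R h%:R).
Local Notation H2 l := (\sum_(1 <= h < l.+1) @GRing.inv R (h%:R ^+ 2)).

Lemma harmonic_le l : (0 < l)%N -> H1 l <= 1 + ln l%:R.
Proof.
case: l => // l _; elim: l => [|l IH]; first by rewrite big_nat1 ln1 invr1 addr0.
rewrite big_nat_recr//=; apply: (le_trans (lerD IH (lexx _))).
have a0 : 0 < l.+1%:R :> R by []; have b0 : 0 < l.+2%:R :> R by [].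
have E : l.+2%:R = l.+1%:R + 1 :> R by rewrite natr1.
have : ln (1 + - l.+2%:R^-1) <= - l.+2%:R^-1 :> R.
  by apply: le_ln1Dx; rewrite ltrN2 invf_lt1// E ltrDr.
have -> : 1 + - l.+2%:R^-1 = l.+1%:R / l.+2%:R :> R.
  have b1 : l.+2%:R != 0 :> R by [].
  by rewrite -[X in X - _](divff b1) -[X in _ - X]mul1r -mulrBl {1}E addrK.
rewrite ln_div ?posrE//.
move: (ln l.+1%:R) (ln l.+2%:R) (l.+2%:R^-1) => x y z; lra.
Qed.

Lemma sum_inv_sqr_le l : H2 l <= 2.
Proof.
case: l => [|l]; first by rewrite big_geq.
suff : H2 l.+1 <= 2 - l.+1%:R^-1.
  by move/le_trans; apply; rewrite gerBl invr_ge0.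
elim: l => [|l IH]; first by rewrite big_nat1 expr1n invr1; lra.
rewrite big_nat_recr//=; apply: (le_trans (lerD IH (lexx _))).
have a0 : 0 < l.+1%:R :> R by []; have b0 : 0 < l.+2%:R :> R by [].
have E : l.+2%:R = l.+1%:R + 1 :> R by rewrite natr1.
have : (l.+2%:R ^+ 2)^-1 <= l.+1%:R^-1 - l.+2%:R^-1 :> R.
  have -> : l.+1%:R^-1 - l.+2%:R^-1 = (l.+1%:R * l.+2%:R)^-1 :> R.
    rewrite E in b0 *; move: (l.+1%:R) a0 b0 => x a0 b0.
    by field; rewrite !gt_eqF.
  rewrite lef_pV2 ?posrE ?mulr_gt0 ?exprn_gt0// expr2 ler_wpM2r// E lerDl//.
move: (l.+1%:R^-1) (l.+2%:R^-1) ((_ ^+ 2)^-1) => x y z; lra.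
Qed.

Lemma sum_geometric_gap h l :
  \sum_(1 <= k < l.+1) (h < k)%N%:R * 2^-1 ^+ (k - h).-1 <= 2 :> R.
Proof.
suff : \sum_(1 <= k < l.+1) (h < k)%N%:R * 2^-1 ^+ (k - h).-1 + 2 * 2^-1 ^+ (l - h) <= 2 :> R.
  have : 0 <= 2 * 2^-1 ^+ (l - h) :> R by rewrite mulr_ge0 ?exprn_ge0.
  lra.
elim: l => [|l IH]; first by rewrite big_geq// sub0n expr0; lra.
rewrite big_nat_recr//=; apply: le_trans IH; rewrite -addrA lerD2l.
have [hl|hl] := leqP h l.
  by rewrite subSn//= ltnS hl mul1r exprS; lra.
have -> : (l.+1 - h = 0)%N by lia.
have -> : (l - h = 0)%N by lia.
by rewrite ltnNge hl mul0r add0r.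
Qed.

(** The last error decays geometrically in k - h, so summing it over pairs costs a factor l only;
    the first keeps the density m_h, whose sum is of harmonic size. *)
Lemma pair_error_sum (m : nat -> R) l (A B D : R) : (forall h, 0 <= m h) ->
  0 <= A -> 0 <= B -> 0 <= D ->
  \sum_(1 <= h < l.+1) \sum_(1 <= k < l.+1)
    ((h < k)%N%:R * (A * m h + B + D * 2^-1 ^+ (k - h).-1)
     + (k < h)%N%:R * (A * m k + B + D * 2^-1 ^+ (h - k).-1)) <=
  2 * (A * l%:R * \sum_(1 <= h < l.+1) m h + B * l%:R ^+ 2 + 2 * D * l%:R).
Proof.
move=> m0 A0 B0 D0.
under eq_bigr => h _ do rewrite big_split /=.
rewrite big_split /= [X in _ + X]exchange_big /=.
set S := (X in X + X <= _).
suff : S <= A * l%:R * \sum_(1 <= h < l.+1) m h + B * l%:R ^+ 2 + 2 * D * l%:R by lra.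
have -> : A * l%:R * \sum_(1 <= h < l.+1) m h + B * l%:R ^+ 2 + 2 * D * l%:R =
   \sum_(1 <= h < l.+1) (A * l%:R * m h + (B * l%:R + 2 * D)).
  by rewrite big_split /= -mulr_sumr sumr_const_nat subn1 /= -[_ *+ l]mulr_natr; ring.
apply: ler_sum => h _.
apply: (@le_trans _ _ (\sum_(1 <= k < l.+1) ((A * m h + B) + D * ((h < k)%N%:R * 2^-1 ^+ (k - h).-1)))).
  apply: ler_sum => k _; case: (h < k)%N; rewrite ?mul1r// !mul0r mulr0 addr0.
  by rewrite addr_ge0// mulr_ge0.
rewrite big_split /= sumr_const_nat subn1 /= -mulr_sumr -[_ *+ l]mulr_natr.
have := ler_wpM2l D0 (sum_geometric_gap h l).
move: (D * _) (m h) => x y; rewrite mulrC [_ * l%:R]mulrC mulrDr; lra.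
Qed.

Lemma ln16_ge b : (16 <= b)%N -> 2 <= ln b%:R :> R.
Proof.
move=> hb; have h : @ln R 16%:R <= ln b%:R by rewrite ler_ln ?posrE ?ltr0n ?ler_nat//; lia.
apply: le_trans h; rewrite -[16%N]/(2 ^ 4)%N natrX lnXn//.
by have := @ln2_gt R; move: (ln _) => y; rewrite -[y *+ 4]mulr_natr; lra.
Qed.

(* b^(-1/8): the width of the smoothing of the prime indicator, up to a factor 2 *)
Local Notation be b := (expR (- (@ln R b%:R / 8))).

Lemma be_itv b : (16 <= b)%N -> 0 < be b <= 1.
Proof.
by move=> hb; have := ln16_ge hb => h; rewrite expR_gt0/= -[leRHS]expR0 ler_expR; lra.
Qed.

Lemma be_exp8 b : (0 < b)%N -> be b ^+ 8 = b%:R^-1.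
Proof.
move=> b0; rewrite -expRM_natl mulrN expRN mulrCA divff// mulr1 lnK// posrE ltr0n//.
Qed.

Lemma be_exp4 b : (0 < b)%N -> be b ^+ 4 = (Num.sqrt b%:R)^-1.
Proof.
move=> b0; apply/eqP; rewrite -(@eqrXn2 _ 2) ?exprn_ge0 ?expR_ge0 ?invr_ge0 ?sqrtr_ge0//.
by rewrite -exprM be_exp8// exprVn sqr_sqrtr.
Qed.

Lemma sqrt_ratio b h k : (16 <= b)%N -> (h < k)%N ->
  Num.sqrt (b ^ h)%:R / Num.sqrt (b ^ k)%:R <= be b ^+ 4 * 2^-1 ^+ (k - h).-1 :> R.
Proof.
move=> hb hk; have b0 : (0 < b)%N by lia.
have s0 n : 0 < Num.sqrt (b ^ n)%:R :> R by rewrite sqrtr_gt0 ltr0n expn_gt0 b0.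
have E : (b ^ k = b ^ h * (b * b ^ (k - h).-1))%N by rewrite -expnS -expnD; congr (_ ^ _)%N; lia.
rewrite E natrM sqrtrM ?ler0n// invfM mulrA divff ?gt_eqF// mul1r natrM sqrtrM ?ler0n//.
rewrite invfM be_exp4// ler_wpM2l ?invr_ge0 ?sqrtr_ge0//.
rewrite exprVn lef_pV2 ?posrE ?exprn_gt0//.
have -> : 2 ^+ (k - h).-1 = Num.sqrt ((4 ^ (k - h).-1)%:R) :> R.
  rewrite -[4%N]/(2 ^ 2)%N -expnM mulnC expnM !natrX sqrtr_sqr ger0_norm ?exprn_ge0//.
rewrite ler_sqrt ?ltr0n ?expn_gt0 ?b0// ler_nat.
by case: (k - h).-1 => [|n]; rewrite ?expn0// leq_exp2r//; lia.
Qed.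

(** This is [correlation] with q = b^h, X = b^k and smoothing width e/2, where e = b^(-1/8). In
    powers of e, 1/b is e^8, and the character term sqrt(q/X)/d is of size e^4/e = e^3 times the
    geometric decay. *)
Theorem pair_bound : generalized_riemann_hypothesis R -> exists2 C : R, 0 < C &
  forall b h k, (16 <= b)%N -> (0 < h < k)%N ->
  `|pcorr R b h k - b%:R / (totient b)%:R * pdens R b h * pdens R b k| <=
  C * (ln b%:R * be b * pdens R b h + k%:R * ln b%:R ^+ 2 * be b ^+ 8
       + k%:R ^+ 2 * ln b%:R ^+ 2 * be b ^+ 3 * 2^-1 ^+ (k - h).-1).
Proof.
move=> grh; have [Ct Ct0 Hrho] := totient_ratio grh.
have K0 := mulr_ge0 (ler0n R 5) (ler0n R 2080).
have cor := @correlation R grh.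
move: K0 cor; move: (5 * 2080%:R) => K K0 cor.
exists (14 * (Ct + 1) + 2 * K); first by lra.
move=> b h k hb /andP[h0 hk]; have b0 : (0 < b)%N by lia.
have b1 : (1 < b)%N by lia.
have q1 : (1 < b ^ h)%N by rewrite -{1}(expn0 b) ltn_exp2l//; lia.
have qX : (b ^ h %| b ^ k)%N by rewrite dvdn_exp2l// ltnW.
have X0 : (0 < b ^ k)%N by rewrite expn_gt0 b0.
have /andP[e0 e1] := be_itv hb; have L2 := ln16_ge hb; have k2 : 2 <= k%:R :> R by rewrite ler_nat; lia.
have lnE n : ln (b ^ n)%:R = n%:R * ln b%:R :> R by rewrite natrX ln_expn ?ltr0n.
have d0 : 0 < be b / 2 by lra.
have d2 : be b / 2 <= 2^-1 by lra.
have u4 : 4 <= @ln R (b ^ k)%:R.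
  by rewrite lnE (_ : 4 = 2 * 2) ?ler_pM//; lra.
have := cor _ _ _ q1 qX X0 d0 d2 u4; rewrite totient_ratio_expn// !lnE -/(pdens R b h) -/(pdens R b k) -/(pcorr R b h k).
move/le_trans; apply.
have /andP[m0 m1] := pdens_itv R b1 h; have rho := Hrho _ hb.
have r0 : 0 <= b%:R / (totient b)%:R :> R by rewrite divr_ge0.
have lL : ln (ln b%:R) <= ln b%:R :> R by rewrite ltW// ln_sublinear//; lra.
have i8 := be_exp8 b0.
have bR : 0 < b%:R :> R by rewrite ltr0n.
have t1 : (Num.sqrt (b ^ k)%:R)^-1 <= be b ^+ 8 :> R.
  rewrite i8 lef_pV2 ?posrE ?sqrtr_gt0 ?ltr0n//.
  have -> : b%:R = Num.sqrt ((b ^ 2)%:R) :> R by rewrite natrX sqrtr_sqr ger0_norm.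
  by apply: ler_wsqrtr; rewrite ler_nat leq_exp2l// (leq_ltn_trans h0 hk).
have t2 : (b ^ h)%:R / (b ^ k)%:R <= be b :> R.
  apply: (@le_trans _ _ (be b ^+ 8)); last by rewrite exprS ler_piMr ?exprn_ile1// ltW.
  rewrite i8 ler_pdivrMr ?ltr0n// mulrC ler_pdivlMr// -natrM ler_nat -expnSr leq_exp2l//.
have t3 : (b ^ h)%:R^-1 <= be b ^+ 8 :> R.
  rewrite i8 lef_pV2 ?posrE ?ltr0n ?(ltnW q1)// ler_nat -{1}(expn1 b) leq_exp2l//.
have t4 := sqrt_ratio hb hk.
have hk' : h%:R <= k%:R :> R by rewrite ler_nat ltnW.
have h0' : 0 <= h%:R :> R by [].
have g0 : 0 <= 2^-1 ^+ (k - h).-1 :> R by rewrite exprn_ge0.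
have x10 : 0 <= (Num.sqrt (b ^ k)%:R)^-1 :> R by rewrite invr_ge0 sqrtr_ge0.
have x20 : 0 <= (b ^ h)%:R / (b ^ k)%:R :> R by rewrite divr_ge0.
have x30 : 0 <= (b ^ h)%:R^-1 :> R by rewrite invr_ge0.
have -> : K * (k%:R * ln b%:R) ^+ 2 * Num.sqrt (b ^ h)%:R / (Num.sqrt (b ^ k)%:R * (be b / 2)) =
   2 * K * (k%:R ^+ 2 * ln b%:R ^+ 2 * (be b)^-1) * (Num.sqrt (b ^ h)%:R / Num.sqrt (b ^ k)%:R).
  by field; rewrite !gt_eqF// sqrtr_gt0 ltr0n.
move: rho r0 lL t1 t2 t3 t4 hk' x10 x20 x30 e0 e1 k2 L2 m0 m1 g0.
move: (b%:R / (totient b)%:R) (ln (ln b%:R)) ((b ^ h)%:R / (b ^ k)%:R) (@GRing.mul R (Num.sqrt (b ^ h)%:R) (Num.sqrt (b ^ k)%:R)^-1).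
move: (@GRing.inv R (Num.sqrt (b ^ k)%:R)) ((b ^ h)%:R^-1) (ln b%:R) (be b) (pdens R b h) (2^-1 ^+ (k - h).-1) h0' => i x L e m g h0'.
move: (h%:R) (k%:R) h0' => hh kk h0' rr ll y z.
move=> rho r0 lL t1 t2 t3 t4 hk' x10 x20 x30 e0 e1 k2 L2 m0 m1 g0.
have e80 : 0 <= e ^+ 8 by rewrite exprn_ge0// ltW.
have p1 : 1 + rr <= (Ct + 1) * L.
  have : Ct * ll <= Ct * L by rewrite ler_wpM2l// ltW.
  lra.
have p2 : 12 * (kk * L) * i + m * (2 * (e / 2) + y) + 2 * (hh * L) * x <=
    14 * (kk * L * e ^+ 8) + 2 * (e * m).
  have kL0 := mulr_ge0 (le_trans (ler0n R 2) k2) (le_trans (ler0n R 2) L2).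
  have a1 : kk * L * i <= kk * L * e ^+ 8 by rewrite ler_wpM2l.
  have a2 : hh * L * x <= kk * L * e ^+ 8.
    by rewrite ler_pM ?mulr_ge0 ?ler_wpM2r// (le_trans (ler0n R 2)).
  have a3 : m * y <= m * e by rewrite ler_wpM2l.
  by move: a1 a2 a3; clear; lra.
have p3 : (kk ^+ 2 * L ^+ 2 * e^-1) * z <= kk ^+ 2 * L ^+ 2 * e ^+ 3 * g.
  have -> : kk ^+ 2 * L ^+ 2 * e ^+ 3 * g = (kk ^+ 2 * L ^+ 2 * e^-1) * (e ^+ 4 * g).
    by field; rewrite gt_eqF.
  by rewrite ler_wpM2l// divr_ge0 ?(ltW e0)// mulr_ge0 ?sqr_ge0.
have q0 : 0 <= 12 * (kk * L) * i + m * (2 * (e / 2) + y) + 2 * (hh * L) * x.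
  by rewrite !addr_ge0 ?mulr_ge0 ?addr_ge0//; move: k2 L2 e0; clear; lra.
have p4 := ler_pM (addr_ge0 ler01 r0) q0 p1 p2.
have p5 := mulr_ge0 (mulr_ge0 (mulr_ge0 (sqr_ge0 kk) (sqr_ge0 L)) (exprn_ge0 3 (ltW e0))) g0.
have L0 : 0 <= L := le_trans (ler0n R 2) L2.
have p6 := mulr_ge0 (mulr_ge0 (le_trans (ler0n R 2) k2) (sqr_ge0 L)) e80.
have p7 := mulr_ge0 (mulr_ge0 L0 (ltW e0)) m0.
have p8 := ler_wpM2l (mulr_ge0 (ler0n R 2) K0) p3.
rewrite mulrA in p8.
apply: (le_trans (lerD p4 p8)).
have -> : (Ct + 1) * L * (14 * (kk * L * e ^+ 8) + 2 * (e * m)) =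
   14 * (Ct + 1) * (kk * L ^+ 2 * e ^+ 8) + 2 * (Ct + 1) * (L * e * m) by ring.
move: (kk ^+ 2 * _ * _ * _) (kk * L ^+ 2 * _) (L * e * m) p5 p6 p7 => A B D p5 p6 p7.
have {}Ct0 := ltW Ct0.
clear -Ct0 K0 p5 p6 p7.
have c1 : 0 <= 14 * (Ct + 1) * A by rewrite mulr_ge0//; lra.
have c2 : 0 <= 2 * K * B by rewrite mulr_ge0//; lra.
have c3 : 0 <= 2 * K * D by rewrite mulr_ge0//; lra.
have c4 : 0 <= (Ct + 1) * D by rewrite mulr_ge0//; lra.
lra.
Qed.

(* Split at l = b^(1/9): below it a power of b is saved against 1/log^3 b, and
   above it l^5 b^(-1/2) dominates. *)
Lemma absorb : exists2 C : R, 0 < C & forall b l, (16 <= b)%N -> (0 < l)%N ->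
  l%:R * H1 l * be b + l%:R ^+ 3 * ln b%:R ^+ 2 * be b ^+ 3 <=
  C * ((ln b%:R ^+ 3)^-1 + l%:R ^+ 5 * ln b%:R ^+ 3 / Num.sqrt b%:R).
Proof.
(* For l <= b^(1/9) one has l b^(-1/8) <= b^(-1/72), whose cube is b^(-1/24). *)
have a72 : 0 < 72^-1 :> R by rewrite invr_gt0.
have a24 : 0 < 24^-1 :> R by rewrite invr_gt0.
have [C1 C10 HC1] := pow_exp 4 a72; have [C2 C20 HC2] := pow_exp 5 a24.
exists (2 * C1 + C2 + 4); first by lra.
move=> b l hb l0; have b0 : (0 < b)%N by lia.
have L2 := ln16_ge hb; have := harmonic_le l0; have := ln_le_sqrt (_ : 0 < l%:R :> R).
rewrite ltr0n => /(_ l0); rewrite -be_exp4//.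
have ll0 := ln_nat_ge0 R l.
have l1 : 1 <= l%:R :> R by rewrite ler1n.
have s1 : 1 <= Num.sqrt l%:R :> R by rewrite -[X in X <= _]sqrtr1 ler_sqrt//; lra.
have sl : Num.sqrt l%:R ^+ 2 = l%:R :> R by rewrite sqr_sqrtr//; lra.
have lE : ln l%:R = 2 * ln (Num.sqrt l%:R) :> R.
  by rewrite -{1}sl lnXn ?mulr_natl// (lt_le_trans ltr01).
have slK : Num.sqrt l%:R = expR (ln (Num.sqrt l%:R)) :> R by rewrite lnK// posrE; lra.
have lK : l%:R = expR (ln l%:R) :> R by rewrite lnK// posrE; lra.
have h0 : 0 <= H1 l by apply: sumr_ge0.
move: (l%:R : R) (@Num.sqrt R l%:R) (ln b%:R) (H1 l) h0 L2 ll0 l1 s1 sl lE slK lK => x s L h h0 L2 ll0 l1 s1 sl lE slK lK hs hl.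
have L3 : 0 < L ^+ 3 by rewrite exprn_gt0//; lra.
have B0 : 0 <= x ^+ 5 * L ^+ 3 * expR (- (L / 8)) ^+ 4.
  by rewrite !mulr_ge0 ?exprn_ge0 ?expR_ge0//; lra.
have V0 : 0 <= (L ^+ 3)^-1 by rewrite invr_ge0 ltW.
have [c|c] := lerP (ln x) (L / 9).
  have h2 : h <= 2 * L by lra.
  have T1 : x * h * expR (- (L / 8)) <= 2 * C1 * (L ^+ 3)^-1.
    have y1 : x * expR (- (L / 8)) <= expR (- (72^-1 * L)).
      by rewrite lK -expRD ler_expR; lra.
    apply: (@le_trans _ _ (2 * L * expR (- (72^-1 * L)))).
      by rewrite mulrAC mulrC ler_pM// mulr_ge0 ?expR_ge0//; lra.
    rewrite -[_ / _]/(_ * _) ler_pdivlMr// expRN mulrAC ler_pdivrMr ?expR_gt0//.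
    have L0 : 0 <= L by lra.
    have := HC1 _ L0; rewrite [L ^+ 4]exprS.
    move: (expR _) (L ^+ 3) => e y; lra.
  have T2 : x ^+ 3 * L ^+ 2 * expR (- (L / 8)) ^+ 3 <= C2 * (L ^+ 3)^-1.
    have y1 : x ^+ 3 * expR (- (L / 8)) ^+ 3 <= expR (- (24^-1 * L)).
      by rewrite lK -!expRM_natl -expRD ler_expR; lra.
    apply: (@le_trans _ _ (L ^+ 2 * expR (- (24^-1 * L)))).
      by rewrite mulrAC mulrC ler_wpM2l// sqr_ge0.
    rewrite ler_pdivlMr// expRN mulrAC ler_pdivrMr ?expR_gt0// -exprD.
    by apply: HC2; lra.
  have z : 0 <= (2 * C1 + C2 + 4) * (x ^+ 5 * L ^+ 3 * expR (- (L / 8)) ^+ 4) by rewrite mulr_ge0//; lra.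
  move: T1 T2 V0 z; rewrite mulrDr.
  move: (x * _ * _) (x ^+ 3 * _ * _) (_ * (x ^+ 5 * _ * _)) ((L ^+ 3)^-1) => u v w t; lra.
have x0 : 0 <= x by lra.
have T1 : x * h * expR (- (L / 8)) <= 3 * (x ^+ 5 * L ^+ 3 * expR (- (L / 8)) ^+ 4).
  have h3 : h <= 3 * s by lra.
  have y1 : s <= x ^+ 4 * expR (- (L / 8)) ^+ 3.
    rewrite slK lK lE -!expRM_natl -expRD ler_expR; lra.
  have y2 : 1 <= L ^+ 3 by rewrite exprn_ege1//; lra.
  have y3 : h <= 3 * (x ^+ 4 * expR (- (L / 8)) ^+ 3 * L ^+ 3).
    apply: (le_trans h3); rewrite ler_wpM2l// (le_trans y1)// ler_peMr// mulr_ge0 ?exprn_ge0 ?expR_ge0//.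
  have -> : 3 * (x ^+ 5 * L ^+ 3 * expR (- (L / 8)) ^+ 4) =
     x * (3 * (x ^+ 4 * expR (- (L / 8)) ^+ 3 * L ^+ 3)) * expR (- (L / 8)) by ring.
  by rewrite ler_wpM2r ?expR_ge0// ler_wpM2l.
have T2 : x ^+ 3 * L ^+ 2 * expR (- (L / 8)) ^+ 3 <= x ^+ 5 * L ^+ 3 * expR (- (L / 8)) ^+ 4.
  have y1 : 1 <= x ^+ 2 * expR (- (L / 8)).
    rewrite lK -!expRM_natl -expRD -[leLHS]expR0 ler_expR; lra.
  have y2 : 1 <= x ^+ 2 * expR (- (L / 8)) * L.
    by rewrite (le_trans y1)// ler_peMr//; lra.
  have -> : x ^+ 5 * L ^+ 3 * expR (- (L / 8)) ^+ 4 =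
    x ^+ 3 * L ^+ 2 * expR (- (L / 8)) ^+ 3 * (x ^+ 2 * expR (- (L / 8)) * L) by ring.
  by rewrite ler_peMr// !mulr_ge0 ?exprn_ge0 ?expR_ge0//; lra.
have z1 : 0 <= (2 * C1 + C2 + 4) * (L ^+ 3)^-1 by rewrite mulr_ge0//; lra.
have z2 : 0 <= (2 * C1 + C2) * (x ^+ 5 * L ^+ 3 * expR (- (L / 8)) ^+ 4) by rewrite mulr_ge0//; lra.
move: T1 T2 z1 z2; rewrite !mulrDr [(_ + 4) * (x ^+ 5 * _ * _)]mulrDl.
move: (x * _ * _) (x ^+ 3 * _ * _) (x ^+ 5 * _ * _) (_ * (L ^+ 3)^-1) => u v w t.
move: ((_ + _) * w) => ww; lra.
Qed.

(** With m = x + x^2 + O(x^3) the second-order term of m cancels against m^2, leaving m - m^2 = x +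
    O(x^3). It is applied with x = 1/(h log b). *)
Lemma density_point (C m x : R) : 0 <= C -> 0 <= m <= 1 -> 0 <= x <= 1 ->
  `|m - x - x ^+ 2| <= C * x ^+ 3 ->
  [/\ `|m - x| <= (C + 1) * x ^+ 2, m <= (C + 2) * x,
      `|m ^+ 2 - x ^+ 2| <= (C + 1) * (C + 3) * x ^+ 3 &
      `|m - m ^+ 2 - x| <= (C + (C + 1) * (C + 3)) * x ^+ 3].
Proof.
move=> C0 /andP[m0 m1] /andP[x0 x1] H.
have x2 : 0 <= x ^+ 2 by exact: sqr_ge0.
have x32 : x ^+ 3 <= x ^+ 2 by rewrite [X in X <= _]exprSr ler_piMr.
have x21 : x ^+ 2 <= x by rewrite expr2 ler_piMr.
have e1 : `|m - x| <= (C + 1) * x ^+ 2.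
  have -> : m - x = (m - x - x ^+ 2) + x ^+ 2 by ring.
  apply: (le_trans (ler_normD _ _)); rewrite (ger0_norm x2) mulrDl mul1r lerD//.
  by apply: (le_trans H); rewrite ler_wpM2l.
have e2 : m <= (C + 2) * x.
  have h1 := le_trans (ler_norm _) e1.
  have : (C + 1) * x ^+ 2 <= (C + 1) * x by rewrite ler_wpM2l//; lra.
  lra.
have e3 : `|m ^+ 2 - x ^+ 2| <= (C + 1) * (C + 3) * x ^+ 3.
  rewrite subr_sqr normrM (ger0_norm (addr_ge0 m0 x0)).
  have -> : (C + 1) * (C + 3) * x ^+ 3 = (C + 1) * x ^+ 2 * ((C + 3) * x) by ring.
  by apply: ler_pM => //; lra.
split => //.
have -> : m - m ^+ 2 - x = (m - x - x ^+ 2) - (m ^+ 2 - x ^+ 2) by ring.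
by apply: (le_trans (ler_normB _ _)); rewrite mulrDl lerD.
Qed.

(** In the last estimate the difference of squares is factored. The sum of m_h - 1/(h log b) is
    O(1/log^2 b) uniformly in l, as the sum of 1/h^2 converges; the other factor is O(H1/log b).
    Hence one harmonic sum only, which becomes the single log l of the error term. *)
Theorem density_moments : generalized_riemann_hypothesis R -> exists2 C : R, 0 < C &
  forall b l, (16 <= b)%N ->
  [/\ \sum_(1 <= h < l.+1) pdens R b h <= C * (H1 l / ln b%:R),
      `|\sum_(1 <= h < l.+1) (pdens R b h - pdens R b h ^+ 2) - H1 l / ln b%:R|
        <= C * (H1 l / ln b%:R ^+ 3) &
      `|((\sum_(1 <= h < l.+1) pdens R b h) ^+ 2 - \sum_(1 <= h < l.+1) pdens R b h ^+ 2)
        - (ln b%:R ^+ 2)^-1 * (H1 l ^+ 2 - H2 l)| <= C * (H1 l / ln b%:R ^+ 3)].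
Proof.
move=> grh; have [C C0 HC] := pnt grh.
pose D := C + (C + 1) * (C + 3).
have D0 : 0 < D by rewrite /D addr_gt0// mulr_gt0//; lra.
have DC : C + 2 <= D.
  have : 0 <= C * C by rewrite mulr_ge0 ?(ltW C0).
  rewrite /D; lra.
exists (3 * D); first by rewrite mulr_gt0.
move=> b l hb; have b0 : (0 < b)%N by lia.
have b1 : (1 < b)%N by lia.
have L2 := ln16_ge hb; have L0 : 0 < ln b%:R :> R by lra.
pose x h : R := (h%:R * ln b%:R)^-1.
have xE h : x h = h%:R^-1 / ln b%:R by rewrite /x invfM.
have pt h : (1 <= h < l.+1)%N ->
   [/\ `|pdens R b h - x h| <= (C + 1) * x h ^+ 2, pdens R b h <= (C + 2) * x h,
      `|pdens R b h ^+ 2 - x h ^+ 2| <= (C + 1) * (C + 3) * x h ^+ 3 &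
      `|pdens R b h - pdens R b h ^+ 2 - x h| <= D * x h ^+ 3].
  move=> /andP[h0 _]; apply: density_point; [exact: ltW|exact: (pdens_itv R b1 h)| |].
    have hL : 1 <= h%:R * ln b%:R :> R.
      by rewrite -[leLHS]mulr1 ler_pM ?ler1n//; lra.
    by rewrite /x invr_ge0 invf_le1 ?hL ?andbT ?(le_trans ler01)// (lt_le_trans ltr01).
  have N1 : (1 < b ^ h)%N by rewrite -{1}(expn0 b) ltn_exp2l//; lia.
  have N0 : 0 < (b ^ h)%:R :> R by rewrite ltr0n ltnW.
  have := HC _ N1.
  have -> : ln (b ^ h)%:R = (x h)^-1 by rewrite /x invrK natrX ln_expn ?ltr0n.
  rewrite /pdens; move: (x h) ((b ^ h)%:R) (ppi R _) N0 => y N p N0 HN.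
  have -> : p / N - y - y ^+ 2 = (p - N / y^-1 - N / y^-1 ^+ 2) / N.
    by rewrite -exprVn !invrK; field; rewrite gt_eqF.
  rewrite normrM normfV (gtr0_norm N0) ler_pdivrMr//.
  by apply: (le_trans HN); rewrite -exprVn invrK mulrCA mulrC.
have sx : \sum_(1 <= h < l.+1) x h = H1 l / ln b%:R.
  by rewrite mulr_suml; apply: eq_bigr => h _.
have sx2 : \sum_(1 <= h < l.+1) x h ^+ 2 = H2 l / ln b%:R ^+ 2.
  by rewrite mulr_suml; apply: eq_bigr => h _; rewrite xE expr_div_n exprVn.
have sx3 : \sum_(1 <= h < l.+1) x h ^+ 3 <= H1 l / ln b%:R ^+ 3.
  rewrite mulr_suml; apply: ler_sum_nat => h /andP[h0 _]; rewrite xE expr_div_n.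
  rewrite ler_wpM2r ?invr_ge0 ?exprn_ge0 ?(ltW L0)//.
  have h1 : h%:R^-1 <= 1 :> R by rewrite invf_le1 ?ler1n ?ltr0n.
  by rewrite exprS ler_piMr ?invr_ge0// exprn_ile1 ?invr_ge0.
have h10 : 0 <= H1 l by apply: sumr_ge0.
have q0 : 0 <= H1 l / ln b%:R ^+ 3 by rewrite divr_ge0// exprn_ge0// ltW.
have q1 : 0 <= H1 l / ln b%:R by rewrite divr_ge0// ltW.
have sm : \sum_(1 <= h < l.+1) pdens R b h <= (C + 2) * (H1 l / ln b%:R).
  by rewrite -sx mulr_sumr; apply: ler_sum_nat => h hh; have [_ ->] := pt h hh.
split.
- apply: (le_trans sm); rewrite ler_wpM2r//; lra.
- rewrite -sx -sumrB; apply: (le_trans (ler_norm_sum _ _ _)).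
  apply: (@le_trans _ _ (\sum_(1 <= h < l.+1) D * x h ^+ 3)).
    by apply: ler_sum_nat => h hh; have [_ _ _ ->] := pt h hh.
  rewrite -mulr_sumr; apply: (le_trans (ler_wpM2l (ltW D0) sx3)).
  by rewrite ler_wpM2r//; lra.
have -> : (ln b%:R ^+ 2)^-1 * (H1 l ^+ 2 - H2 l) =
    (\sum_(1 <= h < l.+1) x h) ^+ 2 - \sum_(1 <= h < l.+1) x h ^+ 2.
  by rewrite sx sx2 expr_div_n; ring.
set S := \sum_(1 <= h < l.+1) pdens R b h; set S2 := \sum_(1 <= h < l.+1) pdens R b h ^+ 2.
have -> : S ^+ 2 - S2 - ((\sum_(1 <= h < l.+1) x h) ^+ 2 - \sum_(1 <= h < l.+1) x h ^+ 2) =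
   (S - \sum_(1 <= h < l.+1) x h) * (S + \sum_(1 <= h < l.+1) x h)
   - (S2 - \sum_(1 <= h < l.+1) x h ^+ 2) by ring.
have S0 : 0 <= S by apply: sumr_ge0 => h _; have /andP[] := pdens_itv R b1 h.
apply: (le_trans (ler_normB _ _)).
have w1 : `|S2 - \sum_(1 <= h < l.+1) x h ^+ 2| <= D * (H1 l / ln b%:R ^+ 3).
  rewrite /S2 -sumrB; apply: (le_trans (ler_norm_sum _ _ _)).
  apply: (@le_trans _ _ (\sum_(1 <= h < l.+1) D * x h ^+ 3)).
    apply: ler_sum_nat => h hh; have [_ _ e3 _] := pt h hh; apply: (le_trans e3).
    by rewrite ler_wpM2r ?exprn_ge0 ?xE ?divr_ge0 ?invr_ge0 ?(ltW L0)// /D lerDr ltW.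
  by rewrite -mulr_sumr ler_wpM2l ?(ltW D0).
have w2 : `|S - \sum_(1 <= h < l.+1) x h| <= (C + 1) * (2 / ln b%:R ^+ 2).
  rewrite /S -sumrB; apply: (le_trans (ler_norm_sum _ _ _)).
  apply: (@le_trans _ _ (\sum_(1 <= h < l.+1) (C + 1) * x h ^+ 2)).
    by apply: ler_sum_nat => h hh; have [-> _ _ _] := pt h hh.
  rewrite -mulr_sumr sx2 ler_wpM2l//; first by lra.
  by rewrite ler_wpM2r ?invr_ge0 ?exprn_ge0 ?(ltW L0)// sum_inv_sqr_le.
have w3 : 0 <= S + \sum_(1 <= h < l.+1) x h by rewrite addr_ge0// sx.
have w4 : S + \sum_(1 <= h < l.+1) x h <= (C + 3) * (H1 l / ln b%:R).
  by move: sm; rewrite sx /S; move: (H1 l / _) (\sum_(1 <= h < l.+1) pdens R b h) => u v; lra.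
have w5 : `|(S - \sum_(1 <= h < l.+1) x h) * (S + \sum_(1 <= h < l.+1) x h)| <=
   2 * D * (H1 l / ln b%:R ^+ 3).
  rewrite normrM (ger0_norm w3).
  have := ler_pM (normr_ge0 _) w3 w2 w4; move/le_trans; apply.
  have -> : (C + 1) * (2 / ln b%:R ^+ 2) * ((C + 3) * (H1 l / ln b%:R)) =
     2 * ((C + 1) * (C + 3)) * (H1 l / ln b%:R ^+ 3).
    by rewrite exprSr; field; rewrite gt_eqF.
  by rewrite ler_wpM2r// ler_wpM2l// /D lerDr ltW.
move: w1 w5; move: `|_| `|_| (H1 l / _ ^+ 3) => u v w; lra.
Qed.

(** Density errors are H1/log^3 b times |b/phi(b) - 1|, which is where log log b enters, and H1 <= 3
    [ln_max2]. Pair errors are reduced by [absorb], whose term 1/log^3 b is covered since [ln_max2]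
    and log log b are both at least 1/2. *)
Theorem variance_estimate : generalized_riemann_hypothesis R -> exists K : R,
  forall b l : nat, (16 <= b)%N -> (0 < l)%N ->
  `|var_TrunL R b l - ((ln b%:R)^-1 * H1 l
       + (ln b%:R ^+ 2)^-1 * (b%:R / (totient b)%:R - 1) * (H1 l ^+ 2 - H2 l))| <=
  K * (ln_max2 R l * ln (ln b%:R) / ln b%:R ^+ 3 + l%:R ^+ 5 * ln b%:R ^+ 3 / Num.sqrt b%:R).
Proof.
move=> grh; have [Ct Ct0 Hrho] := totient_ratio grh; have [Cp Cp0 Hp] := pair_bound grh.
have [Cm Cm0 Hm] := density_moments grh; have [Ca Ca0 Ha] := absorb.
pose Cx := 2 * Cp * Cm + 6 * Cp + 5.
have Cx0 : 0 < Cx by rewrite /Cx; have := mulr_gt0 Cp0 Cm0; lra.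
exists (Cm * (12 + 3 * Ct) + 4 * (Cx * Ca)) => b l hb l0.
have b0 : (0 < b)%N by lia.
have b1 : (1 < b)%N by lia.
have L2 := ln16_ge hb; have /andP[e0 e1] := be_itv hb.
have lr : 1 <= l%:R :> R by rewrite ler1n.
have [m1 m2 m3] := Hm b l hb; have ha := Ha b l hb l0; have hrho := Hrho b hb.
have d0 h : 0 <= pdens R b h by have /andP[] := pdens_itv R b1 h.
have L0 : 0 < ln b%:R :> R by lra.
(* Replacing k by l gives the pair error the shape A m_h + B + D 2^(-(k-h-1)) that [pair_error_sum]
   handles. *)
pose A := Cp * (ln b%:R * be b).
pose B := Cp * (l%:R * ln b%:R ^+ 2 * be b ^+ 8).
pose D := Cp * (l%:R ^+ 2 * ln b%:R ^+ 2 * be b ^+ 3).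
have A0 : 0 <= A by rewrite !mulr_ge0// ltW.
have B0 : 0 <= B by rewrite !mulr_ge0 ?exprn_ge0// ltW.
have D0 : 0 <= D by rewrite !mulr_ge0 ?exprn_ge0// ltW.
have HE h k : (0 < h < k)%N -> (k <= l)%N ->
   `|pcorr R b h k - b%:R / (totient b)%:R * pdens R b h * pdens R b k| <=
   A * pdens R b h + B + D * 2^-1 ^+ (k - h).-1.
  move=> hk kl; apply: (le_trans (Hp b h k hb hk)).
  have kr : k%:R <= l%:R :> R by rewrite ler_nat.
  have -> : A * pdens R b h + B + D * 2^-1 ^+ (k - h).-1 =
    Cp * (ln b%:R * be b * pdens R b h + l%:R * ln b%:R ^+ 2 * be b ^+ 8
       + l%:R ^+ 2 * ln b%:R ^+ 2 * be b ^+ 3 * 2^-1 ^+ (k - h).-1) by rewrite /A /B /D; ring.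
  rewrite ler_wpM2l ?(ltW Cp0)// lerD//.
    by rewrite lerD2l ler_wpM2r ?exprn_ge0 ?(ltW e0)// ler_wpM2r ?sqr_ge0.
  rewrite ler_wpM2r ?exprn_ge0// ler_wpM2r ?exprn_ge0 ?(ltW e0)// ler_wpM2r ?sqr_ge0//.
  by rewrite ler_sqr ?nnegrE.
have v1 := var_TrunL_approx b1 l0 HE.
have v2 := @pair_error_sum (pdens R b) l A B D d0 A0 B0 D0.
set T := \sum_(1 <= h < l.+1) (pdens R b h - pdens R b h ^+ 2) + _ in v1.
have {v1 v2} v3 := le_trans v1 (lerD v2 (lexx _)).
have h10 : 0 <= H1 l by apply: sumr_ge0.
set P := l%:R * H1 l * be b + l%:R ^+ 3 * ln b%:R ^+ 2 * be b ^+ 3 in ha.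
have v4 : 2 * (A * l%:R * \sum_(1 <= h < l.+1) pdens R b h + B * l%:R ^+ 2 + 2 * D * l%:R)
    + 5 * l%:R ^+ 2 / b%:R <= Cx * P.
  rewrite -be_exp8// /P /Cx /A /B /D.
  have w1 : Cp * (ln b%:R * be b) * l%:R * \sum_(1 <= h < l.+1) pdens R b h <=
     Cp * Cm * (l%:R * H1 l * be b).
    have -> : Cp * Cm * (l%:R * H1 l * be b) =
       Cp * (ln b%:R * be b) * l%:R * (Cm * (H1 l / ln b%:R)).
      by field; rewrite gt_eqF.
    by rewrite ler_wpM2l// !mulr_ge0// ltW.
  have w2 : 0 <= l%:R * H1 l * be b by rewrite !mulr_ge0// ltW.
  have w3 : l%:R ^+ 3 * ln b%:R ^+ 2 * be b ^+ 8 <= l%:R ^+ 3 * ln b%:R ^+ 2 * be b ^+ 3.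
    rewrite ler_wpM2l ?mulr_ge0 ?exprn_ge0 ?(ltW L0)//.
    by rewrite (exprD _ 3 5) ler_piMr ?exprn_ile1 ?exprn_ge0// ltW.
  have w4 : l%:R ^+ 2 * be b ^+ 8 <= l%:R ^+ 3 * ln b%:R ^+ 2 * be b ^+ 8.
    have -> : l%:R ^+ 3 * ln b%:R ^+ 2 * be b ^+ 8 = l%:R ^+ 2 * be b ^+ 8 * (l%:R * ln b%:R ^+ 2).
      by ring.
    rewrite ler_peMr ?mulr_ge0 ?exprn_ge0 ?(ltW e0)//.
    by rewrite -[leLHS]mulr1 ler_pM// exprn_ege1//; lra.
  have w5 : 0 <= l%:R ^+ 3 * ln b%:R ^+ 2 * be b ^+ 3 by rewrite !mulr_ge0 ?exprn_ge0// ltW.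
  have -> : Cp * (l%:R * ln b%:R ^+ 2 * be b ^+ 8) * l%:R ^+ 2 =
     Cp * (l%:R ^+ 3 * ln b%:R ^+ 2 * be b ^+ 8) by ring.
  have -> : 2 * (Cp * (l%:R ^+ 2 * ln b%:R ^+ 2 * be b ^+ 3)) * l%:R =
     2 * (Cp * (l%:R ^+ 3 * ln b%:R ^+ 2 * be b ^+ 3)) by ring.
  have w6 := ler_wpM2l (ltW Cp0) w3.
  rewrite -[5 * _ * _]mulrA.
  have w7 := mulr_ge0 (ltW Cp0) w2; have w8 := mulr_ge0 (mulr_ge0 (ltW Cp0) (ltW Cm0)) w5.
  move: w1 w2 w3 w4 w5 w6 w7 w8.
  move: (_ * \sum_(_ <= _ < _) pdens R b _) (l%:R * _ * _) (l%:R ^+ 3 * _ * be b ^+ 8) (l%:R ^+ 2 * be b ^+ 8).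
  move: (l%:R ^+ 3 * _ * be b ^+ 3) => z5 z1 z2 z3 z4; clear; lra.
have h3 : H1 l <= 3 * ln_max2 R l /\ 2^-1 <= ln_max2 R l.
  have n0 : (0 < maxn l 2)%N by rewrite leq_max l0.
  have z1 : ln l%:R <= ln_max2 R l by rewrite ler_ln ?posrE ?ltr0n// ler_nat leq_maxl.
  have z2 : ln 2 <= ln_max2 R l by rewrite ler_ln ?posrE ?ltr0n// ler_nat leq_maxr.
  have := harmonic_le l0; have := @ln2_gt R; move: z1 z2.
  by move: (ln_max2 R l) (ln l%:R) (ln 2) (H1 l) => a c d f; clear; move=> *; split; lra.
have [h31 M2] := h3.
have lnL : 2^-1 <= ln (ln b%:R) :> R.
  by rewrite (le_trans (ltW (@ln2_gt R)))// ler_ln ?posrE.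
have V0 : 0 <= (ln b%:R ^+ 3)^-1 :> R by rewrite invr_ge0 exprn_ge0// ltW.
have rho0 : 0 <= b%:R / (totient b)%:R :> R by rewrite divr_ge0.
set Tg := (_ + _ * _ * _).
have v5 : `|T - Tg| <= Cm * (12 + 3 * Ct) * (ln_max2 R l * ln (ln b%:R) / ln b%:R ^+ 3).
  have -> : T - Tg = (\sum_(1 <= h < l.+1) (pdens R b h - pdens R b h ^+ 2) - H1 l / ln b%:R)
    + (b%:R / (totient b)%:R - 1) * (((\sum_(1 <= h < l.+1) pdens R b h) ^+ 2
       - \sum_(1 <= h < l.+1) pdens R b h ^+ 2) - (ln b%:R ^+ 2)^-1 * (H1 l ^+ 2 - H2 l)).
    by rewrite /T /Tg; ring.
  apply: (le_trans (ler_normD _ _)); rewrite normrM.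
  have r1 : `|b%:R / (totient b)%:R - 1| <= Ct * ln (ln b%:R) + 1.
    by apply: (le_trans (ler_normB _ _)); rewrite normr1 ger0_norm// lerD2r.
  have r2 := ler_pM (normr_ge0 _) (normr_ge0 _) r1 m3.
  apply: (le_trans (lerD m2 r2)).
  have r3 : H1 l <= 6 * (ln_max2 R l * ln (ln b%:R)).
    have : ln_max2 R l <= 2 * (ln_max2 R l * ln (ln b%:R)).
      by rewrite mulrCA ler_peMr//; move: M2 lnL; clear; lra.
    by move: h31; clear; lra.
  have r4 : ln (ln b%:R) * H1 l <= 3 * (ln_max2 R l * ln (ln b%:R)).
    by rewrite mulrA mulrC ler_wpM2r//; move: lnL; clear; lra.
  have -> : Cm * (H1 l / ln b%:R ^+ 3) + (Ct * ln (ln b%:R) + 1) * (Cm * (H1 l / ln b%:R ^+ 3)) =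
     Cm * (2 * H1 l + Ct * (ln (ln b%:R) * H1 l)) / ln b%:R ^+ 3 by ring.
  have -> : Cm * (12 + 3 * Ct) * (ln_max2 R l * ln (ln b%:R) / ln b%:R ^+ 3) =
     Cm * ((12 + 3 * Ct) * (ln_max2 R l * ln (ln b%:R))) / ln b%:R ^+ 3 by ring.
  rewrite ler_wpM2r// ler_wpM2l ?(ltW Cm0)//.
  have r5 := ler_wpM2l (ltW Ct0) r4.
  move: r3 r5; move: (H1 l) (ln_max2 R l * _) (ln (ln b%:R) * H1 l) => y1 y2 y3; clear; lra.
have -> : var_TrunL R b l - Tg = (var_TrunL R b l - T) + (T - Tg) by ring.
apply: (le_trans (ler_normD _ _)).
have v6 := le_trans v3 v4.
have v7 : Cx * P <= Cx * (Ca * ((ln b%:R ^+ 3)^-1 + l%:R ^+ 5 * ln b%:R ^+ 3 / Num.sqrt b%:R)).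
  by rewrite ler_wpM2l ?(ltW Cx0).
have v8 := le_trans v6 v7.
have q1 : (ln b%:R ^+ 3)^-1 <= 4 * (ln_max2 R l * ln (ln b%:R) / ln b%:R ^+ 3) :> R.
  rewrite mulrA ler_peMl//.
  have : 2^-1 * 2^-1 <= ln_max2 R l * ln (ln b%:R) by rewrite ler_pM.
  lra.
apply: (le_trans (lerD v8 v5)).
have q2 : 0 <= l%:R ^+ 5 * ln b%:R ^+ 3 / Num.sqrt b%:R :> R.
  by rewrite divr_ge0 ?sqrtr_ge0 ?mulr_ge0 ?exprn_ge0// ltW.
have q3 : 0 <= Cm * (12 + 3 * Ct) by rewrite mulr_ge0 ?(ltW Cm0)//; move: Ct0; clear; lra.
have q4 : 0 <= Cx * Ca by rewrite mulr_ge0// ltW.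
move: q1 q2 q3 q4; rewrite [Cx * (Ca * _)]mulrA.
move: (@GRing.inv R (ln b%:R ^+ 3)) (@GRing.mul R _ (ln b%:R ^+ 3)^-1).
move: (@GRing.mul R _ (Num.sqrt b%:R)^-1) (Cx * Ca) (Cm * _) => t3 t4 t5 t1 t2 q1 q2 q3 q4.
have := ler_wpM2l q4 q1; have := mulr_ge0 q3 q2; have := mulr_ge0 q4 q2.
by clear; lra.
Qed.

End Assembly.

Theorem theorem1p3 (R : realType) :
  generalized_riemann_hypothesis R ->
  exists (K : R) (b0 : nat), forall b l : nat,
    (2 <= b)%N -> (b0 <= b)%N -> (1 <= l)%N ->
    let L : R := ln b%:R in
    let H1 : R := \sum_(1 <= h < l.+1) h%:R^-1 in
    let H2 : R := \sum_(1 <= h < l.+1) (h%:R ^+ 2)^-1 in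
    `| var_TrunL R b l
       - (L^-1 * H1
          + (L ^+ 2)^-1 * (b%:R / (totient b)%:R - 1) * (H1 ^+ 2 - H2)) |
    <= K * (ln_max2 R l * ln L / L ^+ 3
            + l%:R ^+ 5 * L ^+ 3 / Num.sqrt b%:R).
Proof.
move=> grh; have [K HK] := variance_estimate grh.
(* From b = 16 on, log b >= 2 and log log b >= log 2 > 1/2. *)
by exists K, 16%N => b l _ hb hl; exact: HK.
Qed.
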